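(* Let $W$ be an irreducible Coxeter group of type $E$, $F$ or $H$ (that is, $E_6$, $E_7$, $E_8$, $F_4$, $H_3$ or $H_4$) with Coxeter number $h_W$. Let $d$ be the highest degree of $W$ such that $d<h_W$, and let $c=1/d$. Then the Gaussian inner product converges on the minimal submodule $\mathbb{S}_c$ of the polynomial representation of $H_c(W)$, hence the module $\mathbb{S}_c$ is unitary.
   Context: Let $\mathcal{R}\subset\mathbb{R}^N$ be an irreducible Coxeter root system of rank $N$ with positive roots $\mathcal{R}_+$ and Coxeter group $W$ generated by the reflections $s_\alpha$, and let $c\in\mathbb{R}$ be constant. The degrees of $W$ are the degrees of homogeneous generators of $\mathbb{C}[x]^W$. The Dunkl operators on $\mathbb{C}[x]=\mathbb{C}[x_1,\dots,x_N]$ are $\nabla_\xi=\partial_\xi-\sum_{\alpha\in\mathcal{R}_+}\frac{c(\alpha,\xi)}{(\alpha,x)}(1-s_\alpha)$, $\nabla_i=\nabla_{e_i}$. The rational Cherednik algebra $H_c(W)$ is defined by its faithful (polynomial) representation on $\mathbb{C}[x]$: it is generated by $W$ acting geometrically, by $x_i$ acting by multiplication, and by $y_i$ acting as $\nabla_i$. The minimal submodule $\mathbb{S}_c$ is the unique minimal non-zero $H_c(W)$-submodule of $\mathbb{C}[x]$. It carries a $W$-invariant nondegenerate Hermitian form, unique up to proportionality, with $(x_iu,v)=(u,y_iv)$; $\mathbb{S}_c$ is unitary if this form can be scaled to be positive definite. The Gaussian inner product converges on $\mathbb{S}_c$ if $$\int_{\mathbb{R}^N}|f(x)|^2e^{-\frac12|x|^2}\prod_{\alpha\in\mathcal{R}_+}|(\alpha,x)|^{-2c}\,dx<\infty\quad\text{for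 all } f\in\mathbb{S}_c.$$ *)

(* Defs.v *)
From HB Require Import structures.
From mathcomp Require Import all_boot all_order all_algebra.
From mathcomp Require Import complex.
(* The notations of mpoly clash with those of MathComp-Analysis. *)
From mathcomp Require Import -(notations) mpoly.
From mathcomp Require Import all_classical all_reals all_analysis.

Set Implicit Arguments.
Unset Strict Implicit.
Unset Printing Implicit Defensive.

Import Order.TTheory GRing.Theory Num.Theory.
Local Open Scope classical_set_scope.
Local Open Scope ring_scope.

Section LebesgueTuple.
Context {R : realType}.
Notation T := (measurableTypeR R).

Definition cons_measure n
    (mu : {sigma_finite_measure set (n.-tuple T) -> \bar R}) :=
  pushforward (@lebesgue_measure R \x mu)%E
    (fun p : T * n.-tuple T => cons_tuple p.1 p.2).

Section instances.
Context (n : nat) (mu : {sigma_finite_measure set (n.-tuple T) -> \bar R}).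

Lemma measurable_cons_tuple :
  measurable_fun [set: T * n.-tuple T]
    (fun p => cons_tuple p.1 p.2 : n.+1.-tuple T).
Proof. exact: measurable_cons. Qed.

Let cons_measure0 : cons_measure mu set0 = 0%E.
Proof. by rewrite /cons_measure /pushforward preimage_set0 measure0. Qed.

Let cons_measure_ge0 A : (0 <= cons_measure mu A)%E.
Proof. by rewrite /cons_measure /pushforward measure_ge0. Qed.

Let cons_measure_sigma_additive : semi_sigma_additive (cons_measure mu).
Proof.
move=> F mF tF mUF; apply: measure_semi_sigma_additive => //.
exact: measurable_cons_tuple.
Qed.

HB.instance Definition _ := isMeasure.Build _ _ _ (cons_measure mu)
  cons_measure0 cons_measure_ge0 cons_measure_sigma_additive.

Let cons_measure_sigma_finite : sigma_finite setT (cons_measure mu).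
Proof.
have [F TF Ffin] : sigma_finite setT (@lebesgue_measure R \x mu)%E.
  have /sigma_finiteP[F [TF ndF Foo]] := sigma_finiteT (@lebesgue_measure R).
  have /sigma_finiteP[G [TG ndG Goo]] := sigma_finiteT mu.
  exists (fun k => F k `*` G k).
    rewrite -setXTT TF TG predeqE => -[x y]; split.
      move=> [/= [k _ Fkx] [l _ Gly]]; exists (maxn k l) => //; split.
      - by move: x Fkx; exact/subsetPset/ndF/leq_maxl.
      - by move: y Gly; exact/subsetPset/ndG/leq_maxr.
    by move=> [k _ []/= ? ?]; split; exists k.
  move=> k; have [? ?] := Foo k; have [? ?] := Goo k.
  split; first exact: measurableX.
  by rewrite product_measure1E// lte_mul_pinfty// ge0_fin_numE.
pose uncons (t : n.+1.-tuple T) := (thead t, [tuple of behead t]).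
have unconsK p : uncons (cons_tuple p.1 p.2) = p.
  by case: p => x t; rewrite /uncons /= theadE; congr pair; exact: val_inj.
have muncons : measurable_fun setT uncons.
  apply: measurable_fun_pair; [exact: measurable_tnth|exact: measurable_behead].
exists (fun k => uncons @^-1` F k).
  by rewrite -preimage_bigcup -TF preimage_setT.
move=> k; have [mFk Fkfin] := Ffin k; split.
  by rewrite -[X in measurable X]setTI; exact: muncons.
rewrite /cons_measure /pushforward (_ : _ @^-1` _ = F k)//.
by apply/seteqP; split=> p /=; rewrite unconsK.
Qed.

HB.instance Definition _ := Measure_isSigmaFinite.Build _ _ _ (cons_measure mu)
  cons_measure_sigma_finite.
End instances.

(* Lebesgue measure on the Borel sets of R^n, points being n-tuples. *)
Fixpoint lebesgue_measureN n :
    {sigma_finite_measure set (n.-tuple T) -> \bar R} :=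
  if n is m.+1 then cons_measure (lebesgue_measureN m)
  else dirac ([tuple] : 0.-tuple T).
End LebesgueTuple.

Section RootSystems.
Context {R : realType} {N : nat}.
Implicit Types (a b u v : 'rV[R]_N) (Phi P : seq 'rV[R]_N) (w : 'M[R]_N).

Definition dot u v : R := (u *m v^T) 0 0.

(* Matrices act on row vectors on the right: v *m refl_mx a is
   v - 2 (v, a) / (a, a) a. *)
Definition refl_mx a : 'M[R]_N := 1%:M - (2 / dot a a) *: (a^T *m a).

Definition root_system Phi : Prop :=
  [/\ 0 \notin Phi,
      <<Phi>>%VS = fullv,
      forall a b, a \in Phi -> b \in Phi -> b *m refl_mx a \in Phi &
      forall a (k : R), a \in Phi -> (k *: a \in Phi) = (k == 1) || (k == -1)].

Definition irreducible_roots Phi : Prop :=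
  (0 < size Phi)%N /\
  forall Q : pred 'rV[R]_N,
    (forall a b, a \in Phi -> b \in Phi -> Q a -> ~~ Q b -> dot a b = 0) ->
    {in Phi, forall a, Q a} \/ {in Phi, forall a, ~~ Q a}.

Definition positive_system Phi P : Prop :=
  uniq P /\
  exists v, {in Phi, forall a, dot a v != 0} /\
    forall a, (a \in P) = (a \in Phi) && (0 < dot a v).

Definition simple_system Phi r (s : r.-tuple 'rV[R]_N) : Prop :=
  [/\ {subset s <= Phi},
      basis_of fullv s &
      forall b, b \in Phi -> exists k : 'I_r -> R,
        b = \sum_i k i *: tnth s i /\
        ((forall i, 0 <= k i) \/ (forall i, k i <= 0))].

Inductive coxeter_group Phi : 'M[R]_N -> Prop :=
| coxeter_group1 : coxeter_group Phi 1%:M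
| coxeter_groupM w a : coxeter_group Phi w -> a \in Phi ->
    coxeter_group Phi (w *m refl_mx a).

Definition has_order w (n : nat) : Prop :=
  [/\ (0 < n)%N, w ^+ n = 1%:M & forall k, (0 < k < n)%N -> w ^+ k <> 1%:M].

(* The order of a Coxeter element; it does not depend on the simple system. *)
Definition coxeter_number Phi (h : nat) : Prop :=
  exists s : N.-tuple 'rV[R]_N,
    simple_system Phi s /\ has_order (\prod_(i < N) refl_mx (tnth s i)) h.

End RootSystems.

Inductive EFH_type := type_E6 | type_E7 | type_E8 | type_F4 | type_H3 | type_H4.

Definition type_rank (X : EFH_type) : nat :=
  match X with
  | type_E6 => 6 | type_E7 => 7 | type_E8 => 8
  | type_F4 => 4 | type_H3 => 3 | type_H4 => 4
  end.

(* Bourbaki numbering, shifted to start at 0; the edges below are listed for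
   rank 8 in type E and rank 4 in type H, smaller ranks use an initial part. *)
Definition coxeter_bond (X : EFH_type) (i j : nat) : nat :=
  (match X with
  | type_E6 | type_E7 | type_E8 =>
      if (i, j) \in [:: (0, 2); (1, 3); (2, 3); (3, 4); (4, 5); (5, 6); (6, 7)]
      then 3 else 2
  | type_F4 =>
      if (i, j) == (1, 2) then 4
      else if (i, j) \in [:: (0, 1); (2, 3)] then 3 else 2
  | type_H3 | type_H4 =>
      if (i, j) == (0, 1) then 5
      else if (i, j) \in [:: (1, 2); (2, 3)] then 3 else 2
  end)%N.

Definition coxeter_matrix (X : EFH_type) (i j : nat) : nat :=
  (if i == j then 1 else coxeter_bond X (minn i j) (maxn i j))%N.

Definition has_type (R : realType) (N : nat) (Phi : seq 'rV[R]_N)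
    (X : EFH_type) : Prop :=
  exists s : (type_rank X).-tuple 'rV[R]_N,
    simple_system Phi s /\
    forall i j, has_order (refl_mx (tnth s i) *m refl_mx (tnth s j))
                          (coxeter_matrix X i j).

Section Cherednik.
Context {R : realType} {N : nat}.
Local Notation poly := (mpoly N R[i]).
Implicit Types (a xi : 'rV[R]_N) (Phi P : seq 'rV[R]_N) (w : 'M[R]_N).
Implicit Types (f g : poly) (M : set poly) (c : R).

Definition polyvar (i : 'I_N) : poly := mpolyX R[i] (mnm1 i).

(* (a, x) as a polynomial in x *)
Definition linform a : poly := \sum_i (a 0 i)%:C%C *: polyvar i.

(* (w f)(x) = f (w^-1 x) *)
Definition poly_act w f : poly :=
  comp_mpoly [tuple linform (row i (invmx w)^T) | i < N] f.

(* The quotient (f - s_a f) / (a, x), see divdiffP. *)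
Definition divdiff a f : poly :=
  xget 0 [set g | linform a * g = f - poly_act (refl_mx a) f].

Lemma divdiffP a f : dot a a != 0 ->
  linform a * divdiff a f = f - poly_act (refl_mx a) f.
Proof.
move=> a0; rewrite /divdiff; case: xgetP => [g _ <-//|none].
have reflK : refl_mx a *m refl_mx a = 1%:M.
  rewrite /refl_mx; set k := 2 / dot a a; set A := a^T *m a.
  have AA : A *m A = dot a a *: A.
    rewrite /A mulmxA -(mulmxA a^T a a^T) (mx11_scalar (a *m a^T)).
    by rewrite mul_mx_scalar -scalemxAl.
  rewrite mulmxBl mul1mx mulmxBr mulmx1 -scalemxAl -scalemxAr AA 2!scalerA.
  have -> : k * k * dot a a = k + k by rewrite -mulrA {2}/k divfK// mulr_natr.
  by rewrite scalerDl opprB addrK subrK.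
have invr : invmx (refl_mx a) = refl_mx a.
  have u : refl_mx a \in unitmx by case: (mulmx1_unit reflK).
  by rewrite -[RHS](mulKmx u) reflK mulmx1.
suff [g gP] : exists g, linform a * g = f - poly_act (refl_mx a) f.
  by have := none g; rewrite /= gP.
pose s : {rmorphism poly -> poly} :=
  comp_mpoly [tuple linform (row i (invmx (refl_mx a))^T) | i < N].
have -> : poly_act (refl_mx a) f = s f by [].
have sX i : polyvar i - s (polyvar i) =
            linform a * ((2 / dot a a * a 0 i)%:C%C)%:A.
  rewrite /s /= /polyvar comp_mpolyXU -tnth_nth tnth_mktuple invr /linform.
  rewrite mulr_algr scaler_sumr.
  have -> : mpolyX R[i] (mnm1 i) = \sum_j ((j == i)%:R : R)%:C%C *: polyvar j.
    rewrite (bigD1 i)//= eqxx scale1r big1 ?addr0// => j /negbTE->.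
    by rewrite scale0r.
  rewrite -sumrB; apply: eq_bigr => j _.
  rewrite -scalerBl -rmorphB scalerA -rmorphM /=; congr (_%:C%C *: _).
  rewrite !mxE big_ord1 !mxE opprB addrCA subrr addr0.
  by rewrite mulrA mulrAC.
have sZ z p : s (z *: p) = z *: s p by exact: comp_mpolyZ.
move: s sX sZ => s sX sZ {none reflK invr}.
pose D q := exists g, linform a * g = q - s q.
have DM q1 q2 : D q1 -> D q2 -> D (q1 * q2).
  move=> [g1 e1] [g2 e2]; exists (g1 * q2 + s q1 * g2).
  by rewrite mulrDr mulrA e1 mulrCA e2 rmorphM/= mulrBl mulrBr addrA subrK.
have D1 : D 1 by exists 0; rewrite mulr0 rmorph1 subrr.
have DX m : D (mpolyX R[i] m).
  rewrite mpolyXE_id; elim/big_ind : _ => // i _.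
  elim: (fun_of_multinom m i) => [|k IH]; first by rewrite expr0.
  by rewrite exprS; apply: DM => //; eexists; exact: esym (sX i).
elim/mpolyind: f => [|z m p _ _ [g gP]].
  by exists 0; rewrite mulr0 rmorph0 subrr.
have [g' g'P] := DX m; exists (z *: g' + g).
by rewrite mulrDr gP -scalerAr g'P rmorphD /= sZ scalerBr opprD addrACA.
Qed.

Definition dunkl P c xi f : poly :=
  \sum_i (xi 0 i)%:C%C *: (mderiv i f : poly)
  - \sum_(a <- P) (c * dot a xi)%:C%C *: divdiff a f.

Definition dunkl_coord P c (i : 'I_N) : poly -> poly :=
  dunkl P c (delta_mx 0 i).

(* H_c(W) in its polynomial representation: the algebra of operators on C[x]
   generated by W, the x_i and the y_i. *)
Inductive cherednik Phi P c : (poly -> poly) -> Prop :=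
| cherednik_W w : coxeter_group Phi w -> cherednik Phi P c (poly_act w)
| cherednik_x i : cherednik Phi P c (fun f => polyvar i * f)
| cherednik_y i : cherednik Phi P c (dunkl_coord P c i)
| cherednik_scale (z : R[i]) A :
    cherednik Phi P c A -> cherednik Phi P c (fun f => z *: A f)
| cherednik_add A B : cherednik Phi P c A -> cherednik Phi P c B ->
    cherednik Phi P c (fun f => A f + B f)
| cherednik_comp A B : cherednik Phi P c A -> cherednik Phi P c B ->
    cherednik Phi P c (A \o B).

Definition submodule Phi P c M : Prop :=
  [/\ M 0,
      forall f g, M f -> M g -> M (f + g) &
      forall A f, cherednik Phi P c A -> M f -> M (A f)].

Definition nonzero_submodule Phi P c M : Prop :=
  submodule Phi P c M /\ exists2 f, M f & f != 0.

Definition minimal_submodule Phi P c M : Prop :=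
  nonzero_submodule Phi P c M /\
  forall M', nonzero_submodule Phi P c M' -> M' `<=` M -> M' = M.

(* Only the values of B on M matter. *)
Definition contravariant_form Phi P c M (B : poly -> poly -> R[i]) : Prop :=
  [/\ forall (z : R[i]) u v t, M u -> M v -> M t ->
        B (z *: u + v) t = z * B u t + B v t,
      forall u v, M u -> M v -> B v u = (B u v)^*,
      forall w u v, coxeter_group Phi w -> M u -> M v ->
        B (poly_act w u) (poly_act w v) = B u v,
      forall i u v, M u -> M v ->
        B (polyvar i * u) v = B u (dunkl_coord P c i v) &
      forall u, M u -> (forall v, M v -> B u v = 0) -> u = 0].

Definition unitary Phi P c M : Prop :=
  exists B, contravariant_form Phi P c M B /\
    exists k : R, forall u, M u -> u != 0 -> 0 < k%:C%C * B u u.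

(* On the null set where some dot a v = 0 the factor 0 `^ _ is finite by
   convention, which does not affect the integral. *)
Definition gaussian_converges P c M : Prop :=
  forall f, M f ->
    (\int[lebesgue_measureN N]_x
       (let v : 'rV[R]_N := \row_i tnth x i in
        ComplexField.Normc.normc (meval (fun i => (tnth x i)%:C%C) f) ^+ 2
        * expR (- (2^-1 * dot v v))
        * \prod_(a <- P) `|dot a v| `^ (- (2 * c)))%:E < +oo)%E.

Definition invariant Phi f : Prop :=
  forall w, coxeter_group Phi w -> poly_act w f = f.

(* Algebraically independent homogeneous generators of C[x]^W. *)
Definition basic_invariants Phi (F : N.-tuple poly) (e : N.-tuple nat) : Prop :=
  [/\ forall i, invariant Phi (tnth F i),
      forall i, tnth F i \is ishomog1 (tnth e i) mdeg,
      forall f, invariant Phi f -> exists q, f = comp_mpoly F q &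
      forall q, comp_mpoly F q = 0 -> q = 0].

Definition is_degree Phi (d : nat) : Prop :=
  exists F e, basic_invariants Phi F e /\ d \in e.

Definition highest_degree_below Phi (h d : nat) : Prop :=
  [/\ is_degree Phi d, (d < h)%N &
      forall e, is_degree Phi e -> (e < h)%N -> (e <= d)%N].

End Cherednik.

(* Main.v *)
(* In each type d is 2|P|/(N + 2) = h N/(N + 2). The positive roots, rescaled
   to equal length, form spherical 2- and 4-designs, and c = 1/d is the value at
   which the quadratic polynomials (u, x)(v, x), with u and v orthogonal, become
   singular vectors. They generate a proper ideal stable under the Dunkl
   operators, so by minimality every element of S_c vanishes to order at least 2
   at 0. A greedy choice of bases bounds the Gaussian weight by products of
   |(b, x)|^(-s), s < 1, over bases b of positive roots, times |x|^(-2-c), as soon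
   as every flat spanned by k < N independent roots contains fewer than k d/2
   positive roots. Hence f g is integrable against the weight for f and g in S_c,
   which gives the convergence. Integration by parts, first for the weight
   prod ((a, x)^2 + eps)^(-c) and then in the limit, shows that x_i - y_i is
   adjoint to y_i for the Gaussian inner product, and conjugating by
   exp(-sum y_i^2 / 2) turns it into a positive contravariant form.

   Every root system of a given type is, up to the lengths of the roots, the one
   generated by the Gram matrix of its diagram over Z[phi]. The design identities,
   the count on flats and the order of a Coxeter element are verified there: a
   generic normal vector of a flat can be moved into the dominant chamber, and all
   orderings of a tree diagram give conjugate Coxeter elements. The degrees are
   found from power sums over an orbit, whose Jacobian is nonsingular at one
   point: by the chain rule the degrees of any basic invariants are bounded above,
   up to a permutation, by the degrees of these power sums, while their sum is at
   least |P| + N because their Jacobian vanishes on every reflecting hyperplane. *)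

Require Import Defs.
From HB Require Import structures.
From mathcomp Require Import all_boot all_order all_algebra.
From mathcomp Require Import complex.
From mathcomp Require Import -(notations) mpoly.
From mathcomp Require Import all_classical all_reals all_analysis.
From mathcomp Require Import measurable_realfun.
From mathcomp Require Import ring lra zify ssrZ.

Set Implicit Arguments.
Unset Strict Implicit.
Unset Printing Implicit Defensive.

Import Order.TTheory GRing.Theory Num.Theory.
Import numFieldNormedType.Exports.
Local Open Scope classical_set_scope.
Local Open Scope ring_scope.

(** Orders of vanishing are budgeted as follows. Near 0 the product in the weight is homogeneous of
    degree -2|P|/d = -(N + 2), so the weight alone is not integrable; a factor vanishing to order 3
    makes it so. A product of two elements of S_c has order 4, and a derivative or a divided
    difference costs one, so every integrand that occurs has order at least 3. Integrating by parts
    directly against the weight would leave terms f g / (a, x), which need not be integrable across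
    the walls. For the regularized weight they can be completed by functions odd under s_a, of
    integral zero, until only divided differences are left; those are bounded independently of eps,
    so that dominated convergence applies. The exponent s < 1 comes from the integrality of the
    counts on flats: a strict inequality between integers leaves a uniform margin. Finally, the
    hypotheses do not fix the lengths of the roots, so all comparisons with the tables are made line
    by line, through expressions unchanged when a single root is rescaled. *)

Section ReflectionAction.
Context {R : realType} {N : nat}.
Local Notation poly := (mpoly N R[i]).
Implicit Types (a b u v xi : 'rV[R]_N) (w : 'M[R]_N) (f g : poly) (c : R).

(** * The scalar product and reflections *)

Lemma dotC u v : dot u v = dot v u.
Proof. by rewrite /dot -[u *m v^T]trmxK trmx_mul trmxK mxE. Qed.

Lemma dotE u v : dot u v = \sum_i u 0 i * v 0 i.
Proof. by rewrite /dot mxE; apply: eq_bigr => i _; rewrite mxE. Qed.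

Lemma dotDl u1 u2 v : dot (u1 + u2) v = dot u1 v + dot u2 v.
Proof. by rewrite /dot mulmxDl mxE. Qed.

Lemma dotZl (k : R) u v : dot (k *: u) v = k * dot u v.
Proof. by rewrite /dot -scalemxAl mxE. Qed.

Lemma dotDr u v1 v2 : dot u (v1 + v2) = dot u v1 + dot u v2.
Proof. by rewrite ![dot u _]dotC dotDl. Qed.

Lemma dotZr (k : R) u v : dot u (k *: v) = k * dot u v.
Proof. by rewrite ![dot u _]dotC dotZl. Qed.

Lemma dotNl u v : dot (- u) v = - dot u v.
Proof. by rewrite -scaleN1r dotZl mulN1r. Qed.

Lemma dotNr u v : dot u (- v) = - dot u v.
Proof. by rewrite dotC dotNl dotC. Qed.

Lemma dotBl u1 u2 v : dot (u1 - u2) v = dot u1 v - dot u2 v.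
Proof. by rewrite dotDl dotNl. Qed.

Lemma dotBr u v1 v2 : dot u (v1 - v2) = dot u v1 - dot u v2.
Proof. by rewrite dotDr dotNr. Qed.

Lemma dot0l v : dot 0 v = 0.
Proof. by rewrite /dot mul0mx mxE. Qed.

Lemma dot0r v : dot v 0 = 0.
Proof. by rewrite dotC dot0l. Qed.

Lemma dot_suml (I : Type) (r : seq I) (Q : pred I) (F : I -> 'rV[R]_N) v :
  dot (\sum_(i <- r | Q i) F i) v = \sum_(i <- r | Q i) dot (F i) v.
Proof.
by apply: (big_morph (dot^~ v)) => [x y|]; rewrite ?dotDl ?dot0l.
Qed.

Lemma dot_sumr (I : Type) (r : seq I) (Q : pred I) (F : I -> 'rV[R]_N) v :
  dot v (\sum_(i <- r | Q i) F i) = \sum_(i <- r | Q i) dot v (F i).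
Proof. by rewrite dotC dot_suml; apply: eq_bigr => i _; rewrite dotC. Qed.

Lemma dot_ge0 v : 0 <= dot v v.
Proof. by rewrite dotE sumr_ge0// => i _; rewrite -expr2 sqr_ge0. Qed.

Lemma dot_eq0 v : (dot v v == 0) = (v == 0).
Proof.
apply/eqP/eqP => [|->]; last exact: dot0l.
rewrite dotE => v0; apply/rowP => i; rewrite mxE; apply/eqP.
have /psumr_eq0P -/(_ v0 i erefl)/eqP : forall i, true -> 0 <= v 0 i * v 0 i.
  by move=> j _; rewrite -expr2 sqr_ge0.
by rewrite mulf_eq0 orbb.
Qed.

Lemma dot_gt0 v : (0 < dot v v) = (v != 0).
Proof. by rewrite lt_def dot_ge0 andbT dot_eq0. Qed.

Lemma dot_delta v i : dot v (delta_mx 0 i) = v 0 i.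
Proof. by rewrite /dot trmx_delta -colE mxE. Qed.

Lemma dot_mul u v w : dot (u *m w) v = dot u (v *m w^T).
Proof. by rewrite /dot trmx_mul trmxK mulmxA. Qed.

Lemma dot_eqP u v : (forall x, dot u x = dot v x) -> u = v.
Proof. by move=> uv; apply/rowP => i; rewrite -!dot_delta uv. Qed.

Lemma mul_refl v a : v *m refl_mx a = v - (2 / dot a a * dot v a) *: a.
Proof.
rewrite /refl_mx mulmxBr mulmx1 -scalemxAr mulmxA.
by rewrite (mx11_scalar (v *m a^T)) mul_scalar_mx scalerA.
Qed.

Lemma refl_mxT a : (refl_mx a)^T = refl_mx a.
Proof. by rewrite /refl_mx raddfB/= trmx1 linearZ/= trmx_mul trmxK. Qed.

Lemma refl_mxZ (k : R) a : k != 0 -> refl_mx (k *: a) = refl_mx a.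
Proof.
move=> k0; rewrite /refl_mx dotZl dotZr; congr (_ - _).
rewrite [(k *: a)^T]linearZ/= -!scalemxAl -!scalemxAr !scalerA; congr (_ *: _).
have [->|a0] := eqVneq (dot a a) 0; first by rewrite !mulr0 invr0 !mulr0 !mul0r.
by field; rewrite a0 k0.
Qed.

Lemma refl_mxN a : refl_mx (- a) = refl_mx a.
Proof. by rewrite -scaleN1r refl_mxZ// oppr_eq0 oner_eq0. Qed.

Lemma mul_reflxx a : a *m refl_mx a = - a.
Proof.
have [->|a0] := eqVneq a 0; first by rewrite mul0mx oppr0.
by rewrite mul_refl divfK ?dot_eq0// scaler_nat mulr2n opprD addrA subrr add0r.
Qed.

Lemma refl_mxK a : refl_mx a *m refl_mx a = 1%:M.
Proof.
apply/row_matrixP => i; rewrite rowE mulmxA rowE mulmx1.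
set v := delta_mx 0 i.
rewrite [v *m refl_mx a]mul_refl mulmxBl -scalemxAl mul_reflxx mul_refl.
by rewrite scalerN opprK subrK.
Qed.

Definition orthogonal_mx w := w *m w^T = 1%:M.

Lemma orthogonal_unit w : orthogonal_mx w -> w \in unitmx.
Proof. by move=> /mulmx1_unit[]. Qed.

Lemma orthogonal_inv w : orthogonal_mx w -> invmx w = w^T.
Proof.
by move=> ow; rewrite -[w^T](mulKmx (orthogonal_unit ow)) ow mulmx1.
Qed.

Lemma orthogonalT w : orthogonal_mx w -> w^T *m w = 1%:M.
Proof. by move=> ow; exact: mulmx1C. Qed.

Lemma orthogonalM w1 w2 :
  orthogonal_mx w1 -> orthogonal_mx w2 -> orthogonal_mx (w1 *m w2).
Proof.
rewrite /orthogonal_mx => o1 o2.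
by rewrite trmx_mul mulmxA -(mulmxA w1) o2 mulmx1.
Qed.

Lemma orthogonal1 : orthogonal_mx 1%:M.
Proof. by rewrite /orthogonal_mx trmx1 mulmx1. Qed.

Lemma orthogonal_refl a : orthogonal_mx (refl_mx a).
Proof. by rewrite /orthogonal_mx refl_mxT refl_mxK. Qed.

Lemma dot_orthogonal w u v :
  orthogonal_mx w -> dot (u *m w) (v *m w) = dot u v.
Proof. by move=> ow; rewrite dot_mul -mulmxA ow mulmx1. Qed.

Lemma refl_mxJ a w : orthogonal_mx w ->
  refl_mx (a *m w) = w^T *m refl_mx a *m w.
Proof.
move=> ow; rewrite /refl_mx dot_orthogonal// trmx_mul mulmxBr mulmxBl mulmx1.
by rewrite orthogonalT// -scalemxAr -scalemxAl !mulmxA.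
Qed.

(** * The action on polynomials *)

(* Opaque copies of [poly_act] and [divdiff]: unfolding the originals during
   unification is very expensive. *)
Fact act_key : {A : 'M[R]_N -> poly -> poly | A = poly_act}.
Proof. by exists poly_act. Qed.

Definition act := sval act_key.

Lemma actE : act = poly_act.
Proof. exact: svalP act_key. Qed.

Fact ddiff_key : {A : 'rV[R]_N -> poly -> poly | A = divdiff}.
Proof. by exists divdiff. Qed.

Definition ddiff := sval ddiff_key.

Lemma ddiffE : ddiff = divdiff.
Proof. exact: svalP ddiff_key. Qed.

Lemma polyE (f : poly) : f = \sum_(m <- msupp f) mcoeff m f *: mpolyX R[i] m.
Proof. exact: mpolyE. Qed.

(** Used for nearly every identity between operators on polynomials: the operators are linear and
    their value at 1 is known, so only the commutation with a variable remains to be checked. *)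
Lemma poly_ind_vars (Q : poly -> Prop) :
  Q 1 -> (forall z f, Q f -> Q (z *: f)) ->
  (forall f g, Q f -> Q g -> Q (f + g)) ->
  (forall i f, Q f -> Q (polyvar i * f)) -> forall f, Q f.
Proof.
move=> Q1 QZ QD QX f.
have QXm m : Q (mpolyX R[i] m).
  rewrite mpolyXE_id; elim/big_rec : _ => // i g _ Qg.
  by elim: (fun_of_multinom m i) => [|k IH];
    [rewrite expr0 mul1r | rewrite exprS -mulrA; exact: QX].
elim/mpolyind: f => [|z m p _ _ Qp]; last by apply: QD => //; exact: QZ.
by rewrite -(scale0r 1); exact: QZ.
Qed.

Lemma real_complexM (x y : R) : (x * y)%:C%C = x%:C%C * y%:C%C :> R[i].
Proof. exact: rmorphM. Qed.

Lemma linformE a : linform a = \sum_i (a 0 i)%:C%C *: polyvar i :> poly.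
Proof. by []. Qed.

Lemma linformD a b : linform (a + b) = linform a + linform b :> poly.
Proof.
rewrite /linform -big_split; apply: eq_bigr => i _.
by rewrite mxE rmorphD scalerDl.
Qed.

Lemma linformZ (k : R) a : linform (k *: a) = k%:C%C *: linform a :> poly.
Proof.
rewrite /linform scaler_sumr; apply: eq_bigr => i _.
by rewrite mxE rmorphM scalerA.
Qed.

Lemma linformN a : linform (- a) = - linform a :> poly.
Proof. by rewrite -scaleN1r linformZ rmorphN rmorph1 scaleN1r. Qed.

Lemma linform0 : linform 0 = 0 :> poly.
Proof. by rewrite -(scale0r 0) linformZ rmorph0 scale0r. Qed.

Lemma linform_sum (I : Type) (r : seq I) (Q : pred I) (F : I -> 'rV[R]_N) :
  linform (\sum_(i <- r | Q i) F i) =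
  \sum_(i <- r | Q i) linform (F i) :> poly.
Proof.
by apply: (big_morph linform) => [x y|]; rewrite ?linformD ?linform0.
Qed.

Lemma linform_delta i : linform (delta_mx 0 i) = polyvar i :> poly.
Proof.
rewrite /linform (bigD1 i)//= big1 => [|j ji]; rewrite mxE !eqxx/=.
  by rewrite rmorph1 scale1r addr0.
by rewrite (negbTE ji) rmorph0 scale0r.
Qed.

Lemma linform_eq0 a : (linform a == 0 :> poly) = (a == 0).
Proof.
apply/eqP/eqP => [a0|->]; last exact: linform0.
apply/rowP => i; rewrite mxE.
have := congr1 (mcoeff (mnm1 i)) a0; rewrite mcoeff0 /linform.
rewrite raddf_sum (bigD1 i)//= big1 ?addr0 => [|j ji].
  by rewrite mcoeffZ mcoeffX eqxx mulr1 => -[].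
rewrite mcoeffZ mcoeffX; case: eqP => [/mnmP/(_ i)|]; last by rewrite mulr0.
by rewrite !mnm1E eqxx (negbTE ji).
Qed.

Lemma meval_linform (x : 'I_N -> R[i]) a :
  meval x (linform a) = \sum_i (a 0 i)%:C%C * x i.
Proof.
rewrite /linform rmorph_sum/=; apply: eq_bigr => i _.
by rewrite mevalZ mevalXU.
Qed.

Lemma actM w f g : act w (f * g) = act w f * act w g.
Proof. by rewrite actE /poly_act rmorphM. Qed.

Lemma actD w f g : act w (f + g) = act w f + act w g.
Proof. by rewrite actE /poly_act rmorphD. Qed.

Lemma actB w f g : act w (f - g) = act w f - act w g.
Proof. by rewrite actE /poly_act rmorphB. Qed.

Lemma act0 w : act w 0 = 0 :> poly.
Proof. by rewrite actE /poly_act rmorph0. Qed.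

Lemma act_1 w : act w 1 = 1 :> poly.
Proof. by rewrite actE /poly_act rmorph1. Qed.

Lemma actZ w (z : R[i]) f : act w (z *: f) = z *: act w f.
Proof. by rewrite actE /poly_act comp_mpolyZ. Qed.

Lemma act_sum w (I : Type) (r : seq I) (Q : pred I) (F : I -> poly) :
  act w (\sum_(i <- r | Q i) F i) =
  \sum_(i <- r | Q i) act w (F i).
Proof. by rewrite actE /poly_act rmorph_sum. Qed.

Lemma act_var w i :
  act w (polyvar i) = linform (row i (invmx w)^T) :> poly.
Proof. by rewrite actE /poly_act /polyvar comp_mpolyXU -tnth_nth tnth_mktuple. Qed.

Lemma act_linform w a :
  act w (linform a) = linform (a *m (invmx w)^T) :> poly.
Proof.
rewrite {1}linformE act_sum [a *m _]mulmx_sum_row linform_sum.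
by apply: eq_bigr => i _; rewrite actZ act_var linformZ.
Qed.

Lemma act_linform_orth w a : orthogonal_mx w ->
  act w (linform a) = linform (a *m w) :> poly.
Proof. by move=> ow; rewrite act_linform orthogonal_inv// trmxK. Qed.

Lemma act1 f : act 1%:M f = f.
Proof.
elim/poly_ind_vars : f => [|z f IH|f g IHf IHg|i f IH].
- exact: act_1.
- by rewrite actZ IH.
- by rewrite actD IHf IHg.
- by rewrite actM IH -linform_delta act_linform_orth ?mulmx1//
    ; exact: orthogonal1.
Qed.

(** The order is reversed because matrices act on row vectors from the right: an orthogonal [w]
    sends the linear form of a to that of [a *m w]. *)
Lemma act_mul w1 w2 f : orthogonal_mx w1 -> orthogonal_mx w2 ->
  act (w1 *m w2) f = act w2 (act w1 f).
Proof.
move=> o1 o2; have o12 := orthogonalM o1 o2.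
elim/poly_ind_vars : f => [|z f IH|f g IHf IHg|i f IH].
- by rewrite !act_1.
- by rewrite !actZ IH.
- by rewrite !actD IHf IHg.
- rewrite actM IH [act w1 (_ * _)]actM [RHS]actM.
  congr (_ * _); rewrite -linform_delta.
  by rewrite [LHS]act_linform_orth// [act w1 _]act_linform_orth//
    [RHS]act_linform_orth// mulmxA.
Qed.

Lemma act_reflK a f : act (refl_mx a) (act (refl_mx a) f) = f.
Proof.
rewrite -act_mul ?refl_mxK ?act1//; exact: orthogonal_refl.
Qed.

Lemma meval_poly_act w (x : 'I_N -> R[i]) f :
  meval x (act w f) =
  meval (fun i => \sum_j (invmx w j i)%:C%C * x j) f.
Proof.
rewrite actE /poly_act comp_mpoly_meval; apply: meval_eq => i.
rewrite tnth_mktuple meval_linform; apply: eq_bigr => j _.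
by rewrite !mxE.
Qed.

Lemma ddiffEx a f : a != 0 ->
  linform a * ddiff a f = f - act (refl_mx a) f.
Proof. by move=> a0; rewrite ddiffE actE divdiffP ?dot_eq0. Qed.

(** A nonzero linear form is not a zero divisor, so a divided difference may be identified after
    multiplying back by (a, x). The rules for [ddiff] come from this. *)
Lemma ddiff_uniq a f g : a != 0 ->
  linform a * g = f - act (refl_mx a) f -> ddiff a f = g.
Proof.
move=> a0 eg; apply: (@mulfI _ (linform a)); first by rewrite linform_eq0.
by rewrite ddiffEx.
Qed.


Lemma ddiffD a f g : a != 0 -> ddiff a (f + g) = ddiff a f + ddiff a g.
Proof.
move=> a0; apply: ddiff_uniq => //.
by rewrite mulrDr (ddiffEx f)// (ddiffEx g)// actD opprD addrACA.
Qed.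

Lemma ddiffZ a (z : R[i]) f : a != 0 -> ddiff a (z *: f) = z *: ddiff a f.
Proof.
move=> a0; apply: ddiff_uniq => //.
by rewrite -scalerAr ddiffEx// actZ scalerBr.
Qed.

Lemma ddiff1 a : a != 0 -> ddiff a 1 = 0 :> poly.
Proof.
by move=> a0; apply: ddiff_uniq => //; rewrite mulr0 act_1 subrr.
Qed.

Lemma ddiffM a f g : a != 0 ->
  ddiff a (f * g) = f * ddiff a g + ddiff a f * act (refl_mx a) g.
Proof.
move=> a0; apply: ddiff_uniq => //.
rewrite mulrDr mulrCA ddiffEx// mulrA ddiffEx// actM.
by rewrite mulrBr mulrBl addrA subrK.
Qed.

Lemma act_refl_linform a u :
  act (refl_mx a) (linform u) =
  linform u - (2 / dot a a * dot u a)%:C%C *: linform a :> poly.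
Proof.
rewrite act_linform_orth; last exact: orthogonal_refl.
by rewrite mul_refl linformD linformN linformZ.
Qed.

Lemma ddiff_linform a u : a != 0 ->
  ddiff a (linform u) = (2 / dot a a * dot u a)%:C%C *: 1 :> poly.
Proof.
move=> a0; apply: ddiff_uniq => //.
by rewrite act_refl_linform opprB addrC subrK -scalerAr mulr1.
Qed.

Lemma ddiff_scale (k : R) a f : k != 0 -> a != 0 ->
  ddiff (k *: a) f = k^-1%:C%C *: ddiff a f.
Proof.
move=> k0 a0; apply: ddiff_uniq.
  by rewrite scaler_eq0 (negbTE k0).
rewrite refl_mxZ// linformZ -scalerAl -scalerAr scalerA -rmorphM divff//.
by rewrite rmorph1 scale1r ddiffEx.
Qed.

Lemma ddiffN a f : a != 0 -> ddiff (- a) f = - ddiff a f.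
Proof.
move=> a0; rewrite -scaleN1r ddiff_scale// ?oppr_eq0 ?oner_eq0//.
by rewrite invrN1 rmorphN rmorph1 scaleN1r.
Qed.

Lemma refl_mx_comm a w : orthogonal_mx w ->
  refl_mx a *m w = w *m refl_mx (a *m w).
Proof. by move=> ow; rewrite refl_mxJ// !mulmxA ow mul1mx. Qed.

Lemma act_ddiff w a f : a != 0 -> orthogonal_mx w ->
  act w (ddiff a f) = ddiff (a *m w) (act w f).
Proof.
move=> a0 ow; have oa := orthogonal_refl a; have oaw := orthogonal_refl (a *m w).
apply/esym/ddiff_uniq.
  by rewrite -dot_eq0 dot_orthogonal// dot_eq0.
rewrite -act_linform_orth// -actM ddiffEx// actB.
congr (_ - _).
rewrite -(act_mul f oa ow) -(act_mul f ow oaw).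
by rewrite refl_mx_comm.
Qed.

End ReflectionAction.

(** * Dunkl operators and their commutation *)

Section DunklOperators.
Context {R : realType} {N : nat}.
Local Notation poly := (mpoly N R[i]).
Implicit Types (a b u v xi : 'rV[R]_N) (w : 'M[R]_N) (f g : poly).

Fact pderiv_key :
  {A : 'rV[R]_N -> poly -> poly |
   A = fun xi f => \sum_i (xi 0 i)%:C%C *: (mderiv i f : poly)}.
Proof. by eexists. Qed.

Definition pderiv := sval pderiv_key.

Lemma pderivE xi f : pderiv xi f = \sum_i (xi 0 i)%:C%C *: (mderiv i f : poly).
Proof. by rewrite /pderiv (svalP pderiv_key). Qed.

Lemma pderivD xi f g : pderiv xi (f + g) = pderiv xi f + pderiv xi g.
Proof.
rewrite !pderivE -big_split; apply: eq_bigr => i _.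
by rewrite mderivD scalerDr.
Qed.

Lemma pderivZ xi (z : R[i]) f : pderiv xi (z *: f) = z *: pderiv xi f.
Proof.
rewrite !pderivE scaler_sumr; apply: eq_bigr => i _.
by rewrite mderivZ !scalerA mulrC.
Qed.

Lemma pderivM xi f g : pderiv xi (f * g) = f * pderiv xi g + pderiv xi f * g.
Proof.
rewrite !pderivE mulr_sumr mulr_suml -big_split; apply: eq_bigr => i _.
by rewrite mderivM scalerDr addrC scalerAr scalerAl.
Qed.

Lemma pderiv1 xi : pderiv xi 1 = 0.
Proof.
rewrite pderivE big1// => i _.
by rewrite -mpolyC1 mderivC scaler0.
Qed.

Lemma pderivDl xi1 xi2 f : pderiv (xi1 + xi2) f = pderiv xi1 f + pderiv xi2 f.
Proof.
rewrite !pderivE -big_split; apply: eq_bigr => i _.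
by rewrite mxE rmorphD scalerDl.
Qed.

Lemma pderivZl (k : R) xi f : pderiv (k *: xi) f = k%:C%C *: pderiv xi f.
Proof.
rewrite !pderivE scaler_sumr; apply: eq_bigr => i _.
by rewrite mxE rmorphM scalerA.
Qed.

Lemma pderiv_delta i f : pderiv (delta_mx 0 i) f = mderiv i f.
Proof.
rewrite pderivE (bigD1 i)//= big1 => [|j ji]; rewrite mxE !eqxx/=.
  by rewrite rmorph1 scale1r addr0.
by rewrite (negbTE ji) rmorph0 scale0r.
Qed.

Lemma mderiv_var i j : mderiv i (polyvar j : poly) = ((i == j)%:R)%:C%C *: 1.
Proof.
rewrite /polyvar mderivX mnmE/=; case: (eqVneq j i) => [->|ji].
  rewrite (_ : mnm_sub _ _ = mnm0) ?mpolyX0 ?eqxx ?rmorph1//.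
  by apply/mnmP => k; rewrite !mnmE subnn.
by rewrite !scale0r.
Qed.

Lemma pderiv_var xi i : pderiv xi (polyvar i) = (xi 0 i)%:C%C *: 1.
Proof.
rewrite pderivE (bigD1 i)//= big1 => [|j ji]; rewrite mderiv_var ?eqxx.
  by rewrite addr0 scalerA rmorph1 mulr1.
by rewrite (negbTE ji) rmorph0 scale0r scaler0.
Qed.

Lemma pderiv_sum xi (I : Type) (r : seq I) (Q : pred I) (F : I -> poly) :
  pderiv xi (\sum_(i <- r | Q i) F i) = \sum_(i <- r | Q i) pderiv xi (F i).
Proof.
apply: (big_morph (pderiv xi)) => [f g|]; first exact: pderivD.
by rewrite -(scale0r 1) pderivZ !scale0r.
Qed.

Lemma pderiv_linform xi a : pderiv xi (linform a) = (dot a xi)%:C%C *: 1.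
Proof.
rewrite linformE pderiv_sum dotE rmorph_sum scaler_suml.
by apply: eq_bigr => i _; rewrite pderivZ pderiv_var scalerA rmorphM.
Qed.

Lemma act_pderiv w xi f : orthogonal_mx w ->
  act w (pderiv xi f) = pderiv (xi *m w) (act w f).
Proof.
move=> ow; elim/(@poly_ind_vars R N) : f => [|z f IH|f g IHf IHg|i f IH].
- by rewrite act_1 !pderiv1 act0.
- by rewrite actZ !pderivZ actZ IH.
- by rewrite actD !pderivD actD IHf IHg.
- rewrite actM !pderivM actD !actM IH -linform_delta act_linform_orth//.
  by rewrite !pderiv_linform dot_orthogonal// actZ act_1.
Qed.

Variables (P : seq 'rV[R]_N) (c : R).

(** With [pm_stable] this stands in for the root system in the calculus of Dunkl operators, which
    depends on the roots only up to sign: at most one vector is taken from each pair {a, -a}. *)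
Definition half_system := uniq P /\ {in P, forall a, a != 0 /\ - a \notin P}.

Definition pm_stable w :=
  forall a, a \in P -> (a *m w \in P) || (- (a *m w) \in P).

(** An even function only sees the pairs {a, -a}, which [w] permutes; [h] picks from the image pair
    the member lying in [P]. *)
Lemma big_pm_stable (T : Type) (idx : T) (op : Monoid.com_law idx)
    (F : 'rV[R]_N -> T) w :
  half_system -> orthogonal_mx w -> pm_stable w -> (forall a, F (- a) = F a) ->
  \big[op/idx]_(a <- P) F (a *m w) = \big[op/idx]_(a <- P) F a.
Proof.
move=> [uP nP] ow Pw Fe.
pose h a := if a *m w \in P then a *m w else - (a *m w).
have hP a : a \in P -> h a \in P.
  by move=> /Pw; rewrite /h; case: ifP.
have mwI a b : a *m w = b *m w -> a = b.
  by move=> /(congr1 (mulmx^~ w^T)); rewrite -!mulmxA ow !mulmx1.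
have hI : {in P &, injective h}.
  move=> a b aP bP; rewrite /h; have [_ na] := nP _ aP; have [_ nb] := nP _ bP.
  case: ifP => _; case: ifP => _ e.
  - exact: mwI.
  - by move: e nb; rewrite -mulNmx => /mwI <-; rewrite aP.
  - by move: e na; rewrite -mulNmx => /mwI ->; rewrite bP.
  - exact/mwI/oppr_inj.
have pP : perm_eq (map h P) P.
  apply: uniq_perm => //; first by rewrite map_inj_in_uniq.
  apply: (uniq_min_size _ _ _).2; rewrite ?map_inj_in_uniq ?size_map//.
  by move=> _ /mapP[a aP ->]; exact: hP.
rewrite -[RHS](perm_big _ pP)/= big_map; apply: eq_bigr => a _.
by rewrite /h; case: ifP => // _; rewrite Fe.
Qed.

Fact dk_key : {A : 'rV[R]_N -> poly -> poly |
  A = fun xi f => pderiv xi f - \sum_(a <- P) (c * dot a xi)%:C%C *: ddiff a f}.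
Proof. by eexists. Qed.

Definition dk := sval dk_key.

Lemma dkE xi f :
  dk xi f = pderiv xi f - \sum_(a <- P) (c * dot a xi)%:C%C *: ddiff a f.
Proof. by rewrite /dk (svalP dk_key). Qed.

Lemma dunkl_dk xi f : dunkl P c xi f = dk xi f.
Proof. by rewrite dkE /dunkl pderivE ddiffE. Qed.

Hypothesis hsP : half_system.

Let P0 a : a \in P -> a != 0. Proof. by move=> /hsP.2[]. Qed.

Lemma dkD xi f g : dk xi (f + g) = dk xi f + dk xi g.
Proof.
rewrite !dkE pderivD addrACA -opprD -big_split; congr (_ + - _).
by apply: eq_big_seq => a aP; rewrite ddiffD ?P0// scalerDr.
Qed.

Lemma dkZ xi (z : R[i]) f : dk xi (z *: f) = z *: dk xi f.
Proof.
rewrite !dkE pderivZ scalerBr scaler_sumr; congr (_ - _).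
by apply: eq_big_seq => a aP; rewrite ddiffZ ?P0// !scalerA mulrC.
Qed.

Lemma dk0 xi : dk xi 0 = 0.
Proof. by rewrite -(scale0r 0) dkZ !scale0r. Qed.

Lemma dkN xi f : dk xi (- f) = - dk xi f.
Proof. by rewrite -scaleN1r dkZ scaleN1r. Qed.

Lemma dkB xi f g : dk xi (f - g) = dk xi f - dk xi g.
Proof. by rewrite dkD dkN. Qed.

Lemma dk_sum xi (I : Type) (r : seq I) (Q : pred I) (F : I -> poly) :
  dk xi (\sum_(i <- r | Q i) F i) = \sum_(i <- r | Q i) dk xi (F i).
Proof.
by apply: (big_morph (dk xi)) => [f g|]; [exact: dkD | exact: dk0].
Qed.

Lemma dk1 xi : dk xi 1 = 0.
Proof.
rewrite dkE pderiv1 big_seq big1 ?subrr// => a aP.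
by rewrite ddiff1 ?P0// scaler0.
Qed.

Lemma dkDl xi1 xi2 f : dk (xi1 + xi2) f = dk xi1 f + dk xi2 f.
Proof.
rewrite !dkE pderivDl addrACA -opprD -big_split; congr (_ + - _).
by apply: eq_bigr => a _; rewrite dotDr mulrDr rmorphD scalerDl.
Qed.

Lemma dkZl (k : R) xi f : dk (k *: xi) f = k%:C%C *: dk xi f.
Proof.
rewrite !dkE pderivZl scalerBr scaler_sumr; congr (_ - _).
by apply: eq_bigr => a _; rewrite dotZr mulrCA rmorphM scalerA.
Qed.

Lemma dkNl xi f : dk (- xi) f = - dk xi f.
Proof. by rewrite -scaleN1r dkZl rmorphN rmorph1 scaleN1r. Qed.

Lemma dkBl xi1 xi2 f : dk (xi1 - xi2) f = dk xi1 f - dk xi2 f.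
Proof. by rewrite dkDl dkNl. Qed.

Lemma dk_suml (I : Type) (r : seq I) (Q : pred I) (F : I -> 'rV[R]_N) f :
  dk (\sum_(i <- r | Q i) F i) f = \sum_(i <- r | Q i) dk (F i) f.
Proof.
apply: (big_morph (dk^~ f)) => [x y|]; first exact: dkDl.
by rewrite -(scale0r 0) dkZl rmorph0 !scale0r.
Qed.

Lemma dk_coord xi f : dk xi f = \sum_i (xi 0 i)%:C%C *: dk (delta_mx 0 i) f.
Proof.
rewrite {1}[xi]row_sum_delta dk_suml; apply: eq_bigr => i _; exact: dkZl.
Qed.

Lemma act_dk w xi f : orthogonal_mx w -> pm_stable w ->
  act w (dk xi f) = dk (xi *m w) (act w f).
Proof.
move=> ow Pw; rewrite !dkE actB act_pderiv// act_sum; congr (_ - _).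
pose h a := (c * dot a (xi *m w))%:C%C *: ddiff a (act w f).
(* [big_pm_stable] asks for evenness at every vector, and [ddiffN] says nothing at 0; the test for 0
   closes that gap. *)
transitivity (\sum_(a <- P) if a == 0 then 0 else h (a *m w)).
  apply: eq_big_seq => a aP; rewrite (negbTE (P0 aP)) /h actZ.
  by rewrite dot_orthogonal// act_ddiff ?P0.
pose h' a := if a == 0 then 0 else h a.
transitivity (\sum_(a <- P) h' (a *m w)).
  apply: eq_bigr => a _; rewrite /h' -[in RHS]dot_eq0 dot_orthogonal//.
  by rewrite dot_eq0.
rewrite big_pm_stable//= => [|a].
  by apply: eq_big_seq => a aP; rewrite /h' (negbTE (P0 aP)).
rewrite /h' oppr_eq0; case: eqVneq => // a0.
by rewrite /h dotNl mulrN rmorphN ddiffN// scaleNr scalerN opprK.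
Qed.

(** The commutation relation of the rational Cherednik algebra between y_xi and multiplication by
    (u, x), in its action on f. *)
Lemma dk_linform xi u f :
  dk xi (linform u * f) = linform u * dk xi f + (dot u xi)%:C%C *: f
  - \sum_(a <- P) (c * dot a xi * (2 / dot a a * dot u a))%:C%C
                    *: act (refl_mx a) f.
Proof.
rewrite !dkE pderivM pderiv_linform -scalerAl mul1r mulrBr.
set B := \sum_(a <- P) (c * dot a xi)%:C%C *: ddiff a f.
set C := \sum_(a <- P) (c * dot a xi * (2 / dot a a * dot u a))%:C%C *: _.
have -> : \sum_(a <- P) (c * dot a xi)%:C%C *: ddiff a (linform u * f) =
    linform u * B + C.
  rewrite mulr_sumr -big_split.
  apply: eq_big_seq => a aP; rewrite ddiffM ?P0// ddiff_linform ?P0//.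
  rewrite scalerDr -scalerAr; congr (_ + _).
  by rewrite -scalerAl mul1r scalerA -real_complexM.
ring.
Qed.

Hypothesis PW : {in P, forall a, pm_stable (refl_mx a)}.

Lemma act_refl_dk a xi f : a \in P ->
  act (refl_mx a) (dk xi f) = dk xi (act (refl_mx a) f)
    - (2 / dot a a * dot xi a)%:C%C *: dk a (act (refl_mx a) f).
Proof.
move=> aP; rewrite act_dk; [|exact: orthogonal_refl|exact: PW].
by rewrite mul_refl dkBl dkZl.
Qed.

(* Both orders of [xi] and [eta] produce the same correction terms, so the
   commutator commutes with multiplication by linear forms; it kills 1. *)
Lemma dk_comm xi eta f : dk xi (dk eta f) = dk eta (dk xi f).
Proof.
suff : dk xi (dk eta f) - dk eta (dk xi f) = 0 by move/subr0_eq.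
elim/(@poly_ind_vars R N) : f => [|z f IH|f g IHf IHg|i f IH].
- by rewrite !dk1 !dk0 subrr.
- by rewrite !dkZ -scalerBr IH scaler0.
- by rewrite !dkD opprD addrACA IHf IHg addr0.
rewrite -linform_delta; set u := delta_mx 0 i.
pose S (x y : 'rV[R]_N) := \sum_(a <- P)
  (c * dot a x * (2 / dot a a * dot u a))%:C%C *: act (refl_mx a) (dk y f).
pose T (x y : 'rV[R]_N) := \sum_(a <- P)
  (c * dot a y * (2 / dot a a * dot u a))%:C%C *: dk x (act (refl_mx a) f).
pose X (x y : 'rV[R]_N) := \sum_(a <- P)
  (c * dot a x * (2 / dot a a * dot u a) * (2 / dot a a * dot y a))%:C%C
    *: dk a (act (refl_mx a) f).
have E x y : dk x (dk y (linform u * f)) =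
    linform u * dk x (dk y f) + (dot u x)%:C%C *: dk y f - S x y
    + (dot u y)%:C%C *: dk x f - T x y.
  rewrite dk_linform dkB dkD dk_linform dkZ; congr (_ - _).
  by rewrite dk_sum; apply: eq_bigr => a _; rewrite dkZ.
have ST x y : S x y = T y x - X x y.
  rewrite /S /T /X -sumrB; apply: eq_big_seq => a aP.
  by rewrite act_refl_dk// scalerBr scalerA -real_complexM.
have XC : X xi eta = X eta xi.
  apply: eq_bigr => a _; congr (_%:C%C *: _).
  rewrite (dotC xi a) (dotC eta a); ring.
rewrite !E !ST XC.
have -> (A B C D F G H : poly) : A + B - (F - H) + C - G -
    (D + C - (G - H) + B - F) = A - D by ring.
by rewrite -mulrBr IH mulr0.
Qed.


(** * The Dunkl Laplacian *)

Let e_ (i : 'I_N) : 'rV[R]_N := delta_mx 0 i.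

Definition dlap f := \sum_i dk (e_ i) (dk (e_ i) f).

Lemma dlapD f g : dlap (f + g) = dlap f + dlap g.
Proof. by rewrite -big_split; apply: eq_bigr => i _; rewrite !dkD. Qed.

Lemma dlapZ (z : R[i]) f : dlap (z *: f) = z *: dlap f.
Proof. by rewrite scaler_sumr; apply: eq_bigr => i _; rewrite !dkZ. Qed.

Lemma dlap_dk xi f : dlap (dk xi f) = dk xi (dlap f).
Proof.
rewrite /dlap dk_sum; apply: eq_bigr => i _.
by rewrite [dk _ (dk xi f)]dk_comm dk_comm.
Qed.

(** Any orthonormal basis defines the same operator. Taken with the images of the coordinate
    vectors, this is why the Laplacian commutes with W. *)
Lemma dlap_frame (B : 'M[R]_N) f : orthogonal_mx B ->
  \sum_i dk (row i B) (dk (row i B) f) = dlap f.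
Proof.
move=> oB.
transitivity (\sum_k \sum_l (\sum_i B i k * B i l)%:C%C *: dk (e_ k) (dk (e_ l) f)).
  under eq_bigr => i _.
    rewrite dk_coord; under eq_bigr => k _.
      rewrite [dk (row i B) f]dk_coord dk_sum scaler_sumr.
      under eq_bigr => l _ do rewrite dkZ scalerA -real_complexM !mxE.
      over.
    over.
  rewrite exchange_big; apply: eq_bigr => k _.
  rewrite exchange_big; apply: eq_bigr => l _.
  by rewrite rmorph_sum scaler_suml.
have oT k l : \sum_i B i k * B i l = (k == l)%:R.
  have := congr1 (fun M : 'M[R]_N => M k l) (orthogonalT oB).
  by rewrite mxE [X in _ = X]mxE => <-; apply: eq_bigr => i _; rewrite mxE.
apply: eq_bigr => k _; rewrite (bigD1 k)//= [X in _ + X]big1 ?addr0 => [|l lk].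
  by rewrite oT eqxx scale1r.
by rewrite oT eq_sym (negbTE lk) scale0r.
Qed.

Lemma act_dlap w f : orthogonal_mx w -> pm_stable w ->
  act w (dlap f) = dlap (act w f).
Proof.
move=> ow Pw; rewrite -[RHS](dlap_frame _ ow) act_sum.
by apply: eq_bigr => i _; rewrite !act_dk// -rowE.
Qed.

(* The reflection terms cancel because [s_a] anticommutes with [dk a]. *)
Lemma dlap_linform u f :
  dlap (linform u * f) = linform u * dlap f + 2%:R *: dk u f.
Proof.
pose t x a := c * dot a x * (2 / dot a a * dot u a).
have E x : dk x (dk x (linform u * f)) =
    linform u * dk x (dk x f) + (dot u x)%:C%C *: dk x f
    + (dot u x)%:C%C *: dk x f
    - \sum_(a <- P) (t x a)%:C%C *: (act (refl_mx a) (dk x f) +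
                                    dk x (act (refl_mx a) f)).
  rewrite dk_linform dkB dkD dk_linform dkZ dk_sum.
  rewrite (eq_bigr _ (fun a _ => scalerDr _ _ _)) big_split/=.
  rewrite [X in _ - X = _](eq_bigr (fun a => (t x a)%:C%C *: dk x (act (refl_mx a) f)))
    => [|a _]; last by rewrite dkZ.
  rewrite -/(t x); ring.
rewrite /dlap; under eq_bigr => i _ do rewrite E.
rewrite sumrB !big_split/= -mulr_sumr.
have -> : \sum_i (dot u (e_ i))%:C%C *: dk (e_ i) f = dk u f.
  by rewrite [RHS]dk_coord; apply: eq_bigr => i _; rewrite dot_delta.
rewrite exchange_big/= [X in _ - X]big_seq [X in _ - X]big1 ?subr0 => [|a aP].
  by rewrite scaler_nat mulr2n addrA.
transitivity ((c * (2 / dot a a * dot u a))%:C%C *: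
   (act (refl_mx a) (dk a f) + dk a (act (refl_mx a) f))).
  rewrite [dk a f]dk_coord act_sum [dk a (act _ _)]dk_coord -big_split/= scaler_sumr.
  apply: eq_bigr => i _; rewrite actZ -scalerDr scalerA -real_complexM /t dot_delta.
  by congr (_%:C%C *: _); ring.
rewrite act_dk; [|exact: orthogonal_refl|exact: PW].
by rewrite mul_reflxx dkNl addNr scaler0.
Qed.

(** The commutator of the k-th power with (u, x) is 2k y_u times the (k-1)-st power; at k = 0 the
    coefficient makes the truncated [k.-1] harmless. *)
Lemma iter_dlap_linform u f k :
  iter k dlap (linform u * f) =
  linform u * iter k dlap f + (2 * k)%:R *: dk u (iter k.-1 dlap f).
Proof.
elim: k => [|k IH]; first by rewrite muln0 scale0r addr0.
rewrite iterS IH dlapD dlapZ dlap_linform dlap_dk -iterS -addrA; congr (_ + _).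
case: k {IH} => [|k]; first by rewrite muln0 scale0r addr0.
rewrite -scalerDl -natrD; congr (_%:R *: _); lia.
Qed.

Lemma iter_dlapD k f g : iter k dlap (f + g) = iter k dlap f + iter k dlap g.
Proof. by elim: k => //= k ->; rewrite dlapD. Qed.

Lemma iter_dlapZ k (z : R[i]) f : iter k dlap (z *: f) = z *: iter k dlap f.
Proof. by elim: k => //= k ->; rewrite dlapZ. Qed.

Lemma iter_dlap_dk k xi f : iter k dlap (dk xi f) = dk xi (iter k dlap f).
Proof. by elim: k => //= k ->; rewrite dlap_dk. Qed.

Lemma act_iter_dlap k w f : orthogonal_mx w -> pm_stable w ->
  act w (iter k dlap f) = iter k dlap (act w f).
Proof. by move=> ow Pw; elim: k => //= k <-; rewrite act_dlap. Qed.

End DunklOperators.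

(** * Grading and order at the origin *)

Section Grading.
Context {R : realType} {N : nat}.
Local Notation poly := (mpoly N R[i]).
Implicit Types (a b u v xi : 'rV[R]_N) (w : 'M[R]_N) (f g : poly) (d k : nat).

Definition homog d f := f \is ishomog1 d mdeg.

Lemma homogZ d (z : R[i]) f : homog d f -> homog d (z *: f).
Proof. exact: dhomogZ. Qed.

Lemma homogD d f g : homog d f -> homog d g -> homog d (f + g).
Proof. exact: dhomogD. Qed.

Lemma homogM d e f g : homog d f -> homog e g -> homog (d + e) (f * g).
Proof. exact: dhomogM. Qed.

Lemma homog_sum d (I : eqType) (r : seq I) (F : I -> poly) :
  (forall i, i \in r -> homog d (F i)) -> homog d (\sum_(i <- r) F i).
Proof.
move=> h; rewrite big_seq; elim/big_ind : _ => // [|f g].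
  exact: dhomog0.
exact: homogD.
Qed.

Lemma homog_1 : homog 0 1. Proof. exact: dhomog1. Qed.

Lemma homog_var i : homog 1 (polyvar i).
Proof. by rewrite /homog /polyvar dhomogX/= mdeg1. Qed.

Lemma homog_linform a : homog 1 (linform a).
Proof. by rewrite linformE; apply: homog_sum => i _; exact/homogZ/homog_var. Qed.

Lemma homog_ind (Q : nat -> poly -> Prop) :
  (forall d, Q d 0) -> Q 0%N 1 ->
  (forall d z f, Q d f -> Q d (z *: f)) ->
  (forall d f g, Q d f -> Q d g -> Q d (f + g)) ->
  (forall d i f, Q d f -> Q d.+1 (polyvar i * f)) ->
  forall d f, homog d f -> Q d f.
Proof.
move=> Q0 Q1 QZ QD QX d f hf.
have QXm m : Q (mdeg m) (mpolyX R[i] m).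
  have [n] := ubnP (mdeg m); elim: n m => // n IH m mn.
  have [m0|] := posnP (mdeg m).
    have -> : m = mnm0 by apply/eqP; rewrite -mdeg_eq0 m0.
    by rewrite mpolyX0 mdeg0.
  rewrite lt0n mdeg_eq0 => mN0.
  have [i mi] : exists i, (m i != 0)%N.
    apply/existsP; rewrite -negb_forall; apply: contra mN0 => /forallP h.
    by apply/eqP/mnmP => i; rewrite mnm0E; exact/eqP.
  have em : m = mnm_add (mnm1 i) (mnm_sub m (mnm1 i)).
    apply/mnmP => j; rewrite mnmDE mnmBE mnm1E.
    by case: eqP => [<-|_]; rewrite ?subn0// addnC subnK// lt0n.
  move: mn; rewrite em mdegD mdeg1 mpolyXD => mn; rewrite add1n.
  exact/QX/IH.
rewrite (polyE f) big_seq; elim/big_ind : _ => [|g h|m mf]; [exact: Q0|exact: QD|].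
by apply: QZ; rewrite -((dhomogP _ _ _ hf) m mf); exact: QXm.
Qed.


Lemma homog_polyX m : homog (mdeg m) (mpolyX R[i] m).
Proof. by rewrite /homog dhomogX. Qed.

Lemma homog_act w d f : homog d f -> homog d (act w f).
Proof.
move: d f; apply: homog_ind => [d||d z f IH|d f g IHf IHg|d i f IH].
- by rewrite act0; exact: dhomog0.
- by rewrite act_1; exact: homog_1.
- by rewrite actZ; exact: homogZ.
- by rewrite actD; exact: homogD.
- by rewrite actM act_var -add1n; apply: homogM => //; exact: homog_linform.
Qed.

(** Homogeneous of degree d - 1 without truncation: an operator lowering degrees by one must kill
    constants. *)
Definition homog_pred d f := if d is e.+1 then homog e f else f = 0.

Lemma homog_pred0 d : homog_pred d 0.
Proof. by case: d => // d; exact: dhomog0. Qed.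

Lemma homog_predZ d (z : R[i]) f : homog_pred d f -> homog_pred d (z *: f).
Proof. by case: d => [->|d]; [rewrite /= scaler0|exact: homogZ]. Qed.

Lemma homog_predD d f g :
  homog_pred d f -> homog_pred d g -> homog_pred d (f + g).
Proof. by case: d => [-> ->|d]; [rewrite /= addr0|exact: homogD]. Qed.

Lemma homog_pred_var d i f :
  homog_pred d f -> homog_pred d.+1 (polyvar i * f).
Proof.
case: d => [->|d hf]; first by rewrite mulr0; exact: dhomog0.
by rewrite /= -add1n; apply: homogM => //; exact: homog_var.
Qed.

Lemma homog_pderiv xi d f : homog d f -> homog_pred d (pderiv xi f).
Proof.
suff: homog d f -> homog d f /\ homog_pred d (pderiv xi f) by move=> h /h[].
move: d f; apply: homog_ind =>
    [d||d z f [h IH]|d f g [hf IHf] [hg IHg]|d i f [h IH]].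
- rewrite -(scale0r 0) pderivZ !scale0r.
  by split; [exact: dhomog0|exact: homog_pred0].
- by split; [exact: homog_1|exact: pderiv1].
- by rewrite pderivZ; split; [exact: homogZ|exact: homog_predZ].
- by rewrite pderivD; split; [exact: homogD|exact: homog_predD].
- split; first by rewrite -add1n; apply: homogM => //; exact: homog_var.
  rewrite pderivM pderiv_var -scalerAl mul1r.
  by apply: homog_predD; [exact: homog_pred_var|exact: homog_predZ].
Qed.

Lemma homog_ddiff a d f : a != 0 -> homog d f -> homog_pred d (ddiff a f).
Proof.
move=> a0.
suff: homog d f -> homog d f /\ homog_pred d (ddiff a f) by move=> h /h[].
move: d f; apply: homog_ind =>
    [d||d z f [h IH]|d f g [hf IHf] [hg IHg]|d i f [h IH]].
- rewrite -(scale0r 0) ddiffZ// !scale0r.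
  by split; [exact: dhomog0|exact: homog_pred0].
- by split; [exact: homog_1|exact: ddiff1].
- by rewrite ddiffZ//; split; [exact: homogZ|exact: homog_predZ].
- by rewrite ddiffD//; split; [exact: homogD|exact: homog_predD].
- split; first by rewrite -add1n; apply: homogM => //; exact: homog_var.
  rewrite ddiffM// -linform_delta ddiff_linform// -scalerAl mul1r linform_delta.
  apply: homog_predD; first exact: homog_pred_var.
  exact/homogZ/homog_act.
Qed.

(** The order of vanishing at the origin is at least k. *)
Definition mord k f := forall m, (mdeg m < k)%N -> mcoeff m f = 0.

Definition mdeglt k f := forall m, (k <= mdeg m)%N -> mcoeff m f = 0.

Lemma mord_ind k (Q : poly -> Prop) :
  Q 0 -> (forall f g, Q f -> Q g -> Q (f + g)) ->
  (forall d f, (k <= d)%N -> homog d f -> Q f) -> forall f, mord k f -> Q f.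
Proof.
move=> Q0 QD Qh f hf; rewrite (polyE f) big_seq.
elim/big_ind : _ => [|g h|m]; [exact: Q0|exact: QD|].
rewrite mcoeff_msupp => mf; apply: (Qh (mdeg m)).
  by rewrite leqNgt; apply: contra mf => /hf ->.
exact/homogZ/homog_polyX.
Qed.

Lemma mdeglt_ind k (Q : poly -> Prop) :
  Q 0 -> (forall f g, Q f -> Q g -> Q (f + g)) ->
  (forall d f, (d < k)%N -> homog d f -> Q f) -> forall f, mdeglt k f -> Q f.
Proof.
move=> Q0 QD Qh f hf; rewrite (polyE f) big_seq.
elim/big_ind : _ => [|g h|m]; [exact: Q0|exact: QD|].
rewrite mcoeff_msupp => mf; apply: (Qh (mdeg m)).
  by rewrite ltnNge; apply: contra mf => /hf ->.
exact/homogZ/homog_polyX.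
Qed.

Lemma mdeglt_msize f : mdeglt (msize f) f.
Proof.
by move=> m h; apply/eqP; rewrite mcoeff_eq0; exact: msize_mdeg_ge.
Qed.

Lemma homog_mord k d f : (k <= d)%N -> homog d f -> mord k f.
Proof.
move=> kd hf m mk; apply: (dhomog_nemf_coeff hf).
by rewrite /= neq_ltn (leq_trans mk kd).
Qed.

Lemma homog_mdeglt k d f : (d < k)%N -> homog d f -> mdeglt k f.
Proof.
move=> kd hf m mk; apply: (dhomog_nemf_coeff hf).
by rewrite /= neq_ltn orbC (leq_trans kd mk).
Qed.

Lemma mord0 k : mord k 0. Proof. by move=> m _; rewrite mcoeff0. Qed.

Lemma mdeglt0 k : mdeglt k 0. Proof. by move=> m _; rewrite mcoeff0. Qed.

Lemma mordD k f g : mord k f -> mord k g -> mord k (f + g).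
Proof. by move=> hf hg m mk; rewrite mcoeffD hf// hg// addr0. Qed.

Lemma mdegltD k f g : mdeglt k f -> mdeglt k g -> mdeglt k (f + g).
Proof. by move=> hf hg m mk; rewrite mcoeffD hf// hg// addr0. Qed.

Lemma mordZ k (z : R[i]) f : mord k f -> mord k (z *: f).
Proof. by move=> hf m mk; rewrite mcoeffZ hf// mulr0. Qed.

Lemma mordW k l f : (k <= l)%N -> mord l f -> mord k f.
Proof. by move=> kl hf m mk; apply: hf; exact: leq_trans kl. Qed.

Lemma mordM k l f g : mord k f -> mord l g -> mord (k + l) (f * g).
Proof.
move=> hf hg; move: f hf; apply: mord_ind => [|f f' hf hf'|d f kd hf].
- by rewrite mul0r; exact: mord0.
- by rewrite mulrDl; exact: mordD.
move: g hg; apply: mord_ind => [|g g' hg hg'|e g le hg].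
- by rewrite mulr0; exact: mord0.
- by rewrite mulrDr; exact: mordD.
by apply: homog_mord (homogM hf hg); rewrite leq_add.
Qed.

Lemma mordN k f : mord k f -> mord k (- f).
Proof. by rewrite -scaleN1r; exact: mordZ. Qed.

Lemma mord_act k w f : mord k f -> mord k (act w f).
Proof.
move: f; apply: mord_ind => [|f g hf hg|d f kd hf].
- by rewrite act0; exact: mord0.
- by rewrite actD; exact: mordD.
exact/(homog_mord kd)/homog_act.
Qed.

Lemma homog_pred_mord k d f : (k.+1 <= d)%N -> homog_pred d f -> mord k f.
Proof. by case: d => // d kd; apply: homog_mord. Qed.

Lemma homog_pred_mdeglt k d f : (d < k.+1)%N -> homog_pred d f -> mdeglt k f.
Proof.
by case: d => [_ ->|d kd]; [exact: mdeglt0|exact: homog_mdeglt].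
Qed.

Lemma mord_pderiv k xi f : mord k.+1 f -> mord k (pderiv xi f).
Proof.
move: f; apply: mord_ind => [|f g hf hg|d f kd hf].
- by rewrite -(scale0r 0) pderivZ !scale0r; exact: mord0.
- by rewrite pderivD; exact: mordD.
exact/(homog_pred_mord kd)/homog_pderiv.
Qed.

Lemma mord_ddiff k a f : a != 0 -> mord k.+1 f -> mord k (ddiff a f).
Proof.
move=> a0; move: f; apply: mord_ind => [|f g hf hg|d f kd hf].
- by rewrite -(scale0r 0) ddiffZ// !scale0r; exact: mord0.
- by rewrite ddiffD//; exact: mordD.
exact/(homog_pred_mord kd)/homog_ddiff.
Qed.

Section Dunkl.
Variables (P : seq 'rV[R]_N) (c : R).
Hypothesis hsP : half_system P.
Hypothesis PW : {in P, forall a, pm_stable P (refl_mx a)}.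
Local Notation dk := (dk P c).
Local Notation dlap := (dlap P c).

Lemma homog_dk xi d f : homog d f -> homog_pred d (dk xi f).
Proof.
move=> hf; rewrite dkE; apply: homog_predD; first exact: homog_pderiv.
rewrite -scaleN1r; apply: homog_predZ; rewrite big_seq.
elim/big_ind : _ => [|g h|a aP]; [exact: homog_pred0|exact: homog_predD|].
by apply: homog_predZ; apply: homog_ddiff => //; case: (hsP.2 _ aP).
Qed.

Lemma mord_dk k xi f : mord k.+1 f -> mord k (dk xi f).
Proof.
move: f; apply: mord_ind => [|f g hf hg|d f kd hf].
- by rewrite dk0//; exact: mord0.
- by rewrite dkD//; exact: mordD.
exact/(homog_pred_mord kd)/homog_dk.
Qed.

Lemma mdeglt_dk k xi f : mdeglt k.+1 f -> mdeglt k (dk xi f).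
Proof.
move: f; apply: mdeglt_ind => [|f g hf hg|d f kd hf].
- by rewrite dk0//; exact: mdeglt0.
- by rewrite dkD//; exact: mdegltD.
exact/(homog_pred_mdeglt kd)/homog_dk.
Qed.

Lemma mdegltW k l f : (k <= l)%N -> mdeglt k f -> mdeglt l f.
Proof. by move=> kl hf m mk; apply: hf; exact: leq_trans mk. Qed.

(** The true drop is two, but one already makes the exponential a finite sum and unipotent. *)
Lemma mdeglt_dlap k f : mdeglt k.+1 f -> mdeglt k (dlap f).
Proof.
move=> hf; rewrite /dlap; elim/big_ind : _ => [|g h|i _].
- exact: mdeglt0.
- exact: mdegltD.
apply: mdeglt_dk; apply: (@mdegltW k); first exact: leqnSn.
exact: mdeglt_dk.
Qed.

Lemma mdeglt_iter_dlap j k f : mdeglt (j + k) f -> mdeglt k (iter j dlap f).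
Proof.
elim: j k => // j IH k; rewrite iterS addSnnS => /IH; exact: mdeglt_dlap.
Qed.

Lemma iter_dlap_eq0 k f : (msize f <= k)%N -> iter k dlap f = 0.
Proof.
move=> fk; apply/mpolyP => m; rewrite mcoeff0.
apply: (@mdeglt_iter_dlap k 0%N) => //; rewrite addn0.
exact: mdegltW fk (@mdeglt_msize f).
Qed.

Let tau k : R[i] := (- 2^-1) ^+ k / k`!%:R.

(* The operator exp(-dlap/2); the sum is finite since [dlap] lowers degrees. *)
Definition gauss_exp f := \sum_(k < msize f) tau k *: iter k dlap f.

(** The range of summation depends on the polynomial; identities involving several polynomials are
    compared over a common larger range. *)
Lemma gauss_exp_wide K f : (msize f <= K)%N ->
  gauss_exp f = \sum_(k < K) tau k *: iter k dlap f.
Proof.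
move=> fK; rewrite /gauss_exp (big_ord_widen K (fun k => tau k *: iter k dlap f))//.
rewrite [RHS](bigID (fun k : 'I_K => (k < msize f)%N))/= [X in _ = _ + X]big1 ?addr0//.
by move=> k; rewrite -leqNgt => /iter_dlap_eq0 ->; rewrite scaler0.
Qed.

Lemma gauss_expD f g : gauss_exp (f + g) = gauss_exp f + gauss_exp g.
Proof.
pose K := maxn (msize f) (msize g).
rewrite (@gauss_exp_wide K f) ?leq_maxl// (@gauss_exp_wide K g) ?leq_maxr//.
rewrite (@gauss_exp_wide K) ?msizeD_le// -big_split; apply: eq_bigr => k _.
by rewrite iter_dlapD// scalerDr.
Qed.

Lemma gauss_expZ (z : R[i]) f : gauss_exp (z *: f) = z *: gauss_exp f.
Proof.
rewrite (@gauss_exp_wide (msize f)) ?msizeZ_le// scaler_sumr.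
by apply: eq_bigr => k _; rewrite iter_dlapZ// !scalerA mulrC.
Qed.

(** Conjugation by the exponential turns multiplication by (u, x) into (u, x) - y_u: the
    coefficients satisfy 2(k + 1) tau_(k+1) = - tau_k, so the commutators of the powers add up to -
    y_u after a shift of the index. *)
Lemma gauss_exp_linform u f :
  gauss_exp (linform u * f) = linform u * gauss_exp f - dk u (gauss_exp f).
Proof.
pose K := maxn (msize (linform u * f)) (msize f).
rewrite (@gauss_exp_wide K.+1 (_ * _)) ?(leq_trans (leq_maxl _ _) (leqnSn _))//.
have -> : \sum_(k < K.+1) tau k *: iter k dlap (linform u * f) =
   linform u * (\sum_(k < K.+1) tau k *: iter k dlap f) +
   \sum_(k < K.+1) (tau k * (2 * k)%:R) *: dk u (iter k.-1 dlap f).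
  rewrite mulr_sumr -big_split; apply: eq_bigr => k _.
  by rewrite iter_dlap_linform// scalerDr scalerAr scalerA.
rewrite -(@gauss_exp_wide K.+1 f) ?(leq_trans (leq_maxr _ _) (leqnSn _))//.
congr (_ + _); rewrite big_ord_recl muln0 mulr0 scale0r add0r.
rewrite (@gauss_exp_wide K f) ?leq_maxr// dk_sum// -sumrN.
apply: eq_bigr => k _; rewrite dkZ// -scaleNr lift0/=; congr (_ *: _).
rewrite /tau exprS factS !natrM; field.
by rewrite pnatr_eq0 -lt0n fact_gt0 addrC natr1 pnatr_eq0.
Qed.

Lemma gauss_exp_dk xi f : gauss_exp (dk xi f) = dk xi (gauss_exp f).
Proof.
pose K := maxn (msize (dk xi f)) (msize f).
rewrite (@gauss_exp_wide K f) ?leq_maxr// (@gauss_exp_wide K) ?leq_maxl//.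
rewrite dk_sum//; apply: eq_bigr => k _.
by rewrite dkZ// iter_dlap_dk.
Qed.

Lemma act_gauss_exp w f : orthogonal_mx w -> pm_stable P w ->
  act w (gauss_exp f) = gauss_exp (act w f).
Proof.
move=> ow Pw; pose K := maxn (msize (act w f)) (msize f).
rewrite (@gauss_exp_wide K f) ?leq_maxr// (@gauss_exp_wide K) ?leq_maxl//.
rewrite act_sum; apply: eq_bigr => k _.
by rewrite actZ act_iter_dlap.
Qed.

(** The terms with k > 0 have smaller degree, so the leading coefficient of f survives. *)
Lemma gauss_exp_eq0 f : gauss_exp f = 0 -> f = 0.
Proof.
move=> Tf; apply/eqP; apply/negPn/negP => f0.
have [m mf me] : exists2 m, m \in msupp f & msize f = (mdeg m).+1.
  exists (mlead f); first exact: mlead_supp.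
  by rewrite mlead_deg.
have := congr1 (mcoeff m) Tf; rewrite mcoeff0 /gauss_exp me big_ord_recl /=.
rewrite mcoeffD raddf_sum/= big1 => [|k _].
  rewrite addr0 mcoeffZ /tau expr0 fact0 divr1 mul1r => /eqP.
  by rewrite mcoeff_eq0 mf.
rewrite mcoeffZ -iterS (@mdeglt_iter_dlap _ (mdeg m)) ?mulr0//.
apply: (@mdegltW (msize f)); last exact: mdeglt_msize.
by rewrite me addSn ltnS leq_addl.
Qed.

End Dunkl.

End Grading.

(** * The ideal generated by singular quadratic polynomials *)

Section QuadraticIdeal.
Context {R : realType} {N : nat}.
Local Notation poly := (mpoly N R[i]).
Implicit Types (a b u v xi : 'rV[R]_N) (w : 'M[R]_N) (f g : poly).
Variables (Phi P : seq 'rV[R]_N) (c : R).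
Hypotheses (rsPhi : root_system Phi) (psP : positive_system Phi P).

Lemma root_neq0 a : a \in Phi -> a != 0.
Proof. by case: rsPhi => /negP Phi0 _ _ _ aPhi; apply/eqP => a0; rewrite -a0 in Phi0. Qed.

Lemma root_opp a : a \in Phi -> - a \in Phi.
Proof.
by case: rsPhi => _ _ _ h /h e; rewrite -scaleN1r e eqxx orbT.
Qed.

Lemma root_refl a b : a \in Phi -> b \in Phi -> b *m refl_mx a \in Phi.
Proof. by case: rsPhi => _ _ h _; exact: h. Qed.

Lemma positive_root a : a \in P -> a \in Phi.
Proof. by case: psP => _ [v [_ ->]] /andP[]. Qed.

Lemma positive_half_system : half_system P.
Proof.
case: psP => uP [v [_ vP]]; split => // a aP; split.
  exact/root_neq0/positive_root.
move: aP; rewrite !vP dotNl oppr_gt0 => /andP[_ av].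
by rewrite ltNge (ltW av) andbF.
Qed.

Lemma positive_or_opp a : a \in Phi -> (a \in P) || (- a \in P).
Proof.
case: psP => uP [v [v0 vP]] aPhi.
rewrite !vP aPhi root_opp//= dotNl oppr_gt0.
by case: ltgtP (v0 _ aPhi).
Qed.

Lemma coxeter_orthogonal w : coxeter_group Phi w -> orthogonal_mx w.
Proof.
elim=> [|w' a _ ow _]; first exact: orthogonal1.
exact/orthogonalM/orthogonal_refl.
Qed.

Lemma coxeter_root w a : coxeter_group Phi w -> a \in Phi -> a *m w \in Phi.
Proof.
move=> Ww; elim: Ww a => [a|w' b _ IH bPhi a aPhi]; first by rewrite mulmx1.
by rewrite mulmxA; apply: root_refl => //; exact: IH.
Qed.

Lemma coxeter_pm_stable w : coxeter_group Phi w -> pm_stable P w.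
Proof.
by move=> Ww a /positive_root aP; apply/positive_or_opp/coxeter_root.
Qed.

Lemma coxeter_refl a : a \in Phi -> coxeter_group Phi (refl_mx a).
Proof.
by move=> aPhi; rewrite -[refl_mx a]mul1mx; apply: coxeter_groupM => //;
  exact: coxeter_group1.
Qed.

Lemma positive_refl_pm_stable : {in P, forall a, pm_stable P (refl_mx a)}.
Proof. by move=> a /positive_root/coxeter_refl/coxeter_pm_stable. Qed.

Let hsP := positive_half_system.
Let PW := positive_refl_pm_stable.

(** The rule is arranged with the operator on the second factor, which will be a singular vector. *)
Lemma dkM xi f g : dk P c xi (f * g) = f * dk P c xi g + pderiv xi f * g
  - \sum_(a <- P) (c * dot a xi)%:C%C *: (ddiff a f * act (refl_mx a) g).
Proof.
rewrite !dkE pderivM mulrBr mulr_sumr.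
have -> : \sum_(a <- P) (c * dot a xi)%:C%C *: ddiff a (f * g) =
    \sum_(a <- P) (f * ((c * dot a xi)%:C%C *: ddiff a g)) +
    \sum_(a <- P) (c * dot a xi)%:C%C *: (ddiff a f * act (refl_mx a) g).
  rewrite -big_split; apply: eq_big_seq => a aP.
  by rewrite ddiffM; [rewrite scalerDr scalerAr|case: (hsP.2 _ aP)].
ring.
Qed.

(** The roots enter [design2] and [design4] rescaled to squared length 2, and their moments are
    those of an isotropic distribution; h will be the Coxeter number and k4 the constant 2h / (N +
    2). *)
Variables h k4 : R.
Hypothesis design2 : forall x y,
  \sum_(a <- P) 2 / dot a a * dot a x * dot a y = h * dot x y.
Hypothesis design4 : forall x y z t,
  \sum_(a <- P) (2 / dot a a) ^+ 2 * dot a x * dot a y * dot a z * dot a t =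
  k4 * (dot x y * dot z t + dot x z * dot y t + dot x t * dot y z).
Hypothesis critical : 1 - c * h + c * k4 = 0.

Lemma dk_lin xi v : dk P c xi (linform v) = ((1 - c * h) * dot v xi)%:C%C *: 1.
Proof.
rewrite -[linform v]mulr1 dk_linform// dk1// mulr0 add0r.
under eq_bigr => a _ do rewrite act_1.
rewrite -scaler_suml -scalerBl; congr (_ *: _).
rewrite -rmorph_sum -rmorphB/=; congr (_%:C)%C.
rewrite mulrBl mul1r; congr (_ - _).
rewrite -mulrA -design2 mulr_sumr; apply: eq_bigr => a _.
rewrite (dotC v a); ring.
Qed.

(** The computation gives (1 - c h + c k4) times the linear form of (u, xi) v + (v, xi) u, plus a
    term with factor (u, v); the first vanishes by [critical], the second by orthogonality. *)
Lemma dk_quadratic xi u v : dot u v = 0 ->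
  dk P c xi (linform u * linform v) = 0.
Proof.
move=> uv; rewrite dk_linform// dk_lin.
have -> : \sum_(a <- P) (c * dot a xi * (2 / dot a a * dot u a))%:C%C
             *: act (refl_mx a) (linform v) =
   (c * h * dot u xi)%:C%C *: linform v -
   (c * k4)%:C%C *: linform (dot u xi *: v + dot v xi *: u).
  under eq_bigr => a _ do
    rewrite act_refl_linform scalerBr scalerA -real_complexM -!linformZ.
  rewrite sumrB -!linform_sum -!linformZ; congr (linform _ - linform _).
    rewrite -scaler_suml; congr (_ *: _); rewrite -mulrA -design2 mulr_sumr; apply: eq_bigr => a _.
    rewrite (dotC u a); ring.
  apply: dot_eqP => x.
  rewrite dot_suml dotZl dotDl !dotZl.
  transitivity (c * (k4 * (dot xi u * dot v x + dot xi v * dot u x + dot xi x * dot u v))).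
    rewrite -design4 mulr_sumr; apply: eq_bigr => a _.
    rewrite dotZl (dotC u a) (dotC v a); ring.
  by rewrite uv mulr0 addr0 (dotC xi u) (dotC xi v); ring.
have -> : c * k4 = c * h - 1 by move/eqP: critical; rewrite -eqr_opp; lra.
rewrite -scalerAr mulr1 -!linformZ -linformD.
set A := (X in linform X + _); set B := linform _ - linform _.
have -> : B = linform A.
  rewrite /B -linformN -linformD /A; congr linform.
  by apply/rowP => j; rewrite !mxE; ring.
exact: subrr.
Qed.

Inductive quad_ideal : poly -> Prop :=
| quad_ideal0 : quad_ideal 0
| quad_idealD f g : quad_ideal f -> quad_ideal g -> quad_ideal (f + g)
| quad_ideal_gen g u v :
    dot u v = 0 -> quad_ideal (g * (linform u * linform v)).

Lemma quad_idealM g f : quad_ideal f -> quad_ideal (g * f).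
Proof.
elim=> [|f1 f2 _ h1 _ h2|g' u v uv].
- by rewrite mulr0; exact: quad_ideal0.
- by rewrite mulrDr; exact: quad_idealD.
- by rewrite mulrA; exact: quad_ideal_gen.
Qed.

Lemma quad_idealZ (z : R[i]) f : quad_ideal f -> quad_ideal (z *: f).
Proof. by rewrite -mul_mpolyC; exact: quad_idealM. Qed.

Lemma quad_idealN f : quad_ideal f -> quad_ideal (- f).
Proof. by rewrite -mulN1r; exact: quad_idealM. Qed.

Lemma quad_ideal_act w f :
  orthogonal_mx w -> quad_ideal f -> quad_ideal (act w f).
Proof.
move=> ow; elim=> [|f1 f2 _ h1 _ h2|g' u v uv].
- by rewrite act0; exact: quad_ideal0.
- by rewrite actD; exact: quad_idealD.
- rewrite !actM !act_linform_orth//; apply: quad_ideal_gen.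
  by rewrite dot_orthogonal.
Qed.

(* The generators are singular vectors, so only the commutator terms of the
   product formula [dkM] survive, and these stay in the ideal. *)
Lemma quad_ideal_dk xi f : quad_ideal f -> quad_ideal (dk P c xi f).
Proof.
elim=> [|f1 f2 _ h1 _ h2|g u v uv].
- by rewrite dk0//; exact: quad_ideal0.
- by rewrite dkD//; exact: quad_idealD.
rewrite dkM dk_quadratic// mulr0 add0r; apply: quad_idealD.
  exact: quad_ideal_gen.
apply: quad_idealN; elim/big_ind : _ => [|f1 f2|a _].
- exact: quad_ideal0.
- exact: quad_idealD.
apply/quad_idealZ/quad_idealM/quad_ideal_act; first exact: orthogonal_refl.
by rewrite -[_ * _]mul1r; exact: quad_ideal_gen.
Qed.

Lemma quad_ideal_submodule : submodule Phi P c quad_ideal.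
Proof.
split; [exact: quad_ideal0|exact: quad_idealD|move=> A f hA; elim: hA f].
- by move=> w /coxeter_orthogonal ow f; rewrite -actE; exact: quad_ideal_act.
- by move=> i f; exact: quad_idealM.
- by move=> i f; rewrite /dunkl_coord dunkl_dk; exact: quad_ideal_dk.
- by move=> z A' _ IH f /IH; exact: quad_idealZ.
- by move=> A' B _ IHA _ IHB f hf; apply: quad_idealD; [exact: IHA|exact: IHB].
- by move=> A' B _ IHA _ IHB f /IHB /IHA.
Qed.

Lemma quad_ideal_mord f : quad_ideal f -> mord 2 f.
Proof.
elim=> [|f1 f2 _ h1 _ h2|g u v uv]; [exact: mord0|exact: mordD|].
rewrite -[2%N]add0n; apply: mordM => //; apply: (@mordM _ _ 1 1);
  apply: (@homog_mord _ _ _ 1) => //; exact: homog_linform.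
Qed.

Variable S : set poly.
Hypothesis minS : minimal_submodule Phi P c S.

(** [submodule] does not list closure under complex scalars: it comes from scaling the operator of
    the identity of W. *)
Lemma submoduleZ M (z : R[i]) f : submodule Phi P c M -> M f -> M (z *: f).
Proof.
case=> _ _ hM Mf; apply: (hM (fun f => z *: f)) => //.
have := cherednik_scale z (cherednik_W _ _ (coxeter_group1 Phi)).
move/(_ P c); congr cherednik; apply/funext => g; by rewrite -actE act1.
Qed.

Lemma submodule_mul M g f : submodule Phi P c M -> M f -> M (g * f).
Proof.
move=> sM; case: (sM) => _ hD hM Mf.
elim/(@poly_ind_vars R N) : g => [|z g IH|g g' IH IH'|i g IH].
- by rewrite mul1r.
- by rewrite -scalerAl; exact: submoduleZ.
- by rewrite mulrDl; exact: hD.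
- by rewrite -mulrA; apply: (hM (fun f => polyvar i * f)) => //; exact: cherednik_x.
Qed.

Lemma submodule_dk M xi f : submodule Phi P c M -> M f -> M (dk P c xi f).
Proof.
move=> sM Mf; case: (sM) => h0 hD hM.
rewrite (dk_coord P c); elim/big_ind : _ => // i _; apply: submoduleZ => //.
by rewrite -dunkl_dk; apply: (hM (dunkl_coord P c i)) => //; exact: cherednik_y.
Qed.

Lemma submodule_gauss_exp M f :
  submodule Phi P c M -> M f -> M (gauss_exp P c f).
Proof.
move=> sM Mf; case: (sM) => h0 hD hM.
rewrite /gauss_exp; elim/big_ind : _ => // k _; apply: submoduleZ => //.
elim: (nat_of_ord k) => //= j Mj; rewrite {1}/dlap; elim/big_ind : _ => // i _.
by apply: (submodule_dk _ sM); apply: (submodule_dk _ sM).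
Qed.

(** The intersection of S with the ideal is a submodule, nonzero because it contains g x_0 x_1 for a
    nonzero g in S; by minimality it is S. The hypothesis on N provides two orthogonal coordinate
    vectors. *)
Lemma minimal_submodule_mord f : (1 < N)%N -> S f -> mord 2 f.
Proof.
move=> N1 Sf; apply: quad_ideal_mord.
case: minS => -[sS [g Sg g0]] /(_ (S `&` quad_ideal)) min.
have sM := quad_ideal_submodule.
suff e : S `&` quad_ideal = S by move: Sf; rewrite -{1}e => -[].
apply: min; last by move=> x [].
split.
  case: sS => S0 SD SA; case: sM => M0 MD MA; split => //.
    by move=> f1 f2 [? ?] [? ?]; split; [exact: SD|exact: MD].
  by move=> A f1 hA [? ?]; split; [exact: SA|exact: MA].
pose i0 : 'I_N := Ordinal (ltn_trans (ltnSn 0) N1); pose i1 : 'I_N := Ordinal N1.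
exists (g * (linform (delta_mx 0 i0) * linform (delta_mx 0 i1))).
  split; last by apply: quad_ideal_gen; rewrite dot_delta mxE.
  by rewrite mulrC; exact: submodule_mul.
rewrite !mulf_neq0// linform_eq0; apply/eqP => /rowP.
  by move=> /(_ i0)/eqP; rewrite !mxE !eqxx oner_eq0.
by move=> /(_ i1)/eqP; rewrite !mxE !eqxx oner_eq0.
Qed.

End QuadraticIdeal.

(** * Linear changes of variables *)

Section LinearChange.
Context {R : realType}.
Local Open Scope ereal_scope.
Local Notation T := (measurableTypeR R).
Local Notation mu := (@lebesgue_measure R).
Local Notation LN := (@Defs.lebesgue_measureN R).

Lemma integral_lebesgueS n (f : n.+1.-tuple T -> \bar R) :
  measurable_fun [set: n.+1.-tuple T] f -> (forall x, 0 <= f x) ->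
  \int[LN n.+1]_x f x = \int[mu]_t \int[LN n]_y f (cons_tuple t y).
Proof.
move=> mf f0.
have mc := @measurable_cons_tuple R n.
transitivity (\int[(mu \x LN n)]_p f (cons_tuple p.1 p.2)).
  by rewrite [LHS](ge0_integral_pushforward mc)// preimage_setT.
rewrite fubini_tonelli1//; exact: measurableT_comp.
Qed.

Lemma integral_lebesgueS_swap n (f : n.+1.-tuple T -> \bar R) :
  measurable_fun [set: n.+1.-tuple T] f -> (forall x, 0 <= f x) ->
  \int[LN n.+1]_x f x = \int[LN n]_y \int[mu]_t f (cons_tuple t y).
Proof.
move=> mf f0.
have mc := @measurable_cons_tuple R n.
transitivity (\int[(mu \x LN n)]_p f (cons_tuple p.1 p.2)).
  by rewrite [LHS](ge0_integral_pushforward mc)// preimage_setT.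
rewrite fubini_tonelli2//; exact: measurableT_comp.
Qed.

Lemma lebesgue_shift (r : R) (A : set T) : measurable A ->
  pushforward mu (fun x : T => (x + r)%R : T) A = mu A.
Proof.
move=> mA.
have ms : measurable_fun [set: T] (fun x : T => (x + r)%R : T).
  exact: measurable_funD.
apply/esym/(@lebesgue_measure_unique R
  (pushforward mu (fun x : T => (x + r)%R : T))) => //= _ [[a b]] _ <-.
rewrite /pushforward.
have -> : (fun x : T => (x + r)%R) @^-1` `]a, b]%classic = `](a - r)%R, (b - r)%R]%classic.
  by apply/seteqP; split=> x /=; rewrite !in_itv/= ltrBlDr lerBrDr.
rewrite !lebesgue_measure_itv/= !lte_fin ltrD2r; case: ifP => // _.
by rewrite -!EFinD; congr EFin; lra.
Qed.

Lemma integral_lebesgue_shift (r : R) (f : T -> \bar R) :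
  measurable_fun [set: T] f -> (forall x, 0 <= f x) ->
  \int[mu]_x f (x + r)%R = \int[mu]_x f x.
Proof.
move=> mf f0.
have ms : measurable_fun [set: T] (fun x : T => (x + r)%R : T).
  exact: measurable_funD.
transitivity (\int[pushforward mu (fun x : T => (x + r)%R : T)]_x f x).
  by rewrite (ge0_integral_pushforward ms)// preimage_setT.
apply: eq_measure_integral => A mA _.
by first [exact: lebesgue_shift | exact/esym/lebesgue_shift].
Qed.

Lemma integral_lebesgue_dilate (a : R) (f : T -> \bar R) : a != 0%R ->
  measurable_fun [set: T] f -> (forall x, 0 <= f x) ->
  \int[mu]_x f (a * x)%R = (`|a|^-1)%:E * \int[mu]_x f x.
Proof.
move=> a0 mf f0.
have ms : measurable_fun [set: T] (fun x : T => (a * x)%R : T).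
  exact: measurable_funM.
have na0 : (0 < `|a|)%R by rewrite normr_gt0.
pose k : {nonneg R} := NngNum (normr_ge0 a).
have nuE (A : set T) : measurable A ->
    mu A = mscale k (pushforward mu (fun x : T => (a * x)%R : T)) A.
  apply: (@lebesgue_measure_unique R
    (mscale k (pushforward mu (fun x : T => (a * x)%R : T)))) => //= _ [[x y]] _ <-.
  rewrite /mscale/= /pushforward.
  have [ap|an] := ltP 0%R a.
    have -> : (fun z : T => (a * z)%R) @^-1` `]x, y]%classic =
        `](x / a)%R, (y / a)%R]%classic.
      apply/seteqP; split=> z /=; rewrite !in_itv/= ltr_pdivrMr// ler_pdivlMr//
        ; by rewrite ![(_ * a)%R]mulrC.
    rewrite !lebesgue_measure_itv/= !lte_fin ltr_pM2r ?invr_gt0//.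
    case: ifP => _; last by rewrite mule0.
    rewrite -!EFinD -EFinM gtr0_norm//; congr EFin; field; exact: lt0r_neq0.
  have {}an : (a < 0)%R by rewrite lt_neqAle a0.
  have -> : (fun z : T => (a * z)%R) @^-1` `]x, y]%classic =
      `[(y / a)%R, (x / a)%R[%classic.
    apply/seteqP; split=> z /=; rewrite !in_itv/= ltr_ndivlMr// ler_ndivrMr//
      ; by rewrite ![(_ * a)%R]mulrC andbC.
  rewrite !lebesgue_measure_itv/= !lte_fin ltr_nM2r ?invr_lt0//.
  case: ifP => _; last by rewrite mule0.
  rewrite -!EFinD -EFinM ltr0_norm//; congr EFin; field; exact: ltr0_neq0.
have E : \int[mu]_x f x =
    \int[mscale k (pushforward mu (fun x : T => (a * x)%R : T))]_x f x.
  move=> m; apply: eq_measure_integral => A mA _.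
  by first [exact: nuE | exact/esym/nuE].
rewrite (E ms) ge0_integral_mscale// (ge0_integral_pushforward ms)// preimage_setT.
by rewrite muleA -EFinM mulVf ?gt_eqF// mul1e.
Qed.

Lemma measurable_integral_cons n (f : n.+1.-tuple T -> \bar R) :
  measurable_fun [set: n.+1.-tuple T] f -> (forall x, 0 <= f x) ->
  measurable_fun [set: T] (fun t : T => \int[LN n]_y f (cons_tuple t y)).
Proof.
move=> mf f0.
have h := measurableT_comp mf (@measurable_cons_tuple R n).
exact: (@measurable_fun_fubini_tonelli_F _ _ _ _ _ (LN n) _ h (fun=> f0 _)).
Qed.

(** The factor is left existential: finiteness of integrals does not depend on it, and for a
    reflection it is found to be 1 from the map being an involution. *)
Definition scales_lebesgue n (phi : n.-tuple T -> n.-tuple T) :=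
  measurable_fun [set: n.-tuple T] phi /\
  exists2 k : R, (0 < k)%R & forall f : n.-tuple T -> \bar R,
    measurable_fun [set: n.-tuple T] f -> (forall x, 0 <= f x) ->
    \int[LN n]_x f (phi x) = k%:E * \int[LN n]_x f x.

Lemma scales_lebesgue_comp n (phi psi : n.-tuple T -> n.-tuple T) :
  scales_lebesgue phi -> scales_lebesgue psi -> scales_lebesgue (phi \o psi).
Proof.
move=> [mphi [k k0 hk]] [mpsi [l l0 hl]]; split.
  exact: measurableT_comp.
exists (l * k)%R; first exact: mulr_gt0.
move=> f mf f0 /=; have := hl (f \o phi) (measurableT_comp mf mphi) (fun=> f0 _).
by rewrite /= => ->; rewrite hk// muleA -EFinM.
Qed.

Lemma eq_scales_lebesgue n (phi psi : n.-tuple T -> n.-tuple T) :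
  phi =1 psi -> scales_lebesgue phi -> scales_lebesgue psi.
Proof. by move=> /funext ->. Qed.

Definition unconst n (x : n.+1.-tuple T) : T * n.-tuple T :=
  (thead x, [tuple of behead x]).

Lemma unconstK n (x : n.+1.-tuple T) :
  cons_tuple (unconst x).1 (unconst x).2 = x.
Proof. by case/tupleP: x => a x; exact: val_inj. Qed.

Lemma measurable_thead n :
  measurable_fun [set: n.+1.-tuple T] (fun x : n.+1.-tuple T => thead x : T).
Proof. exact: measurable_tnth. Qed.

Lemma measurable_tbehead n :
  measurable_fun [set: n.+1.-tuple T] (fun x : n.+1.-tuple T => [tuple of behead x]).
Proof. exact: measurable_behead. Qed.

Lemma measurable_consE n d (X : measurableType d) (g : X -> T) (h : X -> n.-tuple T) :
  measurable_fun [set: X] g -> measurable_fun [set: X] h ->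
  measurable_fun [set: X] (fun x => cons_tuple (g x) (h x)).
Proof.
move=> mg mh.
apply: (@measurableT_comp _ _ _ _ _ _ (fun p : T * n.-tuple T => cons_tuple p.1 p.2)
  _ (fun x => (g x, h x))); first exact: measurable_cons_tuple.
exact: measurable_fun_pair.
Qed.

Lemma scales_lebesgue_diag n (a : R) (psi : n.-tuple T -> n.-tuple T) :
  a != 0%R -> scales_lebesgue psi ->
  scales_lebesgue (fun x : n.+1.-tuple T =>
    cons_tuple (a * thead x)%R (psi [tuple of behead x])).
Proof.
move=> a0 [mpsi [k k0 hk]].
have mphi : measurable_fun [set: n.+1.-tuple T] (fun x : n.+1.-tuple T =>
    cons_tuple (a * thead x : T)%R (psi [tuple of behead x])).
  apply: measurable_consE; first exact: (measurable_funM (measurable_cst _) (@measurable_thead n)).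
  exact: (measurableT_comp mpsi (@measurable_tbehead n)).
split=> //.
exists (`|a|^-1 * k)%R; first by rewrite mulr_gt0// invr_gt0 normr_gt0.
move=> f mf f0.
have mft t : measurable_fun [set: n.-tuple T] (fun y => f (cons_tuple t y)).
  by apply: (measurableT_comp mf); exact: measurable_consE.
have mfy y : measurable_fun [set: T] (fun t => f (cons_tuple t y)).
  by apply: (measurableT_comp mf); exact: measurable_consE.
have mint : measurable_fun [set: T] (fun t => \int[LN n]_y f (cons_tuple t y)).
  exact: measurable_integral_cons.
rewrite integral_lebesgueS//; last exact: (measurableT_comp mf mphi).
transitivity (\int[mu]_t (k%:E * \int[LN n]_y f (cons_tuple (a * t)%R y))).
  apply: eq_integral => t _.
  rewrite -hk//; apply: eq_integral => y _.
  rewrite theadE; congr (f (cons_tuple _ (psi _))); exact: val_inj.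
rewrite ge0_integralZl//; last 3 first.
- apply: (measurableT_comp mint); exact: measurable_funM.
- by move=> t _; exact: integral_ge0.
- by rewrite lee_fin ltW.
rewrite (integral_lebesgue_dilate a0 mint); last by move=> t; exact: integral_ge0.
by rewrite muleA -EFinM mulrC integral_lebesgueS.
Qed.

(** Integrated over the first coordinate first, the map is a translation by a constant. In the
    companion [scales_lebesgue_coshear] the roles of the coordinates are exchanged. *)
Lemma scales_lebesgue_shear n (l : n.-tuple T -> T) :
  measurable_fun [set: n.-tuple T] l ->
  scales_lebesgue (fun x : n.+1.-tuple T =>
    cons_tuple (thead x + l [tuple of behead x])%R [tuple of behead x]).
Proof.
move=> ml.
have mphi : measurable_fun [set: n.+1.-tuple T] (fun x : n.+1.-tuple T =>
    cons_tuple (thead x + l [tuple of behead x] : T)%R [tuple of behead x]).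
  apply: measurable_consE; last exact: measurable_tbehead.
  apply: measurable_funD; first exact: measurable_thead.
  exact: (measurableT_comp ml (@measurable_tbehead n)).
split=> //; exists 1%R => // f mf f0; rewrite mul1e.
have mfy y : measurable_fun [set: T] (fun t => f (cons_tuple t y)).
  by apply: (measurableT_comp mf); exact: measurable_consE.
rewrite (integral_lebesgueS_swap (measurableT_comp mf mphi) (fun=> f0 _)).
rewrite (integral_lebesgueS_swap mf f0); apply: eq_integral => y _.
rewrite -(integral_lebesgue_shift (l y) (mfy y))//; apply: eq_integral => t _.
rewrite /= theadE; congr f; apply: val_inj => /=; congr ((_ + l _)%R :: _).
exact: val_inj.
Qed.

Definition addt n (x r : n.-tuple T) : n.-tuple T :=
  [tuple (tnth x i + tnth r i)%R | i < n].

Lemma measurable_addt n (r : n.-tuple T) :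
  measurable_fun [set: n.-tuple T] (fun x => addt x r).
Proof.
apply/measurable_fun_tnthP => i.
rewrite (_ : _ \o _ = fun x : n.-tuple T => (tnth x i + tnth r i)%R : T).
  by apply: measurable_funD => //; exact: measurable_tnth.
by apply/funext => x /=; rewrite tnth_mktuple.
Qed.

Lemma addt_cons n (t s : T) (x r : n.-tuple T) :
  addt (cons_tuple t x) (cons_tuple s r) = cons_tuple (t + s)%R (addt x r).
Proof.
apply: eq_from_tnth => i; rewrite tnth_mktuple.
by case: (unliftP ord0 i) => [j|] ->; rewrite ?tnth0// !tnthS tnth_mktuple.
Qed.

Lemma integral_lebesgue_addt n (r : n.-tuple T) (f : n.-tuple T -> \bar R) :
  measurable_fun [set: n.-tuple T] f -> (forall x, 0 <= f x) ->
  \int[LN n]_x f (addt x r) = \int[LN n]_x f x.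
Proof.
elim: n r f => [r f mf f0|n IH r f mf f0].
  by apply: eq_integral => x _; congr f; apply/esym; rewrite [x]tuple0 [RHS]tuple0.
have mft t : measurable_fun [set: n.-tuple T] (fun y => f (cons_tuple t y)).
  by apply: (measurableT_comp mf); exact: measurable_consE.
have mint : measurable_fun [set: T] (fun t => \int[LN n]_y f (cons_tuple t y)).
  exact: measurable_integral_cons.
rewrite (integral_lebesgueS (measurableT_comp mf (@measurable_addt _ r)) (fun=> f0 _)).
rewrite (integral_lebesgueS mf f0).
rewrite -(integral_lebesgue_shift (unconst r).1 mint); last first.
  by move=> t; exact: integral_ge0.
apply: eq_integral => t _; rewrite -[RHS](IH (unconst r).2)//.
by apply: eq_integral => y _; rewrite -addt_cons unconstK.
Qed.

Lemma scales_lebesgue_coshear n (r : n.-tuple T) :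
  scales_lebesgue (fun x : n.+1.-tuple T =>
    cons_tuple (thead x) [tuple (tnth x (lift ord0 i) + thead x * tnth r i)%R | i < n]).
Proof.
have mphi : measurable_fun [set: n.+1.-tuple T] (fun x : n.+1.-tuple T =>
    cons_tuple (thead x : T)
      [tuple (tnth x (lift ord0 i) + thead x * tnth r i)%R | i < n]).
  apply: measurable_consE; first exact: measurable_thead.
  apply/measurable_fun_tnthP => i.
  rewrite (_ : _ \o _ = fun x : n.+1.-tuple T =>
      (tnth x (lift ord0 i) + thead x * tnth r i)%R : T).
    apply: measurable_funD; first exact: measurable_tnth.
    by apply: measurable_funM => //; exact: measurable_thead.
  by apply/funext => x /=; rewrite tnth_mktuple.
split=> //; exists 1%R => // f mf f0; rewrite mul1e.
have mft t : measurable_fun [set: n.-tuple T] (fun y => f (cons_tuple t y)).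
  by apply: (measurableT_comp mf); exact: measurable_consE.
rewrite (integral_lebesgueS (measurableT_comp mf mphi) (fun=> f0 _)).
rewrite (integral_lebesgueS mf f0); apply: eq_integral => t _.
rewrite -[RHS](integral_lebesgue_addt [tuple (t * tnth r i)%R | i < n])//.
apply: eq_integral => y _; rewrite /= theadE; congr (f (cons_tuple _ _)).
by apply: eq_from_tnth => i; rewrite !tnth_mktuple tnthS.
Qed.

Definition row_of_tuple n (x : n.-tuple T) : 'rV[R]_n := \row_i tnth x i.

Definition tuple_of_row n (v : 'rV[R]_n) : n.-tuple T := [tuple v 0%R i | i < n].

Lemma row_of_tupleK n : cancel (@row_of_tuple n) (@tuple_of_row n).
Proof. by move=> x; apply: eq_from_tnth => i; rewrite tnth_mktuple mxE. Qed.

Lemma tuple_of_rowK n : cancel (@tuple_of_row n) (@row_of_tuple n).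
Proof. by move=> v; apply/rowP => i; rewrite mxE tnth_mktuple. Qed.

Definition mul_tuple n (M : 'M[R]_n) (x : n.-tuple T) : n.-tuple T :=
  tuple_of_row (row_of_tuple x *m M).

Lemma mul_tuple_comp n (M1 M2 : 'M[R]_n) :
  mul_tuple M2 \o mul_tuple M1 =1 mul_tuple (M1 *m M2).
Proof. by move=> x /=; rewrite /mul_tuple tuple_of_rowK mulmxA. Qed.

Lemma row_of_tuple_cons n (x : n.+1.-tuple T) :
  row_of_tuple x =
  row_mx (thead x)%:M (row_of_tuple [tuple of behead x]) :> 'rV[R]_(1 + n).
Proof.
apply/rowP => k; rewrite mxE -[k](@splitK 1 n); case: (fintype.split k) => j /=.
  by rewrite row_mxEl ord1 mxE eqxx mulr1n; congr tnth; exact: val_inj.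
rewrite row_mxEr mxE tnth_behead; congr tnth.
by apply: val_inj; rewrite /= inordK// ltnS.
Qed.

Lemma tuple_of_row_cons n (t : R) (v : 'rV[R]_n) :
  tuple_of_row (row_mx t%:M v : 'rV[R]_(1 + n)) =
  cons_tuple (t : T) (tuple_of_row v).
Proof.
apply: eq_from_tnth => i; rewrite tnth_mktuple.
case: (unliftP ord0 i) => [j|] ->.
  rewrite tnthS tnth_mktuple (_ : lift _ _ = rshift 1 j) ?row_mxEr//.
  exact: val_inj.
have -> : ord0 = lshift n ord0 :> 'I_(1 + n) by exact: val_inj.
by rewrite row_mxEl mxE eqxx mulr1n.
Qed.

Lemma scales_lebesgue_coshear_mx n (r : 'rV[R]_n) :
  scales_lebesgue (mul_tuple (block_mx 1%:M r 0 1%:M : 'M[R]_(1 + n))).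
Proof.
apply: eq_scales_lebesgue (scales_lebesgue_coshear (tuple_of_row r)) => x.
rewrite /mul_tuple row_of_tuple_cons mul_row_block !mulmx1 mulmx0 addr0.
rewrite mul_scalar_mx tuple_of_row_cons; congr cons_tuple.
apply: eq_from_tnth => i; rewrite !tnth_mktuple !mxE tnth_behead addrC.
have -> // : inord i.+1 = lift ord0 i.
by apply: val_inj; rewrite /= inordK// ltnS.
Qed.

Lemma scales_lebesgue_shear_mx n (c : 'cV[R]_n) :
  scales_lebesgue (mul_tuple (block_mx 1%:M 0 c 1%:M : 'M[R]_(1 + n))).
Proof.
pose l (y : n.-tuple T) : T := (row_of_tuple y *m c) 0%R 0%R.
have ml : measurable_fun [set: n.-tuple T] l.
  rewrite (_ : l = fun y => \sum_i (tnth y i * c i 0)%R)%R.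
    apply: measurable_sum => i.
    by apply: measurable_funM => //; exact: measurable_tnth.
  by apply/funext => y; rewrite /l mxE; apply: eq_bigr => i _; rewrite mxE.
apply: eq_scales_lebesgue (scales_lebesgue_shear ml) => x.
rewrite /mul_tuple row_of_tuple_cons mul_row_block !mulmx1 mulmx0 add0r.
rewrite [_ *m c]mx11_scalar -raddfD/= tuple_of_row_cons.
by rewrite row_of_tupleK.
Qed.

Lemma scales_lebesgue_diag_mx n (a : R) (D : 'M[R]_n) : a != 0%R ->
  scales_lebesgue (mul_tuple D) ->
  scales_lebesgue (mul_tuple (block_mx a%:M 0 0 D : 'M[R]_(1 + n))).
Proof.
move=> a0 sD; apply: eq_scales_lebesgue (scales_lebesgue_diag a0 sD) => x.
rewrite /mul_tuple row_of_tuple_cons mul_row_block !mulmx0 addr0 add0r.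
by rewrite -scalar_mxM mulrC tuple_of_row_cons.
Qed.

Local Open Scope ring_scope.

Lemma ulsubmx_coshear n (e : 'rV[R]_n) (A : 'M[R]_(1 + n)) :
  ulsubmx (block_mx 1%:M e 0 1%:M *m A) = ulsubmx A + e *m dlsubmx A.
Proof. by rewrite -{1}[A]submxK mulmx_block block_mxKul mul1mx. Qed.

(* Block LU decomposition: a first shear makes the top-left entry nonzero. *)
Lemma scales_lebesgue_mx n (M : 'M[R]_n) :
  M \in unitmx -> scales_lebesgue (mul_tuple M).
Proof.
elim: n M => [M _|n IH M uM].
  apply: (@eq_scales_lebesgue _ id) => [x|].
    by rewrite [x]tuple0 [RHS]tuple0.
  by split=> //; exists 1 => // f _ _; rewrite mul1e.
suff main (A : 'M[R]_(1 + n)) : A \in unitmx -> ulsubmx A 0%R 0%R != 0%R ->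
    scales_lebesgue (mul_tuple A).
  have [a0|] := eqVneq (ulsubmx (M : 'M[R]_(1 + n)) 0%R 0%R) 0%R; last exact: main.
  (* Otherwise the first column of M would be 0, against invertibility; adding row k to the first
     row then creates a nonzero pivot. *)
  have [k ck] : exists k, dlsubmx (M : 'M[R]_(1 + n)) k 0%R != 0%R.
    apply/existsP; rewrite -negb_forall; apply/negP => /forallP c0.
    have : (M : 'M[R]_(1 + n)) *m (col_mx 1%:M 0 : 'M[R]_(1 + n, 1)) = 0%R.
      rewrite -[M in M *m _](@submxK _ 1 n 1 n) mul_block_col !mulmx1 !mulmx0 !addr0.
      apply/matrixP => p q; rewrite -[p](@splitK 1 n) [q]ord1.
      case: (fintype.split p) => {}p /=; rewrite ?col_mxEu ?col_mxEd [RHS]mxE.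
        by rewrite [p]ord1.
      exact/eqP/c0.
    move/(congr1 (mulmx (invmx M))); rewrite mulKmx// mulmx0.
    move/(congr1 (@usubmx R 1 n 1)); rewrite col_mxKu => /matrixP/(_ ord0 ord0)/eqP.
    by rewrite !mxE eqxx oner_eq0.
  pose e : 'rV[R]_n := delta_mx 0 k.
  pose N0 : 'M[R]_(1 + n) := block_mx 1%:M e 0 1%:M.
  pose N1 : 'M[R]_(1 + n) := block_mx 1%:M (- e) 0 1%:M.
  have N10 : N1 *m N0 = 1%:M.
    rewrite mulmx_block !mulmx1 !mul1mx !mulmx0 !mul0mx !addr0 add0r.
    by rewrite [RHS]scalar_mx_block; congr block_mx; exact: subrr.
  apply: (@eq_scales_lebesgue _ (mul_tuple (N0 *m M) \o mul_tuple N1)).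
    by move=> x; rewrite mul_tuple_comp mulmxA N10 mul1mx.
  apply: scales_lebesgue_comp; last exact: scales_lebesgue_coshear_mx.
  apply: main.
    by rewrite unitmx_mul uM andbT; case: (mulmx1_unit N10).
  have -> := ulsubmx_coshear e (M : 'M[R]_(1 + n)).
  by rewrite mxE a0 add0r -rowE mxE.
move=> {M uM}; rewrite -[A](@submxK _ 1 n 1 n) block_mxKul.
move: (ulsubmx A) (ursubmx A) (dlsubmx A) (drsubmx A) => a1 r c D {A}.
rewrite [a1]mx11_scalar; move: (a1 0%R 0%R) => {a1}a; rewrite mxE eqxx mulr1n.
move=> + a0.
(* The Schur complement of the pivot, to which the induction hypothesis applies. *)
pose D' := D - a^-1 *: (c *m r).
pose L : 'M[R]_(1 + n) := block_mx 1%:M 0 (a^-1 *: c) 1%:M.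
pose G : 'M[R]_(1 + n) := block_mx a%:M 0 0 D'.
pose U : 'M[R]_(1 + n) := block_mx 1%:M (a^-1 *: r) 0 1%:M.
have E : block_mx a%:M r c D = L *m (G *m U).
  rewrite !mulmx_block !mulmx1 !mul1mx !mulmx0 !mul0mx !addr0 !add0r.
  rewrite !mul_scalar_mx !mul_mx_scalar scalerA mulfV// scale1r scalerA mulfV// scale1r.
  by rewrite -scalemxAl /D' addrC subrK.
rewrite E unitmx_mul => /andP[_]; rewrite unitmx_mul => /andP[uG _].
have uD : D' \in unitmx by move: uG; rewrite !unitmxE det_ublock unitrM => /andP[].
apply: eq_scales_lebesgue (mul_tuple_comp _ _) _.
apply: scales_lebesgue_comp; last exact: scales_lebesgue_shear_mx.
apply: eq_scales_lebesgue (mul_tuple_comp _ _) _.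
apply: scales_lebesgue_comp; first exact: scales_lebesgue_coshear_mx.
exact/scales_lebesgue_diag_mx/IH.
Qed.

End LinearChange.

(** * Integrability of the Gaussian weight *)

Section SingularIntegrals.
Context {R : realType}.
Local Notation T := (measurableTypeR R).
Local Notation mu := (@lebesgue_measure R).
Local Notation LN := (@Defs.lebesgue_measureN R).

Lemma continuous_powR_gt0 (p x : R) : 0 < x -> {for x, continuous (fun t : R => t `^ p)}.
Proof.
move=> x0; apply: differentiable_continuous; apply/derivable1_diffP.
by apply: derivable_powR; rewrite in_itv/= x0.
Qed.

Lemma integral_powR_itvcc (s a : R) : s < 1 -> 0 < a < 1 ->
  (\int[mu]_(t in `[a, 1%R]) (t `^ (- s))%:E <= ((1 - s)^-1)%:E)%E.
Proof.
move=> s1 /andP[a0 a1]; have s0 : 0 < 1 - s by rewrite subr_gt0.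
pose F t := (1 - s)^-1 * t `^ (1 - s).
have gt0 x : x \in `[a, 1] -> 0 < x.
  by rewrite in_itv/= => /andP[ax _]; exact: lt_le_trans ax.
have cF x : 0 < x -> {for x, continuous F}.
  by move=> x0; apply: cvgM; [exact: cvg_cst|exact: continuous_powR_gt0].
rewrite (@continuous_FTC2 _ (fun t => t `^ (- s)) F)//.
- rewrite -EFinB lee_fin /F powR1 mulr1 gerBl mulr_ge0 ?powR_ge0//.
  by rewrite invr_ge0 ltW.
- apply: continuous_in_subspaceT => x; rewrite inE/= => /gt0 x0.
  exact: continuous_powR_gt0.
- split.
  + move=> x; rewrite in_itv/= => /andP[ax _]; apply: derivableM => //.
    by apply: derivable_powR; rewrite in_itv/= (lt_trans a0).
  + exact/cvg_at_right_filter/cF.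
  + exact/cvg_at_left_filter/cF.
- move=> x; rewrite in_itv/= => /andP[ax _]; have x0 := lt_trans a0 ax.
  rewrite derive1E deriveM//; last by apply: derivable_powR; rewrite in_itv/= x0.
  rewrite derive_cst scaler0 addr0 -derive1E powR_derive1 ?in_itv/= ?x0//.
  by rewrite scalerA mulVf ?gt_eqF// scale1r; congr powR; lra.
Qed.

Lemma integral_powR_near0 (s : R) : s < 1 ->
  (\int[mu]_(t in `]0%R, 1%R]) (t `^ (- s))%:E <= ((1 - s)^-1)%:E)%E.
Proof.
move=> s1.
(* With i + 2 the left end stays below 1, as [integral_powR_itvcc] requires. *)
pose F (i : nat) : set R := `[i.+2%:R^-1, 1%R]%classic.
have UF : \bigcup_i F i = `]0%R, 1%R]%classic.
  apply/seteqP; split => x /=.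
    move=> [i _]; rewrite /F /= !in_itv/= => /andP[ix ->]; rewrite andbT.
    by apply: lt_le_trans ix; rewrite invr_gt0.
  rewrite in_itv/= => /andP[x0 x1].
  have [k kx] : exists k : nat, x^-1 < k%:R.
    by exists (Num.bound x^-1); rewrite archi_boundP// invr_ge0 ltW.
  exists k => //; rewrite /F/= in_itv/= x1 andbT.
  rewrite -[x]invrK lef_pV2 ?posrE ?invr_gt0 ?ltr0Sn//.
  by rewrite (le_trans (ltW kx))// ler_nat !leqW.
rewrite -UF -(cvg_lim _ (@ge0_nondecreasing_set_cvg_integral _ T R F (fun t => (t `^ (- s))%:E) mu _ _ _ _))//.
- apply: lime_le.
    apply: ereal_nondecreasing_is_cvgn.
    apply: ge0_nondecreasing_set_nondecreasing_integral.
    + move=> m n mn; rewrite subsetEset => x; rewrite /F/= !in_itv/= => /andP[mx ->].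
      rewrite andbT (le_trans _ mx)// lef_pV2 ?posrE ?ltr0Sn// ler_nat ltnS; exact: mn.
    + by move=> i; exact: measurable_itv.
    + by move=> i; apply/measurable_EFinP; apply: measurable_funTS; exact: measurable_powR.
    + by move=> i x _; rewrite lee_fin powR_ge0.
  apply: nearW => n; apply: integral_powR_itvcc => //.
  by rewrite invr_gt0 ltr0Sn invf_lt1 ?ltr0Sn// ltr1n.
- move=> m n mn; rewrite subsetEset => x; rewrite /F/= !in_itv/= => /andP[mx ->].
  rewrite andbT (le_trans _ mx)// lef_pV2 ?posrE ?ltr0Sn// ler_nat ltnS; exact: mn.
- by move=> i; exact: measurable_itv.
- by move=> i; apply/measurable_EFinP; apply: measurable_funTS; exact: measurable_powR.
- by move=> i x _; rewrite lee_fin powR_ge0.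
Qed.

(* The exponent is below 1 so that the singularity is integrable; the second
   factor provides decay at infinity. *)
Definition sing (s t : R) : R := `|t| `^ (- s) / (1 + t ^+ 2).

Lemma sing_ge0 s t : 0 <= sing s t.
Proof. by rewrite /sing divr_ge0 ?powR_ge0// addr_ge0 ?sqr_ge0. Qed.

Lemma measurable_sing s : measurable_fun [set: T] (sing s : T -> R).
Proof.
apply: measurable_funM.
  apply: (measurableT_comp (measurable_powR _)); exact: normr_measurable.
apply: measurable_funTS; apply: continuous_measurable_fun.
exact: continuous_oneDsqrV.
Qed.

Lemma integral_sing_lty s : 0 <= s < 1 ->
  (\int[mu]_t (sing s t)%:E < +oo)%E.
Proof.
move=> /andP[s0 s1].
(* For t > 0, [sing s t] is at most 1 / (1 + t^2) plus t^(-s) on ]0, 1]. These are [h] and [p]; the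
   negative half line is covered by their mirror images. *)
pose h : T -> \bar R := (fun t => (oneDsqr t)^-1%:E) \_ `[0%R, +oo[.
pose p : T -> \bar R := (fun t => (t `^ (- s))%:E) \_ `]0%R, 1%R].
have hE t : h t = if 0 <= t then (oneDsqr t)^-1%:E else 0%E.
  by rewrite /h patchE mem_setE in_itv/= andbT.
have pE t : p t = if 0 < t <= 1 then (t `^ (- s))%:E else 0%E.
  by rewrite /p patchE mem_setE in_itv.
have h0 t : (0 <= h t)%E.
  by rewrite /h patchE; case: ifP => // _; rewrite lee_fin invr_ge0.
have p0 t : (0 <= p t)%E.
  by rewrite /p patchE; case: ifP => // _; rewrite lee_fin powR_ge0.
have mh : measurable_fun [set: T] h.
  apply/(measurable_restrictT _ (measurable_itv _)).
  apply/measurable_EFinP; apply: measurable_funTS.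
  by apply: continuous_measurable_fun; exact: continuous_oneDsqrV.
have mp : measurable_fun [set: T] p.
  apply/(measurable_restrictT _ (measurable_itv _)).
  by apply/measurable_EFinP; apply: measurable_funTS; exact: measurable_powR.
have mN f : measurable_fun [set: T] f -> measurable_fun [set: T] (fun t : T => f (-1 * t)%R : \bar R).
  by move=> mf; apply: (measurableT_comp mf); exact: measurable_funM.
have N1 : (-1 : R) != 0 by rewrite oppr_eq0 oner_eq0.
have ih : (\int[mu]_t h t < +oo)%E.
  by rewrite /h -integral_mkcond integral0y_oneDsqr ltry.
have ip : (\int[mu]_t p t < +oo)%E.
  by rewrite /p -integral_mkcond (le_lt_trans (integral_powR_near0 s1))// ltry.
apply: (@le_lt_trans _ _ (\int[mu]_t ((h t + h (-1 * t)%R) + (p t + p (-1 * t)%R)))%E).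
  apply: ge0_le_integral => //.
  - by move=> t _; rewrite lee_fin sing_ge0.
  - by apply/measurable_EFinP; exact: measurable_sing.
  - by do 2 apply: emeasurable_funD => //; exact: mN.
  move=> t _; rewrite mulN1r !hE !pE /sing /oneDsqr sqrrN.
  have D0 : 0 < 1 + t ^+ 2 by rewrite ltr_wpDr// sqr_ge0.
  have D1 : (1 + t ^+ 2)^-1 <= 1 by rewrite invf_le1// lerDl sqr_ge0.
  have key u : 0 < u -> u `^ (- s) / (1 + t ^+ 2) <=
      (1 + t ^+ 2)^-1 + (if u <= 1 then u `^ (- s) else 0).
    move=> u0; case: (leP u 1) => u1.
      rewrite -[leLHS]add0r lerD ?invr_ge0 ?(ltW D0)//.
      by rewrite ler_piMr ?powR_ge0.
    rewrite addr0 -[leRHS]mul1r ler_wpM2r ?invr_ge0 ?(ltW D0)//.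
    rewrite -[leRHS](powRr0 u); apply: ler_powR; first exact: ltW.
    by rewrite oppr_le0.
  have [t0|t0|t0] := ltrgtP 0 t.
  - rewrite (gtr0_norm t0) oppr_ge0 (lt_geF t0) oppr_gt0 (lt_gtF t0)/= !adde0.
    have := key _ t0; case: ifP => _; rewrite -?EFinD lee_fin//.
  - rewrite (ltr0_norm t0) oppr_ge0 (ltW t0)/= oppr_gt0 t0/= !add0e.
    have t0' : 0 < - t by rewrite oppr_gt0.
    have := key _ t0'; case: ifP => _; rewrite -?EFinD lee_fin//.
  (* At t = 0 the power is 1 for s = 0 and 0 for s > 0, by convention. *)
  - rewrite -t0 oppr0 ?lexx ?ltxx/= normr0 expr0n/= addr0 invr1 mulr1.
    rewrite !adde0 -EFinD lee_fin.
    have [->|s00] := eqVneq s 0; first by rewrite oppr0 powRr0; lra.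
    by rewrite powR0 ?oppr_eq0//; lra.
rewrite ge0_integralD//; last 4 first.
- by move=> t _; rewrite adde_ge0.
- by apply: emeasurable_funD => //; exact: mN.
- by move=> t _; rewrite adde_ge0.
- by apply: emeasurable_funD => //; exact: mN.
rewrite !ge0_integralD//; [|exact: mN|exact: mN].
rewrite !integral_lebesgue_dilate// normrN1 invr1 !mul1e.
by apply: lte_add_pinfty; apply: lte_add_pinfty.
Qed.

Lemma integral_prod_sing_lty s n : 0 <= s < 1 ->
  (\int[LN n]_x (\prod_(i < n) sing s (tnth x i))%:E < +oo)%E.
Proof.
move=> s01.
have mprod m : measurable_fun [set: m.-tuple T]
    (fun x : m.-tuple T => \prod_(i < m) sing s (tnth x i)).
  apply: measurable_prod => i _.
  apply: (measurableT_comp (@measurable_sing s)); exact: measurable_tnth.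
have prod0 m (x : m.-tuple T) : 0 <= \prod_(i < m) sing s (tnth x i).
  by apply: prodr_ge0 => i _; exact: sing_ge0.
elim: n => [|n IH].
  under eq_integral => x _ do rewrite big_ord0.
  by rewrite /= integral_cst//= diracT mule1 ltry.
rewrite integral_lebesgueS; last 2 first.
- by apply/measurable_EFinP; exact: mprod.
- by move=> x; rewrite lee_fin.
pose I := (\int[LN n]_x (\prod_(i < n) sing s (tnth x i))%:E)%E.
have I0 : (0 <= I)%E by apply: integral_ge0 => x _; rewrite lee_fin.
have -> : (\int[mu]_t \int[LN n]_y
    (\prod_(i < n.+1) sing s (tnth (cons_tuple t y) i))%:E =
  \int[mu]_t ((sing s t)%:E * I))%E.
  apply: eq_integral => t _; rewrite -ge0_integralZl//.
  - apply: eq_integral => y _; rewrite big_ord_recl -EFinM tnth0; congr (_ * _)%:E.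
    by apply: eq_bigr => i _; rewrite tnthS.
  - by apply/measurable_EFinP; exact: mprod.
  - by move=> x _; rewrite lee_fin.
  - by rewrite lee_fin sing_ge0.
rewrite ge0_integralZr//; last 2 first.
- by apply/measurable_EFinP; exact: measurable_sing.
- by move=> t _; rewrite lee_fin sing_ge0.
rewrite lte_mul_pinfty//.
- by apply: integral_ge0 => t _; rewrite lee_fin sing_ge0.
- rewrite ge0_fin_numE; first exact: integral_sing_lty.
  by apply: integral_ge0 => t _; rewrite lee_fin sing_ge0.
Qed.

Lemma integral_prod_sing_mx_lty s n (B : 'M[R]_n) : 0 <= s < 1 ->
  B \in unitmx ->
  (\int[LN n]_x (\prod_(i < n) sing s ((row_of_tuple x *m B) 0 i))%:E < +oo)%E.
Proof.
move=> s01 uB; have [mB [k k0 hk]] := scales_lebesgue_mx uB.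
have mprod : measurable_fun [set: n.-tuple T]
    (fun x : n.-tuple T => \prod_(i < n) sing s (tnth x i)).
  apply: measurable_prod => i _.
  apply: (measurableT_comp (@measurable_sing s)); exact: measurable_tnth.
have prod0 (x : n.-tuple T) : 0 <= \prod_(i < n) sing s (tnth x i).
  by apply: prodr_ge0 => i _; exact: sing_ge0.
have -> : (\int[LN n]_x (\prod_(i < n) sing s ((row_of_tuple x *m B) 0 i))%:E =
  \int[LN n]_x (\prod_(i < n) sing s (tnth (mul_tuple B x) i))%:E)%E.
  apply: eq_integral => x _; congr _%:E; apply: eq_bigr => i _.
  by rewrite tnth_mktuple.
rewrite (hk (fun x => (\prod_(i < n) sing s (tnth x i))%:E)); last 2 first.
- exact/measurable_EFinP.
- by move=> x; rewrite lee_fin.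
rewrite lte_mul_pinfty ?lee_fin ?ltW//; exact: integral_prod_sing_lty.
Qed.

End SingularIntegrals.

(** * Bases of roots adapted to a point *)

Section GreedyBasis.
Context {R : realType} {N : nat}.
Implicit Types (a b v : 'rV[R]_N) (P B t : seq 'rV[R]_N).
Variables (P : seq 'rV[R]_N) (c s : R).
Hypotheses (c0 : 0 <= c) (N0 : (0 < N)%N).
Hypothesis flat_bound : forall B, free B -> {subset B <= P} ->
  (size B < N)%N -> 2 * c * (count (mem <<B>>%VS) P)%:R <= s * (size B)%:R.

Lemma size_free_leq B : free B -> (size B <= N)%N.
Proof.
move=> fB; have := dimvS (subvf <<B>>%VS).
by rewrite dimvf (eqP fB) /dim/= mul1n.
Qed.

(* Going through the vectors in increasing order of [L], the elements which
   enlarge the span form a basis [B]; comparing with [flat_bound] along the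
   flag of their spans, [B] carries at least as much singularity. *)
Lemma greedy_basis (L : 'rV[R]_N -> R) t : uniq t -> {subset t <= P} ->
  pairwise (fun a b => L a <= L b) t ->
  exists B, [/\ {subset B <= t}, free B, <<B>>%VS = <<t>>%VS &
   ((size B < N)%N -> forall r, (forall a, a \in t -> L a <= r) ->
      (2 * c * (size t)%:R - s * (size B)%:R) * r <=
      \sum_(a <- t) 2 * c * L a - \sum_(b <- B) s * L b) /\
   (size B = N -> exists b, [/\ b \in B, forall x, x \in B -> L x <= L b &
      (2 * c * (size t)%:R - s * N%:R) * L b <=
      \sum_(a <- t) 2 * c * L a - \sum_(b <- B) s * L b])].
Proof.
elim/last_ind: t => [_ _ _|t a IH].
  exists [::]; split => //; first by rewrite nil_free.
  split => [_ r _|/= Ne]; first by rewrite !big_nil !mulr0 !subr0 mul0r.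
  by exfalso; move: N0; rewrite -Ne.
rewrite rcons_uniq pairwise_rcons => /andP[at_ ut] tP /andP[/allP La pt].
have tP' : {subset t <= P} by move=> x xt; rewrite tP// mem_rcons inE xt orbT.
have [B [Bt fB sB [h1 h2]]] := IH ut tP' pt.
have Bt' : {subset B <= rcons t a}.
  by move=> x /Bt xt; rewrite mem_rcons inE xt orbT.
have sumt : \sum_(x <- rcons t a) 2 * c * L x =
    \sum_(x <- t) 2 * c * L x + 2 * c * L a.
  by rewrite -cats1 big_cat big_seq1.
have sz : ((size (rcons t a))%:R : R) = (size t)%:R + 1.
  by rewrite size_rcons -natr1.
(* Below full rank the coefficient of r is nonpositive by [flat_bound], since all vectors treated so
   far lie in the flat spanned by B'. The estimate at r = [L a] therefore implies it for every
   larger r. *)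
have neg B' : free B' -> {subset B' <= rcons t a} -> (size B' < N)%N ->
    <<B'>>%VS = <<rcons t a>>%VS ->
    2 * c * (size (rcons t a))%:R - s * (size B')%:R <= 0.
  move=> fB' B't B'N sB'; rewrite subr_le0.
  have B'P : {subset B' <= P} by move=> x /B't /tP.
  apply: le_trans (flat_bound fB' B'P B'N); rewrite ler_wpM2l//.
    by rewrite mulr_ge0.
  rewrite ler_nat -size_filter uniq_leq_size//.
    by rewrite rcons_uniq at_.
  move=> x xt; rewrite mem_filter tP// andbT inE sB'.
  exact: memv_span.
have srcons : <<rcons t a>>%VS = (<<t>> + <[a]>)%VS.
  by rewrite -cats1 span_cat span_seq1.
have [aB|aB] := boolP (a \in <<t>>%VS).
  have sB' : <<B>>%VS = <<rcons t a>>%VS.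
    by rewrite srcons sB; apply/esym/addv_idPl; rewrite -memvE.
  exists B; split => //; split => [BN r rt|BN].
    have ra : L a <= r by apply: rt; rewrite mem_rcons inE eqxx.
    apply: (@le_trans _ _ ((2 * c * (size (rcons t a))%:R - s * (size B)%:R) * L a)).
      by apply: ler_wnM2l => //; exact: neg.
    have := h1 BN (L a) La; rewrite sumt sz; lra.
  (* Once the rank is full the estimate is kept at the last basis vector b, and a further term
     preserves it because [L b <= L a]. *)
  have [b [bB Lb hb]] := h2 BN; exists b; split => //.
  have Lba : L b <= L a by apply: La; exact: Bt.
  have : 2 * c * L b <= 2 * c * L a by rewrite ler_wpM2l// mulr_ge0.
  rewrite sumt sz; lra.
have fB' : free (a :: B) by rewrite free_cons sB aB fB.
have sB' : <<a :: B>>%VS = <<rcons t a>>%VS.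
  by rewrite srcons span_cons sB addvC.
have B't : {subset a :: B <= rcons t a}.
  move=> x; rewrite inE => /predU1P[->|/Bt'//].
  by rewrite mem_rcons inE eqxx.
have BN : (size B < N)%N by have := size_free_leq fB'.
have key : (2 * c * (size (rcons t a))%:R - s * (size (a :: B))%:R) * L a <=
    \sum_(x <- rcons t a) 2 * c * L x - \sum_(b <- a :: B) s * L b.
  have := h1 BN (L a) La; rewrite sumt sz big_cons /= -natr1; lra.
exists (a :: B); split => //; split => [B'N r rt|B'N].
  have ra : L a <= r by apply: rt; rewrite mem_rcons inE eqxx.
  by apply: le_trans key; apply: ler_wnM2l => //; exact: neg.
exists a; split; first exact: mem_head.
  by move=> x; rewrite inE => /predU1P[->//|/Bt/La].
have <- : ((size (a :: B))%:R : R) = N%:R by rewrite B'N.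
exact: key.
Qed.

End GreedyBasis.

Section FreeMatrix.
Context {R : realType} {N : nat}.
Implicit Types (B : N.-tuple 'rV[R]_N) (v : 'rV[R]_N).

Definition frame_mx B : 'M[R]_N := \matrix_(i, j) tnth B j 0 i.

Lemma mul_frame_mx B v j : (v *m frame_mx B) 0 j = dot (tnth B j) v.
Proof. by rewrite mxE dotE; apply: eq_bigr => i _; rewrite mxE mulrC. Qed.

Lemma frame_mx_unit B : free B -> frame_mx B \in unitmx.
Proof.
move=> fB; rewrite -unitmx_tr -row_free_unit -kermx_eq0; apply/eqP/row_matrixP => i.
rewrite row0; apply/rowP => j; rewrite mxE.
have : \sum_j (row i (kermx (frame_mx B)^T)) 0 j *: B`_j = 0.
  have := row_sub i (kermx (frame_mx B)^T); rewrite sub_kermx => /eqP e.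
  rewrite -[RHS]e mulmx_sum_row; apply: eq_bigr => k _; congr (_ *: _).
  by apply/rowP => l; rewrite !mxE (tnth_nth 0).
by move=> e; have /freeP/(_ _ e j) := fB; rewrite !mxE.
Qed.

(** Applied with r = |(b, v)| for the largest product over the basis: this one number then controls
    all coordinates of v. *)
Lemma frame_coord_bound B : free B ->
  exists2 K : R, 0 < K & forall v (r : R), (forall j, `|dot (tnth B j) v| <= r) ->
    forall i, `|v 0 i| <= K * r.
Proof.
move=> fB; pose M := invmx (frame_mx B).
exists (1 + \sum_i \sum_j `|M j i|).
  by rewrite ltr_pwDl// sumr_ge0// => i _; rewrite sumr_ge0.
move=> v r h i; have r0 : 0 <= r by exact: le_trans (h i).
have -> : v = v *m frame_mx B *m M by rewrite mulmxK// frame_mx_unit.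
rewrite mxE (le_trans (ler_norm_sum _ _ _))//.
rewrite mulrDl mul1r; apply: ler_wpDl => //.
rewrite [X in _ <= X * r](bigD1 i)//= mulrDl; apply: ler_wpDr.
  by rewrite mulr_ge0// sumr_ge0// => k _; rewrite sumr_ge0.
rewrite mulr_suml; apply: ler_sum => j _.
by rewrite normrM mulrC mul_frame_mx ler_wpM2l.
Qed.

End FreeMatrix.

Section PolyGauss.
Context {R : realType}.

Lemma poly_gauss_bound (M : nat) (delta : R) : 0 < delta ->
  exists2 C : R, 0 < C & forall t, 0 <= t ->
    (1 + t) ^+ M * expR (- (delta * t ^+ 2)) <= C.
Proof.
move=> d0; have [->|M0] := posnP M.
  exists 1 => // t t0; rewrite expr0 mul1r -expR0 ler_expR oppr_le0.
  by rewrite mulr_ge0 ?sqr_ge0 ?ltW.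
(* After extracting M-th roots it is enough to bound 1 + t by C exp(k t^2), which follows from 1 + u
   <= exp u. *)
pose k := delta / M%:R; have k0 : 0 < k by rewrite divr_gt0 ?ltr0n.
pose C := 2 + k^-1; have C0 : 0 < C by rewrite addr_gt0 ?invr_gt0.
exists (C ^+ M); first exact: exprn_gt0.
move=> t t0; rewrite expRN ler_pdivrMr ?expR_gt0//.
have -> : expR (delta * t ^+ 2) = expR (k * t ^+ 2) ^+ M.
  rewrite -expRM_natl; congr expR; rewrite /k; field.
  by rewrite pnatr_eq0 -lt0n.
rewrite -exprMn; apply: lerXn2r; rewrite ?nnegrE.
- exact: addr_ge0.
- by rewrite mulr_ge0 ?(ltW C0) ?expR_ge0.
apply: (@le_trans _ _ (C * (1 + k * t ^+ 2))); last first.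
  by rewrite ler_wpM2l ?(ltW C0)// expR_ge1Dx.
have kt : 0 <= k * t ^+ 2 by rewrite mulr_ge0 ?sqr_ge0 ?(ltW k0).
have kV : 0 < k^-1 by rewrite invr_gt0.
have kkt : k^-1 * (k * t ^+ 2) = t ^+ 2 by rewrite mulKf// gt_eqF.
have t2 : 0 <= t ^+ 2 := sqr_ge0 t.
rewrite /C mulrDr mulr1 mulrDl kkt; have [t1|t1] := leP t 1; first by lra.
have : t <= t ^+ 2 by rewrite expr2 ler_peMr// ltW.
lra.
Qed.

End PolyGauss.

(** * Domination of the weight by products over bases *)

Section WeightIntegrable.
Context {R : realType} {N : nat}.
Local Notation T := (measurableTypeR R).
Local Notation LN := (@Defs.lebesgue_measureN R).
Implicit Types (a b v : 'rV[R]_N).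
Variables (P : seq 'rV[R]_N) (c s : R).
Hypotheses (c0 : 0 < c) (N0 : (0 < N)%N) (uP : uniq P).
Hypothesis spanP : <<P>>%VS = fullv.
Hypothesis flat_bound : forall B, free B -> {subset B <= P} ->
  (size B < N)%N -> 2 * c * (count (mem <<B>>%VS) P)%:R <= s * (size B)%:R.
Hypothesis s01 : 0 <= s < 1.
(** The part of the homogeneity degree of the weight that remains after the basis has taken s per
    vector. Being at most 3, it is absorbed by a factor of order 3. *)
Let theta := 2 * c * (size P)%:R - s * N%:R.
Hypothesis theta03 : 0 <= theta <= 3.

Definition weight v : R :=
  expR (- (2^-1 * dot v v)) * \prod_(a <- P) `|dot a v| `^ (- (2 * c)).

Lemma prod_powR_expR (r : R) (t : seq 'rV[R]_N) v :
  (forall a, a \in t -> dot a v != 0) ->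
  \prod_(a <- t) `|dot a v| `^ r = expR (\sum_(a <- t) r * ln `|dot a v|).
Proof.
elim: t => [|a t IH] h; first by rewrite !big_nil expR0.
rewrite !big_cons expRD IH => [|x xt]; last by rewrite h// inE xt orbT.
by rewrite /powR normr_eq0 (negbTE (h a _)) ?mem_head.
Qed.

(** This is [greedy_basis] for L a = ln |(a, v)|, exponentiated. Sorting by |(a, v)| lets the most
    singular factors enter the basis first. *)
Lemma prod_root_bound v : (forall a, a \in P -> dot a v != 0) ->
  exists B : N.-tuple 'rV[R]_N, [/\ {subset B <= P}, free B &
    exists b, [/\ b \in B, forall x, x \in B -> `|dot x v| <= `|dot b v| &
      \prod_(a <- P) `|dot a v| `^ (- (2 * c)) <=
      `|dot b v| `^ (- theta) * \prod_(x <- B) `|dot x v| `^ (- s)]].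
Proof.
move=> h; pose L a := ln `|dot a v|.
pose le a b := L a <= L b.
have letot : total le by move=> a b; exact: le_total.
have letr : transitive le by move=> a b d; exact: le_trans.
have := sort_sorted letot P; rewrite (sorted_pairwise letr) => pw.
have ps : perm_eq (sort le P) P by rewrite perm_sort.
have us : uniq (sort le P) by rewrite sort_uniq.
have sub : {subset sort le P <= P} by move=> x; rewrite mem_sort.
have [B [Bt fB sB [_ h2]]] := greedy_basis (ltW c0) N0 flat_bound us sub pw.
have sBf : <<B>>%VS = fullv.
  rewrite sB -spanP; apply: eq_span => x; exact: mem_sort.
have BN : size B = N.
  have := eqP fB; rewrite sBf dimvf /dim/= mul1n => e; exact: esym.
have [b [bB Lb hb]] := h2 BN.
have /eqP sz := BN.
have BP : {subset B <= P} by move=> x /Bt; exact: sub.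
exists (Tuple sz); split => //; exists b; split => //.
  move=> x xB; rewrite -ler_ln ?posrE ?normr_gt0 ?h ?BP//; exact: Lb.
have nz (t : seq 'rV[R]_N) : {subset t <= P} -> forall a, a \in t -> dot a v != 0.
  by move=> tP a /tP; exact: h.
rewrite (prod_powR_expR _ h) (prod_powR_expR _ (nz _ BP)).
have -> : `|dot b v| `^ (- theta) = expR (- theta * L b).
  by rewrite /powR normr_eq0 (negbTE (h _ (BP _ bB))).
rewrite -expRD ler_expR -(perm_big _ ps)/=.
move: hb; rewrite size_sort -/theta => hb.
rewrite (eq_bigr (fun a => - (2 * c * L a))) => [|a _]; last by rewrite mulNr.
rewrite [X in _ <= _ + X](eq_bigr (fun a => - (s * L a))) => [|a _]; last by rewrite mulNr.
rewrite !sumrN mulNr; lra.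
Qed.

(** Vanishing to order k at 0 and polynomial growth at infinity in a single bound. *)
Definition poly_growth (k : nat) (F : 'rV[R]_N -> R) :=
  exists (C : R) (D : nat), 0 <= C /\ forall v (r : R), 0 <= r -> (forall i, `|v 0 i| <= r) ->
    `|F v| <= C * r ^+ k * (1 + r) ^+ D.

Lemma dot_sqr_le u v : dot u v ^+ 2 <= dot u u * dot v v.
Proof.
have [->|u0] := eqVneq u 0; first by rewrite !dot0l expr0n mul0r.
have uu : 0 < dot u u by rewrite dot_gt0.
have := dot_ge0 (dot u u *: v - dot u v *: u).
rewrite !(dotBl, dotBr, dotZl, dotZr) (dotC v u) => h.
have : 0 <= dot u u * (dot u u * dot v v - dot u v ^+ 2).
  by apply: le_trans h _; rewrite le_eqVlt; apply/orP; left; apply/eqP; ring.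
by rewrite pmulr_rge0// subr_ge0.
Qed.

(** Put t = |(b, v)|. The factor t^3 absorbs t^(-theta), and the Gaussian absorbs the powers of 1 +
    t, including the 2N of them that pay for the denominators in [sing]. *)
Lemma weighted_growth_bound F (B : N.-tuple 'rV[R]_N) b : poly_growth 3 F ->
  free B -> b \in B ->
  exists2 C, 0 <= C & forall v, (forall x, x \in B -> dot x v != 0) ->
    (forall x, x \in B -> `|dot x v| <= `|dot b v|) ->
    `|F v| * (expR (- (2^-1 * dot v v)) *
      (`|dot b v| `^ (- theta) * \prod_(x <- B) `|dot x v| `^ (- s)))
    <= C * \prod_(j < N) sing s (dot (tnth B j) v).
Proof.
move=> [C [D [C0 hF]]] fB bB.
have [K K0 hK] := frame_coord_bound fB.
have b0 : b != 0.
  by apply/eqP => b0; have := free_not0 fB bB; rewrite b0 eqxx.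
have bb : 0 < dot b b by rewrite dot_gt0.
(* By Cauchy-Schwarz (b, v)^2 <= (b, b) (v, v), so the Gaussian in v is at most one in t with this
   rate. *)
pose delta := (2 * dot b b)^-1.
have d0 : 0 < delta by rewrite invr_gt0 mulr_gt0.
have [C2 C20 hC2] := poly_gauss_bound (D + 2 * N + 3)%N d0.
pose c1 := C * K ^+ 3 * (1 + K) ^+ D.
have K1 : 0 <= 1 + K by rewrite addr_ge0 // ltW.
have c10 : 0 <= c1 by rewrite !mulr_ge0 ?exprn_ge0 ?(ltW K0).
exists (c1 * C2); first by rewrite mulr_ge0 // ltW.
move=> v h hb; set t := `|dot b v|.
have t0 : 0 < t by rewrite normr_gt0 h.
have t1 : 0 <= 1 + t by rewrite addr_ge0// ltW.
have Kv : forall i, `|v 0 i| <= K * t.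
  by apply: hK => j; apply: hb; exact: mem_tnth.
have A1 : `|F v| <= c1 * t ^+ 3 * (1 + t) ^+ D.
  apply: le_trans (hF v (K * t) _ Kv) _; first by rewrite mulr_ge0 ?(ltW K0) ?(ltW t0).
  rewrite /c1 exprMn.
  have e : (1 + K * t) ^+ D <= (1 + K) ^+ D * (1 + t) ^+ D.
    rewrite -exprMn; apply: lerXn2r; rewrite ?nnegrE ?mulr_ge0//.
      by rewrite addr_ge0// mulr_ge0 ?(ltW K0) ?(ltW t0).
    by have := K0; have := t0; nra.
  have CK : 0 <= C * (K ^+ 3 * t ^+ 3).
    by rewrite !mulr_ge0 ?exprn_ge0 ?(ltW K0) ?(ltW t0).
  apply: (le_trans (ler_wpM2l CK e)); rewrite le_eqVlt; apply/orP; left.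
  by apply/eqP; ring.
have A2 : expR (- (2^-1 * dot v v)) <= expR (- (delta * t ^+ 2)).
  rewrite ler_expR lerN2 /t real_normK ?num_real// /delta invfM -mulrA.
  rewrite ler_wpM2l ?invr_ge0// mulrC ler_pdivrMr// mulrC.
  exact: dot_sqr_le.
have /andP[th0 th3] := theta03.
have A3 : t ^+ 3 * t `^ (- theta) <= (1 + t) ^+ 3.
  have -> : t ^+ 3 = t `^ 3%:R by rewrite powR_mulrn// ltW.
  rewrite -powRD; last by apply/implyP => _; rewrite gt_eqF.
  apply: (@le_trans _ _ ((1 + t) `^ (3 + - theta))).
    apply: ge0_ler_powR; rewrite ?nnegrE ?(ltW t0)// ?subr_ge0//.
    by rewrite lerDr.
  have -> : (1 + t) ^+ 3 = (1 + t) `^ 3%:R by rewrite powR_mulrn.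
  apply: ler_powR; first by rewrite lerDl ltW.
  by rewrite gerBl.
pose S := \prod_(j < N) sing s (dot (tnth B j) v).
have S0 : 0 <= S by apply: prodr_ge0 => j _; exact: sing_ge0.
have A4 : \prod_(x <- B) `|dot x v| `^ (- s) <= (1 + t) ^+ (2 * N) * S.
  rewrite big_tuple mulnC exprM -[in (_ ^+ N) ^+ 2]exprM mulnC exprM.
  rewrite -[X in _ ^+ X * _](card_ord N) -prodr_const -big_split/=.
  apply: ler_prod => j _; rewrite powR_ge0/= /sing.
  set y := dot _ _; have y2 : 0 < 1 + y ^+ 2 by rewrite ltr_wpDr// sqr_ge0.
  rewrite mulrCA ler_peMr ?powR_ge0// ler_pdivlMr// mul1r.
  have : `|y| <= t by apply: hb; exact: mem_tnth.
  rewrite -(real_normK (num_real y)); move: (normr_ge0 y) (t0); nra.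
have E0 := expR_ge0 (- (delta * t ^+ 2)).
apply: (@le_trans _ _ ((c1 * t ^+ 3 * (1 + t) ^+ D) *
   (expR (- (delta * t ^+ 2)) * (t `^ (- theta) * ((1 + t) ^+ (2 * N) * S))))).
  apply: ler_pM => //; first by rewrite !mulr_ge0 ?expR_ge0 ?powR_ge0// prodr_ge0// => j _; exact: powR_ge0.
  apply: ler_pM => //; rewrite ?expR_ge0// ?mulr_ge0 ?powR_ge0//.
    by apply: prodr_ge0 => j _; exact: powR_ge0.
  by rewrite ler_wpM2l ?powR_ge0.
rewrite (_ : _ * _ = c1 * ((t ^+ 3 * t `^ (- theta)) * ((1 + t) ^+ (D + 2 * N)
   * expR (- (delta * t ^+ 2)))) * S); last by rewrite exprD; ring.
apply: ler_wpM2r => //; apply: ler_wpM2l => //.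
apply: le_trans (hC2 t (ltW t0)); rewrite mulrA; apply: ler_wpM2r => //.
by rewrite [X in _ <= X]exprD mulrC; apply: ler_wpM2l => //; exact: exprn_ge0.
Qed.

Lemma measurable_dot a :
  measurable_fun [set: N.-tuple T] (fun x : N.-tuple T => dot a (row_of_tuple x)).
Proof.
rewrite (_ : (fun x => _) = fun x : N.-tuple T => \sum_j (a 0 j * tnth x j)).
  apply: measurable_sum => j; apply: measurable_funM => //.
  exact: measurable_tnth.
by apply/funext => x; rewrite dotE; apply: eq_bigr => j _; rewrite mxE.
Qed.

Lemma measurable_dotxx : measurable_fun [set: N.-tuple T]
  (fun x : N.-tuple T => dot (row_of_tuple x) (row_of_tuple x)).
Proof.
rewrite (_ : (fun x => _) = fun x : N.-tuple T => \sum_j (tnth x j * tnth x j : R)).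
  apply: measurable_sum => j; apply: measurable_funM; exact: measurable_tnth.
by apply/funext => x; rewrite dotE; apply: eq_bigr => j _; rewrite mxE.
Qed.

Lemma measurable_weight :
  measurable_fun [set: N.-tuple T] (fun x : N.-tuple T => weight (row_of_tuple x)).
Proof.
apply: measurable_funM.
  apply: (measurableT_comp (@measurable_expR R)).
  apply: (measurableT_comp (@oppr_measurable R setT)).
  by apply: measurable_funM => //; exact: measurable_dotxx.
apply: measurable_prod => a _; apply: (measurableT_comp (measurable_powR _)).
apply: (measurableT_comp (@normr_measurable R setT)); exact: measurable_dot.
Qed.

Lemma weight_ge0 v : 0 <= weight v.
Proof.
by rewrite mulr_ge0 ?expR_ge0// prodr_ge0// => a _; exact: powR_ge0.
Qed.

(** A power of 0 with nonzero exponent is 0 by convention, so the weight vanishes on the walls and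
    the estimates off the walls extend to all points. *)
Lemma weight_eq0 v a : a \in P -> dot a v = 0 -> weight v = 0.
Proof.
move=> aP av; rewrite /weight (perm_big _ (perm_to_rem aP))/= big_cons av.
by rewrite normr0 powR0 ?mul0r ?mulr0// oppr_eq0 mulf_neq0// gt_eqF.
Qed.

(** The basis given by [prod_root_bound] varies with the point, but there are finitely many choices:
    the dominating function is the sum of the bounds over all tuples of indices into [P], those that
    are not free contributing 0. *)
Lemma integrable_weight F : poly_growth 3 F ->
  measurable_fun [set: N.-tuple T] (fun x : N.-tuple T => F (row_of_tuple x)) ->
  (LN N).-integrable setT
    (fun x : N.-tuple T => (F (row_of_tuple x) * weight (row_of_tuple x))%:E).
Proof.
move=> gF mF.
pose I := ({ffun 'I_N -> 'I_(size P)} * 'I_N)%type.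
pose B (p : I) : N.-tuple 'rV[R]_N := [tuple P`_(p.1 j) | j < N].
have /choice[C hC] (p : I) : exists C, 0 <= C /\ (free (B p) ->
    forall v, (forall x, x \in B p -> dot x v != 0) ->
    (forall x, x \in B p -> `|dot x v| <= `|dot (tnth (B p) p.2) v|) ->
    `|F v| * (expR (- (2^-1 * dot v v)) *
      (`|dot (tnth (B p) p.2) v| `^ (- theta) *
       \prod_(x <- B p) `|dot x v| `^ (- s)))
    <= C * \prod_(j < N) sing s (dot (tnth (B p) j) v)).
  have [fB|fB] := boolP (free (B p)); last by exists 0; split.
  by have [C C0 hC] := weighted_growth_bound gF fB (mem_tnth p.2 (B p)); exists C.
pose J (p : I) := if free (B p) then C p else 0.
pose G (p : I) (x : N.-tuple T) : R :=
  J p * \prod_(j < N) sing s (dot (tnth (B p) j) (row_of_tuple x)).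
have J0 p : 0 <= J p by rewrite /J; case: ifP => // _; case: (hC p).
have G0 p x : 0 <= G p x.
  by rewrite mulr_ge0// prodr_ge0// => j _; exact: sing_ge0.
have mG p : measurable_fun [set: N.-tuple T] (G p).
  apply: measurable_funM => //; apply: measurable_prod => j _.
  apply: (measurableT_comp (@measurable_sing R s)); exact: measurable_dot.
have iG p : (LN N).-integrable setT (EFin \o G p).
  apply/integrableP; split; first exact/measurable_EFinP.
  rewrite (eq_integral (fun x => ((J p)%:E *
      (\prod_(j < N) sing s (dot (tnth (B p) j) (row_of_tuple x)))%:E)%E)); last first.
    by move=> x _ /=; rewrite ger0_norm.
  rewrite ge0_integralZl_EFin//; last 2 first.
  - by move=> x _; rewrite lee_fin prodr_ge0// => j _; exact: sing_ge0.
  - apply/measurable_EFinP; apply: measurable_prod => j _.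
    apply: (measurableT_comp (@measurable_sing R s)); exact: measurable_dot.
  rewrite /J; case: ifPn => [fB|_]; last by rewrite mul0e ltry.
  rewrite lte_mul_pinfty// ?lee_fin; first by case: (hC p).
  rewrite (eq_integral (fun x => (\prod_(j < N)
     sing s ((row_of_tuple x *m frame_mx (B p)) 0 j))%:E)).
    by apply: integral_prod_sing_mx_lty => //; exact: frame_mx_unit.
  by move=> x _; congr EFin; apply: eq_bigr => j _; rewrite mul_frame_mx.
have mW : measurable_fun [set: N.-tuple T]
    (fun x : N.-tuple T => F (row_of_tuple x) * weight (row_of_tuple x)).
  by apply: measurable_funM => //; exact: measurable_weight.
apply: (@le_integrable _ _ _ _ _ _ _
   (fun x => \sum_(p <- index_enum I) (EFin \o G p) x)%E) => //.
- exact/measurable_EFinP.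
- move=> x _; rewrite /= sumEFin lee_fin.
  rewrite [X in _ <= X]ger0_norm ?sumr_ge0//.
  set v := row_of_tuple x; rewrite normrM (ger0_norm (weight_ge0 v)).
  have [|hv] := boolP (has (fun a => dot a v == 0) P).
    move=> /hasP[a aP /eqP av]; rewrite (weight_eq0 aP av) mulr0.
    by apply: sumr_ge0 => p _; exact: G0.
  have {}hv a : a \in P -> dot a v != 0.
    by move=> aP; apply: contra hv => av; apply/hasP; exists a.
  have [A [AP fA [b [bA hb hp]]]] := prod_root_bound hv.
  have iA j : (index (tnth A j) P < size P)%N by rewrite index_mem AP// mem_tnth.
  have [k kb] : exists k, tnth A k = b by case/tnthP: bA => k ->; exists k.
  pose p : I := ([ffun j => Ordinal (iA j)], k).
  have BA : B p = A.
    by apply: eq_from_tnth => j; rewrite tnth_mktuple ffunE/= nth_index// AP// mem_tnth.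
  rewrite (bigD1 p)//=; apply: ler_wpDr; first by apply: sumr_ge0 => q _; exact: G0.
  rewrite /G /J BA fA; have [_] := hC p; rewrite BA => /(_ fA v) h.
  apply: le_trans (h _ _); last first.
  + by rewrite /= kb.
  + by move=> y yA; apply: hv; exact: AP.
  by rewrite /= kb /weight; apply: ler_wpM2l => //; apply: ler_wpM2l; rewrite ?expR_ge0.
- by apply: integrable_sum => // p _; exact: iG.
Qed.

End WeightIntegrable.

(** * Integration by parts *)

Section RowIntegral.
Context {R : realType}.
Local Notation T := (measurableTypeR R).
Local Notation mu := (@lebesgue_measure R).
Local Notation LN := (@Defs.lebesgue_measureN R).

(** A function of integral 1. It shows that a reflection has factor 1 and that the whole space is
    not a null set. *)
Definition unit_box n (x : n.-tuple T) : R :=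
  \prod_(j < n) \1_(`[0, 1]%classic : set R) (tnth x j).

Lemma unit_box_ge0 n (x : n.-tuple T) : 0 <= unit_box x.
Proof. by apply: prodr_ge0 => j _; rewrite indicE. Qed.

Lemma measurable_unit_box n : measurable_fun [set: n.-tuple T] (@unit_box n).
Proof.
apply: measurable_prod => j _.
apply: (measurableT_comp (f := \1_(`[0, 1]%classic : set R) : T -> R)).
  exact: measurable_indic.
exact: measurable_tnth.
Qed.

Lemma integral_unit_box n : (\int[LN n]_x (unit_box x)%:E = 1)%E.
Proof.
elim: n => [|n IH].
  under eq_integral => x _ do rewrite /unit_box big_ord0.
  by rewrite /= integral_cst//= diracT mule1.
rewrite integral_lebesgueS; last 2 first.
- by apply/measurable_EFinP; exact: measurable_unit_box.
- by move=> x; rewrite lee_fin unit_box_ge0.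
rewrite (_ : (fun t : T => _) = fun t : T => (\1_(`[0, 1]%classic : set R) t)%:E).
  rewrite [LHS](integral_indic mu measurableT)// setIT; have := @lebesgue_measure_itv R `[0, 1].
  by rewrite /= lte_fin ltr01 sube0.
apply/funext => t; rewrite -[RHS]mule1 -IH -ge0_integralZl//.
- apply: eq_integral => y _; rewrite -EFinM; congr EFin.
  rewrite /unit_box big_ord_recl tnth0; congr (_ * _).
  by apply: eq_bigr => j _; rewrite tnthS.
- by apply/measurable_EFinP; exact: measurable_unit_box.
- by move=> y _; rewrite lee_fin unit_box_ge0.
Qed.

Section Dim.
Variable N : nat.
Implicit Types (a v e : 'rV[R]_N) (F G : 'rV[R]_N -> R) (phi : 'rV[R]_N -> 'rV[R]_N).

Definition row_measurable F :=
  measurable_fun [set: N.-tuple T] (fun x : N.-tuple T => F (row_of_tuple x)).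
Definition row_integrable F :=
  (LN N).-integrable setT (fun x : N.-tuple T => (F (row_of_tuple x))%:E).
Definition row_ae (Q : 'rV[R]_N -> Prop) :=
  {ae LN N, forall x : N.-tuple T, Q (row_of_tuple x)}.
Definition row_int F : R := fine (\int[LN N]_x (F (row_of_tuple x))%:E)%E.

Lemma row_integrable_measurable F : row_integrable F -> row_measurable F.
Proof. by move=> /integrableP[/measurable_EFinP]. Qed.

Lemma row_integrableD F G : row_integrable F -> row_integrable G ->
  row_integrable (fun v => F v + G v).
Proof. by move=> iF iG; apply: (integrableD measurableT iF iG). Qed.

Lemma row_integrableZ (k : R) F : row_integrable F ->
  row_integrable (fun v => k * F v).
Proof. by move=> iF; apply: (integrableZl measurableT k iF). Qed.

Lemma row_intD F G : row_integrable F -> row_integrable G ->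
  row_int (fun v => F v + G v) = row_int F + row_int G.
Proof. by move=> iF iG; rewrite /row_int -[RHS]RintegralD. Qed.

Lemma row_intZ (k : R) F : row_integrable F ->
  row_int (fun v => k * F v) = k * row_int F.
Proof. by move=> iF; rewrite /row_int -[RHS]RintegralZl. Qed.

Lemma row_int_lim (F : nat -> 'rV[R]_N -> R) F0 G :
  (forall n, row_measurable (F n)) -> row_measurable F0 -> row_integrable G ->
  row_ae (fun v => F ^~ v @ \oo --> F0 v) ->
  row_ae (fun v => forall n, `|F n v| <= G v) ->
  row_int (F n) @[n --> \oo] --> row_int F0.
Proof.
move=> mF mF0 iG cF bF.
pose e F' := fun x : N.-tuple T => (F' (row_of_tuple x : 'rV[R]_N))%:E : \bar R.
have me F' : row_measurable F' -> measurable_fun setT (e F').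
  by move=> mF'; apply/measurable_EFinP.
have [iF _ h] : [/\ (LN N).-integrable setT (e F0),
  [sequence (\int[LN N]_x `|e (F n) x - e F0 x|)%E]_n @ \oo --> 0%E &
  [sequence (\int[LN N]_x (e (F n) x))%E]_n @ \oo --> (\int[LN N]_x (e F0 x))%E].
  apply: (@dominated_convergence _ _ _ (LN N) setT measurableT (fun n => e (F n)) (e F0) (e G)) => //; try by move=> *; apply: me.
  - move: cF; rewrite /row_ae; apply: filterS => x cx _; rewrite /e; apply/fine_cvgP; split; [exact: nearW|exact: cx].
  - move: bF; rewrite /row_ae; apply: filterS => x bx n _; rewrite /e/= lee_fin; exact: bx.
by apply: fine_cvg; rewrite fineK//; exact: integrable_fin_num.
Qed.

Definition preserves_lebesgue phi :=
  (forall F, row_measurable F -> row_measurable (F \o phi)) /\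
  forall F, row_measurable F -> (forall v, 0 <= F v) ->
    (\int[LN N]_x (F (phi (row_of_tuple x)))%:E =
     \int[LN N]_x (F (row_of_tuple x))%:E)%E.

Lemma preserves_row_integrable phi F : preserves_lebesgue phi ->
  row_integrable F -> row_integrable (F \o phi).
Proof.
move=> [mphi hphi] /integrableP[/measurable_EFinP mF iF]; apply/integrableP; split.
  by apply/measurable_EFinP; exact: mphi.
rewrite /= -[X in (X < _)%E](_ : (\int[LN N]_x (`|F (row_of_tuple x)|)%:E)%E = _)//.
by rewrite -(hphi (fun v => `|F v|))//; apply: measurableT_comp.
Qed.

Lemma preserves_row_int phi F : preserves_lebesgue phi ->
  row_measurable F -> row_int (F \o phi) = row_int F.
Proof.
move=> [mphi hphi] mF; rewrite /row_int integralE [in RHS]integralE; congr fine.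
have mp : row_measurable (fun v => Num.max (F v) 0) by exact: measurable_maxr.
have mn : row_measurable (fun v => Num.max (- F v) 0).
  by apply: measurable_maxr => //; exact: measurableT_comp.
have := hphi _ mp (fun v => _); rewrite /= => hp.
have := hphi _ mn (fun v => _); rewrite /= => hn.
congr (_ - _)%E.
- transitivity (\int[LN N]_x (Num.max (F (phi (row_of_tuple x))) 0)%:E)%E.
    by apply: eq_integral => x _; rewrite funeposE EFin_max.
  rewrite hp => [|v]; last by rewrite le_max lexx orbT.
  by apply: eq_integral => x _; rewrite funeposE EFin_max.
- transitivity (\int[LN N]_x (Num.max (- F (phi (row_of_tuple x))) 0)%:E)%E.
    by apply: eq_integral => x _; rewrite funenegE EFin_max.
  rewrite hn => [|v]; last by rewrite le_max lexx orbT.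
  by apply: eq_integral => x _; rewrite funenegE EFin_max.
Qed.

Lemma preserves_shift e : preserves_lebesgue (fun v => v + e).
Proof.
have E (x : N.-tuple T) : row_of_tuple x + e = row_of_tuple (addt x (tuple_of_row e)).
  by apply/rowP => i; rewrite !mxE !tnth_mktuple.
split=> [F mF|F mF F0].
  rewrite /row_measurable (_ : (fun x => _) =
    (fun x : N.-tuple T => F (row_of_tuple x)) \o (fun x => addt x (tuple_of_row e))).
    by apply: measurableT_comp => //; exact: measurable_addt.
  by apply/funext => x /=; rewrite E.
under eq_integral => x _ do rewrite E.
apply: (integral_lebesgue_addt (tuple_of_row e) (f := fun x => (F (row_of_tuple x))%:E)).
- exact/measurable_EFinP.
- by move=> x; rewrite lee_fin.
Qed.

Lemma preserves_refl a : preserves_lebesgue (fun v => v *m refl_mx a).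
Proof.
have uM : refl_mx a \in unitmx by exact/orthogonal_unit/orthogonal_refl.
have E (x : N.-tuple T) : row_of_tuple x *m refl_mx a =
    row_of_tuple (mul_tuple (refl_mx a) x).
  by rewrite /mul_tuple tuple_of_rowK.
have EE (x : N.-tuple T) : mul_tuple (refl_mx a) (mul_tuple (refl_mx a) x) = x.
  by rewrite -[LHS]row_of_tupleK -!E -mulmxA refl_mxK mulmx1 row_of_tupleK.
have [mM [k k0 hk]] := scales_lebesgue_mx uM.
(* A reflection is an involution, so its factor satisfies k^2 = 1. *)
have k1 : k = 1.
  have mb := @measurable_unit_box N.
  have h : (\int[LN N]_x (unit_box x)%:E = k%:E * (k%:E * 1))%E.
    rewrite -[X in (_ * (_ * X))%E](integral_unit_box N).
    have h2 := hk (fun x => (unit_box (mul_tuple (refl_mx a) x))%:E).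
    rewrite -(hk (fun x => (unit_box x)%:E)) -?h2; try (by move=> x;
      rewrite lee_fin unit_box_ge0); try by apply/measurable_EFinP => //;
      exact: measurableT_comp.
    by apply: eq_integral => x _; rewrite EE.
  move: h; rewrite integral_unit_box mule1 -EFinM => -[kk].
  by apply/eqP; move/esym/eqP: kk; rewrite -expr2 sqrf_eq1 => /orP[//|/eqP kN];
    move: k0; rewrite kN ltr0N1.
split=> [F mF|F mF F0].
  rewrite /row_measurable (_ : (fun x => _) =
    (fun x : N.-tuple T => F (row_of_tuple x)) \o mul_tuple (refl_mx a)).
    exact: measurableT_comp.
  by apply/funext => x /=; rewrite E.
under eq_integral => x _ do rewrite E.
rewrite (hk (fun x => (F (row_of_tuple x))%:E)) ?k1 ?mul1e//.
  exact/measurable_EFinP.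
by move=> x; rewrite lee_fin.
Qed.

End Dim.

(** If the first coefficient is zero, the slices at a fixed first coordinate are hyperplanes of
    lower dimension; otherwise, once the remaining coordinates are fixed, the slice is a point. *)
Lemma hyperplane_measure0 n (a : 'rV[R]_n) (b : R) : a != 0 ->
  LN n [set x | dot a (row_of_tuple x) = b] = 0%E.
Proof.
have mH m (a' : 'rV[R]_m) b' :
    measurable [set x : m.-tuple T | dot a' (row_of_tuple x) = b'].
  rewrite -[X in measurable X]setTI.
  exact: (measurable_dot a' _ (measurable_set1 b')).
elim: n a b => [a b|n IH a b a0].
  by rewrite [a](thinmx0) eqxx.
have [i ai] : exists i, a 0 i != 0.
  by apply/existsP; apply: contraNT a0 => /existsPn h; apply/eqP/rowP => i;
    rewrite mxE; apply/eqP; move: (h i); rewrite negbK.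
pose a' : 'rV[R]_n := \row_j a 0 (lift ord0 j).
have dE t (y : n.-tuple T) : dot a (row_of_tuple (cons_tuple t y)) =
    a 0 ord0 * t + dot a' (row_of_tuple y).
  rewrite !dotE big_ord_recl !mxE tnth0; congr (_ + _); apply: eq_bigr => j _.
  by rewrite !mxE tnthS.
set H := [set x | _].
rewrite -[H]setIT -(integral_indic _ measurableT)//; last exact: mH.
have mI : measurable_fun [set: n.+1.-tuple T] (EFin \o (\1_H : _ -> R)).
  by apply/measurable_EFinP; apply: measurable_indic; exact: mH.
have I0 (x : n.+1.-tuple T) : (0 <= (\1_H x : R)%:E)%E by rewrite lee_fin indicE.
have [a00|a00] := eqVneq (a 0 ord0) 0.
  rewrite (integral_lebesgueS mI I0); apply: integral0_eq => t _.
  have a'0 : a' != 0.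
    apply: contra ai => /eqP a'0; have [->|[j ->]] : i = ord0 \/ exists j, i = lift ord0 j.
      by case: (unliftP ord0 i) => [j ->|->]; [right; exists j|left].
      by rewrite a00.
    by move/rowP: a'0 => /(_ j); rewrite !mxE => ->.
  rewrite -(IH a' b a'0) -[X in _ = LN n X]setIT.
  rewrite -(integral_indic _ measurableT); last exact: mH.
  apply: eq_integral => y _; rewrite /= !indicE; congr (_%:R)%:E.
  by congr nat_of_bool; apply/idP/idP; rewrite !inE /H/= dE a00 mul0r add0r.
rewrite (integral_lebesgueS_swap mI I0); apply: integral0_eq => y _.
pose t0 := (b - dot a' (row_of_tuple y)) / a 0 ord0.
rewrite -(lebesgue_measure_set1 t0) -[X in _ = mu X]setIT.
rewrite -(integral_indic mu measurableT)//.
apply: eq_integral => t _; rewrite /= !indicE; congr (_%:R)%:E.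
congr nat_of_bool; apply/idP/idP; rewrite !inE /H/= dE /t0.
  by move=> <-; rewrite addrK mulrC mulKf.
by move=> ->; rewrite mulrC divfK// subrK.
Qed.

Lemma row_ae_neq0 N (P : seq 'rV[R]_N) : (forall a, a \in P -> a != 0) ->
  row_ae (fun v => forall a, a \in P -> dot a v != 0).
Proof.
elim: P => [_|a P IH h].
  by apply: aeW => x a; rewrite in_nil.
have ha : row_ae (fun v => dot a v != 0).
  exists [set x | dot a (row_of_tuple x) = 0]; split.
  - rewrite -[X in measurable X]setTI.
    exact: (measurable_dot a _ (measurable_set1 0)).
  - by apply: hyperplane_measure0; rewrite h ?mem_head.
  - by move=> x /= /negP; rewrite negbK => /eqP.
have {}IH : row_ae (fun v => forall b, b \in P -> dot b v != 0).
  by apply: IH => b bP; apply: h; rewrite inE bP orbT.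
apply: filterS2 ha IH => x xa xP b.
by rewrite inE => /predU1P[->//|]; exact: xP.
Qed.

End RowIntegral.

(** * Values and growth of polynomials at real points *)

Section PolyValues.
Context {R : realType} {N : nat}.
Local Notation T := (measurableTypeR R).
Local Notation poly := (mpoly N R[i]).
Implicit Types (a b e u v xi : 'rV[R]_N) (f g : poly).

Definition peval f v : R[i] := meval (fun i => (v 0 i)%:C%C) f.
Definition re_eval f v : R := complex.Re (peval f v).
Definition im_eval f v : R := complex.Im (peval f v).

Lemma re_evalD f g v : re_eval (f + g) v = re_eval f v + re_eval g v.
Proof. by rewrite /re_eval /peval mevalD raddfD. Qed.

Lemma im_evalD f g v : im_eval (f + g) v = im_eval f v + im_eval g v.
Proof. by rewrite /im_eval /peval mevalD raddfD. Qed.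

Lemma re_evalZ (z : R[i]) f v :
  re_eval (z *: f) v = complex.Re z * re_eval f v - complex.Im z * im_eval f v.
Proof. by rewrite /re_eval /im_eval /peval mevalZ; case: z (meval _ _) => ? ? []. Qed.

Lemma im_evalZ (z : R[i]) f v :
  im_eval (z *: f) v = complex.Re z * im_eval f v + complex.Im z * re_eval f v.
Proof. by rewrite /re_eval /im_eval /peval mevalZ; case: z (meval _ _) => ? ? []. Qed.

Lemma re_evalN f v : re_eval (- f) v = - re_eval f v.
Proof. by rewrite /re_eval /peval mevalN raddfN. Qed.

Lemma re_eval_sum (I : Type) (r : seq I) (Q : pred I) (F : I -> poly) v :
  re_eval (\sum_(i <- r | Q i) F i) v = \sum_(i <- r | Q i) re_eval (F i) v.
Proof.
apply: (big_morph (fun f => re_eval f v)) => [f g|]; first exact: re_evalD.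
by rewrite -(scale0r 0) re_evalZ !mul0r subrr.
Qed.

Lemma peval_linform a v : peval (linform a) v = (dot a v)%:C%C.
Proof.
rewrite /peval meval_linform dotE rmorph_sum/=.
by apply: eq_bigr => i _; rewrite rmorphM.
Qed.

Lemma re_evalM_linform a f v : re_eval (linform a * f) v = dot a v * re_eval f v.
Proof.
rewrite /re_eval /peval mevalM -/(peval (linform a) v) peval_linform.
by case: (meval _ _) => x y /=; rewrite mul0r subr0.
Qed.

Lemma im_evalM_linform a f v : im_eval (linform a * f) v = dot a v * im_eval f v.
Proof.
rewrite /im_eval /peval mevalM -/(peval (linform a) v) peval_linform.
by case: (meval _ _) => x y /=; rewrite mul0r addr0.
Qed.

Lemma re_evalM_var i f v : re_eval (polyvar i * f) v = v 0 i * re_eval f v.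
Proof. by rewrite -linform_delta re_evalM_linform dotC dot_delta. Qed.

Lemma im_evalM_var i f v : im_eval (polyvar i * f) v = v 0 i * im_eval f v.
Proof. by rewrite -linform_delta im_evalM_linform dotC dot_delta. Qed.

Lemma re_eval1 v : re_eval 1 v = 1.
Proof. by rewrite /re_eval /peval meval1. Qed.

Lemma im_eval1 v : im_eval 1 v = 0.
Proof. by rewrite /im_eval /peval meval1. Qed.

Lemma peval_act w f v : orthogonal_mx w -> peval (act w f) v = peval f (v *m w^T).
Proof.
move=> ow; rewrite /peval meval_poly_act orthogonal_inv//; apply: meval_eq => i.
rewrite mxE rmorph_sum; apply: eq_bigr => j _.
by rewrite mulrC -rmorphM.
Qed.

Lemma re_eval_act w f v : orthogonal_mx w -> re_eval (act w f) v = re_eval f (v *m w^T).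
Proof. by move=> ow; rewrite /re_eval peval_act. Qed.

(** The two parts are handled together because multiplication by a complex scalar mixes them; the
    same happens in [is_derive_line] and [poly_growth_homog]. *)
Lemma measurable_re_im f : row_measurable (re_eval f) /\ row_measurable (im_eval f).
Proof.
elim/(@poly_ind_vars R N) : f => [|z f [IHr IHi]|f g [fr fi] [gr gi]|i f [IHr IHi]].
- have -> : re_eval 1 = cst 1 by apply/funext => v; exact: re_eval1.
  have -> : im_eval 1 = cst 0 by apply/funext => v; exact: im_eval1.
  by split; exact: measurable_cst.
- split.
    rewrite (_ : re_eval _ = fun v => complex.Re z * re_eval f v - complex.Im z * im_eval f v).
      by apply: measurable_funB; apply: measurable_funM.
    by apply/funext => v; exact: re_evalZ.
  rewrite (_ : im_eval _ = fun v => complex.Re z * im_eval f v + complex.Im z * re_eval f v).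
    by apply: measurable_funD; apply: measurable_funM.
  by apply/funext => v; exact: im_evalZ.
- split.
    rewrite (_ : re_eval _ = fun v => re_eval f v + re_eval g v).
      exact: measurable_funD.
    by apply/funext => v; exact: re_evalD.
  rewrite (_ : im_eval _ = fun v => im_eval f v + im_eval g v).
    exact: measurable_funD.
  by apply/funext => v; exact: im_evalD.
have mi : row_measurable (fun v : 'rV[R]_N => v 0 i).
  rewrite /row_measurable (_ : (fun x => _) = fun x : N.-tuple T => tnth x i).
    exact: measurable_tnth.
  by apply/funext => x; rewrite mxE.
split.
  rewrite (_ : re_eval _ = fun v => v 0 i * re_eval f v).
    exact: measurable_funM.
  by apply/funext => v; exact: re_evalM_var.
rewrite (_ : im_eval _ = fun v => v 0 i * im_eval f v).
  exact: measurable_funM.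
by apply/funext => v; exact: im_evalM_var.
Qed.

Lemma measurable_re_eval f : row_measurable (re_eval f).
Proof. by case: (measurable_re_im f). Qed.

Lemma is_derive_line e v f (t : R) :
  is_derive t 1 (fun s : R => re_eval f (v + s *: e)) (re_eval (pderiv e f) (v + t *: e)) /\
  is_derive t 1 (fun s : R => im_eval f (v + s *: e)) (im_eval (pderiv e f) (v + t *: e)).
Proof.
elim/(@poly_ind_vars R N) : f => [|z f [IHr IHi]|f g [fr fi] [gr gi]|i f [IHr IHi]].
- rewrite pderiv1 -(scale0r 0) re_evalZ im_evalZ !mul0r subrr addr0.
  split.
    by under eq_fun do rewrite re_eval1; exact: is_derive_cst.
  by under eq_fun do rewrite im_eval1; exact: is_derive_cst.
- rewrite pderivZ re_evalZ im_evalZ; split.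
    under eq_fun do rewrite re_evalZ.
    exact: (is_deriveB (is_deriveZ (complex.Re z) IHr) (is_deriveZ (complex.Im z) IHi)).
  under eq_fun do rewrite im_evalZ.
  exact: (is_deriveD (is_deriveZ (complex.Re z) IHi) (is_deriveZ (complex.Im z) IHr)).
- rewrite pderivD re_evalD im_evalD; split.
    by under eq_fun do rewrite re_evalD; exact: is_deriveD.
  by under eq_fun do rewrite im_evalD; exact: is_deriveD.
have di : is_derive t (1 : R) (fun s : R => (v + s *: e) 0 i) (e 0 i).
  rewrite (_ : (fun s : R => _) = fun s : R => v 0 i + s * e 0 i); last first.
    by apply/funext => s; rewrite !mxE.
  have h := is_deriveD (is_derive_cst (v 0 i : R) t (1 : R))
     (is_deriveM (is_derive_id t (1 : R)) (is_derive_cst (e 0 i : R) t (1 : R))).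
  apply: (is_derive_eq h); rewrite /= scaler0 add0r; rewrite add0r.
  by rewrite -[RHS]mulr1.
rewrite pderivM pderiv_var re_evalD im_evalD re_evalM_var im_evalM_var.
rewrite -scalerAl mul1r re_evalZ im_evalZ /= !mul0r subr0 addr0; split.
  under eq_fun do rewrite re_evalM_var.
  by apply: (is_derive_eq (is_deriveM di IHr)); rewrite /= [X in _ + X]mulrC.
under eq_fun do rewrite im_evalM_var.
by apply: (is_derive_eq (is_deriveM di IHi)); rewrite /= [X in _ + X]mulrC.
Qed.

Lemma poly_growthD k F G : poly_growth k F -> poly_growth k G ->
  poly_growth k (fun v : 'rV[R]_N => F v + G v).
Proof.
move=> [C1 [D1 [C10 h1]]] [C2 [D2 [C20 h2]]].
exists (C1 + C2), (D1 + D2)%N; split; first exact: addr_ge0.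
move=> v r r0 vr; have r1 : 1 <= 1 + r by rewrite lerDl.
have E1 : (1 + r) ^+ D1 <= (1 + r) ^+ (D1 + D2) by rewrite ler_weXn2l ?leq_addr.
have E2 : (1 + r) ^+ D2 <= (1 + r) ^+ (D1 + D2) by rewrite ler_weXn2l ?leq_addl.
rewrite !mulrDl; apply: (le_trans (ler_normD _ _)); apply: lerD.
  apply: (le_trans (h1 v r r0 vr)); apply: ler_wpM2l => //.
  by rewrite mulr_ge0 ?exprn_ge0.
apply: (le_trans (h2 v r r0 vr)); apply: ler_wpM2l => //.
by rewrite mulr_ge0 ?exprn_ge0.
Qed.

Lemma poly_growthZ k (c : R) F : poly_growth k F ->
  poly_growth k (fun v : 'rV[R]_N => c * F v).
Proof.
move=> [C [D [C0 h]]]; exists (`|c| * C), D; split; first exact: mulr_ge0.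
by move=> v r r0 vr; rewrite normrM -!mulrA ler_wpM2l// mulrA h.
Qed.

Lemma poly_growth_homog d f : homog d f ->
  poly_growth d (re_eval f) /\ poly_growth d (im_eval f).
Proof.
move: d f; apply: homog_ind => [d||d z f [IHr IHi]|d f g [fr fi] [gr gi]|d i f [IHr IHi]].
- split; exists 0, 0%N; split => // v r _ _; rewrite -(scale0r 0) ?re_evalZ ?im_evalZ !mul0r.
    by rewrite subrr normr0.
  by rewrite addr0 normr0.
- split; exists 1, 0%N; split => // v r _ _; rewrite ?re_eval1 ?im_eval1 !mulr1.
    by rewrite normr1.
  by rewrite normr0.
- split.
    rewrite (_ : re_eval _ = fun v => complex.Re z * re_eval f v + (- complex.Im z) * im_eval f v).
      by apply: poly_growthD; exact: poly_growthZ.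
    by apply/funext => v; rewrite re_evalZ mulNr.
  rewrite (_ : im_eval _ = fun v => complex.Re z * im_eval f v + complex.Im z * re_eval f v).
    by apply: poly_growthD; exact: poly_growthZ.
  by apply/funext => v; exact: im_evalZ.
- split.
    rewrite (_ : re_eval _ = fun v => re_eval f v + re_eval g v).
      exact: poly_growthD.
    by apply/funext => v; exact: re_evalD.
  rewrite (_ : im_eval _ = fun v => im_eval f v + im_eval g v).
    exact: poly_growthD.
  by apply/funext => v; exact: im_evalD.
split.
  case: IHr => C [D [C0 h]]; exists C, D; split => // v r r0 vr.
  rewrite re_evalM_var normrM exprS [C * _]mulrCA -[X in _ <= X]mulrA.
  by apply: ler_pM => //; exact: h.
case: IHi => C [D [C0 h]]; exists C, D; split => // v r r0 vr.
rewrite im_evalM_var normrM exprS [C * _]mulrCA -[X in _ <= X]mulrA.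
by apply: ler_pM => //; exact: h.
Qed.

Lemma poly_growthW k l F : (k <= l)%N -> poly_growth l F ->
  @poly_growth R N k F.
Proof.
move=> kl [C [D [C0 h]]]; exists C, (D + (l - k))%N; split => // v r r0 vr.
apply: (le_trans (h v r r0 vr)); rewrite -!mulrA; apply: ler_wpM2l => //.
rewrite -{1}(subnKC kl) exprD -mulrA; apply: ler_wpM2l; first exact: exprn_ge0.
rewrite exprD mulrC; apply: ler_wpM2l; first by rewrite exprn_ge0// addr_ge0.
by apply: lerXn2r; rewrite ?nnegrE ?addr_ge0// lerDr.
Qed.

Lemma poly_growth_mord k f : mord k f -> poly_growth k (re_eval f).
Proof.
move: f; apply: mord_ind => [|f g hf hg|d f kd /poly_growth_homog[h _]].
- exists 0, 0%N; split => // v r _ _; rewrite -(scale0r 0) re_evalZ !mul0r.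
  by rewrite subrr normr0.
- rewrite (_ : re_eval _ = fun v => re_eval f v + re_eval g v).
    exact: poly_growthD.
  by apply/funext => v; exact: re_evalD.
exact: poly_growthW h.
Qed.

End PolyValues.

(** * Functions with Gaussian decay *)

Section Tempered.
Context {R : realType} {N : nat}.
Local Notation T := (measurableTypeR R).
Local Notation LN := (@Defs.lebesgue_measureN R).
Local Notation poly := (mpoly N R[i]).
Implicit Types (a b e u v xi : 'rV[R]_N) (f g : poly) (F G : 'rV[R]_N -> R).

Definition poly_bounded F := exists (C : R) (D : nat), 0 <= C /\
  forall v, `|F v| <= C * (1 + dot v v) ^+ D.

Lemma ge1_Ddot v : 1 <= 1 + dot v v.
Proof. by rewrite lerDl dot_ge0. Qed.

Lemma poly_bounded_cst (r : R) : poly_bounded (fun=> r).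
Proof. by exists `|r|, 0%N; split => // v; rewrite mulr1. Qed.

Lemma poly_boundedD F G : poly_bounded F -> poly_bounded G ->
  poly_bounded (fun v => F v + G v).
Proof.
move=> [C1 [D1 [C10 h1]]] [C2 [D2 [C20 h2]]].
exists (C1 + C2), (D1 + D2)%N; split; first exact: addr_ge0.
move=> v; have v1 := ge1_Ddot v; rewrite mulrDl (le_trans (ler_normD _ _))//.
apply: lerD; [apply: (le_trans (h1 v))|apply: (le_trans (h2 v))];
  by apply: ler_wpM2l => //; rewrite ler_weXn2l ?leq_addr ?leq_addl.
Qed.

Lemma poly_boundedM F G : poly_bounded F -> poly_bounded G ->
  poly_bounded (fun v => F v * G v).
Proof.
move=> [C1 [D1 [C10 h1]]] [C2 [D2 [C20 h2]]].
exists (C1 * C2), (D1 + D2)%N; split; first exact: mulr_ge0.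
by move=> v; rewrite normrM exprD mulrACA ler_pM.
Qed.

Lemma poly_boundedN F : poly_bounded F -> poly_bounded (fun v => - F v).
Proof. by move=> [C [D [C0 h]]]; exists C, D; split => // v; rewrite normrN. Qed.

Lemma poly_bounded_sum (I : Type) (r : seq I) (F : I -> 'rV[R]_N -> R) :
  (forall i, poly_bounded (F i)) -> poly_bounded (fun v => \sum_(i <- r) F i v).
Proof.
move=> h; elim: r => [|i r IH].
  by under eq_fun do rewrite big_nil; exact: poly_bounded_cst.
by under eq_fun do rewrite big_cons; exact: poly_boundedD.
Qed.

Lemma poly_bounded_re_eval f : poly_bounded (re_eval f).
Proof.
have [C [D [C0 h]]] : poly_growth 0 (re_eval f) by exact: poly_growth_mord.
exists (C * 2 ^+ D), D; split; first by rewrite mulr_ge0 ?exprn_ge0.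
move=> v; apply: (le_trans (h v (1 + dot v v) _ _)).
- by rewrite addr_ge0 ?dot_ge0.
- move=> i; have : v 0 i ^+ 2 <= dot v v.
    rewrite dotE (bigD1 i)//= expr2 lerDl sumr_ge0// => j _.
    by rewrite -expr2 sqr_ge0.
  by rewrite -(real_normK (num_real (v 0 i))); move: (normr_ge0 (v 0 i)); nra.
rewrite mulr1 -mulrA; apply: ler_wpM2l => //; rewrite -exprMn.
have := dot_ge0 v => v0; apply: lerXn2r; rewrite ?nnegrE; lra.
Qed.

Lemma poly_bounded_dot a : poly_bounded (dot a).
Proof.
rewrite (_ : dot a = re_eval (linform a)); first exact: poly_bounded_re_eval.
by apply/funext => v; rewrite /re_eval peval_linform.
Qed.

Lemma poly_exp_bound D (delta : R) : 0 < delta ->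
  exists2 C : R, 0 <= C & forall q, 0 <= q -> (1 + q) ^+ D * expR (- (delta * q)) <= C.
Proof.
move=> d0; have [C C0 h] := poly_gauss_bound (2 * D) d0; exists C; first exact: ltW.
move=> q q0; have := h _ (sqrtr_ge0 q); rewrite sqr_sqrtr// exprM.
apply: le_trans; apply: ler_wpM2r; first exact: expR_ge0.
apply: lerXn2r; rewrite ?nnegrE ?exprn_ge0 ?addr_ge0 ?sqrtr_ge0//.
by rewrite -{1}(sqr_sqrtr q0); have := sqrtr_ge0 q; nra.
Qed.

(** A Gaussian is bounded by a multiple of the product of the 1 / (1 + x_j^2), and these factors are
    [sing] with exponent 0, already integrated. *)
Lemma gauss_integrable F (C delta : R) : 0 < delta -> row_measurable F ->
  (forall v, `|F v| <= C * expR (- (delta * dot v v))) -> row_integrable F.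
Proof.
move=> d0 mF hF; have [C1 C10 h1] := poly_exp_bound N d0.
pose G (x : N.-tuple T) : R := \prod_(j < N) sing 0 (tnth x j).
have G0 x : 0 <= G x by apply: prodr_ge0 => j _; exact: sing_ge0.
have iG : (LN N).-integrable setT (EFin \o G).
  have mG : measurable_fun [set: N.-tuple T] G.
    apply: measurable_prod => j _; apply: (measurableT_comp (@measurable_sing R 0)).
    exact: measurable_tnth.
  apply/integrableP; split; first exact/measurable_EFinP.
  under eq_integral => x _ do rewrite /= ger0_norm//.
  by apply: integral_prod_sing_lty; rewrite lexx ltr01.
apply: (le_integrable measurableT _ _ (integrableZl measurableT (`|C| * C1) iG)).
  exact/measurable_EFinP.
move=> x _; rewrite /= lee_fin [X in _ <= X]ger0_norm ?mulr_ge0//.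
set v := row_of_tuple x; apply: (le_trans (hF v)).
apply: (@le_trans _ _ (`|C| * expR (- (delta * dot v v)))).
  by apply: ler_wpM2r; [exact: expR_ge0|exact: ler_norm].
rewrite -mulrA; apply: ler_wpM2l => //.
have v0 := dot_ge0 v; have G1 : G x * \prod_(j < N) (1 + v 0 j ^+ 2) = 1.
  rewrite -big_split/= big1// => j _; rewrite /sing oppr0 powRr0 mxE mul1r mulVf//.
  by rewrite gt_eqF// ltr_wpDr// sqr_ge0.
have G2 : \prod_(j < N) (1 + v 0 j ^+ 2) <= (1 + dot v v) ^+ N.
  rewrite -[X in _ ^+ X](card_ord N) -prodr_const; apply: ler_prod => j _.
  rewrite addr_ge0 ?sqr_ge0//= lerD2l dotE (bigD1 j)//= expr2 lerDl sumr_ge0// => i _.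
  by rewrite -expr2 sqr_ge0.
have E0 := expR_ge0 (- (delta * dot v v)).
rewrite -[X in X <= _]mul1r -G1 -mulrA mulrC; apply: ler_wpM2r => //.
apply: le_trans (h1 _ v0); exact: ler_wpM2r.
Qed.

(** Half of the exponent absorbs the polynomial factor, the other half is kept for integrability. *)
Lemma gauss_tail F : poly_bounded F -> forall delta : R, 0 < delta ->
  exists2 C, 0 <= C & forall v,
    `|F v * expR (- ((delta + delta) * dot v v))| <= C * expR (- (delta * dot v v)).
Proof.
move=> [C [D [C0 hF]]] delta d0; have [C1 C10 h1] := poly_exp_bound D d0.
exists (C * C1); first exact: mulr_ge0.
move=> v; rewrite normrM (ger0_norm (expR_ge0 _)) mulrDl opprD expRD.
rewrite mulrA; apply: ler_wpM2r; first exact: expR_ge0.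
apply: (@le_trans _ _ (C * ((1 + dot v v) ^+ D * expR (- (delta * dot v v))))).
  by rewrite mulrA; apply: ler_wpM2r => //; exact: expR_ge0.
by apply: ler_wpM2l => //; apply: h1; exact: dot_ge0.
Qed.

Lemma tempered_integrable F G : row_measurable F -> poly_bounded G ->
  (forall v, `|F v| <= `|G v * expR (- (2^-1 * dot v v))|) -> row_integrable F.
Proof.
move=> mF bG h; have d0 : 0 < 4^-1 :> R by rewrite invr_gt0.
have [C C0 hC] := gauss_tail bG d0.
apply: (gauss_integrable d0 (C := C)) => // v; apply: (le_trans (h v)).
by have := hC v; rewrite (_ : 4^-1 + 4^-1 = 2^-1 :> R)//; field.
Qed.

(* Translation invariance makes the integrals of the difference quotients of
   [F] vanish; they converge to that of [dF]. *)
Lemma row_int_derive e F dF G dG :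
  row_measurable F -> row_measurable dF -> poly_bounded G -> poly_bounded dG ->
  (forall v, `|F v| <= `|G v * expR (- (2^-1 * dot v v))|) ->
  (forall v, `|dF v| <= `|dG v * expR (- (2^-1 * dot v v))|) ->
  (forall v (t : R), is_derive t 1 (fun s : R => F (v + s *: e)) (dF (v + t *: e))) ->
  row_int dF = 0.
Proof.
move=> mF mdF bG bdG hF hdF der.
have iF := tempered_integrable mF bG hF.
have d0 : 0 < 4^-1 :> R by rewrite invr_gt0.
have [C C0 hC] := gauss_tail bdG d0.
have {}hC v : `|dF v| <= C * expR (- (4^-1 * dot v v)).
  apply: (le_trans (hdF v)).
  by have := hC v; rewrite (_ : 4^-1 + 4^-1 = 2^-1 :> R)//; field.
(* The bound has to be uniform over steps of at most [e], so as to dominate all difference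
   quotients; moving from v + r e back to v lowers the rate from 1/4 to 1/8. *)
pose C3 := C * expR (4^-1 * dot e e).
have bound v (r : R) : 0 <= r <= 1 ->
    `|dF (v + r *: e)| <= C3 * expR (- (8^-1 * dot v v)).
  move=> /andP[r0 r1]; apply: (le_trans (hC _)); rewrite -mulrA; apply: ler_wpM2l => //.
  rewrite -expRD ler_expR.
  (* |v + r e|^2 + |e|^2 exceeds |v|^2 / 2 by |v + 2 r e|^2 / 2 plus (1 - r^2) |e|^2. *)
  have := dot_ge0 (v + r *: e + r *: e); rewrite !(dotDl, dotDr, dotZl, dotZr).
  rewrite (dotC e v) => h; have e0 := dot_ge0 e.
  have : r * (r * dot e e) <= dot e e.
    by rewrite mulrA ler_piMl// mulr_ile1.
  lra.
pose h n : R := n.+1%:R^-1.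
have h01 n : 0 < h n <= 1.
  by rewrite /h invr_gt0 ltr0n/= invf_le1 ?ler1n.
pose Q n v := (h n)^-1 * (F (v + h n *: e) - F v).
(* By the mean value theorem a difference quotient is a value of [dF], so the bound on [dF] applies
   to it. *)
have QE n v : exists2 r : R, 0 <= r <= 1 & Q n v = dF (v + r *: e).
  have /andP[hn0 hn1] := h01 n.
  have [r rI rE] : exists2 r : R, r \in `[0, h n]%R &
      F (v + h n *: e) - F (v + 0 *: e) = dF (v + r *: e) * (h n - 0).
    apply: (@MVT_segment _ (fun s => F (v + s *: e)) (fun s => dF (v + s *: e))).
    - exact: ltW.
    - by apply: derivable_within_continuous => x _; case: (der v x).
  exists r.
    by move: rI; rewrite in_itv/= => /andP[-> /le_trans]; exact.
  by move: rE; rewrite scale0r addr0 subr0 /Q => ->; rewrite mulrC mulfK// gt_eqF.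
have mQ n : row_measurable (Q n).
  apply: measurable_funM => //; apply: measurable_funB => //.
  by have [+ _] := preserves_shift (h n *: e); exact.
have Q0 n : row_int (Q n) = 0.
  have iS := preserves_row_integrable (preserves_shift (h n *: e)) iF.
  rewrite row_intZ; last first.
    have := row_integrableD iS (row_integrableZ (-1) iF).
    by under eq_fun do rewrite mulN1r.
  rewrite [X in _ * X](_ : _ = row_int (F \o (fun v => v + h n *: e)) + row_int (fun v => -1 * F v)).
    rewrite preserves_row_int//; last exact: preserves_shift.
    by rewrite row_intZ// mulN1r subrr mulr0.
  rewrite -row_intD//; last exact: row_integrableZ.
  by congr row_int; apply/funext => v; rewrite /= mulN1r.
have : row_int (Q n) @[n --> \oo] --> row_int dF.
  apply: (row_int_lim (G := fun v => C3 * expR (- (8^-1 * dot v v)))) => //.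
  - apply: (gauss_integrable (delta := 8^-1) (C := C3)); rewrite ?invr_gt0//.
      apply: measurable_funM => //; apply: (measurableT_comp (@measurable_expR R)).
      apply: (measurableT_comp (@oppr_measurable R setT)).
      by apply: measurable_funM => //; exact: measurable_dotxx.
    move=> v; rewrite ger0_norm// mulr_ge0 ?expR_ge0// mulr_ge0 ?expR_ge0//.
  - apply: aeW => x; set v := row_of_tuple x.
    pose f (s : R) := F (v + s *: e).
    have [df Df] : is_derive (0 : R) (1 : R) f (dF v).
      by have := der v 0; rewrite scale0r addr0.
    have /cvgr_dnbhsP cf : r^-1 *: ((f \o shift 0) (r *: (1 : R)) - f 0) @[r --> (0 : R)^'] --> dF v.
      by rewrite -Df; exact: df.
    have := cf h; rewrite /= => {}cf.
    rewrite (_ : (fun n => _) = fun n => (h n)^-1 *: (f (h n *: (1 : R) + 0) - f 0)).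
      apply: cf; split; first by move=> n; rewrite gt_eqF//; case/andP: (h01 n).
      exact: cvg_harmonic.
    by apply/funext => n; rewrite /f addr0 scale0r addr0 [_ *: 1]mulr1.
  - apply: aeW => x n; have [r r01 ->] := QE n (row_of_tuple x); exact: bound.
under eq_cvg do rewrite Q0.
by move=> h0; apply/esym; apply: (cvg_unique _ (cvg_cst 0) h0).
Qed.

End Tempered.

(** * Integration by parts for the regularized weight *)

Section RegularizedWeight.
Context {R : realType} {N : nat}.
Local Notation T := (measurableTypeR R).
Local Notation poly := (mpoly N R[i]).
Implicit Types (a b e u v xi : 'rV[R]_N) (f g : poly) (F G : 'rV[R]_N -> R).
Variables (P : seq 'rV[R]_N) (c : R).
Hypothesis c0 : 0 < c.
Hypothesis hsP : half_system P.
Hypothesis PW : {in P, forall a, pm_stable P (refl_mx a)}.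

Lemma row_int_sum0 (I : eqType) (r : seq I) (F : I -> 'rV[R]_N -> R) :
  (forall i, i \in r -> row_integrable (F i) /\ row_int (F i) = 0) ->
  row_integrable (fun v => \sum_(i <- r) F i v) /\
  row_int (fun v => \sum_(i <- r) F i v) = 0.
Proof.
elim: r => [_|i r IH h].
  under eq_fun do rewrite big_nil.
  split; last by rewrite /row_int integral0.
  by apply: (eq_integrable measurableT (cst 0%E)) => //; exact: integrable0.
have [iF F0] := h i (mem_head _ _).
have {}/IH[iS S0] j : j \in r -> row_integrable (F j) /\ row_int (F j) = 0.
  by move=> jr; apply: h; rewrite inE jr orbT.
under eq_fun do rewrite big_cons; split; first exact: row_integrableD.
by rewrite row_intD// F0 S0 addr0.
Qed.

(** The weight with (a, x)^2 + eps in place of (a, x)^2, written as an exponential so that its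
    logarithmic derivative can be read off. *)
Definition reg_weight (eps : R) v :=
  expR (- (2^-1 * dot v v) - c * \sum_(a <- P) ln (dot a v ^+ 2 + eps)).

(** The smooth substitute for 1 / (a, x) that differentiating [reg_weight] produces. *)
Definition reg_inv (eps : R) a v := dot a v / (dot a v ^+ 2 + eps).

Section Eps.
Variable eps : R.
Hypothesis eps0 : 0 < eps.
Local Notation w := (reg_weight eps).
Local Notation K := (reg_inv eps).

Lemma reg_den_gt0 a v : 0 < dot a v ^+ 2 + eps.
Proof. by rewrite ltr_wpDl// sqr_ge0. Qed.

Lemma measurable_reg_weight : row_measurable w.
Proof.
apply: (measurableT_comp (@measurable_expR R)); apply: measurable_funB.
  apply: (measurableT_comp (@oppr_measurable R setT)).
  by apply: measurable_funM => //; exact: measurable_dotxx.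
apply: measurable_funM => //; apply: measurable_sum => a.
apply: (measurableT_comp (@measurable_ln R)); apply: measurable_funD => //.
by apply: measurable_funX; exact: measurable_dot.
Qed.

Lemma measurable_reg_inv a : row_measurable (K a).
Proof.
rewrite /row_measurable (_ : (fun x => _) = fun x : N.-tuple T =>
  dot a (row_of_tuple x) * expR (- ln (dot a (row_of_tuple x) ^+ 2 + eps))).
  apply: measurable_funM; first exact: measurable_dot.
  apply: (measurableT_comp (@measurable_expR R)).
  apply: (measurableT_comp (@oppr_measurable R setT)).
  apply: (measurableT_comp (@measurable_ln R)); apply: measurable_funD => //.
  by apply: measurable_funX; exact: measurable_dot.
by apply/funext => x; rewrite expRN lnK// posrE reg_den_gt0.
Qed.

Lemma poly_bounded_reg_inv a : poly_bounded (K a).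
Proof.
have [C [D [C0 h]]] := poly_boundedM (poly_bounded_cst eps^-1) (poly_bounded_dot a).
exists C, D; split => // v; apply: le_trans (h v); rewrite !normrM mulrC.
apply: ler_wpM2r => //; have d0 := reg_den_gt0 a v.
rewrite !ger0_norm ?invr_ge0 ?(ltW d0) ?(ltW eps0)//.
by rewrite lef_pV2 ?posrE// lerDr sqr_ge0.
Qed.

Lemma reg_weight_le : exists2 C, 0 <= C &
  forall v, w v <= C * expR (- (2^-1 * dot v v)).
Proof.
exists (expR (- (c * \sum_(a <- P) ln eps))); first exact: expR_ge0.
move=> v; rewrite mulrC -expRD ler_expR lerD2l lerN2; apply: ler_wpM2l.
  exact: ltW.
by apply: ler_sum => a _; rewrite ler_ln ?posrE ?reg_den_gt0// lerDr sqr_ge0.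
Qed.

Lemma reg_weight_bound F : poly_bounded F -> exists2 G, poly_bounded G &
  forall v, `|F v * w v| <= `|G v * expR (- (2^-1 * dot v v))|.
Proof.
move=> bF; have [C C0 hC] := reg_weight_le.
exists (fun v => F v * C); first exact: poly_boundedM (poly_bounded_cst C).
move=> v; rewrite -mulrA !normrM; apply: ler_wpM2l => //.
by rewrite -normrM !ger0_norm ?mulr_ge0 ?expR_ge0.
Qed.

Lemma reg_integrable F : row_measurable F -> poly_bounded F ->
  row_integrable (fun v => F v * w v).
Proof.
move=> mF bF; have [G bG hG] := reg_weight_bound bF.
apply: (tempered_integrable _ bG hG).
by apply: measurable_funM => //; exact: measurable_reg_weight.
Qed.

Lemma reg_weight_refl b v : b \in P -> w (v *m refl_mx b) = w v.
Proof.
move=> bP; have ob := orthogonal_refl b.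
rewrite /reg_weight dot_orthogonal//; congr (expR (_ - c * _)).
rewrite -[RHS](big_pm_stable (F := fun a => ln (dot a v ^+ 2 + eps)) _ hsP ob (PW bP)).
  by apply: eq_bigr => a _; rewrite dot_mul refl_mxT.
by move=> a; rewrite dotNl sqrrN.
Qed.

Lemma reg_inv_refl a v : K a (v *m refl_mx a) = - K a v.
Proof.
rewrite /reg_inv; have -> : dot a (v *m refl_mx a) = - dot a v.
  by rewrite dotC dot_mul refl_mxT dotC mul_reflxx dotNl.
by rewrite sqrrN mulNr.
Qed.

Let is_derive_dot a v e (t : R) :
  is_derive t 1 (fun s : R => dot a (v + s *: e)) (dot a e).
Proof.
have [h _] := is_derive_line e v (linform a) t.
rewrite (_ : (fun s => _) = fun s : R => re_eval (linform a) (v + s *: e)).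
  apply: (is_derive_eq h); rewrite pderiv_linform re_evalZ/= re_eval1.
  by rewrite mulr1 mul0r subr0.
by apply/funext => s; rewrite /re_eval peval_linform.
Qed.

Let is_derive_log_sum (r : seq 'rV[R]_N) v e (t : R) :
  is_derive t 1 (fun s : R => \sum_(a <- r) ln (dot a (v + s *: e) ^+ 2 + eps))
    (\sum_(a <- r) 2 * dot a e * K a (v + t *: e)).
Proof.
elim: r => [|a r IH].
  by under eq_fun do rewrite big_nil; rewrite big_nil; exact: is_derive_cst.
under eq_fun do rewrite big_cons; rewrite big_cons; apply: is_deriveD.
have da := is_derive_dot a v e t.
have h : is_derive t (1 : R) (fun s : R => dot a (v + s *: e) ^+ 2 + eps)
    (2 * dot a e * dot a (v + t *: e)).
  have := is_deriveD (is_deriveM da da) (is_derive_cst eps t (1 : R)).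
  move=> h; apply: (is_derive_eq h); rewrite addr0 /GRing.scale /=; ring.
have := @is_derive1_comp _ (@ln R) (fun s : R => dot a (v + s *: e) ^+ 2 + eps)
  _ _ _ (is_derive1_ln (reg_den_gt0 a (v + t *: e))) h.
by move=> h2; apply: (is_derive_eq h2); rewrite /reg_inv; ring.
Qed.

Lemma is_derive_reg_weight v e (t : R) :
  is_derive t 1 (fun s : R => w (v + s *: e))
    ((- dot e (v + t *: e) - c * \sum_(a <- P) 2 * dot a e * K a (v + t *: e))
     * w (v + t *: e)).
Proof.
have dq : is_derive t (1 : R) (fun s : R => - (2^-1 * dot (v + s *: e) (v + s *: e)))
    (- dot e (v + t *: e)).
  rewrite (_ : (fun s => _) = fun s : R =>
    (- 2^-1) * dot (v + s *: e) v + (- 2^-1) * (s * dot e (v + s *: e))).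
    have d1 := is_deriveZ (- 2^-1) (is_derive_dot v v e t).
    have d2 := is_deriveM (is_derive_id t (1 : R)) (is_derive_dot e v e t).
    have h := is_deriveD d1 (is_deriveZ (- 2^-1) d2).
    rewrite (_ : (fun s => _) = - 2^-1 \*: (fun s : R => dot v (v + s *: e)) +
      - 2^-1 \*: (id * (fun s : R => dot e (v + s *: e)))).
      apply: (is_derive_eq h); rewrite /GRing.scale /= !(dotDr, dotZr) (dotC e v).
      by field.
    by apply/funext => s /=; rewrite dotC.
  by apply/funext => s; rewrite !(dotDl, dotDr, dotZl, dotZr) (dotC e v); ring.
have ds := is_deriveZ (- c) (is_derive_log_sum P v e t).
pose L (s : R) : R := - (2^-1 * dot (v + s *: e) (v + s *: e)) -
  c * \sum_(a <- P) ln (dot a (v + s *: e) ^+ 2 + eps).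
set dl := (X in _ X (w _)).
have dL : is_derive t (1 : R) L dl.
  rewrite (_ : L = (fun s : R => - (2^-1 * dot (v + s *: e) (v + s *: e))) + - c \*:
     (fun s : R => \sum_(a <- P) ln (dot a (v + s *: e) ^+ 2 + eps))).
    by apply: (is_derive_eq (is_deriveD dq ds)); rewrite /dl /GRing.scale /= mulNr.
  by apply/funext => s; rewrite /L -[X in _ + X]mulNr.
by apply: (is_derive_eq (is_derive1_comp (is_derive_expR (L t)) dL)); rewrite mulrC.
Qed.

Lemma reg_ibp xi f : row_int (fun v =>
  (re_eval (pderiv xi f) v - dot xi v * re_eval f v -
   \sum_(a <- P) 2 * c * dot a xi * (K a v * re_eval f v)) * w v) = 0.
Proof.
pose H v := re_eval (pderiv xi f) v - dot xi v * re_eval f v -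
   \sum_(a <- P) 2 * c * dot a xi * (K a v * re_eval f v).
have mH : row_measurable H.
  apply: measurable_funB; first apply: measurable_funB.
  - exact: measurable_re_eval.
  - by apply: measurable_funM; [exact: measurable_dot|exact: measurable_re_eval].
  apply: measurable_sum => a; apply: measurable_funM => //.
  by apply: measurable_funM; [exact: measurable_reg_inv|exact: measurable_re_eval].
have bH : poly_bounded H.
  apply: poly_boundedD; first apply: poly_boundedD.
  - exact: poly_bounded_re_eval.
  - apply/poly_boundedN/poly_boundedM; [exact: poly_bounded_dot|].
    exact: poly_bounded_re_eval.
  apply/poly_boundedN/poly_bounded_sum => a.
  apply: poly_boundedM; first exact: poly_bounded_cst.
  by apply: poly_boundedM; [exact: poly_bounded_reg_inv|exact: poly_bounded_re_eval].
have [G bG hG] := reg_weight_bound (poly_bounded_re_eval f).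
have [dG bdG hdG] := reg_weight_bound bH.
apply: (row_int_derive (e := xi) (F := fun v => re_eval f v * w v)
  (dF := fun v => H v * w v) _ _ bG bdG hG hdG).
- by apply: measurable_funM; [exact: measurable_re_eval|exact: measurable_reg_weight].
- by apply: measurable_funM => //; exact: measurable_reg_weight.
move=> v t; have [h _] := is_derive_line xi v f t.
apply: (is_derive_eq (is_deriveM h (is_derive_reg_weight v xi t))).
rewrite /H /GRing.scale /=.
have -> : \sum_(a <- P) 2 * c * dot a xi * (K a (v + t *: xi) * re_eval f (v + t *: xi))
   = c * (\sum_(a <- P) 2 * dot a xi * K a (v + t *: xi)) * re_eval f (v + t *: xi).
  by rewrite mulr_sumr mulr_suml; apply: eq_bigr => a _; ring.
ring.
Qed.

(** The integrand is odd under s_a, which preserves Lebesgue measure. *)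
Lemma reg_odd a g : a \in P -> act (refl_mx a) g = g ->
  row_integrable (fun v => K a v * re_eval g v * w v) /\
  row_int (fun v => K a v * re_eval g v * w v) = 0.
Proof.
move=> aP ag; set F := fun v => _.
have iF : row_integrable F.
  apply: reg_integrable.
    by apply: measurable_funM; [exact: measurable_reg_inv|exact: measurable_re_eval].
  by apply: poly_boundedM; [exact: poly_bounded_reg_inv|exact: poly_bounded_re_eval].
suff e : row_int F = - row_int F by split => //; lra.
have pr := preserves_refl a.
rewrite -[LHS](preserves_row_int pr (row_integrable_measurable iF)).
rewrite -mulN1r -row_intZ//; congr row_int; apply/funext => v /=.
have ev : re_eval g (v *m refl_mx a) = re_eval g v.
  by rewrite -{2}ag re_eval_act ?refl_mxT//; exact: orthogonal_refl.
by rewrite /F reg_weight_refl// reg_inv_refl ev; ring.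
Qed.

(** With K_a for [reg_inv], adding the odd terms K_a (s_a f g + f s_a g) to [reg_ibp] replaces 2 K_a
    f g by K_a (2 f g - s_a f g - f s_a g). The last bracket is (a, x) times a combination of
    divided differences, and (a, x) K_a lies between 0 and 1 whatever eps is. *)
Lemma reg_dunkl_ibp xi f g : row_int (fun v =>
  (re_eval (pderiv xi (f * g) - linform xi * (f * g)) v -
   \sum_(a <- P) c * dot a xi * (dot a v * K a v *
     re_eval (ddiff a f * g + f * ddiff a g) v)) * w v) = 0.
Proof.
pose A v := (re_eval (pderiv xi (f * g)) v - dot xi v * re_eval (f * g) v -
   \sum_(a <- P) 2 * c * dot a xi * (K a v * re_eval (f * g) v)) * w v.
pose s a h := act (refl_mx a) h : poly.
pose B a v := c * dot a xi * (K a v * re_eval (s a f * g + f * s a g) v * w v).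
have [iB B0] : row_integrable (fun v => \sum_(a <- P) B a v) /\
    row_int (fun v => \sum_(a <- P) B a v) = 0.
  apply: row_int_sum0 => a aP.
  have [|iC C0] := @reg_odd a (s a f * g + f * s a g) aP.
    by rewrite actD !actM /s !act_reflK addrC [act _ f * g]mulrC [f * _]mulrC mulrC
       [X in _ + X]mulrC.
  split; first exact: row_integrableZ.
  by rewrite row_intZ// C0 mulr0.
have A0 : row_int A = 0 := reg_ibp xi (f * g).
have iA : row_integrable A.
  apply: reg_integrable.
    apply: measurable_funB; first apply: measurable_funB.
    - exact: measurable_re_eval.
    - by apply: measurable_funM; [exact: measurable_dot|exact: measurable_re_eval].
    apply: measurable_sum => a; apply: measurable_funM => //.
    by apply: measurable_funM; [exact: measurable_reg_inv|exact: measurable_re_eval].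
  apply: poly_boundedD; first apply: poly_boundedD.
  - exact: poly_bounded_re_eval.
  - apply/poly_boundedN/poly_boundedM; [exact: poly_bounded_dot|].
    exact: poly_bounded_re_eval.
  apply/poly_boundedN/poly_bounded_sum => a.
  apply: poly_boundedM; first exact: poly_bounded_cst.
  by apply: poly_boundedM; [exact: poly_bounded_reg_inv|exact: poly_bounded_re_eval].
transitivity (row_int (fun v => A v + \sum_(a <- P) B a v)); last first.
  by rewrite row_intD// A0 B0 addr0.
congr row_int; apply/funext => v.
rewrite /A /B re_evalD re_evalN re_evalM_linform.
rewrite [X in _ = _ + X](_ : _ = (\sum_(a <- P) c * dot a xi *
   (K a v * re_eval (s a f * g + f * s a g) v)) * w v); last first.
  by rewrite mulr_suml; apply: eq_bigr => a _; rewrite !mulrA.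
rewrite -mulrDl; congr (_ * _).
rewrite -[RHS]addrA; congr (_ + _).
rewrite addrC; apply: oppr_inj; rewrite opprK opprB -sumrB.
apply: eq_big_seq => a aP.
have [a0 _] := hsP.2 a aP.
rewrite -[dot a v * K a v]mulrC -[K a v * _ * _]mulrA -re_evalM_linform.
have -> : linform a * (ddiff a f * g + f * ddiff a g) =
    2 *: (f * g) - (s a f * g + f * s a g).
  rewrite mulrDr mulrA mulrCA !ddiffEx// scaler_nat /s; ring.
rewrite re_evalD re_evalN re_evalZ /=; ring.
Qed.

End Eps.
End RegularizedWeight.

(** * Removing the regularization *)

Section SingularIntegrationByParts.
Context {R : realType} {N : nat}.
Local Notation T := (measurableTypeR R).
Local Notation LN := (@Defs.lebesgue_measureN R).
Local Notation poly := (mpoly N R[i]).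
Implicit Types (a b e u v xi : 'rV[R]_N) (f g : poly) (F G : 'rV[R]_N -> R).
Variables (P : seq 'rV[R]_N) (c : R).
Hypothesis c0 : 0 < c.
Hypothesis hsP : half_system P.
Hypothesis PW : {in P, forall a, pm_stable P (refl_mx a)}.
Hypothesis weight_integrable : forall f, mord 3 f ->
  row_integrable (fun v => re_eval f v * weight P c v).

Let h n : R := n.+1%:R^-1.

Let h0 n : 0 < h n. Proof. by rewrite invr_gt0 ltr0n. Qed.

Let cvgh : h @ \oo --> (0 : R).
Proof. exact: cvg_harmonic. Qed.

Lemma weight_expE v : (forall a, a \in P -> dot a v != 0) ->
  weight P c v = expR (- (2^-1 * dot v v) - c * \sum_(a <- P) ln (dot a v ^+ 2)).
Proof.
move=> v0; rewrite /weight prod_powR_expR// -expRD; congr (expR (_ + _)).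
rewrite mulr_sumr -sumrN; apply: eq_big_seq => a /v0 av.
rewrite -(real_normK (num_real (dot a v))) lnXn ?normr_gt0// mulr2n; ring.
Qed.

Lemma cvg_sum_seq (I : eqType) (r : seq I) (F : I -> nat -> R) (l : I -> R) :
  (forall i, i \in r -> F i @ \oo --> l i) ->
  (fun n => \sum_(i <- r) F i n) @ \oo --> \sum_(i <- r) l i.
Proof.
elim: r => [_|i r IH hF].
  by under eq_fun do rewrite big_nil; rewrite big_nil; exact: cvg_cst.
under eq_fun do rewrite big_cons; rewrite big_cons; apply: cvgD.
  by apply: hF; rewrite mem_head.
by apply: IH => j jr; apply: hF; rewrite inE jr orbT.
Qed.

Lemma reg_weight_cvg v : (forall a, a \in P -> dot a v != 0) ->
  (fun n => reg_weight P c (h n) v) @ \oo --> weight P c v.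
Proof.
move=> v0; rewrite weight_expE//.
apply: continuous_cvg; first exact: continuous_expR.
apply: cvgB; first exact: cvg_cst.
apply: cvgM; first exact: cvg_cst.
apply: cvg_sum_seq => a /v0 av.
apply: continuous_cvg; first by apply: continuous_ln; rewrite exprn_even_gt0.
by rewrite -[X in _ --> X]addr0; apply: cvgD => //; exact: cvg_cst.
Qed.

Lemma reg_weight_weight n v : (forall a, a \in P -> dot a v != 0) ->
  reg_weight P c (h n) v <= weight P c v.
Proof.
move=> v0; rewrite weight_expE// ler_expR lerD2l lerN2; apply: ler_wpM2l; first exact: ltW.
rewrite big_seq [X in _ <= X]big_seq; apply: ler_sum => a /v0 av.
have a2 : 0 < dot a v ^+ 2 by rewrite exprn_even_gt0.
have hn := h0 n; by rewrite ler_ln ?posrE ?addr_gt0// lerDl ltW.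
Qed.

(** The limit of [reg_dunkl_ibp] as eps tends to 0. Off the walls the integrands converge, and they
    are dominated by absolute values of polynomials of order 3 times the singular weight: f g has
    order 4, and one derivative or divided difference is taken. *)
Lemma dunkl_ibp xi f g : mord 2 f -> mord 2 g ->
  row_int (fun v => re_eval (dk P c xi f * g + f * dk P c xi g
                             - linform xi * (f * g)) v * weight P c v) = 0.
Proof.
move=> mf mg; pose p0 := pderiv xi (f * g) - linform xi * (f * g) : poly.
pose q a := ddiff a f * g + f * ddiff a g : poly.
pose k a := c * dot a xi.
have aP0 a : a \in P -> a != 0 by move=> /hsP.2[].
have mp0 : mord 3 p0.
  apply: mordD; first exact/mord_pderiv/(@mordM _ _ 2 2).
  apply/mordN/(@mordW _ _ _ 5)/(@mordM _ _ 1 4) => //.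
    exact/homog_mord/homog_linform.
  exact: (@mordM _ _ 2 2).
have mq a : a \in P -> mord 3 (q a).
  move=> /aP0 a0; apply: mordD.
    by apply: (@mordM _ _ 1 2) => //; exact: mord_ddiff.
  by apply: (@mordM _ _ 2 1) => //; exact: mord_ddiff.
have E : dk P c xi f * g + f * dk P c xi g - linform xi * (f * g) =
    p0 - \sum_(a <- P) (k a)%:C%C *: q a.
  rewrite !dkE mulrBl mulrBr mulr_suml mulr_sumr /p0 pderivM.
  under [\sum_(i <- P) _ *: q i]eq_bigr => a _ do
    rewrite /q scalerDr scalerAl scalerAr.
  rewrite big_split /=; ring.
pose A n v := (re_eval p0 v - \sum_(a <- P) k a * (dot a v * reg_inv (h n) a v *
   re_eval (q a) v)) * reg_weight P c (h n) v.
have A0 n : row_int (A n) = 0 := reg_dunkl_ibp c0 hsP PW (h0 n) xi f g.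
have mA n : row_measurable (A n).
  apply: measurable_funM; last exact: measurable_reg_weight.
  apply: measurable_funB; first exact: measurable_re_eval.
  apply: measurable_sum => a; apply: measurable_funM => //.
  apply: measurable_funM; last exact: measurable_re_eval.
  by apply: measurable_funM; [exact: measurable_dot|exact: measurable_reg_inv].
have habs f' : mord 3 f' -> row_integrable (fun v => `|re_eval f' v| * weight P c v).
  move=> /weight_integrable /integrable_abse.
  apply: eq_integrable => // x _ /=; congr EFin.
  by rewrite normrM (ger0_norm (weight_ge0 _ _ _)).
pose G v := `|re_eval p0 v| * weight P c v +
   \sum_(a <- P) `|k a| * (`|re_eval (q a) v| * weight P c v).
have iG : row_integrable G.
  apply: row_integrableD; first exact: habs.
  suff hr (r : seq 'rV[R]_N) : {subset r <= P} ->
      row_integrable (fun v => \sum_(a <- r) `|k a| * (`|re_eval (q a) v| * weight P c v)).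
    exact: hr.
  elim: r => [_|a r IH rP].
    under eq_fun do rewrite big_nil.
    by apply: (eq_integrable measurableT (cst 0%E)) => //; exact: integrable0.
  under eq_fun do rewrite big_cons; apply: row_integrableD.
    by apply/row_integrableZ/habs/mq/rP/mem_head.
  by apply: IH => b br; apply: rP; rewrite inE br orbT.
have mT : row_measurable (fun v => re_eval (p0 - \sum_(a <- P) (k a)%:C%C *: q a) v * weight P c v).
  by apply: measurable_funM; [exact: measurable_re_eval|exact: measurable_weight].
have rE v : re_eval (p0 - \sum_(a <- P) (k a)%:C%C *: q a) v =
    re_eval p0 v - \sum_(a <- P) k a * re_eval (q a) v.
  rewrite re_evalD re_evalN re_eval_sum; congr (_ - _).
  by apply: eq_bigr => a _; rewrite re_evalZ /= mul0r subr0.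
have kap1 n a v : dot a v * reg_inv (h n) a v = dot a v ^+ 2 / (dot a v ^+ 2 + h n).
  by rewrite /reg_inv mulrA.
rewrite E; have : row_int (A n) @[n --> \oo] -->
    row_int (fun v => re_eval (p0 - \sum_(a <- P) (k a)%:C%C *: q a) v * weight P c v).
  apply: (row_int_lim mA mT iG).
    move: (row_ae_neq0 aP0); rewrite /row_ae; apply: filterS => x v0.
    set v := row_of_tuple x in v0 *; rewrite rE; apply: cvgM; last exact: reg_weight_cvg.
    apply: cvgB; first exact: cvg_cst.
    apply: cvg_sum_seq => a aP; apply: cvgM; first exact: cvg_cst.
    rewrite -[X in _ --> X]mul1r; apply: cvgM; last exact: cvg_cst.
    rewrite (_ : (fun n => _) = fun n => dot a v ^+ 2 / (dot a v ^+ 2 + h n)); last first.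
      by apply/funext => n; exact: kap1.
    have av : dot a v ^+ 2 != 0 by rewrite expf_neq0// v0.
    rewrite -[X in _ --> X](divff av); apply: cvgM; first exact: cvg_cst.
    apply: cvgV => //; rewrite -[X in _ --> X]addr0.
    by apply: cvgD => //; exact: cvg_cst.
  move: (row_ae_neq0 aP0); rewrite /row_ae; apply: filterS => x v0 n.
  set v := row_of_tuple x in v0 *.
  have w0 : 0 <= weight P c v := weight_ge0 _ _ _.
  rewrite /A normrM [X in _ * X]ger0_norm ?expR_ge0// /G.
  rewrite [X in _ <= _ + X](eq_bigr (fun a => `|k a| * `|re_eval (q a) v| * weight P c v)); last first.
    by move=> a _; rewrite mulrA.
  rewrite -mulr_suml -mulrDl; apply: ler_pM => //; rewrite ?expR_ge0//; last exact: reg_weight_weight.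
  apply: (le_trans (ler_normB _ _)); rewrite lerD2l.
  apply: (le_trans (ler_norm_sum _ _ _)); apply: ler_sum => a _.
  rewrite normrM; apply: ler_wpM2l => //; rewrite normrM.
  rewrite ler_piMl// kap1 ger0_norm; last by rewrite divr_ge0 ?addr_ge0 ?sqr_ge0 ?(ltW (h0 n)).
  have d0 : 0 < dot a v ^+ 2 + h n by rewrite ltr_wpDl// sqr_ge0.
  by rewrite ler_pdivrMr// mul1r lerDl (ltW (h0 n)).
under eq_cvg do rewrite A0.
by move=> hc; apply/esym; apply: (cvg_unique _ (cvg_cst 0) hc).
Qed.

End SingularIntegrationByParts.

(** * Polynomials vanishing almost everywhere *)

Section AlmostEverywhereZero.
Context {R : realType} {N : nat}.
Local Notation T := (measurableTypeR R).
Local Notation LN := (@Defs.lebesgue_measureN R).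
Local Notation poly := (mpoly N R[i]).
Implicit Types (e v : 'rV[R]_N) (f g : poly).

Lemma row_ae_shift (Q : 'rV[R]_N -> Prop) e : row_ae Q -> row_ae (fun v => Q (v + e)).
Proof.
move=> [A [mA A0 hA]].
pose t := tuple_of_row e; pose B := (fun x => addt x t) @^-1` A.
have mB : measurable B by rewrite -[B]setTI; exact: measurable_addt.
exists B; split => //.
  rewrite -[X in LN N X]setIT -(integral_indic (LN N) measurableT mB) -[RHS]A0.
  rewrite -[X in _ = LN N X]setIT -(integral_indic (LN N) measurableT mA).
  rewrite -[RHS](integral_lebesgue_addt t (f := fun x => (\1_A x)%:E))//.
  exact/measurable_EFinP.
move=> x /= nQ; apply: hA => /= q; apply: nQ.
rewrite (_ : row_of_tuple x + e = row_of_tuple (addt x t))//.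
by apply/rowP => i; rewrite !mxE !tnth_mktuple.
Qed.

Lemma row_ae_nonvoid : ~ row_ae (fun _ : 'rV[R]_N => False).
Proof.
move=> h; have := @integral_unit_box R N.
rewrite (@ae_eq_integral _ _ _ (LN N) setT (cst 0%E))//.
- by rewrite integral0 => /esym/eqP; rewrite onee_eq0.
- by apply/measurable_EFinP; exact: measurable_unit_box.
- by move: h; rewrite /row_ae; apply: filterS.
Qed.

(** For almost every v the polynomial vanishes at v and at all v + e / (n + 1), by translation
    invariance; the difference quotients, and hence their limit, are then 0. *)
Lemma row_ae_pderiv e f : row_ae (fun v => peval f v = 0) ->
  row_ae (fun v => peval (pderiv e f) v = 0).
Proof.
move=> f0; pose h n : R := n.+1%:R^-1.
have h1 : row_ae (fun v => forall n, peval f (v + h n *: e) = 0).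
  apply: (ae_foralln (P := fun n (x : N.-tuple T) =>
    peval f (row_of_tuple x + h n *: e) = 0)) => n.
  exact: (row_ae_shift (Q := fun v => peval f v = 0)).
have : row_ae (fun v => peval f v = 0 /\ forall n, peval f (v + h n *: e) = 0).
  by move: f0 h1; rewrite /row_ae; apply: filterS2.
rewrite /row_ae; apply: filterS => x; set v := row_of_tuple x => -[v0 vn].
have key (F : R -> R) (l : R) : is_derive (0 : R) (1 : R) F l -> F 0 = 0 ->
    (forall n, F (h n) = 0) -> l = 0.
  move=> [dF DF] F0 Fn.
  have /cvgr_dnbhsP cf : r^-1 *: ((F \o shift 0) (r *: (1 : R)) - F 0) @[r --> (0 : R)^'] --> l.
    by rewrite -DF; exact: dF.
  have hh : (fun n : nat => (h n)^-1 *: (F (h n *: (1 : R) + 0) - F 0)) @ \oo --> l.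
    apply: cf; split; first by move=> n; rewrite invr_eq0 pnatr_eq0.
    exact: cvg_harmonic.
  apply/esym; apply: (cvg_unique _ _ hh) => //.
  rewrite (_ : (fun n => _) = cst 0); first exact: cvg_cst.
  by apply/funext => n; rewrite addr0 F0 subr0 [_ *: 1]mulr1 Fn [_ *: 0]mulr0.
have [dr di] := is_derive_line e v f 0; move: dr di.
rewrite scale0r addr0 => dr di.
have := key _ _ dr _ _; rewrite scale0r addr0 /re_eval v0 => hr.
have := key _ _ di _ _; rewrite scale0r addr0 /im_eval v0 => hi.
have {}hr : re_eval (pderiv e f) v = 0 by apply: hr => // n; rewrite vn.
have {}hi : im_eval (pderiv e f) v = 0 by apply: hi => // n; rewrite vn.
by move: hr hi; rewrite /re_eval /im_eval; case: (peval _ _) => x1 x2 /= -> ->.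
Qed.

(** Induction on the degree: the partial derivatives are 0, so f is a constant, and a nonzero
    constant would make the whole space a null set. *)
Lemma row_ae_poly_eq0 f : row_ae (fun v => peval f v = 0) -> f = 0.
Proof.
have : mdeglt (msize f) f := @mdeglt_msize R N f.
move: (msize f) => k; elim: k f => [f hf _|k IH f hf f0].
  by apply/mpolyP => m; rewrite mcoeff0 hf.
have df i : mderiv i f = 0.
  rewrite -pderiv_delta; apply: IH; last exact: row_ae_pderiv.
  (* With no roots the Dunkl operator is the plain derivative, which supplies the degree bound. *)
  have hs : @half_system R N [::] by split.
  have := @mdeglt_dk R N [::] 0 hs k (delta_mx 0 i) f hf.
  by rewrite dkE big_nil subr0.
have fE : f = mcoeff mnm0 f *: 1.
  apply/mpolyP => m; rewrite mcoeffZ mcoeff1.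
  have [->|m0] := eqVneq m mnm0; first by rewrite mulr1.
  rewrite mulr0.
  have [i mi] : exists i, (0 < m i)%N.
    have [/existsP//|] := boolP [exists i, (0 < m i)%N].
    rewrite negb_exists => /forallP h; case/eqP: m0; apply/mnmP => i.
    by rewrite mnm0E; apply/eqP; have := h i; rewrite lt0n negbK.
  have le := lep1mP i m; rewrite -lt0n mi in le.
  have := mcoeff_deriv i (mnm_sub m (mnm1 i)) f; rewrite df mcoeff0 submK//.
  by move/esym/eqP; rewrite mulrn_eq0 => /eqP.
move: f0; rewrite fE => f0.
have [->|z0] := eqVneq (mcoeff mnm0 f) 0; first by rewrite scale0r.
case: (@row_ae_nonvoid); move: f0; rewrite /row_ae; apply: filterS => x.
by rewrite /peval mevalZ meval1 mulr1 => /eqP; rewrite (negbTE z0).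
Qed.

End AlmostEverywhereZero.

(** * The contravariant form *)

Section UnitaryForm.
Context {R : realType} {N : nat}.
Local Notation T := (measurableTypeR R).
Local Notation LN := (@Defs.lebesgue_measureN R).
Local Notation poly := (mpoly N R[i]).
Implicit Types (a b e u v xi : 'rV[R]_N) (f g : poly) (z : R[i]).

Lemma conjcD (z1 z2 : R[i]) : (z1 + z2)^* = z1^* + z2^*.
Proof. exact: rmorphD. Qed.

Lemma conjcM (z1 z2 : R[i]) : (z1 * z2)^* = z1^* * z2^*.
Proof. exact: rmorphM. Qed.

(** Conjugates the coefficients. At real points this conjugates the values, so Hermitian products
    become integrals of polynomials. *)
Fact conj_poly_key : {A : poly -> poly | A = map_mpoly (@Num.conj R[i])}.
Proof. by exists (map_mpoly (@Num.conj R[i])). Qed.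

Definition conj_poly := sval conj_poly_key.

Lemma conj_polyE : conj_poly = map_mpoly (@Num.conj R[i]).
Proof. exact: svalP conj_poly_key. Qed.

Lemma mcoeff_conj m f : mcoeff m (conj_poly f) = (mcoeff m f)^*.
Proof. by rewrite conj_polyE mcoeff_map_mpoly. Qed.

Lemma conj_polyD f g : conj_poly (f + g) = conj_poly f + conj_poly g.
Proof. rewrite conj_polyE; exact: rmorphD. Qed.

Lemma conj_polyM f g : conj_poly (f * g) = conj_poly f * conj_poly g.
Proof. rewrite conj_polyE; exact: rmorphM. Qed.

Lemma conj_poly1 : conj_poly 1 = 1.
Proof. rewrite conj_polyE; exact: rmorph1. Qed.

Lemma conj_polyB f g : conj_poly (f - g) = conj_poly f - conj_poly g.
Proof. rewrite conj_polyE; exact: rmorphB. Qed.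

Lemma conj_polyZ z f : conj_poly (z *: f) = z^* *: conj_poly f.
Proof. by apply/mpolyP => m; rewrite mcoeff_conj !mcoeffZ mcoeff_conj conjcM. Qed.

Lemma conj_polyK f : conj_poly (conj_poly f) = f.
Proof. by apply/mpolyP => m; rewrite !mcoeff_conj conjCK. Qed.

Lemma conj_poly_sum (I : Type) (r : seq I) (Q : pred I) (F : I -> poly) :
  conj_poly (\sum_(i <- r | Q i) F i) = \sum_(i <- r | Q i) conj_poly (F i).
Proof. rewrite conj_polyE; exact: rmorph_sum. Qed.

Lemma conj_real (x : R) : (x%:C%C : R[i])^* = x%:C%C.
Proof. by apply: conj_Creal; rewrite complex_real. Qed.

Lemma conj_poly_var i : conj_poly (polyvar i) = polyvar i.
Proof.
apply/mpolyP => m; rewrite mcoeff_conj /polyvar mcoeffX.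
by case: eqP => _; rewrite ?rmorph1 ?rmorph0.
Qed.

Lemma conj_poly_linform a : conj_poly (linform a) = linform a.
Proof.
rewrite linformE conj_poly_sum; apply: eq_bigr => i _.
by rewrite conj_polyZ conj_real conj_poly_var.
Qed.

Lemma conj_poly_act w f : orthogonal_mx w -> conj_poly (act w f) = act w (conj_poly f).
Proof.
move=> ow; elim/(@poly_ind_vars R N) : f => [|z f IH|f g IHf IHg|i f IH].
- by rewrite act_1 conj_poly1 act_1.
- by rewrite actZ !conj_polyZ actZ IH.
- by rewrite actD !conj_polyD actD IHf IHg.
rewrite actM !conj_polyM actM IH conj_poly_var; congr (_ * _).
by rewrite -linform_delta act_linform_orth// conj_poly_linform.
Qed.

Lemma conj_poly_pderiv xi f : conj_poly (pderiv xi f) = pderiv xi (conj_poly f).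
Proof.
elim/(@poly_ind_vars R N) : f => [|z f IH|f g IHf IHg|i f IH].
- by rewrite conj_poly1 !pderiv1 -[in LHS](scale0r 1) conj_polyZ rmorph0 scale0r.
- by rewrite pderivZ !conj_polyZ pderivZ IH.
- by rewrite pderivD !conj_polyD pderivD IHf IHg.
rewrite pderivM conj_polyD !conj_polyM pderivM IH conj_poly_var pderiv_var.
by rewrite conj_polyZ conj_real conj_poly1.
Qed.

Lemma conj_poly_ddiff a f : a != 0 -> conj_poly (ddiff a f) = ddiff a (conj_poly f).
Proof.
move=> a0; apply/esym/ddiff_uniq => //.
rewrite -{1}conj_poly_linform -conj_polyM ddiffEx// conj_polyB conj_poly_act//.
exact: orthogonal_refl.
Qed.

Lemma pevalD f g v : peval (f + g) v = peval f v + peval g v.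
Proof. exact: mevalD. Qed.

Lemma peval_conj f v : peval (conj_poly f) v = (peval f v)^*.
Proof.
elim/(@poly_ind_vars R N) : f => [|z f IH|f g IHf IHg|i f IH].
- by rewrite conj_poly1 /peval meval1 rmorph1.
- by rewrite conj_polyZ /peval !mevalZ conjcM; move: IH; rewrite /peval => ->.
- by rewrite conj_polyD pevalD IHf IHg pevalD conjcD.
rewrite conj_polyM conj_poly_var -linform_delta /peval !mevalM conjcM.
move: IH; rewrite /peval => ->; congr (_ * _).
by rewrite -/(peval (linform _) v) peval_linform conj_real.
Qed.

Lemma mord_conj k f : mord k f -> mord k (conj_poly f).
Proof. by move=> h m mk; rewrite mcoeff_conj h// rmorph0. Qed.

Variables (Phi P : seq 'rV[R]_N) (c : R).
Hypotheses (rsPhi : root_system Phi) (psP : positive_system Phi P).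
Hypothesis c0 : 0 < c.
Hypothesis weight_integrable : forall f, mord 3 f ->
  row_integrable (fun v => re_eval f v * weight P c v).

Let hsP : half_system P := positive_half_system rsPhi psP.
Let PW := positive_refl_pm_stable rsPhi psP.
Local Notation w := (weight P c).
Local Notation dk := (dk P c).

Lemma conj_poly_dk xi f : conj_poly (dk xi f) = dk xi (conj_poly f).
Proof.
rewrite !dkE conj_polyB conj_poly_pderiv conj_poly_sum; congr (_ - _).
by apply: eq_big_seq => a /hsP.2[a0 _]; rewrite conj_polyZ conj_real conj_poly_ddiff.
Qed.

Fact re_int_key : {A : poly -> R | A = fun f => row_int (fun v => re_eval f v * w v)}.
Proof. by exists (fun f => row_int (fun v => re_eval f v * w v)). Qed.

Definition re_int := sval re_int_key.

Lemma re_intE f : re_int f = row_int (fun v => re_eval f v * w v).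
Proof. by rewrite /re_int (svalP re_int_key). Qed.

Definition minus_i : R[i] := Complex 0 (-1).

(* Im z = Re (- i z) *)
Definition gauss_int f : R[i] := (re_int f +i* re_int (minus_i *: f))%C.

Lemma re_intD f g : mord 3 f -> mord 3 g -> re_int (f + g) = re_int f + re_int g.
Proof.
move=> mf mg; rewrite !re_intE -row_intD; [|exact: weight_integrable..].
by congr row_int; apply/funext => v; rewrite re_evalD mulrDl.
Qed.

Lemma re_intZ (k : R) f : mord 3 f -> re_int (k%:C%C *: f) = k * re_int f.
Proof.
move=> mf; rewrite !re_intE -row_intZ; last exact: weight_integrable.
by congr row_int; apply/funext => v; rewrite re_evalZ /= mul0r subr0 mulrA.
Qed.

Lemma gauss_intD f g : mord 3 f -> mord 3 g ->
  gauss_int (f + g) = gauss_int f + gauss_int g.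
Proof.
by move=> mf mg; rewrite /gauss_int scalerDr !re_intD//; exact: mordZ.
Qed.

Lemma gauss_intZ z f : mord 3 f -> gauss_int (z *: f) = z * gauss_int f.
Proof.
move=> mf; have mif : mord 3 (minus_i *: f) by exact: mordZ.
have E : z *: f = (complex.Re z)%:C%C *: f + (- complex.Im z)%:C%C *: (minus_i *: f).
  rewrite scalerA -scalerDl; congr (_ *: _).
  by case: z => x y; rewrite /minus_i; simpc.
have E2 : minus_i *: (z *: f) = (complex.Im z)%:C%C *: f + (complex.Re z)%:C%C *: (minus_i *: f).
  rewrite !scalerA -scalerDl; congr (_ *: _).
  by case: z {E} => x y; rewrite /minus_i; simpc.
have e1 : re_int (z *: f) = complex.Re z * re_int f - complex.Im z * re_int (minus_i *: f).
  rewrite E re_intD; [|exact: mordZ|exact: mordZ].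
  by rewrite (re_intZ _ mf) (re_intZ _ mif) mulNr.
have e2 : re_int (minus_i *: (z *: f)) = complex.Im z * re_int f + complex.Re z * re_int (minus_i *: f).
  rewrite E2 re_intD; [|exact: mordZ|exact: mordZ].
  by rewrite (re_intZ _ mf) (re_intZ _ mif).
rewrite /gauss_int e1 e2; case: z {E E2 e1 e2} => x y /=; simpc => /=.
by rewrite [y * _ + _]addrC.
Qed.

Lemma gauss_int_refl a f : a \in P -> mord 3 f ->
  gauss_int (act (refl_mx a) f) = gauss_int f.
Proof.
move=> aP; have key g : mord 3 g -> re_int (act (refl_mx a) g) = re_int g.
  move=> mg; rewrite !re_intE -[RHS](preserves_row_int (preserves_refl a)).
    congr row_int; apply/funext => v /=.
    rewrite re_eval_act ?refl_mxT; last exact: orthogonal_refl.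
    congr (_ * _); have oa := orthogonal_refl a.
    have e : \prod_(b <- P) `|dot b (v *m refl_mx a)| `^ (- (2 * c)) =
        \prod_(b <- P) `|dot b v| `^ (- (2 * c)).
      rewrite -[RHS](big_pm_stable (F := fun b => `|dot b v| `^ (- (2 * c))) _ hsP oa (PW aP)).
        by apply: eq_bigr => b _; rewrite dot_mul refl_mxT.
      by move=> b; rewrite dotNl normrN.
    by rewrite /weight dot_orthogonal// e.
  by apply: row_integrable_measurable; exact: weight_integrable.
by move=> mf; rewrite /gauss_int -actZ !key//; exact: mordZ.
Qed.

Lemma gauss_int_act x f : coxeter_group Phi x -> mord 3 f ->
  gauss_int (act x f) = gauss_int f.
Proof.
move=> Wx mf; elim: Wx => [|x' a Wx' IH aPhi]; first by rewrite act1.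
have ox' := coxeter_orthogonal Wx'.
rewrite act_mul; [|exact: ox'|exact: orthogonal_refl].
have [aP|naP] := orP (positive_or_opp rsPhi psP aPhi).
  by rewrite gauss_int_refl; [exact: IH|exact: aP|exact: mord_act].
by rewrite -refl_mxN gauss_int_refl; [exact: IH|exact: naP|exact: mord_act].
Qed.

Lemma gauss_int_ibp xi f g : mord 2 f -> mord 2 g ->
  gauss_int (dk xi f * g + f * dk xi g - linform xi * (f * g)) = 0.
Proof.
move=> mf mg; rewrite /gauss_int.
have -> : minus_i *: (dk xi f * g + f * dk xi g - linform xi * (f * g)) =
    dk xi (minus_i *: f) * g + (minus_i *: f) * dk xi g - linform xi * ((minus_i *: f) * g).
  by rewrite dkZ// -!scalerAl -scalerAr -scalerDr -scalerBr.
have ibp f' : mord 2 f' ->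
    re_int (dk xi f' * g + f' * dk xi g - linform xi * (f' * g)) = 0.
  by move=> mf'; rewrite re_intE; exact: dunkl_ibp.
by rewrite (ibp f mf) (ibp (minus_i *: f) (mordZ minus_i mf)).
Qed.

Lemma gauss_int_conj f : mord 3 f -> gauss_int (conj_poly f) = (gauss_int f)^*.
Proof.
move=> mf; have E g : re_int (conj_poly g) = re_int g.
  rewrite !re_intE; congr row_int; apply/funext => v; congr (_ * _).
  by rewrite /re_eval peval_conj; case: (peval g v).
rewrite /gauss_int E.
have -> : minus_i *: conj_poly f = conj_poly ((- minus_i) *: f).
  by rewrite conj_polyZ; congr (_ *: _); rewrite /minus_i; simpc.
rewrite E; have -> : re_int (- minus_i *: f) = - re_int (minus_i *: f).
  have h := re_intZ (-1) (mordZ minus_i mf); rewrite mulN1r in h; rewrite -h.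
  congr re_int.
  by rewrite scalerA; congr (_ *: _); rewrite /minus_i; simpc.
by [].
Qed.

Lemma normc_re_eval f v :
  ComplexField.Normc.normc (peval f v) ^+ 2 = re_eval (f * conj_poly f) v.
Proof.
rewrite /re_eval [peval (f * _) v]/peval mevalM -!/(peval _ _) peval_conj.
case: (peval f v) => x y /=; rewrite sqr_sqrtr ?addr_ge0 ?sqr_ge0//.
by rewrite mulrN opprK !expr2.
Qed.

(** A zero integral would make |f|^2 times the weight vanish almost everywhere. Off the walls the
    weight is positive, so f itself would vanish almost everywhere. *)
Lemma gauss_int_gt0 f : mord 2 f -> f != 0 -> 0 < gauss_int (f * conj_poly f).
Proof.
move=> mf f0; have mff : mord 3 (f * conj_poly f).
  by apply: (@mordW _ _ _ 4) => //; apply: (@mordM _ _ 2 2) => //; exact: mord_conj.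
have iE v : re_eval (minus_i *: (f * conj_poly f)) v = 0.
  rewrite re_evalZ /im_eval/= [peval (f * _) v]/peval mevalM -!/(peval _ _) peval_conj.
  by case: (peval f v) => x y /=; ring.
have im0 : re_int (minus_i *: (f * conj_poly f)) = 0.
  rewrite !re_intE (_ : (fun v => _) = fun=> 0); first by rewrite /row_int integral0.
  by apply/funext => v; rewrite iE mul0r.
have pos v : 0 <= re_eval (f * conj_poly f) v * w v.
  by rewrite -normc_re_eval mulr_ge0 ?sqr_ge0 ?weight_ge0.
have iI := weight_integrable mff.
rewrite /gauss_int im0 ltcE /= eqxx /= re_intE.
rewrite /row_int fine_gt0//; apply/andP; split; last first.
  have /integrableP[_] := iI; apply: le_lt_trans; apply: ge0_le_integral => //.
  - by move=> x _; rewrite lee_fin.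
  - by apply/measurable_EFinP; exact: (row_integrable_measurable iI).
  - apply/measurable_EFinP; apply: (measurableT_comp (@normr_measurable R setT)).
    exact: (row_integrable_measurable iI).
  - by move=> x _; rewrite lee_fin ler_norm.
rewrite lt_neqAle integral_ge0 ?andbT; last by move=> x _; rewrite lee_fin.
apply/eqP => I0; have : row_ae (fun v => re_eval (f * conj_poly f) v * w v = 0).
  have : (\int[LN N]_x `|(re_eval (f * conj_poly f) (row_of_tuple x) * w (row_of_tuple x))%:E| = 0)%E.
    by rewrite [RHS]I0; apply: eq_integral => x _; rewrite gee0_abs// lee_fin.
  have mI : measurable_fun setT (fun x : N.-tuple T =>
      (re_eval (f * conj_poly f) (row_of_tuple x) * w (row_of_tuple x))%:E).
    by apply/measurable_EFinP; exact: (row_integrable_measurable iI).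
  move/(ae_eq_integral_abs (LN N) measurableT mI).
  rewrite /row_ae; apply: filterS => x /= h; have := h I => -[]//.
move=> ae0; have {}ae0 : row_ae (fun v => peval f v = 0).
  have hn := row_ae_neq0 (fun a aP => (hsP.2 a aP).1).
  move: ae0 hn; rewrite /row_ae; apply: filterS2 => x.
  set v := row_of_tuple x => /eqP; rewrite mulf_eq0 => /orP[|]; last first.
    move=> /eqP w0 v0; exfalso; move: w0; rewrite weight_expE// => /eqP.
    by rewrite gt_eqF// expR_gt0.
  rewrite -normc_re_eval sqrf_eq0 => /eqP/ComplexField.Normc.eq0_normc //.
by move: f0; rewrite (row_ae_poly_eq0 ae0) eqxx.
Qed.

Variable S : set poly.
Hypothesis sS : submodule Phi P c S.
Hypothesis mS : forall f, S f -> mord 2 f.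

Lemma submodule_gaussian_converges : gaussian_converges P c S.
Proof.
move=> f Sf; have mff : mord 3 (f * conj_poly f).
  apply: (@mordW _ _ _ 4) => //; apply: (@mordM _ _ 2 2); first exact: mS.
  exact/mord_conj/mS.
have /integrableP[_] := weight_integrable mff; apply: le_lt_trans.
rewrite le_eqVlt; apply/orP; left; apply/eqP; apply: eq_integral => x _.
rewrite -normc_re_eval gee0_abs; last by rewrite lee_fin mulr_ge0 ?weight_ge0 ?sqr_ge0.
have -> : peval f (row_of_tuple x) = meval (fun i => (tnth x i)%:C%C) f.
  by apply: meval_eq => i; rewrite mxE.
by rewrite /weight mulrA.
Qed.

Lemma submodule_unitary : unitary Phi P c S.
Proof.
pose T' := gauss_exp P c.
have ST f : S f -> S (T' f) by move=> Sf; exact: (submodule_gauss_exp sS).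
have mT f : S f -> mord 2 (T' f) by move=> /ST/mS.
have mB f g : S f -> S g -> mord 3 (T' f * conj_poly (T' g)).
  move=> Sf Sg; apply: (@mordW _ _ _ 4) => //; apply: (@mordM _ _ 2 2); first exact: mT.
  exact/mord_conj/mT.
pose B f g := gauss_int (T' f * conj_poly (T' g)).
have Bpos (u : poly) : S u -> u != 0 -> 0 < B u u.
  move=> Su u0; apply: gauss_int_gt0; first exact: mT.
  by apply: contra u0 => /eqP/gauss_exp_eq0->.
exists B; split; last first.
  by exists 1 => u Su u0; rewrite mul1r; exact: Bpos.
split.
- move=> z u v t Su Sv St; rewrite /B /T' gauss_expD// gauss_expZ// mulrDl -scalerAl.
  by rewrite gauss_intD ?gauss_intZ//; [exact: mB|apply: mordZ; exact: mB|exact: mB].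
- move=> u v Su Sv; by rewrite /B -(gauss_int_conj (mB _ _ Su Sv)) conj_polyM conj_polyK mulrC.
- move=> x u v Wx Su Sv; rewrite -actE /B /T'.
  have ox := coxeter_orthogonal Wx.
  have Px := coxeter_pm_stable rsPhi psP Wx.
  have eT f : gauss_exp P c (act x f) = act x (gauss_exp P c f) by rewrite act_gauss_exp.
  rewrite !eT.
  by rewrite (conj_poly_act _ ox) -actM (gauss_int_act Wx (mB _ _ Su Sv)).
- move=> i u v Su Sv; rewrite /dunkl_coord dunkl_dk /B /T' -linform_delta.
  rewrite (gauss_exp_linform _ hsP PW) (gauss_exp_dk _ hsP PW) conj_poly_dk.
  set f := gauss_exp P c u; set g := conj_poly _; set e := delta_mx 0 i.
  have mf : mord 2 f := mT _ Su.
  have mg : mord 2 g by apply/mord_conj/mT.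
  have h := gauss_int_ibp e mf mg.
  (* After conjugation x_e acts as x_e - y_e, and the two sides of the adjunction differ by the
     integrand of [gauss_int_ibp]. *)
  have -> : (linform e * f - dk e f) * g = f * dk e g +
      (- 1) *: (dk e f * g + f * dk e g - linform e * (f * g)).
    by rewrite scaleN1r mulrBl; ring.
  have m1 : mord 3 (f * dk e g) by apply: (@mordM _ _ 2 1) => //; exact: mord_dk.
  have m2 : mord 3 (dk e f * g + f * dk e g - linform e * (f * g)).
    apply: mordD; first apply: mordD => //.
      by apply: (@mordM _ _ 1 2) => //; exact: mord_dk.
    apply/mordN/(@mordW _ _ _ 5)/(@mordM _ _ 1 4) => //.
      exact/homog_mord/homog_linform.
    exact: (@mordM _ _ 2 2).
  by rewrite (gauss_intD m1 (mordZ _ m2)) (gauss_intZ _ m2) h mulr0 addr0.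
move=> u Su h; apply/eqP/negPn/negP => u0.
by have := Bpos u Su u0; rewrite h// ltxx.
Qed.

End UnitaryForm.

(** * Unitarity from the moments and the counts on flats *)

Section Unitarity.
Context {R : realType} {N : nat}.
Implicit Types (Phi P B : seq 'rV[R]_N) (x y z t : 'rV[R]_N).

Lemma unitary_of_designs Phi P (d : nat) (S : set (mpoly N R[i])) (h k4 : R) :
  root_system Phi -> positive_system Phi P -> (1 < N)%N -> (0 < d)%N ->
  (forall x y, \sum_(a <- P) 2 / dot a a * dot a x * dot a y = h * dot x y) ->
  (forall x y z t,
    \sum_(a <- P) (2 / dot a a) ^+ 2 * dot a x * dot a y * dot a z * dot a t =
    k4 * (dot x y * dot z t + dot x z * dot y t + dot x t * dot y z)) ->
  1 - d%:R^-1 * h + d%:R^-1 * k4 = 0 ->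
  (forall B, free B -> {subset B <= P} -> (size B < N)%N -> (0 < size B)%N ->
    (2 * count (mem <<B>>%VS) P < size B * d)%N) ->
  (2 * size P = (N + 2) * d)%N ->
  minimal_submodule Phi P d%:R^-1 S ->
  gaussian_converges P d%:R^-1 S /\ unitary Phi P d%:R^-1 S.
Proof.
move=> rs ps N1 d0 des2 des4 crit flat szP minS.
have c0 : 0 < d%:R^-1 :> R by rewrite invr_gt0 ltr0n.
have dR : 1 <= d%:R :> R by rewrite ler1n.
have NR : 2 <= N%:R :> R by rewrite ler_nat.
have N0 : (0 < N)%N by exact: ltnW.
have hs := positive_half_system rs ps.
(* The strict inequality on flats gives 2 count + 1 <= (size B) d. Dividing by d leaves a margin
   1/d, which covers (size B) / (d N) since B has at most N elements. *)
pose s : R := 1 - (d%:R * N%:R)^-1.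
have dN : 0 < (d%:R * N%:R : R) by apply: mulr_gt0; lra.
have s01 : 0 <= s < 1.
  rewrite /s subr_ge0 gtrBl invr_gt0 dN andbT invf_le1//.
  by rewrite -natrM ler1n muln_gt0 d0 N0.
have spanP : <<P>>%VS = fullv.
  apply/eqP; rewrite eqEsubv subvf /=; case: (rs) => _ <- _ _.
  apply/span_subvP => a aPhi; have [aP|naP] := orP (positive_or_opp rs ps aPhi).
    exact: memv_span.
  by rewrite -[a]opprK rpredN memv_span.
have flat' B : free B -> {subset B <= P} -> (size B < N)%N ->
    2 * d%:R^-1 * (count (mem <<B>>%VS) P)%:R <= s * (size B)%:R.
  move=> fB BP BN; have [sB|sB] := posnP (size B).
    rewrite sB mulr0 (_ : count _ _ = 0%N) ?mulr0//.
    apply/eqP; rewrite -leqn0 leqNgt -has_count; apply/hasPn => a aP /=.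
    by rewrite (size0nil sB) span_nil memv0 (hs.2 a aP).1.
  have := flat B fB BP BN sB; rewrite -(ler_nat R) -natr1 !natrM => h1.
  have h2 : (size B)%:R <= N%:R :> R by rewrite ler_nat ltnW.
  rewrite mulrC mulrA ler_pdivrMr ?ltr0n//.
  have -> : s * (size B)%:R * d%:R = (size B)%:R * d%:R - (size B)%:R / N%:R.
    by rewrite /s; field; rewrite !gt_eqF// ltr0n.
  have : (size B)%:R / N%:R <= 1 :> R by rewrite ler_pdivrMr ?ltr0n// mul1r.
  by move=> h3; move: h1; rewrite [_ * 2]mulrC; lra.
(* By the count of P, 2|P|/d = N + 2, and s N = N - 1/d; the difference is 2 + 1/d. *)
have theta03 : 0 <= 2 * d%:R^-1 * (size P)%:R - s * N%:R <= 3.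
  have e : 2 * (size P)%:R = (N%:R + 2) * d%:R :> R.
    by rewrite -natrM szP natrM natrD.
  have -> : 2 * d%:R^-1 * (size P)%:R - s * N%:R = 2 + d%:R^-1.
    rewrite mulrAC e /s; field; rewrite !gt_eqF// ltr0n //.
  have : d%:R^-1 <= 1 :> R by rewrite invf_le1 ?ltr0n.
  lra.
have winv f : mord 3 f -> row_integrable (fun v => re_eval f v * weight P d%:R^-1 v).
  move=> mf; apply: (integrable_weight c0 N0 hs.1 spanP flat' s01 theta03).
    exact: poly_growth_mord.
  exact: measurable_re_eval.
have [[sS _] _] := minS.
have mS f : S f -> mord 2 f.
  by move=> Sf; apply: (minimal_submodule_mord rs ps des2 des4 crit minS) Sf.
split.
  exact: (submodule_gaussian_converges winv mS).
exact: (submodule_unitary rs ps c0 winv sS mS).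
Qed.

End Unitarity.

(** * Simple systems *)

Section CoxeterGroup.
Context {R : realType} {N : nat}.
Implicit Types (Phi : seq 'rV[R]_N) (w : 'M[R]_N).

Lemma coxeter_group_mul Phi w1 w2 :
  coxeter_group Phi w1 -> coxeter_group Phi w2 -> coxeter_group Phi (w1 *m w2).
Proof.
move=> W1; elim=> [|w' a _ IH aPhi]; first by rewrite mulmx1.
by rewrite mulmxA; exact: coxeter_groupM.
Qed.

Lemma coxeter_group_trmx Phi w : coxeter_group Phi w -> coxeter_group Phi w^T.
Proof.
elim=> [|w' a _ IH aPhi]; first by rewrite trmx1; exact: coxeter_group1.
by rewrite trmx_mul refl_mxT; apply: coxeter_group_mul => //; exact: coxeter_refl.
Qed.

End CoxeterGroup.

Section SimpleSystems.
Context {R : realType} {N r : nat}.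
Implicit Types (a b u v : 'rV[R]_N) (w : 'M[R]_N).
Variables (Phi : seq 'rV[R]_N) (s : r.-tuple 'rV[R]_N).
Hypotheses (rsPhi : root_system Phi) (ssS : simple_system Phi s).

Lemma simple_root i : tnth s i \in Phi.
Proof. by case: ssS => h _ _; apply: h; exact: mem_tnth. Qed.

Lemma simple_basis : basis_of fullv s.
Proof. by case: ssS. Qed.

Lemma simple_free : free s.
Proof. exact: basis_free simple_basis. Qed.

Lemma simple_rank : r = N.
Proof. have /andP[/eqP sS /eqP fS] := simple_basis.
by rewrite -(size_tuple s) -fS sS dimvf /dim/= mul1n. Qed.

Lemma simple_coord v : v = \sum_i coord s i v *: tnth s i.
Proof.
rewrite {1}(coord_basis simple_basis (memvf v)); apply: eq_bigr => i _.
by rewrite (tnth_nth 0).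
Qed.

Lemma coord_simple i j : coord s i (tnth s j) = (i == j)%:R.
Proof. by rewrite (tnth_nth 0) coord_free ?simple_free// eq_sym. Qed.

Lemma coord_lin_sum (k : 'I_r -> R) i : coord s i (\sum_j k j *: tnth s j) = k i.
Proof.
rewrite linear_sum/= (bigD1 i)//= linearZ/= coord_simple eqxx mulr1 big1 ?addr0//.
by move=> j ji; rewrite linearZ/= coord_simple eq_sym (negbTE ji) mulr0.
Qed.

Definition simple_pos b := [forall i, 0 <= coord s i b].

Lemma simple_pos_or b : b \in Phi -> simple_pos b || simple_pos (- b).
Proof.
case: ssS => _ _ h /h[k [-> [k0|k0]]]; apply/orP; [left|right];
  apply/forallP => i; rewrite ?linearN/= coord_lin_sum ?oppr_ge0//.
Qed.

Lemma simple_posN b : b != 0 -> simple_pos b -> ~~ simple_pos (- b).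
Proof.
move=> b0 /forallP h; apply: contra b0 => /forallP h'.
rewrite [b]simple_coord big1// => i _.
have := h' i; rewrite linearN oppr_ge0 => le0; have := h i => ge0.
by rewrite (@le_anti _ R (coord s i b) 0) ?scale0r// le0 ge0.
Qed.

Lemma simple_pos_simple i : simple_pos (tnth s i).
Proof. by apply/forallP => j; rewrite coord_simple; case: eqP. Qed.

Lemma coord_refl i j b : coord s j (b *m refl_mx (tnth s i)) =
  coord s j b - 2 / dot (tnth s i) (tnth s i) * dot b (tnth s i) * (j == i)%:R.
Proof. by rewrite mul_refl linearB linearZ/= coord_simple. Qed.

Lemma simple_pos_dominates b j : b \in Phi -> 0 < coord s j b -> simple_pos b.
Proof.
move=> bPhi bj; have := simple_pos_or bPhi => /orP[//|/forallP/(_ j)].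
by rewrite linearN oppr_ge0 leNgt bj.
Qed.

(** The reflection changes only the i-th coordinate. Some other coordinate of b is positive, as b
    would otherwise be a multiple of the simple root, and one positive coordinate decides the sign
    of a root. *)
Lemma simple_pos_refl i b : b \in Phi -> simple_pos b -> b != tnth s i ->
  simple_pos (b *m refl_mx (tnth s i)).
Proof.
move=> bPhi /forallP pb bi.
have sbPhi : b *m refl_mx (tnth s i) \in Phi := root_refl rsPhi (simple_root i) bPhi.
have [/existsP[j /andP[ji bj]]|/existsPn h] :=
    boolP [exists j, (j != i) && (0 < coord s j b)].
  apply: (@simple_pos_dominates _ j) => //.
  by rewrite coord_refl (negbTE ji) mulr0 subr0.
exfalso; have bE : b = coord s i b *: tnth s i.
  rewrite {1}[b]simple_coord (bigD1 i)//= big1 ?addr0// => j ji.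
  have := h j; rewrite ji /= -leNgt => le0.
  by rewrite (@le_anti _ R (coord s j b) 0) ?scale0r// le0 pb.
have [_ _ _ red] := rsPhi; move: bPhi; rewrite bE red ?simple_root// => /orP[] /eqP k1.
  by move: bi; rewrite bE k1 scale1r eqxx.
by have := pb i; rewrite k1 oppr_ge0 lt_geF.
Qed.

(** The image of the j-th simple root under the i-th reflection is positive, and its i-th coordinate
    is a negative multiple of the scalar product. *)
Lemma simple_dot_le0 i j : i != j -> dot (tnth s i) (tnth s j) <= 0.
Proof.
move=> ij; have ji : tnth s j != tnth s i.
  apply: contra ij => /eqP e; have := coord_simple i j.
  by rewrite e coord_simple eqxx; case: eqP => // _ /eqP; rewrite oner_eq0.
have := simple_pos_refl (simple_root j) (simple_pos_simple j) ji => /forallP/(_ i).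
rewrite coord_refl coord_simple (negbTE ij) eqxx mulr1 sub0r oppr_ge0.
have n0 : 0 < dot (tnth s i) (tnth s i) by rewrite dot_gt0 (root_neq0 rsPhi)// simple_root.
by rewrite pmulr_rle0 1?dotC// divr_gt0.
Qed.

(* Reflecting in a simple root on which [u] is negative lowers the number of
   positive roots on which [u] is negative. *)
Lemma exists_dominant u :
  exists2 w, coxeter_group Phi w & forall i, 0 <= dot (tnth s i) (u *m w).
Proof.
pose A x := [seq b <- undup Phi | simple_pos b & dot b x < 0].
have [n] := ubnP (size (A u)); elim: n u => // n IH u; rewrite ltnS => un.
have [/existsP[i ui]|/existsPn h] := boolP [exists i, dot (tnth s i) u < 0]; last first.
  by exists 1%:M; [exact: coxeter_group1|move=> i; rewrite mulmx1 leNgt].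
pose f := refl_mx (tnth s i); have iPhi := simple_root i.
have fd b : dot b (u *m f) = dot (b *m f) u by rewrite dot_mul refl_mxT.
(* The root [tnth s i] lies in [A u] only, and the reflection maps [A (u *m f)] injectively into the
   rest of [A u]. *)
have lt : (size (A (u *m f)) < size (A u))%N.
  have iA : tnth s i \in A u.
    by rewrite mem_filter simple_pos_simple ui mem_undup simple_root.
  rewrite (perm_size (perm_to_rem iA)) /= ltnS -(size_map (fun b => b *m f)).
  have uA x : uniq (A x) by rewrite filter_uniq// undup_uniq.
  apply: uniq_leq_size.
    rewrite map_inj_uniq// => x y /(congr1 (mulmx^~ f)).
    by rewrite -!mulmxA refl_mxK !mulmx1.
  move=> _ /mapP[b + ->]; rewrite mem_filter fd mem_undup => /andP[/andP[pb bu] bPhi].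
  have bi : b != tnth s i.
    apply: contraTneq bu => ->; rewrite mul_reflxx dotNl -leNgt oppr_ge0; exact: ltW.
  rewrite mem_rem_uniq// inE mem_filter mem_undup root_refl// simple_pos_refl// bu !andbT /=.
  apply: contraTneq pb => /(congr1 (mulmx^~ f)); rewrite -mulmxA refl_mxK mulmx1 => ->.
  rewrite mul_reflxx simple_posN ?simple_pos_simple//; exact: root_neq0 iPhi.
have [w Ww hw] := IH _ (leq_trans lt un).
exists (f *m w); last by move=> j; rewrite mulmxA.
exact/coxeter_group_mul/Ww/coxeter_refl.
Qed.

End SimpleSystems.

Section SimpleConjugacy.
Context {R : realType} {N : nat}.
Implicit Types (a b u v : 'rV[R]_N) (w : 'M[R]_N).
Variables (Phi : seq 'rV[R]_N).
Hypothesis rsPhi : root_system Phi.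

Lemma exists_dual (s : N.-tuple 'rV[R]_N) (k : 'I_N -> R) : free s ->
  exists v, forall i, dot (tnth s i) v = k i.
Proof.
move=> fs; exists ((\row_i k i) *m invmx (frame_mx s)) => i.
by rewrite -mul_frame_mx mulmxKV ?frame_mx_unit// mxE.
Qed.

(** A vector v having product 1 with every element of s' is moved by w into the closed dominant
    chamber of s. The two notions of positivity then agree after applying w, and indecomposability
    forces each element of s' to land in s. *)
Lemma simple_conjugate (s s' : N.-tuple 'rV[R]_N) :
  simple_system Phi s -> simple_system Phi s' ->
  exists2 w, coxeter_group Phi w & perm_eq [seq a *m w | a <- s'] s.
Proof.
move=> ss ss'; have fs' := simple_free ss'.
have [v hv] := exists_dual (fun=> 1) fs'.
have [w Ww hw] := exists_dominant rsPhi ss v.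
have ow := coxeter_orthogonal Ww; exists w => //.
have dv a : dot (a *m w) (v *m w) = dot a v by rewrite dot_orthogonal.
have wTPhi a : a \in Phi -> a *m w^T \in Phi.
  by apply: coxeter_root; [exact: rsPhi|exact: coxeter_group_trmx].
have wK a : a *m w^T *m w = a by rewrite -mulmxA orthogonalT// mulmx1.
have Kw a : a *m w *m w^T = a by rewrite -mulmxA ow mulmx1.
have dvE b : dot b v = \sum_j coord s' j b.
  rewrite {1}(simple_coord ss' b) dot_suml; apply: eq_bigr => j _.
  by rewrite dotZl hv mulr1.
have pos_dot b : b \in Phi -> simple_pos s' b -> 0 < dot b v.
  move=> bPhi /forallP pb; rewrite dvE lt_neqAle sumr_ge0 ?andbT => [|j _]; last exact: pb.
  rewrite eq_sym psumr_eq0; last by move=> j _; exact: pb.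
  apply: contra (root_neq0 rsPhi bPhi) => /allP h.
  rewrite (simple_coord ss' b) big1// => j _.
  by have /eqP -> := h j (mem_index_enum j); rewrite scale0r.
have dot_pos b : b \in Phi -> 0 <= dot b v -> simple_pos s' b.
  move=> bPhi b0; have /orP[//|nb] := simple_pos_or ss' bPhi.
  by have := pos_dot _ (root_opp rsPhi bPhi) nb; rewrite dotNl oppr_gt0 ltNge b0.
have lpos i j : 0 <= coord s' j (tnth s i *m w^T).
  have h : 0 <= dot (tnth s i *m w^T) v by rewrite -dv wK.
  exact: (forallP (dot_pos _ (wTPhi _ (simple_root ss i)) h)).
have kpos i j : 0 <= coord s i (tnth s' j *m w).
  have jPhi : tnth s' j *m w \in Phi by apply: coxeter_root; rewrite ?simple_root.
  have /orP[/forallP//|/forallP nk] := simple_pos_or ss jPhi.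
  suff : dot (tnth s' j *m w) (v *m w) <= 0 by rewrite dv hv ler10.
  rewrite (simple_coord ss (tnth s' j *m w)) dot_suml sumr_le0// => k _.
  by rewrite dotZl mulr_le0_ge0//; have := nk k; rewrite linearN oppr_ge0.
have inS j : tnth s' j *m w \in s.
  have [i ki] : exists i, 0 < coord s i (tnth s' j *m w).
    have [/existsP//|] := boolP [exists i, 0 < coord s i (tnth s' j *m w)].
    rewrite negb_exists => /forallP h; exfalso.
    have : dot (tnth s' j *m w) (v *m w) = 0.
      rewrite (simple_coord ss (tnth s' j *m w)) dot_suml big1// => k _.
      rewrite (@le_anti _ R (coord s k (tnth s' j *m w)) 0) ?scale0r ?dot0l//.
      by rewrite kpos andbT leNgt h.
    by rewrite dv hv => /eqP; rewrite oner_eq0.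
  (* Expanding [tnth s' j *m w] in s, each coordinate of [tnth s' j] becomes a sum of nonnegative
     terms. Those with m different from j sum to 0, so [tnth s i *m w^T] is a multiple of
     [tnth s' j]. *)
  have lz m : m != j -> coord s' m (tnth s i *m w^T) = 0.
    move=> mj; have := coord_simple ss' m j; rewrite (negbTE mj) -{1}[tnth s' j]Kw.
    rewrite (simple_coord ss (tnth s' j *m w)) mulmx_suml linear_sum /= => /eqP.
    rewrite psumr_eq0 => [/allP/(_ i (mem_index_enum i))|k _]; last first.
      by rewrite -scalemxAl linearZ/= mulr_ge0.
    by rewrite -scalemxAl linearZ/= mulf_eq0 gt_eqF//= => /eqP.
  have e : tnth s i *m w^T = coord s' j (tnth s i *m w^T) *: tnth s' j.
    rewrite {1}(simple_coord ss' (tnth s i *m w^T)) (bigD1 j)//= big1 ?addr0// => m mj.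
    by rewrite lz// scale0r.
  have [_ _ _ red] := rsPhi; have := wTPhi _ (simple_root ss i).
  rewrite e red ?simple_root// => /orP[] /eqP k1; last first.
    by have := lpos i j; rewrite k1 oppr_ge0 ler10.
  by rewrite -[X in X *m w]scale1r -k1 -e wK mem_tnth.
have uM : uniq [seq a *m w | a <- s'].
  rewrite map_inj_uniq ?free_uniq// => x y /(congr1 (mulmx^~ w^T)).
  by rewrite -!mulmxA ow !mulmx1.
have sub : {subset [seq a *m w | a <- s'] <= s}.
  by move=> _ /mapP[a /tnthP[j ->] ->].
apply: uniq_perm => //; first exact: free_uniq (simple_free ss).
by case: (uniq_min_size uM sub); rewrite ?size_map ?size_tuple.
Qed.

End SimpleConjugacy.

(** * Coxeter elements of tree diagrams *)

Section TreeWords.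
Context {R : realType} {N : nat}.
Variable g : nat -> 'M[R]_N.
Hypothesis gK : forall i, g i *m g i = 1%:M.

Definition commuting i j := g i *m g j = g j *m g i.

Definition word_mx (u : seq nat) : 'M[R]_N := foldr (fun i A => g i *m A) 1%:M u.

Lemma word_mx_cat u v : word_mx (u ++ v) = word_mx u *m word_mx v.
Proof. by elim: u => [|i u IH] /=; rewrite ?mul1mx// IH mulmxA. Qed.

(** Moves that keep the conjugacy class of the product: commutations and cyclic rotations. *)
Inductive word_equiv : seq nat -> seq nat -> Prop :=
| word_equiv_refl u : word_equiv u u
| word_equiv_trans u v w : word_equiv u v -> word_equiv v w -> word_equiv u w
| word_equiv_swap u i j v : commuting i j ->
    word_equiv (u ++ i :: j :: v) (u ++ j :: i :: v)
| word_equiv_rot i u : word_equiv (i :: u) (rcons u i).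

Lemma word_equiv_perm u v : word_equiv u v -> perm_eq u v.
Proof.
elim=> [w|w1 w2 w3 _ h1 _ h2|w i j w' _|i w].
- by [].
- exact: perm_trans h1 h2.
- by rewrite perm_cat2l (perm_catCA [:: i] [:: j]).
by rewrite perm_sym perm_rcons.
Qed.

Lemma word_equiv_order u v : word_equiv u v ->
  forall k, word_mx u ^+ k = 1%:M <-> word_mx v ^+ k = 1%:M.
Proof.
elim=> [//|w1 w2 w3 _ h1 _ h2|w i j w' c|i w] k.
  exact: iff_trans (h1 k) (h2 k).
  by rewrite !word_mx_cat /= !mulmxA -(mulmxA _ (g i)) c !mulmxA.
rewrite -cats1 word_mx_cat /= mulmx1; set A := word_mx w.
have cj l : (A *m g i) ^+ l = g i *m (g i *m A) ^+ l *m g i.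
  elim: l => [|l IH]; first by rewrite !expr0 mulmx1 gK.
  rewrite !exprS IH; rewrite -[_ * _]/(_ *m _) -[(g i *m A) * _]/(_ *m _).
  by rewrite !mulmxA gK mul1mx -!mulmxA (mulmxA (g i) (g i)) gK mul1mx.
rewrite cj; split=> [->|e]; first by rewrite mulmx1 gK.
have := congr1 (fun M => g i *m M *m g i) e.
by rewrite !mulmxA gK mul1mx -mulmxA gK !mulmx1 gK.
Qed.

Lemma word_equiv_catC u v : word_equiv (u ++ v) (v ++ u).
Proof.
elim: u v => [|i u IH] v; first by rewrite cats0; exact: word_equiv_refl.
apply: word_equiv_trans (word_equiv_rot _ _) _.
by rewrite -cat_rcons rcons_cat; exact: IH.
Qed.

Lemma word_equiv_to_front n u v : (forall i, i \in u -> commuting i n) ->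
  word_equiv (u ++ n :: v) (n :: u ++ v).
Proof.
elim/last_ind: u v => [|u i IH] v h; first exact: word_equiv_refl.
rewrite cat_rcons; apply: (@word_equiv_trans _ (u ++ n :: i :: v)).
  by apply: word_equiv_swap; apply: h; rewrite mem_rcons mem_head.
by rewrite cat_rcons; apply: IH => j ju; apply: h; rewrite mem_rcons inE ju orbT.
Qed.

(* A leaf [n] of the tree, attached at [p], can follow any move of the word
   formed by the other letters. *)
Lemma word_equiv_leaf n p u v : uniq u ->
  (forall i, i \in u -> i != p -> commuting i n) ->
  word_equiv u v -> word_equiv (rcons u n) (rcons v n).
Proof.
move=> uu hu uv; elim: uv uu hu => {u v} [u|u v w uv IH1 vw IH2 uu hu|u i j v c _ _|i u].
- by move=> _ _; exact: word_equiv_refl.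
- have pe := word_equiv_perm uv; apply: word_equiv_trans (IH1 uu hu) (IH2 _ _).
    by rewrite -(perm_uniq pe).
  by move=> x; rewrite -(perm_mem pe); exact: hu.
- by rewrite !rcons_cat /=; exact: word_equiv_swap.
move=> /= /andP[iu uu] hu.
apply: (@word_equiv_trans _ (u ++ [:: n; i])).
  by apply: word_equiv_trans (word_equiv_rot _ _) _; rewrite -cats1 cat_rcons;
    exact: word_equiv_refl.
have [ip|ip] := eqVneq i p.
  apply: word_equiv_trans (word_equiv_to_front _ _) _.
    move=> j ju; apply: hu; rewrite ?inE ?ju ?orbT//.
    by rewrite -ip; apply: contraNneq iu => <-.
  by rewrite cats1; exact: word_equiv_rot.
rewrite -!cats1 -catA /=.
apply: word_equiv_swap; apply: esym; apply: hu; rewrite ?mem_head//.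
Qed.

(** A forest grown leaf by leaf: each new letter commutes with all earlier ones except possibly its
    point of attachment. *)
Inductive tree_order : seq nat -> Prop :=
| tree_order_nil : tree_order [::]
| tree_order_rcons t n p : tree_order t ->
    (forall i, i \in t -> i != p -> commuting i n) -> tree_order (rcons t n).

(** Rotating the word brings the last leaf n to its end; the other letters are put in order by
    induction, and [word_equiv_leaf] carries n along. *)
Lemma tree_word_equiv t u : tree_order t -> uniq t -> perm_eq u t -> word_equiv u t.
Proof.
move=> tt; elim: tt u => {t} [u _|t n p _ IH ht u].
  by move=> /perm_nilP ->; exact: word_equiv_refl.
rewrite rcons_uniq => /andP[nt ut] pu.
have nu : n \in u by rewrite (perm_mem pu) mem_rcons mem_head.
case/splitPr: nu pu => a b pu.
have pba : perm_eq (b ++ a) t.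
  move: pu; rewrite perm_sym perm_rcons => pu.
  rewrite -(perm_cons n) perm_sym (perm_trans pu)// perm_catC /=.
  by rewrite perm_cons perm_refl.
apply: word_equiv_trans (word_equiv_catC _ _) _.
apply: word_equiv_trans (word_equiv_rot _ _) _.
apply: (@word_equiv_leaf n p); [|move=> i; rewrite (perm_mem pba); exact: ht|].
  by rewrite (perm_uniq pba).
exact: IH.
Qed.

End TreeWords.

(** * Scalar products of simple roots *)

Section CartanNumbers.
Context {R : realType} {N r : nat}.
Implicit Types (a b u v : 'rV[R]_N) (w : 'M[R]_N).
Variables (Phi : seq 'rV[R]_N) (s : r.-tuple 'rV[R]_N).
Hypotheses (rsPhi : root_system Phi) (ssS : simple_system Phi s).

Definition golden : R := (1 + Num.sqrt 5) / 2.

Lemma golden_sqr : golden ^+ 2 = golden + 1.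
Proof.
have h : Num.sqrt 5 ^+ 2 = 5 :> R by rewrite sqr_sqrtr.
by rewrite /golden expr_div_n sqrrD h; field.
Qed.

Lemma golden_gt1 : 1 < golden.
Proof.
have h : Num.sqrt 5 ^+ 2 = 5 :> R by rewrite sqr_sqrtr.
have := sqrtr_ge0 (5 : R); rewrite /golden; nra.
Qed.

(** The number 4 cos^2(pi / m) for m = 2, 3, 4, 5. *)
Definition bond_number (m : nat) : R :=
  match m with 2 => 0 | 3 => 1 | 4 => 2 | _ => golden ^+ 2 end.

(** On the plane of the two roots, the condition that the m-th power of the product is trivial
    becomes polynomial equations in p = x y = 4 (a, b)^2 / ((a, a) (b, b)). They also admit the
    values of 4 cos^2 at other multiples of pi / m, which are excluded by the exact order or by
    [p1]. *)
Lemma cartan_number i j m : i != j -> (2 <= m <= 5)%N ->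
  has_order (refl_mx (tnth s i) *m refl_mx (tnth s j)) m ->
  4 * dot (tnth s i) (tnth s j) ^+ 2 =
  bond_number m * (dot (tnth s i) (tnth s i) * dot (tnth s j) (tnth s j)).
Proof.
move=> ij m25 [m0 wm wk]; set a := tnth s i; set b := tnth s j.
have aPhi : a \in Phi := simple_root ssS i.
have bPhi : b \in Phi := simple_root ssS j.
have aa : 0 < dot a a by rewrite dot_gt0 (root_neq0 rsPhi).
have bb : 0 < dot b b by rewrite dot_gt0 (root_neq0 rsPhi).
have ab : dot a b <= 0 := simple_dot_le0 rsPhi ssS ij.
pose y := - (2 / dot a a * dot a b); pose x := - (2 / dot b b * dot a b).
have x0 : 0 <= x by rewrite oppr_ge0 pmulr_rle0// divr_gt0.
have y0 : 0 <= y by rewrite oppr_ge0 pmulr_rle0// divr_gt0.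
have Ea k l : (k *: a + l *: b) *m refl_mx a = (y * l - k) *: a + l *: b.
  rewrite mul_refl dotDl !dotZl (dotC b a) /y addrAC -!scalerBl; congr (_ *: _ + _).
  by field; rewrite gt_eqF.
have Eb k l : (k *: a + l *: b) *m refl_mx b = k *: a + (x * k - l) *: b.
  rewrite mul_refl dotDl !dotZl /x -addrA -!scalerBl; congr (_ + _ *: _).
  by field; rewrite gt_eqF.
set w := refl_mx a *m refl_mx b in wm wk *.
have W k l : (k *: a + l *: b) *m w = (y * l - k) *: a + (x * (y * l - k) - l) *: b.
  by rewrite mulmxA Ea Eb.
have coordab k l : coord s i (k *: a + l *: b) = k /\ coord s j (k *: a + l *: b) = l.
  rewrite !linearD !linearZ /= !(coord_simple ssS) !eqxx (negbTE ij) eq_sym (negbTE ij).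
  by rewrite !mulr1 !mulr0 addr0 add0r.
have aw k l : (k *: a + l *: b) = a -> k = 1 /\ l = 0.
  have [h1 h2] := coordab k l; move=> e; move: h1 h2.
  by rewrite e !(coord_simple ssS) eqxx [j == i]eq_sym (negbTE ij) => <- <-.
(* If p is nonzero, then b s_a s_b = y a + (x y - 1) b is a root with positive coordinate at a, so
   its other coordinate is nonnegative. *)
have p1 : x * y = 0 \/ 1 <= x * y.
  have [y00|y1] := eqVneq y 0; first by left; rewrite y00 mulr0.
  right; have : (0 *: a + 1 *: b) *m refl_mx a *m refl_mx b \in Phi.
    by rewrite scale0r add0r scale1r !root_refl.
  rewrite Ea Eb mulr1 subr0 => cPhi.
  have yp : 0 < y by rewrite lt_neqAle eq_sym y1.
  have [ci cj] := coordab y (x * y - 1).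
  have /forallP/(_ j) : simple_pos s (y *: a + (x * y - 1) *: b).
    by apply: (simple_pos_dominates ssS (j := i) cPhi); rewrite ci.
  by rewrite cj subr_ge0.
have key : x * y = bond_number m -> 4 * dot a b ^+ 2 =
    bond_number m * (dot a a * dot b b).
  by move=> <-; rewrite /x /y; field; rewrite !gt_eqF.
apply: key.
have Wn k l n : (k *: a + l *: b) *m w ^+ n.+1 =
    ((y * l - k) *: a + (x * (y * l - k) - l) *: b) *m w ^+ n.
  by rewrite exprS -![_ * _]/(_ *m _) mulmxA W.
have xy00 : x * y = 0 -> dot a b = 0.
  move/eqP; rewrite mulf_eq0 !oppr_eq0 !mulf_eq0 !invr_eq0 !pnatr_eq0 /=.
  by rewrite (gt_eqF aa) (gt_eqF bb) /= orbb => /eqP.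
pose p := x * y; rewrite -/p in p1 xy00 *.
have xN0 q : 1 <= p -> x * q = 0 -> q = 0.
  move=> p1' /eqP; rewrite mulf_eq0 => /orP[/eqP xz|/eqP//].
  by move: p1'; rewrite /p xz mul0r ler10.
have comm0 : p = 0 -> w ^+ 2 = 1%:M.
  move=> /xy00 ab0; rewrite expr2 -[LHS]/(w *m w) /w.
  have c : refl_mx a *m refl_mx b = refl_mx b *m refl_mx a.
    rewrite refl_mx_comm; last exact: orthogonal_refl.
    by rewrite mul_refl ab0 mulr0 scale0r subr0.
  by rewrite {2}c mulmxA -(mulmxA (refl_mx a)) refl_mxK mulmx1 refl_mxK.
have awm : (1 *: a + 0 *: b) *m w ^+ m = a.
  by rewrite wm mulmx1 scale1r scale0r addr0.
case: m m25 m0 wm wk awm => [|[|[|[|[|[|m]]]]]]//= _ _ wm wk;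
  rewrite !Wn expr0 mulmx1 => /aw[e1 e2].
- have h : 1 - p = 1 by rewrite -[RHS]e1 /p; ring.
  lra.
- have h1 : (p - 1) * (p - 2) = 0 by move/eqP: e1; rewrite -subr_eq0 => /eqP; rewrite /p; lra.
  have h2 : x * ((1 - p) * (3 - p)) = 0 by rewrite -[RHS]oppr0 -[in RHS]e2 /p; ring.
  clear e1 e2 Wn W Ea Eb aw coordab.
  have [p0|p1'] := p1; first by move: h1; rewrite p0; lra.
  by have := xN0 _ p1' h2; nra.
- have h1 : p * (p - 2) * (p - 3) = 0.
    by rewrite -[RHS]oppr0 -[in RHS](subrr 1) -[X in X - 1]e1 /p; ring.
  have h2 : x * ((1 - 3 * p + p ^+ 2) + (1 - p) ^+ 2 * (3 - p)) = 0.
    by rewrite -[RHS]e2 /p; ring.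
  clear e1 e2 Wn W Ea Eb aw coordab.
  have [p0|p1'] := p1; first by case: (wk 2%N isT); exact: comm0.
  have {}h2 := xN0 _ p1' h2.
  clearbody p; move/eqP: h1; rewrite !mulf_eq0 !subr_eq0 => /orP[/orP[]|] /eqP e; move: p1' h2; rewrite e//; lra.
- have h1 : p ^+ 4 - 7 * p ^+ 3 + 15 * p ^+ 2 - 10 * p + 2 = 0.
    by rewrite -[RHS](subrr 1) -[X in _ = _ - X]e1 /p; ring.
  have h2 : x * (p ^+ 4 - 8 * p ^+ 3 + 21 * p ^+ 2 - 20 * p + 5) = 0.
    by rewrite -[RHS]oppr0 -[in RHS]e2 /p; ring.
  clear e1 e2 Wn W Ea Eb aw coordab.
  have [p0|p1'] := p1; first by move: h1; rewrite p0 => h; exfalso; lra.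
  have {}h2 := xN0 _ p1' h2.
  have h3 : p ^+ 2 - 3 * p + 1 = 0.
    have f1 : (p ^+ 2 - 3 * p + 1) * (p ^+ 2 - 4 * p + 2) = 0 by rewrite -[RHS]h1; ring.
    have f2 : (p ^+ 2 - 3 * p + 1) * (p ^+ 2 - 5 * p + 5) = 0 by rewrite -[RHS]h2; ring.
    have [//|h] := eqVneq (p ^+ 2 - 3 * p + 1) 0.
    move/eqP: f1; rewrite mulf_eq0 (negbTE h) /= => /eqP f1.
    move/eqP: f2; rewrite mulf_eq0 (negbTE h) /= => /eqP f2.
    have p3 : p = 3 by lra.
    by exfalso; move: f1; rewrite p3; lra.
  (* The second root 3 - phi^2 is 4 cos^2(2 pi / 5), which is below 1 and contradicts [p1]. *)
  have h4 : (p - golden ^+ 2) * (p - (3 - golden ^+ 2)) = 0.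
    have -> : (p - golden ^+ 2) * (p - (3 - golden ^+ 2)) =
        (p ^+ 2 - 3 * p + 1) + (golden ^+ 2 * (3 - golden ^+ 2) - 1) by ring.
    by rewrite h3 golden_sqr; have := golden_sqr; nra.
  move/eqP: h4; rewrite mulf_eq0 !subr_eq0 => /orP[] /eqP // e.
  by exfalso; have := golden_gt1; have := golden_sqr; rewrite e in p1'; lra.
Qed.


End CartanNumbers.

(** * Root tables *)

(* [(x, y)] stands for x + y phi, with phi the golden ratio. *)
Notation zphi := (BinNums.Z * BinNums.Z)%type.

Definition zphi_add (x y : zphi) : zphi :=
  (BinInt.Z.add x.1 y.1, BinInt.Z.add x.2 y.2).
Definition zphi_sub (x y : zphi) : zphi :=
  (BinInt.Z.sub x.1 y.1, BinInt.Z.sub x.2 y.2).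
Definition zphi_mul (x y : zphi) : zphi :=
  let bd := BinInt.Z.mul x.2 y.2 in
  (BinInt.Z.add (BinInt.Z.mul x.1 y.1) bd,
   BinInt.Z.add (BinInt.Z.add (BinInt.Z.mul x.1 y.2) (BinInt.Z.mul x.2 y.1)) bd).
Definition zphi_nat (n : nat) : zphi := (BinInt.Z.of_nat n, BinNums.Z0).
Definition zphi_opp (x : zphi) : zphi := zphi_sub (zphi_nat 0) x.
Definition zphi_phi : zphi := (BinNums.Z0, BinInt.Z.of_nat 1).
Definition zphi_nneg (x : zphi) : bool :=
  BinInt.Z.leb BinNums.Z0 x.1 && BinInt.Z.leb BinNums.Z0 x.2.

Notation zvec := (seq zphi).
Definition zdot (u v : zvec) : zphi :=
  foldr (fun p x => zphi_add (zphi_mul p.1 p.2) x) (zphi_nat 0) (zip u v).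
Definition zsum (I : Type) (F : I -> zphi) (l : seq I) : zphi :=
  foldr (fun i x => zphi_add (F i) x) (zphi_nat 0) l.

(* Squared lengths of the simple roots, rescaled so that their Gram matrix has
   entries in Z[phi]. *)
Definition simple_norm (X : EFH_type) (i : nat) : nat :=
  if X is type_F4 then (if (i < 2)%N then 4 else 2)%N else 2%N.

(** Minus half the square root of [bond_number m] times the two squared lengths. These are equal for
    m = 3, they are 4 and 2 for m = 4, and both are 2 for m = 5. *)
Definition bond_dot (m ni : nat) : zphi :=
  match m with
  | 2 => zphi_nat 0 | 3 => zphi_opp (zphi_nat ni./2)
  | 4 => zphi_opp (zphi_nat 2) | _ => zphi_opp zphi_phi end.

Definition gram (X : EFH_type) (i j : nat) : zphi :=
  if i == j then zphi_nat (simple_norm X i)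
  else bond_dot (coxeter_matrix X i j) (simple_norm X i).

(** The number 2 (a_i, a_j) / (a_j, a_j), the squared length being 2 or 4. The value 4 occurs only
    in F4, where no entry involves phi, so halving the first component is enough. *)
Definition cartan (X : EFH_type) (i j : nat) : zphi :=
  let g := gram X i j in
  if simple_norm X j == 4%N then (BinInt.Z.div2 g.1, g.2) else g.

Definition col_of (X : EFH_type) (M : nat -> nat -> zphi) (j : nat) : zvec :=
  [seq M i j | i <- iota 0 (type_rank X)].

(* Coordinates, in the basis of simple roots, of the image of [l] under the
   [j]-th simple reflection. *)
Definition zrefl (X : EFH_type) (j : nat) (l : zvec) : zvec :=
  set_nth (zphi_nat 0) l j
    (zphi_sub (nth (zphi_nat 0) l j) (zdot l (col_of X (cartan X) j))).

Definition zunit (X : EFH_type) (j : nat) : zvec :=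
  [seq zphi_nat (i == j) | i <- iota 0 (type_rank X)].

(** Breadth-first search, with F the last layer found. That the number of layers suffices is seen
    from the closure checks on the results. *)
Fixpoint zclosure (X : EFH_type) (P : pred zvec) (n : nat) (L F : seq zvec) : seq zvec :=
  if n is n'.+1 then
    let F' := undup [seq l <- [seq zrefl X j l | l <- F, j <- iota 0 (type_rank X)]
                    | P l && (l \notin L)] in
    zclosure X P n' (L ++ F') F'
  else L.

Fact zroots_key : unit. Proof. exact: tt. Qed.

(* Locked: otherwise [done] tries to compute the table. *)
Definition zroots (X : EFH_type) : seq zvec :=
  let L := [seq zunit X j | j <- iota 0 (type_rank X)] in
  locked_with zroots_key (zclosure X (all zphi_nneg) 30 L L).

Lemma zrootsE X : zroots X =
  let L := [seq zunit X j | j <- iota 0 (type_rank X)] in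
  zclosure X (all zphi_nneg) 30 L L.
Proof. by rewrite /zroots unlock. Qed.

Definition znorm (X : EFH_type) (l : zvec) : zphi :=
  zdot l [seq zdot l (col_of X (gram X) j) | j <- iota 0 (type_rank X)].

Definition type_coxeter (X : EFH_type) : nat :=
  match X with
  | type_E6 => 12 | type_E7 => 18 | type_E8 => 30
  | type_F4 => 12 | type_H3 => 10 | type_H4 => 30
  end.

Definition type_degree (X : EFH_type) : nat :=
  match X with
  | type_E6 => 9 | type_E7 => 14 | type_E8 => 24
  | type_F4 => 8 | type_H3 => 6 | type_H4 => 20
  end.

Definition index_pairs (X : EFH_type) : seq (nat * nat) :=
  [seq (i, j) | i <- iota 0 (type_rank X), j <- iota 0 (type_rank X)].

Definition gram_check (X : EFH_type) : bool :=
  all (fun p : nat * nat =>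
    let i := p.1 in let j := p.2 in
    let m := coxeter_matrix X i j in
    let ni := simple_norm X i in let nj := simple_norm X j in
    [&& (i == j) || (2 <= m <= 5)%N,
        (i == j) || (m == 2) || (m == 3) && (ni == nj) || (m == 4) && (ni * nj == 8)%N
          || (m == 5) && (ni == 2) && (nj == 2)
      & zphi_mul (zphi_nat 2) (gram X i j) == zphi_mul (cartan X i j) (zphi_nat nj)])
    (index_pairs X).

Definition closed_check (X : EFH_type) (L : seq zvec) : bool :=
  all (fun l => all (fun j => (l == zunit X j) || (zrefl X j l \in L))
     (iota 0 (type_rank X))) L.

Definition parallel_minors (l l' : zvec) : bool :=
  let n := size l in
  all (fun i => all (fun j =>
    zphi_mul (nth (zphi_nat 0) l i) (nth (zphi_nat 0) l' j) ==
    zphi_mul (nth (zphi_nat 0) l j) (nth (zphi_nat 0) l' i)) (iota 0 n)) (iota 0 n).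

(** Parallel vectors of equal norm agree up to sign, which nonnegative coordinates settle; minors
    are compared only for different norms. *)
Definition lines_check (X : EFH_type) (L : seq zvec) : bool :=
  let K := [seq (znorm X l, l) | l <- L] in
  uniq L && all (fun p => all (fun q => (p.1 == q.1) || ~~ parallel_minors p.2 q.2) K) K.

(* 4 / (l, l), a squared length being 2 or 4. *)
Definition zweight (X : EFH_type) (l : zvec) : zphi :=
  zphi_nat (if znorm X l == zphi_nat 4 then 1 else 2).

Definition norm_check (X : EFH_type) (L : seq zvec) : bool :=
  all (fun l => (znorm X l == zphi_nat 2) || (znorm X l == zphi_nat 4)) L.

Definition zdots (X : EFH_type) (L : seq zvec) : seq (zphi * zvec) :=
  [seq (zweight X l,
        [seq zdot l (col_of X (gram X) j) | j <- iota 0 (type_rank X)]) | l <- L].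

Definition design2_check (X : EFH_type) (L : seq zvec) : bool :=
  let D := zdots X L in
  all (fun p : nat * nat =>
    zsum (fun z => zphi_mul z.1 (zphi_mul (nth (zphi_nat 0) z.2 p.1)
                                          (nth (zphi_nat 0) z.2 p.2))) D
    == zphi_mul (zphi_nat (2 * type_coxeter X)) (gram X p.1 p.2)) (index_pairs X).

(** The identity is cleared of denominators: [zweight] is twice 2 / (l, l), so its square
    contributes a factor 4, and 4 times [design_const] is 8h / (n + 2). *)
Definition design4_check (X : EFH_type) (L : seq zvec) : bool :=
  let D := zdots X L in
  let I := iota 0 (type_rank X) in
  let G := gram X in
  all (fun p => all (fun q => all (fun r => all (fun s =>
    zphi_mul (zphi_nat (type_rank X + 2))
      (zsum (fun z => zphi_mul (zphi_mul z.1 z.1)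
        (zphi_mul (zphi_mul (nth (zphi_nat 0) z.2 p) (nth (zphi_nat 0) z.2 q))
                  (zphi_mul (nth (zphi_nat 0) z.2 r) (nth (zphi_nat 0) z.2 s)))) D)
    == zphi_mul (zphi_nat (8 * type_coxeter X))
        (zphi_add (zphi_add (zphi_mul (G p q) (G r s)) (zphi_mul (G p r) (G q s)))
                  (zphi_mul (G p s) (G q r))))
    (iota 0 r.+1)) (iota 0 q.+1)) (iota 0 p.+1)) I.

Fixpoint masks (n : nat) : seq (seq bool) :=
  if n is n'.+1 then
    [seq true :: m | m <- masks n'] ++ [seq false :: m | m <- masks n']
  else [:: [::]].

Definition supported (m : seq bool) (l : zvec) : bool :=
  all (fun p : bool * zphi => p.1 || (p.2 == zphi_nat 0)) (zip m l).

(** A mask selects simple roots, and the roots in their span are the table entries supported on it;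
    these are the standard parabolic flats. *)
Definition flats_check (X : EFH_type) (L : seq zvec) : bool :=
  all (fun m => all id m || ~~ has id m ||
        (2 * count (supported m) L < count id m * type_degree X)%N)
      (masks (type_rank X)).

Definition tree_word (X : EFH_type) : seq nat :=
  match X with
  | type_E6 => [:: 0; 2; 3; 1; 4; 5] | type_E7 => [:: 0; 2; 3; 1; 4; 5; 6]
  | type_E8 => [:: 0; 2; 3; 1; 4; 5; 6; 7]
  | type_F4 | type_H4 => [:: 0; 1; 2; 3] | type_H3 => [:: 0; 1; 2]
  end.

Definition tree_check (X : EFH_type) : bool :=
  let t := tree_word X in
  perm_eq t (iota 0 (type_rank X)) &&
  all (fun k => let n := nth 0%N t k in
    (count (fun i => coxeter_matrix X i n != 2) (take k t) <= 1)%N)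
    (iota 0 (size t)).

Definition zcoxeter (X : EFH_type) (l : zvec) : zvec :=
  foldl (fun l j => zrefl X j l) l (tree_word X).

Definition coxeter_fixes (X : EFH_type) (k : nat) : bool :=
  all (fun j => iter k (zcoxeter X) (zunit X j) == zunit X j) (iota 0 (type_rank X)).

(** This yields [type_degree] < h <= [type_coxeter] for the order h of a Coxeter element. No degree
    lies strictly between these bounds, so they determine the highest degree below h. *)
Definition coxeter_check (X : EFH_type) : bool :=
  coxeter_fixes X (type_coxeter X) &&
  ~~ has (coxeter_fixes X) (iota 1 (type_degree X)).

Definition count_check (X : EFH_type) (L : seq zvec) : bool :=
  2 * size L == (type_rank X + 2) * type_degree X.

Lemma gram_checkP X : gram_check X.
Proof. by case: X; vm_compute. Qed.

Lemma closed_checkP X : closed_check X (zroots X).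
Proof. by rewrite zrootsE; case: X; vm_compute. Qed.

Lemma lines_checkP X : lines_check X (zroots X).
Proof. by rewrite zrootsE; case: X; vm_compute. Qed.

Lemma norm_checkP X : norm_check X (zroots X).
Proof. by rewrite zrootsE; case: X; vm_compute. Qed.

Lemma design2_checkP X : design2_check X (zroots X).
Proof. by rewrite zrootsE; case: X; vm_compute. Qed.

Lemma design4_checkP X : design4_check X (zroots X).
Proof. by rewrite zrootsE; case: X; vm_compute. Qed.

Lemma flats_checkP X : flats_check X (zroots X).
Proof. by rewrite zrootsE; case: X; vm_compute. Qed.

Lemma tree_checkP X : tree_check X.
Proof. by case: X; vm_compute. Qed.

Lemma coxeter_checkP X : coxeter_check X.
Proof. by case: X; vm_compute. Qed.

Lemma count_checkP X : count_check X (zroots X).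
Proof. by rewrite zrootsE; case: X; vm_compute. Qed.

(** * The embedding of Z[phi] in the real numbers *)

Section GoldenValues.
Context {R : realType}.

Definition zval (z : BinNums.Z) : R := (int_of_Z z)%:~R.

Definition gval (x : zphi) : R := zval x.1 + zval x.2 * golden.

Lemma zvalD x y : zval (BinInt.Z.add x y) = zval x + zval y.
Proof. by rewrite /zval -[BinInt.Z.add x y]/(x + y)%R !rmorphD. Qed.

Lemma zvalM x y : zval (BinInt.Z.mul x y) = zval x * zval y.
Proof. by rewrite /zval -[BinInt.Z.mul x y]/(x * y)%R !rmorphM. Qed.

Lemma zvalB x y : zval (BinInt.Z.sub x y) = zval x - zval y.
Proof. by rewrite /zval (_ : BinInt.Z.sub x y = (x - y)%R) ?rmorphB. Qed.

Lemma zval_nat n : zval (BinInt.Z.of_nat n) = n%:R.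
Proof.
rewrite /zval; elim: n => // n IH.
by rewrite Znat.Nat2Z.inj_succ -BinInt.Z.add_1_r -[LHS]/(zval _) zvalD /zval IH -natr1.
Qed.

Lemma zval_ge0 z : BinInt.Z.leb BinNums.Z0 z -> 0 <= zval z.
Proof. by move=> h; rewrite /zval ler0z; lia. Qed.

Lemma gvalD x y : gval (zphi_add x y) = gval x + gval y.
Proof. by rewrite /gval !zvalD; ring. Qed.

Lemma gvalB x y : gval (zphi_sub x y) = gval x - gval y.
Proof. by rewrite /gval !zvalB; ring. Qed.

Lemma gvalM x y : gval (zphi_mul x y) = gval x * gval y.
Proof.
rewrite /gval /= !zvalD !zvalM.
have -> : (zval x.1 + zval x.2 * golden) * (zval y.1 + zval y.2 * golden) =
  zval x.1 * zval y.1 + (zval x.1 * zval y.2 + zval x.2 * zval y.1) * golden +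
  zval x.2 * zval y.2 * golden ^+ 2 by ring.
by rewrite golden_sqr; ring.
Qed.

Lemma gval_nat n : gval (zphi_nat n) = n%:R.
Proof. by rewrite /gval zval_nat [X in X * _](_ : _ = 0) ?mul0r ?addr0. Qed.

Lemma gvalN x : gval (zphi_opp x) = - gval x.
Proof. by rewrite gvalB gval_nat sub0r. Qed.

Lemma gval_phi : gval zphi_phi = golden.
Proof. by rewrite /gval /zphi_phi [zval _](_ : _ = 0)// [zval _](_ : _ = 1)// mul1r add0r. Qed.

Lemma gval_ge0 x : zphi_nneg x -> 0 <= gval x.
Proof.
move=> /andP[h1 h2]; rewrite addr_ge0 ?mulr_ge0 ?zval_ge0//.
Qed.

(** The 5-adic valuation is even on the left and odd on the right unless b = 0. This irrationality
    of sqrt 5 makes [gval] injective, so equality in the tables reflects equality of real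
    numbers. *)
Lemma sqr_eq_5sqr (a b : nat) : (a ^ 2 = 5 * b ^ 2)%N -> b = 0%N.
Proof.
move=> e; apply/eqP; rewrite -leqn0 leqNgt; apply/negP => b0.
have a0 : (0 < a)%N by case: a e => // /eqP; rewrite eq_sym muln_eq0 expn_eq0 andbT; lia.
have := congr1 (logn 5) e; rewrite lognM ?expn_gt0 ?b0// !lognX /=.
have -> : logn 5 5 = 1%N by [].
lia.
Qed.

Lemma gval_eq0 x : gval x = 0 -> x = zphi_nat 0.
Proof.
case: x => x y; rewrite /gval /= /zval /golden.
set a := int_of_Z x; set b := int_of_Z y => e.
have h5 : Num.sqrt 5 ^+ 2 = 5 :> R by rewrite sqr_sqrtr.
have e1 : b%:~R * Num.sqrt 5 = - (2 * a%:~R + b%:~R) :> R by lra.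
have e2 : ((2 * a + b) ^+ 2)%:~R = (5 * b ^+ 2)%:~R :> R.
  have iM (m k : int) : (m * k)%:~R = m%:~R * k%:~R :> R by exact: rmorphM.
  have iD (m k : int) : (m + k)%:~R = m%:~R + k%:~R :> R by exact: rmorphD.
  rewrite !expr2 !iM iD iM; have -> : (2 : int)%:~R = 2 :> R by [].
  have -> : (5 : int)%:~R = 5 :> R by [].
  by rewrite -expr2 -sqrrN -e1 exprMn h5; ring.
have {}e2 : (2 * a + b) ^+ 2 = 5 * b ^+ 2 by apply/eqP; rewrite -(eqr_int R) e2.
have e3 : (absz (2 * a + b)%R ^ 2 = 5 * absz b ^ 2)%N.
  by have := congr1 absz e2; rewrite abszM !abszX.
have /eqP := sqr_eq_5sqr e3; rewrite absz_eq0 => /eqP b0.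
have a0 : a = 0 by move: e2; rewrite b0; nia.
by rewrite -(int_of_ZK x) -(int_of_ZK y) -/a -/b a0 b0.
Qed.

Lemma gval_inj : injective gval.
Proof.
move=> x y e; have : gval (zphi_sub x y) = 0 by rewrite gvalB e subrr.
move/gval_eq0; case: x y {e} => x1 x2 [y1 y2]; rewrite /zphi_sub /zphi_nat /= => -[h1 h2].
by congr (_, _); lia.
Qed.

Lemma gval_zdot u v : size u = size v ->
  gval (zdot u v) = \sum_(i < size u) gval (nth (zphi_nat 0) u i) * gval (nth (zphi_nat 0) v i).
Proof.
elim: u v => [|x u IH] [|y v] //= e; first by rewrite big_ord0 gval_nat.
by rewrite gvalD gvalM big_ord_recl /= IH//; case: e.
Qed.

Lemma gval_zsum (I : Type) (F : I -> zphi) (l : seq I) :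
  gval (zsum F l) = \sum_(i <- l) gval (F i).
Proof.
by elim: l => [|i l IH]; rewrite ?big_nil ?gval_nat// big_cons /= gvalD IH.
Qed.

End GoldenValues.

(** * Roots of a given type *)

Section RootLines.
Context {R : realType}.
Variable X : EFH_type.
Local Notation n := (type_rank X).
Implicit Types (a b u v : 'rV[R]_n) (w : 'M[R]_n) (l : zvec).
Variables (Phi : seq 'rV[R]_n) (s : n.-tuple 'rV[R]_n).
Hypotheses (rsPhi : root_system Phi) (ssS : simple_system Phi s).
Hypothesis ordS : forall i j, has_order (refl_mx (tnth s i) *m refl_mx (tnth s j))
  (coxeter_matrix X i j).

Local Notation g0 := (zphi_nat 0).
Local Notation gv := (@gval R).

Definition scaling (i : 'I_n) : R :=
  Num.sqrt ((simple_norm X i)%:R / dot (tnth s i) (tnth s i)).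

Definition sroot (i : 'I_n) : 'rV[R]_n := scaling i *: tnth s i.

Lemma index_pairsP (Q : nat * nat -> bool) (i j : 'I_n) :
  all Q (index_pairs X) -> Q (i : nat, j : nat).
Proof.
by move=> /allP; apply; apply/allpairsP; exists (i : nat, j : nat); rewrite !mem_iota !ltn_ord.
Qed.

Lemma simple_norm_gt0 i : (0 < simple_norm X i)%N.
Proof. by rewrite /simple_norm; case: X => //; case: ifP. Qed.

Lemma simple_norm_even i : ~~ odd (simple_norm X i).
Proof. by rewrite /simple_norm; case: X => //; case: ifP. Qed.

Lemma simple_dot_gt0 i : 0 < dot (tnth s i) (tnth s i).
Proof. by rewrite dot_gt0 (root_neq0 rsPhi)// (simple_root ssS). Qed.

Lemma scaling_gt0 i : 0 < scaling i.
Proof. by rewrite sqrtr_gt0 divr_gt0 ?simple_dot_gt0// ltr0n simple_norm_gt0. Qed.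

Lemma scaling_sqr i : scaling i ^+ 2 * dot (tnth s i) (tnth s i) = (simple_norm X i)%:R.
Proof.
rewrite sqr_sqrtr ?divfK ?gt_eqF ?simple_dot_gt0// divr_ge0 ?ler0n// ltW//.
exact: simple_dot_gt0.
Qed.

Lemma gval_half m : ~~ odd m -> gv (zphi_nat m./2) = m%:R / 2.
Proof.
move=> em; rewrite gval_nat -[in RHS](odd_double_half m) (negbTE em) add0n.
by rewrite -muln2 natrM mulfK ?pnatr_eq0.
Qed.

(** Off the diagonal the squares agree by [cartan_number], and both numbers are nonpositive. *)
Lemma dot_sroot i j : dot (sroot i) (sroot j) = gv (gram X i j).
Proof.
rewrite /sroot dotZl dotZr /gram; have [<-|ij] := eqVneq i j.
  by rewrite eqxx gval_nat mulrA -expr2 scaling_sqr.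
have ijn : (nat_of_ord i == j) = false by exact: negbTE.
rewrite ijn; have := index_pairsP i j (gram_checkP X); rewrite /= ijn /=.
set m := coxeter_matrix X i j; set ni := simple_norm X i; set nj := simple_norm X j.
move=> /and3P[m25 hm _].
have cn := cartan_number rsPhi ssS ij m25 (ordS i j).
have si := scaling_gt0 i; have sj := scaling_gt0 j.
have ei := scaling_sqr i; have ej := scaling_sqr j; rewrite -/ni -/nj in ei ej.
have le0 := simple_dot_le0 rsPhi ssS ij.
set x := dot (tnth s i) (tnth s j) in cn le0 *; set y := scaling i * (scaling j * x).
have y0 : y <= 0 by rewrite !pmulr_rle0.
have y2 : 4 * y ^+ 2 = bond_number m * (ni%:R * nj%:R).
  rewrite -ei -ej /y !exprMn.
  rewrite (_ : 4 * _ = scaling i ^+ 2 * scaling j ^+ 2 * (4 * x ^+ 2)); last by ring.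
  by rewrite cn; ring.
suff [z0 z2] : gv (bond_dot m ni) <= 0 /\ 4 * gv (bond_dot m ni) ^+ 2 = 4 * y ^+ 2.
  by apply/eqP; rewrite -eqr_opp -(@eqrXn2 _ 2) ?oppr_ge0// !sqrrN; apply/eqP; lra.
rewrite y2; move: hm => /orP[/orP[/orP[/eqP ->|/andP[/eqP -> /eqP <-]]|/andP[/eqP -> /eqP h8]]|/andP[/andP[/eqP -> /eqP ->] /eqP ->]] /=.
- by rewrite gval_nat mul0r expr0n/= mulr0.
- have en : ~~ odd ni := simple_norm_even i.
  rewrite gvalN gval_half// oppr_le0 divr_ge0 ?ler0n//; split => //.
  by field.
- by rewrite gvalN gval_nat oppr_le0 ler0n -natrM h8; split => //; ring.
by rewrite gvalN gval_phi oppr_le0 (le_trans ler01 (ltW golden_gt1)); split => //; ring.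
Qed.

Definition zval_vec l : 'rV[R]_n := \sum_(i < n) gv (nth g0 l i) *: sroot i.

Lemma sroot_coord v : v = \sum_i (coord s i v / scaling i) *: sroot i.
Proof.
rewrite {1}(simple_coord ssS v); apply: eq_bigr => j _.
by rewrite /sroot scalerA divfK// gt_eqF ?scaling_gt0.
Qed.

Lemma coord_zval_vec l i : coord s i (zval_vec l) = gv (nth g0 l (i : 'I_n)) * scaling i.
Proof.
rewrite /zval_vec; under eq_bigr => j _ do rewrite /sroot scalerA.
exact: (coord_lin_sum ssS).
Qed.

Lemma size_col_of M j : size (col_of X M j) = n.
Proof. by rewrite size_map size_iota. Qed.

Lemma gval_zdot_col M l j : size l = n ->
  gv (zdot l (col_of X M j)) = \sum_(i < n) gv (nth g0 l i) * gv (M i j).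
Proof.
move=> sl; rewrite gval_zdot ?size_col_of ?sl//; apply: eq_bigr => i _.
by rewrite (nth_map 0%N) ?size_iota// nth_iota.
Qed.

Lemma dot_zval_vec l (j : 'I_n) : size l = n ->
  dot (zval_vec l) (sroot j) = gv (zdot l (col_of X (gram X) j)).
Proof.
move=> sl; rewrite gval_zdot_col// /zval_vec dot_suml; apply: eq_bigr => i _.
by rewrite dotZl dot_sroot.
Qed.

Lemma size_zrefl l (j : 'I_n) : size l = n -> size (zrefl X j l) = n.
Proof. by move=> sl; rewrite size_set_nth sl; apply/maxn_idPr. Qed.

Lemma zval_vec_refl l (j : 'I_n) : size l = n ->
  zval_vec (zrefl X j l) = zval_vec l *m refl_mx (tnth s j).
Proof.
move=> sl; rewrite -(refl_mxZ (tnth s j) (k := scaling j)) ?gt_eqF ?scaling_gt0//.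
rewrite -/(sroot j) mul_refl dot_sroot dot_zval_vec//.
have nj : gv (gram X j j) = (simple_norm X j)%:R by rewrite /gram eqxx gval_nat.
rewrite nj; have nj0 : (simple_norm X j)%:R != 0 :> R by rewrite pnatr_eq0 -lt0n simple_norm_gt0.
have e : 2 / (simple_norm X j)%:R * gv (zdot l (col_of X (gram X) j)) =
    gv (zdot l (col_of X (cartan X) j)).
  rewrite !gval_zdot_col// mulr_sumr; apply: eq_bigr => i _.
  have := index_pairsP i j (gram_checkP X) => /and3P[_ _ /eqP/(congr1 gv)] /=.
  rewrite !gvalM !gval_nat => h.
  by apply: (mulfI nj0); rewrite [RHS]mulrCA -[X in _ = _ * X]mulrC -h; field.
rewrite e /zval_vec (bigD1 j)//= [in RHS](bigD1 j)//= addrAC -scalerBl; congr (_ + _).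
  by rewrite nth_set_nth /= eqxx gvalB.
by apply: eq_bigr => i ij; rewrite nth_set_nth /= (_ : (i == j :> nat) = false)//; exact: negbTE.
Qed.

Lemma nth_zunit (i j : 'I_n) : nth g0 (zunit X j) i = zphi_nat (i == j).
Proof. by rewrite (nth_map 0%N) ?size_iota// nth_iota. Qed.

Lemma zval_vec_unit (j : 'I_n) : zval_vec (zunit X j) = sroot j.
Proof.
rewrite /zval_vec (bigD1 j)//= nth_zunit eqxx gval_nat scale1r big1 ?addr0// => i ij.
by rewrite nth_zunit (negbTE ij) gval_nat scale0r.
Qed.

Lemma zclosure_ind (Q : zvec -> Prop) (P : pred zvec) k L F :
  (forall l, l \in L -> Q l) -> (forall l, l \in F -> Q l) ->
  (forall l (j : 'I_n), Q l -> P (zrefl X j l) -> Q (zrefl X j l)) ->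
  forall l, l \in zclosure X P k L F -> Q l.
Proof.
elim: k L F => [//|k IH] L F QL QF step /=; apply: IH => // l.
  rewrite mem_cat => /orP[/QL//|]; rewrite mem_undup mem_filter => /andP[/andP[Pl _]].
  move=> /allpairsP[[l' j] /= [/QF Ql' + e]]; rewrite mem_iota => /andP[_ jn].
  by rewrite e in Pl *; exact: (step l' (Ordinal jn)).
rewrite mem_undup mem_filter => /andP[/andP[Pl _]].
move=> /allpairsP[[l' j] /= [/QF Ql' + e]]; rewrite mem_iota => /andP[_ jn].
by rewrite e in Pl *; exact: (step l' (Ordinal jn)).
Qed.

Lemma zclosure_sub (P : pred zvec) k L F : {subset L <= zclosure X P k L F}.
Proof.
by elim: k L F => [|k IH] L F l lL //=; apply: IH; rewrite mem_cat lL.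
Qed.

(** Rescaling the simple roots preserves the lines of roots but not the roots. *)
Definition root_line v := exists2 k : R, k != 0 & k *: v \in Phi.

Lemma zunit_roots (j : 'I_n) : zunit X j \in zroots X.
Proof. by rewrite zrootsE; apply: zclosure_sub; apply/mapP; exists (j : nat); rewrite ?mem_iota ?ltn_ord. Qed.

Lemma zroots_facts l : l \in zroots X ->
  [/\ size l = n, all zphi_nneg l & root_line (zval_vec l)].
Proof.
pose Q l := [/\ size l = n, all zphi_nneg l & root_line (zval_vec l)].
have QU l' : l' \in [seq zunit X j | j <- iota 0 n] -> Q l'.
  move=> /mapP[j + ->]; rewrite mem_iota => /andP[_ jn]; split.
  - by rewrite size_map size_iota.
  - by apply/allP => _ /mapP[i _ ->]; case: (i == j).
  exists (scaling (Ordinal jn))^-1; first by rewrite invr_eq0 gt_eqF ?scaling_gt0.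
  rewrite (zval_vec_unit (Ordinal jn)) scalerA mulVf ?gt_eqF ?scaling_gt0// scale1r.
  exact: (simple_root ssS).
rewrite zrootsE; apply: (@zclosure_ind Q) => // l' j [sl _ [k k0 kl]] nn; split => //.
  exact: size_zrefl.
exists k => //; rewrite zval_vec_refl// scalemxAl root_refl//.
exact: (simple_root ssS).
Qed.

Lemma zroots_size l : l \in zroots X -> size l = n.
Proof. by case/zroots_facts. Qed.

Lemma dot_zval_vecxx l : size l = n -> dot (zval_vec l) (zval_vec l) = gv (znorm X l).
Proof.
move=> sl; rewrite {2}/zval_vec dot_sumr /znorm gval_zdot ?sl ?size_map ?size_iota//.
apply: eq_bigr => i _; rewrite dotZr dot_zval_vec//.
by rewrite (nth_map 0%N) ?size_iota// nth_iota.
Qed.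

Lemma zval_vec_neq0 l : l \in zroots X -> zval_vec l != 0.
Proof.
move=> /zroots_facts[_ _ [k k0 kPhi]]; have := root_neq0 rsPhi kPhi.
by rewrite scaler_eq0 negb_or => /andP[].
Qed.

Lemma zval_vec_pos l : l \in zroots X -> simple_pos s (zval_vec l).
Proof.
move=> /zroots_facts[sl /allP nn _]; apply/forallP => i.
rewrite coord_zval_vec mulr_ge0 ?(ltW (scaling_gt0 i))//; apply/gval_ge0/nn.
by rewrite mem_nth// sl.
Qed.

(** If the norms agree, then k is 1 or -1 and positivity decides. Otherwise proportionality makes
    all minors vanish, which [lines_check] excludes. *)
Lemma zval_vec_line_inj l l' (k : R) : l \in zroots X -> l' \in zroots X ->
  zval_vec l = k *: zval_vec l' -> l = l'.
Proof.
move=> lL lL' e; have sl := zroots_size lL; have sl' := zroots_size lL'.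
have ce i : gv (nth g0 l i) = k * gv (nth g0 l' i).
  have [ni|ni] := ltnP i n; last first.
    rewrite (@nth_default _ g0 l i) ?sl; last exact: ni.
    by rewrite (@nth_default _ g0 l' i) ?sl'; [rewrite gval_nat mulr0|exact: ni].
  have := congr1 (coord s (Ordinal ni)) e; rewrite linearZ /= !coord_zval_vec /= mulrA.
  by move/mulIf; apply; rewrite gt_eqF ?scaling_gt0.
have /andP[_ /allP/(_ (znorm X l, l))] := lines_checkP X.
have mm x : x \in zroots X -> (znorm X x, x) \in [seq (znorm X l, l) | l <- zroots X].
  by move=> xL; apply/mapP; exists x.
move=> /(_ (mm _ lL))/allP/(_ (znorm X l', l'))/(_ (mm _ lL')) /= /orP[/eqP en|].
  have := congr1 gv en; rewrite -!dot_zval_vecxx// e dotZl dotZr mulrA -expr2.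
  have d0 : 0 < dot (zval_vec l') (zval_vec l') by rewrite dot_gt0 zval_vec_neq0.
  move=> /(canRL (mulfK (negbT (gt_eqF d0)))); rewrite divff ?gt_eqF// => /eqP.
  rewrite sqrf_eq1 => /orP[] /eqP k1.
    apply: (@eq_from_nth _ g0) => [|i _]; first by rewrite sl sl'.
    by apply: (@gval_inj R); rewrite ce k1 mul1r.
  have := simple_posN ssS (zval_vec_neq0 lL') (zval_vec_pos lL').
  by rewrite -scaleN1r -k1 -e zval_vec_pos.
move=> /negP[]; apply/allP => i _; apply/allP => j _; apply/eqP/(@gval_inj R).
by rewrite !gvalM !ce; ring.
Qed.

(** Induction along the height: a positive root that is not simple has positive product with some
    simple root, the reflection in it lowers the height, and the table is closed under simple
    reflections. *)
Lemma zroots_cover b : b \in Phi -> simple_pos s b ->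
  exists2 l, l \in zroots X & exists2 k : R, k != 0 & b = k *: zval_vec l.
Proof.
pose ht b := \sum_i coord s i b.
have [m] := ubnP (size [seq c <- undup Phi | ht c < ht b]).
elim: m b => // m IH b; rewrite ltnS => bm bPhi pb.
have b0 := root_neq0 rsPhi bPhi.
have [/existsP[i /eqP bi]|/existsPn nb] := boolP [exists i, b == tnth s i].
  exists (zunit X i); first exact: zunit_roots.
  exists (scaling i)^-1; first by rewrite invr_eq0 gt_eqF ?scaling_gt0.
  by rewrite zval_vec_unit scalerA mulVf ?gt_eqF ?scaling_gt0// scale1r.
have [i bi] : exists i, 0 < dot b (tnth s i).
  have [/existsP//|/existsPn h] := boolP [exists i, 0 < dot b (tnth s i)].
  exfalso; have : dot b b <= 0; last by rewrite leNgt dot_gt0 b0.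
  rewrite {2}(simple_coord ssS b) dot_sumr sumr_le0// => i _; rewrite dotZr.
  by rewrite mulr_ge0_le0//; [exact: (forallP pb i)|rewrite leNgt h].
pose c := b *m refl_mx (tnth s i).
have cPhi : c \in Phi := root_refl rsPhi (simple_root ssS i) bPhi.
have pc : simple_pos s c by apply: (simple_pos_refl rsPhi ssS) => //; exact: nb.
have hc : ht c < ht b.
  rewrite /ht (eq_bigr _ (fun j _ => coord_refl ssS i j b)) sumrB ltrBlDr ltrDl.
  rewrite (bigD1 i)//= eqxx mulr1 big1 => [|j ji]; last by rewrite (negbTE ji) mulr0.
  by rewrite addr0 mulr_gt0// divr_gt0 ?simple_dot_gt0.
have lt : (size [seq x <- undup Phi | (ht x < ht c)%R] <
           size [seq x <- undup Phi | (ht x < ht b)%R])%N.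
  have cin : c \in [seq x <- undup Phi | ht x < ht b] by rewrite mem_filter hc mem_undup.
  rewrite (perm_size (perm_to_rem cin)) /= ltnS; apply: uniq_leq_size.
    by rewrite filter_uniq// undup_uniq.
  move=> x; rewrite mem_filter => /andP[xc xPhi].
  rewrite mem_rem_uniq ?filter_uniq ?undup_uniq// inE mem_filter xPhi (lt_trans xc hc) !andbT.
  by apply: contraTneq xc => ->; rewrite ltxx.
have [l lL [k k0 cE]] := IH c (leq_trans lt bm) cPhi pc.
have bE : b = k *: (zval_vec l *m refl_mx (tnth s i)).
  by rewrite scalemxAl -cE /c -mulmxA refl_mxK mulmx1.
have := allP (closed_checkP X) _ lL => /allP/(_ (i : nat)).
rewrite mem_iota ltn_ord => /(_ isT)/orP[/eqP lu|lL'].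
  (* The only exit from the table is the simple root i itself; b would then be that root or its
     opposite. *)
  exfalso; have [_ _ _ red] := rsPhi; move: bPhi pb (nb i).
  rewrite bE lu zval_vec_unit /sroot -scalemxAl mul_reflxx scalerN scalerN scalerA -scaleNr.
  rewrite red ?(simple_root ssS)// => /orP[] /eqP ->; rewrite ?scale1r ?eqxx//.
  rewrite scaleN1r => h; have := simple_posN ssS (root_neq0 rsPhi (simple_root ssS i)).
  by rewrite (simple_pos_simple ssS) h => /(_ isT).
by exists (zrefl X i l) => //; exists k => //; rewrite zval_vec_refl// zroots_size.
Qed.

Variable P : seq 'rV[R]_n.
Hypothesis psP : positive_system Phi P.

(** [f l] is whichever of the two roots on the line of l lies in [P]; that a line carries only two
    opposite roots makes this a bijection. *)
Lemma positive_lines : exists f : zvec -> 'rV[R]_n,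
  perm_eq [seq f l | l <- zroots X] P /\
  forall l, l \in zroots X -> exists2 k : R, k != 0 & f l = k *: zval_vec l.
Proof.
have hsP := positive_half_system rsPhi psP.
have /choice[f hf] l : exists a, l \in zroots X -> a \in P /\
    exists2 k : R, k != 0 & a = k *: zval_vec l.
  have [lL|_] := boolP (l \in zroots X); last by exists 0.
  have [_ _ [k k0 kPhi]] := zroots_facts lL.
  have [kP|kP] := orP (positive_or_opp rsPhi psP kPhi).
    by exists (k *: zval_vec l) => _; split; [exact: kP|exists k; [exact: k0|]].
  exists (- (k *: zval_vec l)) => _; split; first exact: kP.
  by exists (- k); [rewrite oppr_eq0; exact: k0|rewrite scaleNr].
exists f; split; last by move=> l /hf[].
have /andP[uL _] := lines_checkP X.
have fI : {in zroots X &, injective f}.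
  move=> l l' lL lL' e; have [_ [k k0 ek]] := hf _ lL; have [_ [k' k'0 ek']] := hf _ lL'.
  apply: (@zval_vec_line_inj _ _ (k^-1 * k')) => //.
  by rewrite -scalerA -ek' -e ek scalerA mulVf// scale1r.
apply: uniq_perm; [by rewrite map_inj_in_uniq|exact: hsP.1|].
move=> a; apply/mapP/idP => [[l /hf[fP _] ->]//|aP].
have aPhi := positive_root psP aP.
have [l lL [k k0 ak]] : exists2 l, l \in zroots X & exists2 k : R, k != 0 & a = k *: zval_vec l.
  have [pa|pa] := orP (simple_pos_or ssS aPhi); first exact: zroots_cover.
  have [l lL [k k0 e]] := zroots_cover (root_opp rsPhi aPhi) pa.
  by exists l => //; exists (- k); rewrite ?oppr_eq0// scaleNr -e opprK.
exists l => //; have [fP [k' k'0 fk]] := hf _ lL.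
have e : f l = (k' / k) *: a by rewrite fk ak scalerA divfK.
have [_ _ _ red] := rsPhi; have := positive_root psP fP; rewrite e red//.
move=> /orP[] /eqP k1; first by rewrite k1 scale1r.
by have := (hsP.2 _ aP).2; rewrite -scaleN1r -k1 -e fP.
Qed.

Lemma big_positive (T : Type) (idx : T) (op : Monoid.com_law idx) (F : 'rV[R]_n -> T) :
  (forall (k : R) a, k != 0 -> F (k *: a) = F a) ->
  \big[op/idx]_(a <- P) F a = \big[op/idx]_(l <- zroots X) F (zval_vec l).
Proof.
move=> hF; have [f [fP hf]] := positive_lines.
rewrite -(perm_big _ fP) big_map; apply: eq_big_seq => l /hf[k k0 ->]; exact: hF.
Qed.

Lemma size_positive : size P = size (zroots X).
Proof. by have [f [/perm_size <- _]] := positive_lines; rewrite size_map. Qed.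

End RootLines.

(** * Generic normal vectors *)

Lemma nonroot_exists (F : numDomainType) (p : {poly F}) : p != 0 -> exists t, p.[t] != 0.
Proof.
move=> p0; have [/hasP[t _ ht]|/hasPn h] :=
  boolP (has (fun t => p.[t] != 0) [seq k%:R | k <- iota 0 (size p)]); first by exists t.
have := max_poly_roots p0 (rs := [seq k%:R : F | k <- iota 0 (size p)]).
rewrite size_map size_iota ltnn map_inj_uniq ?iota_uniq; last first.
  by move=> i j /eqP; rewrite eqr_nat => /eqP.
move=> h'; exfalso; suff: false by []; apply: h' => //.
by apply/allP => t /h; rewrite negbK.
Qed.

Lemma span_dot_eq0 (R : realType) (N : nat) (B : seq 'rV[R]_N) u a :
  {in B, forall b, dot b u = 0} -> a \in <<B>>%VS -> dot a u = 0.
Proof.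
move=> hB /(@coord_span _ _ _ (in_tuple B)) ->; rewrite dot_suml big1// => i _.
by rewrite dotZl hB ?mulr0// mem_nth.
Qed.

(** The cokernel C of the matrix of B kills a exactly when a lies in the span. Pairing a C with (1,
    t, t^2, ...) gives the value at t of a polynomial, and a finite product of nonzero polynomials
    has a point where it does not vanish. *)
Lemma generic_normal (R : realType) (N : nat) (B L : seq 'rV[R]_N) : exists u,
  {in B, forall b, dot b u = 0} /\ {in L, forall a, a \notin <<B>>%VS -> dot a u != 0}.
Proof.
pose M := \matrix_(i < size B) B`_i; pose C := cokermx M.
pose u t : 'rV[R]_N := (C *m \col_j (t ^+ j))^T.
have dotu a t : dot a (u t) = (rVpoly (a *m C)).[t].
  rewrite /dot /u trmxK mulmxA mxE [rVpoly]lock (@horner_coef_wide _ N) -?lock ?size_poly//.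
  by apply: eq_bigr => j _; rewrite coef_rVpoly_ord; congr (_ * _); rewrite mxE.
have B0 b : b \in B -> b *m C = 0.
  move=> bB; apply/eqP; rewrite -submxE.
  have ib : (index b B < size B)%N by rewrite index_mem.
  rewrite (_ : b = row (Ordinal ib) M) ?row_sub// rowK /= nth_index//.
have notB a : a \notin <<B>>%VS -> rVpoly (a *m C) != 0.
  apply: contra => /eqP/(congr1 (poly_rV (d := N))); rewrite rVpolyK linear0 => /eqP.
  rewrite -submxE => /submxP[D ->]; rewrite mulmx_sum_row memv_suml// => i _.
  by rewrite rowK memvZ// memv_span// mem_nth.
have [t ht] : exists t, (\prod_(a <- [seq a <- L | a \notin <<B>>%VS]) rVpoly (a *m C)).[t] != 0.
  apply: nonroot_exists; rewrite prodf_seq_neq0; apply/allP => a.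
  by rewrite mem_filter => /andP[/notB].
exists (u t); split=> [b /B0 bC|a aL aB]; first by rewrite dotu bC linear0 horner0.
move: ht; rewrite horner_prod prodf_seq_neq0 => /allP/(_ a).
by rewrite mem_filter aB aL dotu; apply.
Qed.

(** * Moments and flats of the root systems *)

Section TypeDesigns.
Context {R : realType}.
Variable X : EFH_type.
Local Notation n := (type_rank X).
Implicit Types (a b u v : 'rV[R]_n) (w : 'M[R]_n) (l : zvec).
Variables (Phi P : seq 'rV[R]_n) (s : n.-tuple 'rV[R]_n).
Hypotheses (rsPhi : root_system Phi) (ssS : simple_system Phi s).
Hypothesis ordS : forall i j, has_order (refl_mx (tnth s i) *m refl_mx (tnth s j))
  (coxeter_matrix X i j).
Hypothesis psP : positive_system Phi P.

Local Notation g0 := (zphi_nat 0).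
Local Notation gv := (@gval R).
Local Notation sroot := (@sroot R X s).
Local Notation zv := (@zval_vec R X s).
Local Notation zd l j := (zdot l (col_of X (gram X) j)).

Lemma sroot_ext (f g : 'rV[R]_n -> R) : scalar f -> scalar g ->
  (forall i, f (sroot i) = g (sroot i)) -> forall v, f v = g v.
Proof.
have lin (F : 'rV[R]_n -> R) : scalar F -> forall k : 'I_n -> R,
    F (\sum_i k i *: sroot i) = \sum_i k i * F (sroot i).
  move=> lF k; have F0 : F 0 = 0.
    by have := lF (-1) 0 0; rewrite scaler0 addr0 mulN1r addNr.
  by elim/big_rec2: _ => // i x y _ <-; rewrite lF.
move=> lf lg e v; rewrite (sroot_coord rsPhi ssS v) !lin//.
by apply: eq_bigr => i _; rewrite e.
Qed.

Lemma weight_val l : l \in zroots X -> 2 / dot (zv l) (zv l) = gv (zweight X l) / 2.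
Proof.
move=> lL; rewrite (dot_zval_vecxx rsPhi ssS ordS); last exact: (zroots_size rsPhi ssS ordS lL).
have := allP (norm_checkP X) _ lL; rewrite /zweight.
case: (eqVneq (znorm X l) (zphi_nat 4)) => [-> _|_]; first by rewrite !gval_nat; field.
by rewrite orbF => /eqP ->; rewrite !gval_nat; field.
Qed.

Lemma sum_zdots (F : zphi * zvec -> zphi) (G : zvec -> R) :
  (forall l, l \in zroots X -> gv (F (zweight X l, [seq zd l j | j <- iota 0 n])) = G l) ->
  gv (zsum F (zdots X (zroots X))) = \sum_(l <- zroots X) G l.
Proof. by move=> h; rewrite gval_zsum big_map; apply: eq_big_seq. Qed.

Lemma nth_zd l (j : 'I_n) : nth g0 [seq zd l j | j <- iota 0 n] j = zd l j.
Proof. by rewrite (nth_map 0%N) ?size_iota// nth_iota. Qed.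

Lemma gv_zd l (j : 'I_n) : l \in zroots X -> gv (zd l j) = dot (zv l) (sroot j).
Proof.
by move=> lL; rewrite (dot_zval_vec rsPhi ssS ordS)// (zroots_size rsPhi ssS ordS lL).
Qed.

Lemma sum_positive (F : 'rV[R]_n -> R) : (forall (k : R) a, k != 0 -> F (k *: a) = F a) ->
  \sum_(a <- P) F a = \sum_(l <- zroots X) F (zv l).
Proof. exact: (big_positive rsPhi ssS ordS psP). Qed.

Lemma type_design2 x y :
  \sum_(a <- P) 2 / dot a a * dot a x * dot a y = (type_coxeter X)%:R * dot x y.
Proof.
rewrite (@sum_positive
  (fun a => 2 / dot a a * dot a x * dot a y)); last first.
  move=> k a k0; have [->|a0] := eqVneq a 0; first by rewrite scaler0 !dot0l !mulr0.
  by rewrite !dotZl dotZr; field; rewrite k0 dot_eq0 a0.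
move: x y; suff base i j : \sum_(l <- zroots X) 2 / dot (zv l) (zv l) * dot (zv l) (sroot i) *
    dot (zv l) (sroot j) = (type_coxeter X)%:R * dot (sroot i) (sroot j).
  have lin (F : 'rV[R]_n -> R) : scalar (fun y => \sum_(l <- zroots X) F (zv l) * dot (zv l) y).
    move=> k u v; rewrite mulr_sumr -big_split; apply: eq_bigr => l _.
    by rewrite dotDr dotZr /=; ring.
  have lin' m (x : 'rV[R]_n) : scalar (fun y => m%:R * dot x y).
    by move=> k u v; rewrite dotDr dotZr; ring.
  move=> x y.
  apply: (sroot_ext (lin (fun a => 2 / dot a a * dot a x) ) (lin' _ _)) => j.
  have sw (t : 'rV[R]_n) : \sum_(l <- zroots X) 2 / dot (zv l) (zv l) * dot (zv l) t * dot (zv l) (sroot j)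
    = \sum_(l <- zroots X) 2 / dot (zv l) (zv l) * dot (zv l) (sroot j) * dot (zv l) t.
    by apply: eq_bigr => l _; ring.
  rewrite sw (dotC x).
  apply: (sroot_ext (lin (fun a => 2 / dot a a * dot a (sroot j))) (lin' _ _)) => i.
  by rewrite -sw base dotC.
have := index_pairsP i j (design2_checkP X) => /eqP/(congr1 gv).
rewrite (sum_zdots (G := fun l => gv (zweight X l) * (dot (zv l) (sroot i) * dot (zv l) (sroot j)))).
  rewrite gvalM gval_nat -(dot_sroot rsPhi ssS ordS) natrM => e.
  have -> : (type_coxeter X)%:R * dot (sroot i) (sroot j) =
    2^-1 * (2 * (type_coxeter X)%:R * dot (sroot i) (sroot j)) by field.
  rewrite -e mulr_sumr; apply: eq_big_seq => l lL; rewrite weight_val//.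
  by field.
by move=> l lL; rewrite !gvalM !nth_zd !gv_zd.
Qed.

(** Adjacent transpositions bring any quadruple of indices into decreasing order, the only order
    examined by [design4_check]. *)
Lemma sym4_ind (Q : 'I_n -> 'I_n -> 'I_n -> 'I_n -> Prop) :
  (forall p q r t, Q p q r t -> Q q p r t) ->
  (forall p q r t, Q p q r t -> Q p r q t) ->
  (forall p q r t, Q p q r t -> Q p q t r) ->
  (forall p q r t : 'I_n, (q <= p)%N -> (r <= q)%N -> (t <= r)%N -> Q p q r t) ->
  forall p q r t, Q p q r t.
Proof.
move=> s1 s2 s3 h.
have h3 (p q r t : 'I_n) : (q <= p)%N -> (r <= q)%N -> Q p q r t.
  move=> qp rq; have [tr|/ltnW rt] := leqP t r; first exact: h.
  have [tq|/ltnW qt] := leqP t q; first by apply: s3; exact: h.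
  have [tp|/ltnW pt] := leqP t p; first by apply/s3/s2; exact: h.
  by apply/s3/s2/s1; exact: h.
have h2 (p q r t : 'I_n) : (q <= p)%N -> Q p q r t.
  move=> qp; have [rq|/ltnW qr] := leqP r q; first exact: h3.
  have [rp|/ltnW pr] := leqP r p; first by apply: s2; exact: h3.
  by apply/s2/s1; exact: h3.
move=> p q r t; have [qp|/ltnW pq] := leqP q p; first exact: h2.
by apply: s1; exact: h2.
Qed.

(** The value of k4 forced by contracting two arguments of the fourth moment: twice the second
    moment appears on one side and (n + 2) k4 on the other. *)
Definition design_const : R := 2 * (type_coxeter X)%:R / (n + 2)%:R.

Lemma type_design4 x y z t :
  \sum_(a <- P) (2 / dot a a) ^+ 2 * dot a x * dot a y * dot a z * dot a t =
  design_const * (dot x y * dot z t + dot x z * dot y t + dot x t * dot y z).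
Proof.
rewrite (@sum_positive
  (fun a => (2 / dot a a) ^+ 2 * dot a x * dot a y * dot a z * dot a t)); last first.
  move=> k a k0; have [->|a0] := eqVneq a 0; first by rewrite scaler0 !dot0l !mulr0.
  by rewrite !dotZl dotZr; field; rewrite k0 dot_eq0 a0.
pose E x y z t := \sum_(l <- zroots X) (2 / dot (zv l) (zv l)) ^+ 2 * dot (zv l) x *
  dot (zv l) y * dot (zv l) z * dot (zv l) t =
  design_const * (dot x y * dot z t + dot x z * dot y t + dot x t * dot y z).
have E1 p q r u : E p q r u -> E q p r u.
  rewrite /E (dotC q p) => e.
  rewrite (_ : _ + _ + _ = dot p q * dot r u + dot p r * dot q u + dot p u * dot q r); last by ring.
  by rewrite -e; apply: eq_bigr => l _; ring.
have E2 p q r u : E p q r u -> E p r q u.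
  rewrite /E (dotC r q) => e.
  rewrite (_ : _ + _ + _ = dot p q * dot r u + dot p r * dot q u + dot p u * dot q r); last by ring.
  by rewrite -e; apply: eq_bigr => l _; ring.
have E3 p q r u : E p q r u -> E p q u r.
  rewrite /E (dotC u r) => e.
  rewrite (_ : _ + _ + _ = dot p q * dot r u + dot p r * dot q u + dot p u * dot q r); last by ring.
  by rewrite -e; apply: eq_bigr => l _; ring.
have extE p q r : (forall i, E p q r (sroot i)) -> forall u, E p q r u.
  move=> h u; apply: (@sroot_ext
    (fun u => \sum_(l <- zroots X) (2 / dot (zv l) (zv l)) ^+ 2 * dot (zv l) p *
      dot (zv l) q * dot (zv l) r * dot (zv l) u)
    (fun u => design_const * (dot p q * dot r u + dot p r * dot q u + dot p u * dot q r))
    _ _ h u) => k {}u v.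
    rewrite mulr_sumr -big_split; apply: eq_bigr => l _ /=.
    by rewrite dotDr dotZr; ring.
  by rewrite !dotDr !dotZr; ring.
suff base i j k m : E (sroot i) (sroot j) (sroot k) (sroot m).
  suff : E x y z t by [].
  apply: (extE) => m; apply/E3; apply: (extE) => k; apply/E2/E3; apply: (extE) => j.
  by apply/E1/E2/E3; apply: (extE) => i.
move: i j k m; apply: sym4_ind.
- by move=> p q r u; apply: E1.
- by move=> p q r u; apply: E2.
- by move=> p q r u; apply: E3.
move=> p q r u qp rq ur; rewrite /E.
have := design4_checkP X => /allP/(_ (p : nat)); rewrite mem_iota ltn_ord => /(_ isT).
move=> /allP/(_ (q : nat)); rewrite mem_iota ltnS => /(_ qp).
move=> /allP/(_ (r : nat)); rewrite mem_iota ltnS => /(_ rq).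
move=> /allP/(_ (u : nat)); rewrite mem_iota ltnS => /(_ ur).
move=> /eqP/(congr1 gv).
rewrite gvalM gval_nat (sum_zdots (G := fun l => gv (zweight X l) ^+ 2 *
  (dot (zv l) (sroot p) * dot (zv l) (sroot q) *
   (dot (zv l) (sroot r) * dot (zv l) (sroot u))))); last first.
  by move=> l lL; rewrite !gvalM !nth_zd !gv_zd// expr2.
rewrite gvalM gval_nat !gvalD !gvalM -!(dot_sroot rsPhi ssS ordS) natrM => e.
have n0 : (n + 2)%:R != 0 :> R by rewrite pnatr_eq0 addn2.
rewrite /design_const.
apply: (mulfI n0); rewrite (_ : (n + 2)%:R * (_ * _) = 4^-1 *
  (8 * (type_coxeter X)%:R * (dot (sroot p) (sroot q) * dot (sroot r) (sroot u) +
    dot (sroot p) (sroot r) * dot (sroot q) (sroot u) +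
    dot (sroot p) (sroot u) * dot (sroot q) (sroot r)))); last by field.
rewrite -e mulrCA; congr (_ * _).
rewrite mulr_sumr; apply: eq_big_seq => l lL; rewrite weight_val//.
by field.
Qed.

Lemma type_critical :
  1 - (type_degree X)%:R^-1 * (type_coxeter X)%:R + (type_degree X)%:R^-1 * design_const = 0 :> R.
Proof.
have e : (type_coxeter X * n = type_degree X * (n + 2))%N by case: X.
have d0 : (type_degree X)%:R != 0 :> R by rewrite pnatr_eq0; case: X.
have n0 : (n + 2)%:R != 0 :> R by rewrite pnatr_eq0 addn2.
have {}e : (type_coxeter X)%:R * n%:R = (type_degree X)%:R * (n + 2)%:R :> R.
  by rewrite -!natrM e.
have e2 : (n + 2)%:R = n%:R + 2 :> R by rewrite natrD.
rewrite /design_const; apply: (mulfI d0); apply: (mulfI n0); rewrite !mulr0.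
rewrite (_ : _ * _ = (type_degree X)%:R * (n + 2)%:R - (type_coxeter X)%:R * ((n + 2)%:R - 2)).
  by rewrite -e e2 addrK subrr.
by move: (n + 2)%:R n0 => m m0; field; rewrite d0 m0.
Qed.

Lemma type_count : (2 * size P = (n + 2) * type_degree X)%N.
Proof.
by rewrite (size_positive rsPhi ssS ordS psP); apply/eqP; exact: count_checkP.
Qed.


Lemma masks_complete m : m \in masks (size m).
Proof.
elim: m => [|b m IH] //=; rewrite mem_cat.
by case: b; apply/orP; [left|right]; apply/mapP; exists m.
Qed.

(** Both the coordinates of l and the products of u with the simple roots are nonnegative, so the
    sum vanishes only term by term. *)
Lemma dot_zval_vec_ge0 l u : l \in zroots X -> (forall i, 0 <= dot (tnth s i) u) ->
  (dot (zv l) u == 0) = supported [seq dot v u == 0 | v <- s] l.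
Proof.
move=> lL du; have [sl /allP nn _] := zroots_facts rsPhi ssS ordS lL.
have term i : gv (nth g0 l (i : 'I_n)) * dot (sroot i) u >= 0.
  rewrite mulr_ge0//; first by apply/gval_ge0/nn; rewrite mem_nth// sl.
  by rewrite dotZl mulr_ge0// ltW//; exact: (scaling_gt0 rsPhi ssS).
have -> : dot (zv l) u = \sum_i gv (nth g0 l (i : 'I_n)) * dot (sroot i) u.
  by rewrite dot_suml; apply: eq_bigr => i _; rewrite dotZl.
have ss : size s = n by rewrite size_tuple.
have zi (i : 'I_n) : (gv (nth g0 l i) * dot (sroot i) u == 0) =
    (dot s`_i u == 0) || (nth g0 l i == g0).
  have si := scaling_gt0 rsPhi ssS i.
  rewrite mulf_eq0 orbC dotZl mulf_eq0 (gt_eqF si)/= (tnth_nth 0); congr (_ || _).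
  apply/eqP/eqP => [/gval_eq0//|->]; exact: gval_nat.
rewrite psumr_eq0 /supported; last by move=> i _; exact: term.
apply/allP/allP => [h [b z] /(nthP (false, g0))[k]|h i _ /=].
  rewrite size_zip size_map ss sl minnn => kn; rewrite nth_zip ?size_map ?ss ?sl//= => -[<- <-].
  rewrite (nth_map 0) ?ss//; have := h (Ordinal kn) (mem_index_enum _) => /=.
  by rewrite (zi (Ordinal kn)).
rewrite zi; have := h (nth (false, g0) (zip [seq dot v u == 0 | v <- s] l) i).
rewrite mem_nth ?size_zip ?size_map ?ss ?sl ?minnn ?ltn_ord//.
rewrite nth_zip ?size_map ?ss ?sl//= (nth_map 0) ?ss ?ltn_ord//.
by apply.
Qed.

(* Moving a generic normal vector of the flat into the closed dominant chamber
   turns the flat into a standard parabolic one. *)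
Lemma type_flats B : free B -> {subset B <= P} -> (size B < n)%N -> (0 < size B)%N ->
  (2 * count (mem <<B>>%VS) P < size B * type_degree X)%N.
Proof.
move=> fB BP Bn B0; have [u [uB uPhi]] := generic_normal B Phi.
have inB a : a \in Phi -> (a \in <<B>>%VS) = (dot a u == 0).
  move=> aPhi; apply/idP/eqP => [|e]; first exact: span_dot_eq0.
  by apply: contraTT (uPhi a aPhi) _; rewrite ?e ?eqxx.
have [w Ww dom] := exists_dominant rsPhi ssS u; have ow := coxeter_orthogonal Ww.
pose u' := u *m w; pose m := [seq dot v u' == 0 | v <- s].
have hP := positive_half_system rsPhi psP.
have countE : count (mem <<B>>%VS) P = count (supported m) (zroots X).
  rewrite -!sum1_count big_mkcond [RHS]big_mkcond /=.
  pose F u a : nat := if dot a u == 0 then 1%N else 0%N.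
  rewrite (eq_big_seq (F u)); last by move=> a aP; rewrite inB// (positive_root psP).
  have -> : (\sum_(a <- P) F u a = \sum_(a <- P) F u' (a *m w))%N.
    by apply: eq_bigr => a _; rewrite /F /u' dot_orthogonal.
  rewrite (@big_pm_stable R n P nat 0%N addn (F u') w hP ow); last first.
  - by move=> a; rewrite /F dotNl oppr_eq0.
  - exact: (coxeter_pm_stable rsPhi psP Ww).
  rewrite (@big_positive R X Phi s rsPhi ssS ordS P psP nat 0%N addn (F u')).
    by apply: eq_big_seq => l lL; rewrite /F dot_zval_vec_ge0.
  by move=> k a k0; rewrite /F dotZl mulf_eq0 (negbTE k0).
have sm : size m = n by rewrite size_map size_tuple.
have := allP (flats_checkP X) m; rewrite -{1}sm masks_complete => /(_ isT).
(* The simple roots orthogonal to u' are free and lie in the flat moved by w. *)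
have mB : (count id m <= size B)%N.
  rewrite count_map -size_filter; set J := [seq _ <- _ | _].
  have fJ : free J by apply: filter_free; exact: (simple_free ssS).
  have JB : {subset J <= <<[seq b *m w | b <- B]>>%VS}.
    move=> v; rewrite mem_filter => /andP[/eqP v0 /tnthP[i vi]].
    have vw : v *m w^T \in <<B>>%VS.
      rewrite inB; last first.
        apply: (coxeter_root rsPhi (coxeter_group_trmx Ww)).
        by rewrite vi; exact: (simple_root ssS).
      by rewrite dot_mul trmxK v0.
    rewrite -[v]mulmx1 -(orthogonalT ow) mulmxA.
    move: vw => /(@coord_span _ _ _ (in_tuple B)) ->.
    rewrite mulmx_suml memv_suml// => j _; rewrite -scalemxAl memvZ// memv_span//.
    by apply: map_f; rewrite mem_nth.
  have /eqP <- : \dim <<J>>%VS == size J by exact: fJ.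
  apply: leq_trans (dimvS (_ : (<<J>> <= <<[seq b *m w | b <- B]>>)%VS)) _.
    exact/span_subvP.
  by apply: leq_trans (dim_span _) _; rewrite size_map.
have d0 : (0 < type_degree X)%N by case: X.
(* The two masks left out of the table: the full one gives u = 0, so that B would span all roots,
   and for the empty one no root lies in the flat. *)
case/orP=> [/orP[/allP mall|/hasPn mno]|].
- have u0 i : dot (tnth s i) u' = 0.
    by apply/eqP; apply: mall; apply/mapP; exists (tnth s i); rewrite ?mem_tnth.
  have u'0 : dot u' u' = 0.
    rewrite {1}(simple_coord ssS u') dot_suml big1// => i _.
    by rewrite dotZl u0 mulr0.
  have u00 : u = 0 by apply/eqP; rewrite -dot_eq0 -(dot_orthogonal _ _ ow) -/u' u'0.
  have /span_subvP : {subset Phi <= <<B>>%VS}.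
    by move=> a aPhi; rewrite inB// u00 dot0r.
  have [_ -> _ _] := rsPhi => /dimvS/leq_trans/(_ (dim_span _)).
  by rewrite dimvf /dim /= mul1n leqNgt Bn.
- have c0 : count (supported m) (zroots X) = 0%N.
    apply/eqP; rewrite -leqn0 leqNgt -has_count; apply/hasPn => l lL.
    apply/negP => /allP hl; have := zval_vec_neq0 rsPhi ssS ordS lL.
    have sl := zroots_size rsPhi ssS ordS lL.
    rewrite /zval_vec big1 ?eqxx// => i _.
    have := hl (nth (false, g0) (zip m l) i).
    rewrite mem_nth ?size_zip ?sm ?sl ?minnn ?ltn_ord// nth_zip ?sm ?sl//= => /(_ isT).
    have /negbTE -> /= : ~~ nth false m i by apply: mno; rewrite mem_nth// sm.
    by move=> /eqP ->; rewrite gval_nat scale0r.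
  by rewrite countE c0 muln0 muln_gt0 B0.
by rewrite countE => /leq_trans; apply; rewrite leq_mul2r mB orbT.
Qed.

End TypeDesigns.

(** * The order of a Coxeter element *)

Section TypeCoxeter.
Context {R : realType}.
Variable X : EFH_type.
Local Notation n := (type_rank X).
Variables (Phi : seq 'rV[R]_n) (s : n.-tuple 'rV[R]_n).
Hypotheses (rsPhi : root_system Phi) (ssS : simple_system Phi s).
Hypothesis ordS : forall i j, has_order (refl_mx (tnth s i) *m refl_mx (tnth s j))
  (coxeter_matrix X i j).

Local Notation zv := (@zval_vec R X s).
Local Notation g := (fun i : nat => refl_mx (s`_i)).
Let gK i : g i *m g i = 1%:M. Proof. exact: refl_mxK. Qed.

Lemma prod_refl_conj (L : seq 'rV[R]_n) w : orthogonal_mx w ->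
  \prod_(a <- L) refl_mx a = w *m \prod_(a <- [seq a *m w | a <- L]) refl_mx a *m w^T.
Proof.
move=> ow; elim: L => [|a L IH]; first by rewrite !big_nil mulmx1 ow.
rewrite big_cons IH /= big_cons refl_mxJ// -![_ * _]/(_ *m _).
by rewrite !mulmxA ow mul1mx.
Qed.

Lemma prod_refl_word u : \prod_(a <- [seq s`_i | i <- u]) refl_mx a = word_mx g u.
Proof. by elim: u => [|i u IH]; rewrite ?big_nil// big_cons IH. Qed.

Lemma commuting_bond (i j : nat) : (i < n)%N -> (j < n)%N ->
  coxeter_matrix X i j = 2%N -> commuting g i j.
Proof.
move=> iN jN m2; have := ordS (Ordinal iN) (Ordinal jN); rewrite !(tnth_nth 0) /= m2.
rewrite /commuting; move: (refl_mx s`_i) (refl_mx s`_j) (gK i) (gK j) => A B AA BB [_ + _].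
rewrite expr2 -[_ * _]/(_ *m _) => e.
have h : A *m B *m A = B by rewrite -[RHS]mul1mx -e !mulmxA -(mulmxA _ B B) BB mulmx1.
by rewrite -{2}h -!mulmxA AA mulmx1.
Qed.

Lemma tree_word_perm : perm_eq (tree_word X) (iota 0 n).
Proof. by have /andP[] := tree_checkP X. Qed.

Lemma tree_word_order : tree_order g (tree_word X).
Proof.
have /andP[pt /allP ht] := tree_checkP X.
have lt i : i \in tree_word X -> (i < n)%N by rewrite (perm_mem pt) mem_iota.
suff h k : (k <= size (tree_word X))%N -> tree_order g (take k (tree_word X)).
  by rewrite -(take_size (tree_word X)); exact: h.
elim: k => [_|k IH kt]; first by rewrite take0; exact: tree_order_nil.
rewrite (take_nth 0%N)//; set m := nth _ _ k; set t := take k _ in IH *.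
have := ht k; rewrite mem_iota kt => /(_ isT); move=> c1.
have {}c1 : (count (fun i => coxeter_matrix X i m != 2%N) t <= 1)%N by exact: c1.
have mn : (m < n)%N by apply: lt; rewrite mem_nth.
have tn i : i \in t -> (i < n)%N by move/mem_take/lt.
(* The single earlier neighbour allowed by the check, or 0 if there is none. *)
pose p := head 0%N [seq i <- t | coxeter_matrix X i m != 2%N].
apply: (@tree_order_rcons _ _ _ _ _ p); first exact/IH/ltnW.
move=> i it ip; apply: commuting_bond; [exact: tn|exact: mn|].
apply/eqP; apply: contraNT ip => i2.
move: c1; rewrite -size_filter /p.
have : i \in [seq i <- t | coxeter_matrix X i m != 2%N] by rewrite mem_filter i2.
by case: [seq _ <- _ | _] => [|y [|z r]]//; rewrite inE.
Qed.

Lemma zval_vec_word u l : size l = n -> {in u, forall i, (i < n)%N} ->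
  size (foldl (fun l j => zrefl X j l) l u) = n /\
  zv (foldl (fun l j => zrefl X j l) l u) = zv l *m word_mx g u.
Proof.
elim: u l => [|i u IH] l sl hu /=; first by rewrite mulmx1.
have iN : (i < n)%N by apply: hu; rewrite mem_head.
have [j ju|-> ->] := IH (zrefl X i l) (size_zrefl (Ordinal iN) sl).
  by apply: hu; rewrite inE ju orbT.
by rewrite (zval_vec_refl rsPhi ssS ordS (Ordinal iN) sl) mulmxA (tnth_nth 0).
Qed.

Lemma zval_vec_inj l l' : size l = n -> size l' = n -> zv l = zv l' -> l = l'.
Proof.
move=> sl sl' e; apply: (@eq_from_nth _ (zphi_nat 0)) => [|i]; first by rewrite sl sl'.
rewrite sl => iN; apply: (@gval_inj R).
have := congr1 (coord s (Ordinal iN)) e; rewrite !(coord_zval_vec ssS) /=.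
by move/mulIf; apply; rewrite gt_eqF// (scaling_gt0 rsPhi ssS).
Qed.

Lemma coxeter_fixesP k :
  coxeter_fixes X k <-> word_mx g (tree_word X) ^+ k = 1%:M.
Proof.
set A := word_mx g _; have lt i : i \in tree_word X -> (i < n)%N.
  by rewrite (perm_mem tree_word_perm) mem_iota.
have iterE (j : 'I_n) : size (iter k (zcoxeter X) (zunit X j)) = n /\
    zv (iter k (zcoxeter X) (zunit X j)) = sroot s j *m A ^+ k.
  elim: k => [|k [sk ek]].
    by rewrite expr0 mulmx1 (zval_vec_unit s) size_map size_iota.
  have [s1 e1] := zval_vec_word sk lt; rewrite iterS; split; first exact: s1.
  by rewrite [LHS]e1 ek -mulmxA exprSr.
have su (j : 'I_n) : size (zunit X j) = n by rewrite size_map size_iota.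
split=> [/allP h|e].
  apply/row_matrixP => i; rewrite !rowE mulmx1.
  rewrite (sroot_coord rsPhi ssS (delta_mx 0 i)) mulmx_suml; apply: eq_bigr => j _.
  rewrite -scalemxAl; congr (_ *: _); have [_ <-] := iterE j.
  have /eqP -> : iter k (zcoxeter X) (zunit X j) == zunit X j.
    by apply: h; rewrite mem_iota ltn_ord.
  exact: zval_vec_unit.
apply/allP => j; rewrite mem_iota => /andP[_ jn]; apply/eqP.
have [sj ej] := iterE (Ordinal jn); apply: zval_vec_inj; [exact: sj|exact: (su (Ordinal jn))|].
by rewrite ej e mulmx1 (zval_vec_unit s (Ordinal jn)).
Qed.

Lemma type_coxeter_bounds h : coxeter_number Phi h ->
  (type_degree X < h <= type_coxeter X)%N.
Proof.
move=> [s' [ss' [h0 oh mh]]]; have [w Ww /(perm_iotaP 0)[u pu wu]] := simple_conjugate rsPhi ssS ss'.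
have ow := coxeter_orthogonal Ww.
move: pu; rewrite size_tuple => pu.
(* The product over s' is conjugate by w to the word u in the simple roots of s, and u can be
   brought to the tabulated word. *)
have orderE k : (\prod_(i < n) refl_mx (tnth s' i)) ^+ k = 1%:M <-> coxeter_fixes X k.
  have put : perm_eq u (tree_word X) by apply: perm_trans pu _; rewrite perm_sym tree_word_perm.
  have ut : uniq (tree_word X) by rewrite (perm_uniq tree_word_perm) iota_uniq.
  have := word_equiv_order gK (tree_word_equiv tree_word_order ut put) k.
  have -> : \prod_(i < n) refl_mx (tnth s' i) = \prod_(a <- s') refl_mx a by rewrite big_tuple.
  rewrite (prod_refl_conj _ ow) wu prod_refl_word => e.
  rewrite coxeter_fixesP -e; set A := word_mx g u.
  have cj m : (w *m A *m w^T) ^+ m = w *m A ^+ m *m w^T.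
    elim: m => [|m IH]; first by rewrite !expr0 mulmx1 ow.
    rewrite !exprS IH -[_ * _]/(_ *m _) -[A * _]/(_ *m _).
    by rewrite !mulmxA -(mulmxA _ w^T w) orthogonalT// mulmx1.
  rewrite cj; split=> [e1|->]; last by rewrite mulmx1 ow.
  have := congr1 (fun M => w^T *m M *m w) e1.
  by rewrite !mulmxA orthogonalT// mul1mx -mulmxA orthogonalT// !mulmx1 orthogonalT.
have /andP[ch nch] := coxeter_checkP X; apply/andP; split.
  rewrite ltnNge; apply: contra nch => hd; apply/hasP; exists h; first by rewrite mem_iota h0.
  exact/orderE.
rewrite leqNgt; apply/negP => lt; apply: (mh (type_coxeter X)); last exact/orderE.
by rewrite lt andbT; case: X.
Qed.

End TypeCoxeter.

(** * Degrees *)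

Section Degrees.
Context {R : realType} {N : nat}.
Local Notation poly := (mpoly N R[i]).
Implicit Types (a b u v x y xi : 'rV[R]_N) (w : 'M[R]_N) (f g q : poly).

Lemma pevalM f g v : peval (f * g) v = peval f v * peval g v.
Proof. exact: mevalM. Qed.

Lemma pevalZ z f v : peval (z *: f) v = z * peval f v.
Proof. exact: mevalZ. Qed.

Lemma peval1 v : peval 1 v = 1.
Proof. exact: meval1. Qed.

Lemma peval0 v : peval 0 v = 0.
Proof. exact: meval0. Qed.

Lemma peval_sum (I : Type) (r : seq I) (Q : pred I) (f : I -> poly) v :
  peval (\sum_(i <- r | Q i) f i) v = \sum_(i <- r | Q i) peval (f i) v.
Proof.
by apply: (big_morph (fun f => peval f v)); [move=> f1 f2; exact: pevalD|exact: peval0].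
Qed.

Lemma peval_exp f v k : peval (f ^+ k) v = peval f v ^+ k.
Proof. by elim: k => [|k IH]; rewrite ?expr0 ?peval1// !exprS pevalM IH. Qed.

Lemma pderiv_exp xi f k : pderiv xi (f ^+ k.+1) = k.+1%:R *: (f ^+ k * pderiv xi f).
Proof.
elim: k => [|k IH]; first by rewrite expr0 expr1 mul1r scale1r.
rewrite exprS pderivM IH -scalerAr mulrA -exprS -[in RHS]natr1 scalerDl scale1r.
by rewrite [pderiv _ _ * _]mulrC.
Qed.

Section Invariants.
Variables (F : N.-tuple poly) (e : N.-tuple nat).
Hypothesis homF : forall i, homog (tnth e i) (tnth F i).
Local Notation cF := (comp_mpoly F).

Lemma pderiv_comp xi q :
  pderiv xi (cF q) = \sum_j cF (mderiv j q) * pderiv xi (tnth F j).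
Proof.
have [C CE] : {C | C = cF} by exists cF.
have CD q1 q2 : C (q1 + q2) = C q1 + C q2 by rewrite CE comp_mpolyD.
have CZ z q1 : C (z *: q1) = z *: C q1 by rewrite CE comp_mpolyZ.
have CM q1 q2 : C (q1 * q2) = C q1 * C q2 by rewrite CE rmorphM.
have C1 : C 1 = 1 by rewrite CE comp_mpoly1.
have C0 : C 0 = 0 by rewrite CE comp_mpoly0.
have CX i : C (polyvar i) = tnth F i by rewrite CE /polyvar comp_mpolyXU -tnth_nth.
rewrite -CE; elim/(@poly_ind_vars R N) : q => [|z q IH|q1 q2 IH1 IH2|i q IH].
- rewrite C1 pderiv1 big1// => j _.
  by rewrite -mpolyC1 mderivC C0 mul0r.
- rewrite CZ pderivZ IH scaler_sumr; apply: eq_bigr => j _.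
  by rewrite mderivZ CZ scalerAl.
- rewrite CD pderivD IH1 IH2 -big_split; apply: eq_bigr => j _.
  by rewrite mderivD CD mulrDl.
rewrite CM CX pderivM IH mulr_sumr.
rewrite [RHS](eq_bigr (fun j => ((i == j)%:R)%:C%C *: (C q * pderiv xi (tnth F j)) +
    tnth F i * (C (mderiv j q) * pderiv xi (tnth F j)))); last first.
  move=> j _; rewrite mderivM mderiv_var CD !CM CX CZ C1.
  by rewrite mulrDl -scalerAl mul1r -scalerAl eq_sym mulrA.
rewrite big_split/= addrC; congr (_ + _).
rewrite (bigD1 i)//= eqxx rmorph1 scale1r big1 ?addr0 1?mulrC// => j ji.
by rewrite eq_sym (negbTE ji) rmorph0 scale0r.
Qed.

(** Giving the j-th variable weight e_j, q' consists of the monomials of q of weight d; a variable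
    of larger weight cannot occur in them. *)
Lemma weighted_part d q : exists q', cF q' = pihomog mdeg d (cF q) /\
  forall j, (d < tnth e j)%N -> mderiv j q' = 0.
Proof.
elim/mpolyind: q => [|z m q _ _ [q' [eq' dq']]].
  by exists 0; split => [|j _]; rewrite ?comp_mpoly0 ?pihomog0 ?linear0.
have hX : homog (\sum_i m i * tnth e i) (cF (mpolyX R[i] m)).
  rewrite comp_mpolyX; elim/big_rec2: _ => [|i k g _ hg]; first exact: homog_1.
  apply: homogM hg; elim: (m i) => [|k' IH]; first by rewrite expr0 mul0n; exact: homog_1.
  by rewrite exprS mulSn; exact: homogM.
rewrite comp_mpolyD comp_mpolyZ pihomogD -eq' linearZ /=.
have [ed|ed] := eqVneq (\sum_i m i * tnth e i)%N d; last first.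
  by exists q'; split => //; rewrite (pihomog_ne0 ed hX) scaler0 add0r.
exists (z *: mpolyX R[i] m + q'); split.
  by rewrite comp_mpolyD comp_mpolyZ (pihomog_dE (d := d))// -ed.
move=> j dj; rewrite mderivD dq'// addr0 mderivZ mderivX.
suff -> : m j = 0%N by rewrite scale0r scaler0.
apply/eqP; rewrite -leqn0 leqNgt; apply: contraL dj => mj.
by rewrite -leqNgt -ed (bigD1 j)//= (leq_trans (leq_pmull _ mj))// leq_addr.
Qed.

End Invariants.

Lemma line_poly x y d f : homog d f -> exists2 p : {poly R[i]}, (size p <= d.+1)%N &
  forall t : R, peval f (x + t *: y) = p.[t%:C%C].
Proof.
move: d f; apply: homog_ind => [d||d z f [p sp hp]|d f g [p sp hp] [p' sp' hp']|d i f [p sp hp]].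
- by exists 0; rewrite ?size_poly0// => t; rewrite horner0 peval0.
- by exists 1; rewrite ?size_poly1// => t; rewrite hornerC peval1.
- by exists (z *: p) => [|t]; rewrite ?hornerZ ?pevalZ ?hp// (leq_trans (size_scale_leq _ _)).
- exists (p + p') => [|t]; last by rewrite hornerD pevalD hp hp'.
  by rewrite (leq_trans (size_polyD _ _))// geq_max sp sp'.
exists (((y 0 i)%:C%C *: 'X + (x 0 i)%:C%C%:P) * p) => [|t].
  apply: (leq_trans (size_polyMleq _ _)); rewrite -subn1 leq_subLR add1n.
  rewrite (leq_trans (leq_add (n2 := d.+1) (_ : _ <= 2)%N sp))//.
  rewrite (leq_trans (size_polyD _ _))// geq_max (leq_trans (size_scale_leq _ _)) ?size_polyX//.
  by rewrite (leq_trans (size_polyC_leq1 _)).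
rewrite pevalM hp hornerM; congr (_ * _).
rewrite /peval /polyvar mevalXU !mxE hornerD hornerZ hornerX hornerC rmorphD rmorphM /=.
by rewrite addrC mulrC.
Qed.

Variables (Phi P : seq 'rV[R]_N).
Hypotheses (rsPhi : root_system Phi) (psP : positive_system Phi P).
Variables (F : N.-tuple poly) (e : N.-tuple nat).
Hypothesis biF : basic_invariants Phi F e.

Let homF i : homog (tnth e i) (tnth F i). Proof. by case: biF => _ h _ _; exact: h. Qed.

Definition jacobian v : 'M[R[i]]_N :=
  \matrix_(i, j) peval (mderiv i (tnth F j)) v.

(** By invariance the derivative along a is odd under s_a, hence zero on the wall; so a is in the
    left kernel of the Jacobian matrix there. *)
Lemma jacobian_wall a v : a \in Phi -> dot a v = 0 -> \det (jacobian v) = 0.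
Proof.
move=> aPhi av; apply/eqP/det0P; exists (map_mx (fun r => r%:C%C) a).
  have := root_neq0 rsPhi aPhi; apply: contra => /eqP e0; apply/eqP/rowP => i.
  by have := congr1 (fun M : 'rV_N => M 0 i) e0; rewrite !mxE => /(congr1 (@complex.Re R)).
apply/rowP => j; rewrite !mxE.
have -> : \sum_i map_mx (fun r => r%:C%C) a 0 i * jacobian v i j =
    peval (pderiv a (tnth F j)) v.
  rewrite pderivE peval_sum; apply: eq_bigr => i _.
  by rewrite !mxE pevalZ.
have inv : act (refl_mx a) (tnth F j) = tnth F j.
  by case: biF => h _ _ _; rewrite actE; apply: h; exact: coxeter_refl.
have oa := orthogonal_refl a.
have vv : v *m (refl_mx a)^T = v.
  by rewrite refl_mxT mul_refl dotC av mulr0 scale0r subr0.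
have := peval_act (pderiv a (tnth F j)) v oa.
rewrite vv act_pderiv// inv mul_reflxx -scaleN1r pderivZl pevalZ rmorphN1 mulN1r.
by move=> /eqP; rewrite eq_sym -subr_eq0 opprK -mulr2n mulrn_eq0 => /orP[//|/eqP].
Qed.

(** On a line through x0 the determinant is a nonzero polynomial of degree at most the sum of the
    e_i - 1, with a zero where the line meets each wall. *)
Lemma sum_degrees_ge x0 : \det (jacobian x0) != 0 ->
  (size P + N <= \sum_i tnth e i)%N.
Proof.
move=> J0; have hP := positive_half_system rsPhi psP.
have x0P a : a \in P -> dot a x0 != 0.
  move=> aP; apply: contra J0 => /eqP ax; apply/eqP.
  exact: jacobian_wall (positive_root psP aP) ax.
(* The direction y avoids the vectors (a, x0) b - (b, x0) a so that the parameters - (a, x0) / (a,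
   y) of the intersections are distinct. *)
have [y [_ yL]] := generic_normal [::]
  (P ++ [seq dot a x0 *: b - dot b x0 *: a | a <- P, b <- P]).
have yP a : a \in P -> dot a y != 0.
  move=> aP; apply: yL; first by rewrite mem_cat aP.
  by rewrite span_nil memv0 (hP.2 a aP).1.
have /choice[M hM] (ij : 'I_N * 'I_N) : exists p : {poly R[i]}, (size p <= tnth e ij.2)%N /\
    forall t : R, peval (mderiv ij.1 (tnth F ij.2)) (x0 + t *: y) = p.[t%:C%C].
  case: ij => i j /=; have := homog_pderiv (delta_mx 0 i) (homF j).
  rewrite pderiv_delta /homog_pred; case: (tnth e j) => [->|k /(line_poly x0 y)[p sp hp]].
    by exists 0; split => [|t]; rewrite ?size_poly0// peval0 horner0.
  by exists p.
pose p : {poly R[i]} := \det (\matrix_(i, j) M (i, j)).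
have pE (t : R) : p.[t%:C%C] = \det (jacobian (x0 + t *: y)).
  rewrite -[LHS]/(horner_eval _ p) -det_map_mx; congr (\det _); apply/matrixP => i j.
  by rewrite !mxE /horner_eval (hM (i, j)).2.
have p0 : p != 0.
  apply: contra J0 => /eqP pz; have := pE 0; rewrite scale0r addr0 => <-.
  by rewrite pz horner0.
have sp : (size p <= (\sum_i tnth e i).+1 - N)%N.
  apply: (leq_trans (size_sum _ _ _)); apply/bigmax_leqP => s _.
  set q := \prod_i _; have sq : (size q <= (\sum_i tnth e i).+1 - N)%N.
    apply: (leq_trans (size_prod_leq _ _)).
    rewrite card_ord leq_sub2r// ltnS [leqRHS](reindex_inj (@perm.perm_inj _ s)) /=.
    by apply: leq_sum => i _; rewrite mxE; exact: (hM (i, perm.fun_of_perm s i)).1.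
  by rewrite mulr_sign; case: ifP; rewrite ?size_polyN.
pose ts := [seq (- (dot a x0 / dot a y))%:C%C | a <- P].
have uts : uniq ts.
  rewrite map_inj_in_uniq ?hP.1// => a b aP bP /= [] /oppr_inj e1.
  apply/eqP; apply: contraT => ab; exfalso.
  have : dot (dot a x0 *: b - dot b x0 *: a) y = 0.
    rewrite dotBl !dotZl; apply/eqP; rewrite subr_eq0; apply/eqP.
    by move/eqP: e1; rewrite eqr_div ?yP// => /eqP.
  apply/eqP; apply: yL.
    by rewrite mem_cat; apply/orP; right; apply/allpairsP; exists (a, b).
  rewrite span_nil memv0 subr_eq0; apply: contra ab => /eqP e2.
  have [_ _ _ red] := rsPhi.
  have e3 : b = (dot b x0 / dot a x0) *: a.
    by rewrite mulrC -scalerA -e2 scalerA mulVf ?scale1r ?x0P.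
  have := positive_root psP bP; rewrite {1}e3 red ?(positive_root psP aP)//.
  move=> /orP[] /eqP k1; first by rewrite e3 k1 scale1r.
  by have := (hP.2 _ aP).2; rewrite -scaleN1r -k1 -e3 bP.
have := max_poly_roots p0 _ uts; rewrite size_map => rt.
have {rt} : (size P < size p)%N.
  apply: rt; apply/allP => _ /mapP[a aP ->]; apply/rootP; rewrite pE.
  apply: (jacobian_wall (positive_root psP aP)).
  by rewrite dotDr dotZr mulNr divfK ?subrr// yP.
by move: sp; set m := \sum_i _; lia.
Qed.

Lemma det_neq0_transversal (K : comNzRingType) (A : 'M[K]_N) : \det A != 0 ->
  exists2 s : 'I_N -> 'I_N, injective s & forall i, A i (s i) != 0.
Proof.
apply: contra_neqP => h; rewrite /determinant big1// => s _.
have [/existsP[i /eqP Ai]|] := boolP [exists i, A i (perm.fun_of_perm s i) == 0].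
  by rewrite (bigD1 i)//= Ai mul0r mulr0.
rewrite negb_exists => /forallP hs; case: h.
by exists (perm.fun_of_perm s); [exact: perm.perm_inj|exact: hs].
Qed.

(* The chain rule factors the Jacobian of the [f k] through that of [F]; the
   other factor is nonsingular and vanishes at [(j, k)] when [e_j > D k]. *)
Lemma basic_degrees (D : 'I_N -> nat) (f : 'I_N -> poly) (b : 'I_N -> 'rV[R]_N) x0 :
  (forall k, Defs.invariant Phi (f k)) -> (forall k, homog (D k) (f k)) ->
  \det (\matrix_(p, k) peval (pderiv (b p) (f k)) x0) != 0 ->
  (\sum_k D k = size P + N)%N ->
  exists2 s : 'I_N -> 'I_N, injective s & forall k, tnth e (s k) = D k.
Proof.
move=> invf homf detf sumD.
have /choice[q hq] k : exists q, comp_mpoly F q = f k /\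
    forall j, (D k < tnth e j)%N -> mderiv j q = 0.
  have [_ _ /(_ _ (invf k))[q fq] _] := biF.
  have [q' [eq' hq']] := weighted_part homF (D k) q.
  exists q'; split; last exact: hq'.
  by rewrite eq' -fq; apply: pihomog_dE; exact: homf.
pose Q := \matrix_(k, j) peval (comp_mpoly F (mderiv j (q k))) x0.
pose B : 'M[R[i]]_N := \matrix_(p, i) (b p 0 i)%:C%C.
have fact : \matrix_(p, k) peval (pderiv (b p) (f k)) x0 = B *m jacobian x0 *m Q^T.
  apply/matrixP => p k; rewrite !mxE -(hq k).1 pderiv_comp peval_sum.
  apply: eq_bigr => j _; rewrite !mxE pevalM mulrC; congr (_ * _).
  rewrite pderivE peval_sum; apply: eq_bigr => i _.
  by rewrite pevalZ !mxE.
move: detf; rewrite fact !det_mulmx det_tr !mulf_eq0 !negb_or => /andP[/andP[_ J0] Q0].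
have [s sI hs] := det_neq0_transversal Q0; exists s => //.
have le k : (tnth e (s k) <= D k)%N.
  rewrite leqNgt; apply: contra (hs k) => lt.
  by rewrite mxE (hq k).2// comp_mpoly0 peval0.
(* The inequalities hold term by term and the total cannot be strict, so each one is an equality. *)
have := sum_degrees_ge J0; rewrite -sumD [leqRHS](reindex_inj sI) /= => ge.
move=> k; apply/eqP; rewrite eqn_leq le /=.
move: ge; rewrite (bigD1 k)//= [leqRHS](bigD1 k)//=.
have : (\sum_(i | i != k) tnth e (s i) <= \sum_(i | i != k) D i)%N by exact: leq_sum.
by set m := \sum_(i | _) _; set m' := \sum_(i | _) _; lia.
Qed.

End Degrees.

(* In type E6 the start is a multiple of the weight generating the orbit of 27 weights, whose
   odd power sums do not vanish. *)
Definition orbit_start (X : EFH_type) : zvec :=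
  if X is type_E6 then [seq zphi_nat k | k <- [:: 4; 3; 5; 6; 4; 2]%N] else zunit X 0.

Definition zorbit (X : EFH_type) : seq zvec :=
  locked_with zroots_key (zclosure X xpredT 60 [:: orbit_start X] [:: orbit_start X]).

Lemma zorbitE X : zorbit X = zclosure X xpredT 60 [:: orbit_start X] [:: orbit_start X].
Proof. by rewrite /zorbit unlock. Qed.

Definition type_degrees (X : EFH_type) : seq nat :=
  match X with
  | type_E6 => [:: 2; 5; 6; 8; 9; 12] | type_E7 => [:: 2; 6; 8; 10; 12; 14; 18]
  | type_E8 => [:: 2; 8; 12; 14; 18; 20; 24; 30] | type_F4 => [:: 2; 6; 8; 12]
  | type_H3 => [:: 2; 6; 10] | type_H4 => [:: 2; 12; 20; 30]
  end.

Definition zphi_exp (x : zphi) (k : nat) : zphi := iter k (zphi_mul x) (zphi_nat 1).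

Definition zheight (l : zvec) : zphi := zsum id l.

(* Up to the factor [d], the gradient of the sum of the powers (l, x)^d, at the point x where
   every simple root takes the value 1. *)
Definition power_row (X : EFH_type) (L : seq zvec) (d : nat) : zvec :=
  let W := [seq (zphi_exp (zheight l) d.-1, l) | l <- L] in
  [seq zsum (fun p => zphi_mul p.1 (nth (zphi_nat 0) p.2 j)) W | j <- iota 0 (type_rank X)].

(** Dividing by the gcd keeps the numbers small. The quotient is accepted only if multiplying back
    restores the row, so correctness does not rest on properties of the gcd or of the division. *)
Definition primitive_row (r : zvec) : zvec :=
  let g := foldr (fun x g => BinInt.Z.gcd x.1 (BinInt.Z.gcd x.2 g)) BinNums.Z0 r in
  let r' := [seq (BinInt.Z.div x.1 g, BinInt.Z.div x.2 g) | x <- r] in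
  let gp : zphi := (g, BinNums.Z0) in
  if (gp != zphi_nat 0) && ([seq zphi_mul gp x | x <- r'] == r) then r' else r.

Definition eliminate (k : nat) (r0 r : zvec) : zvec :=
  let h0 := nth (zphi_nat 0) r0 0 in let h := nth (zphi_nat 0) r 0 in
  [seq zphi_sub (zphi_mul h0 (nth (zphi_nat 0) r i.+1)) (zphi_mul h (nth (zphi_nat 0) r0 i.+1))
  | i <- iota 0 k].

(** Fraction-free elimination on all rows. The pivot row is kept: it turns into a zero row, which
    adds no condition. *)
Fixpoint trivial_kernel (k : nat) (rows : seq zvec) : bool :=
  if k is k'.+1 then
    let r0 := nth [::] rows (find (fun r => nth (zphi_nat 0) r 0 != zphi_nat 0) rows) in
    (nth (zphi_nat 0) r0 0 != zphi_nat 0) &&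
    trivial_kernel k' [seq primitive_row (eliminate k' r0 r) | r <- rows]
  else true.

Definition orbit_check (X : EFH_type) (L : seq zvec) : bool :=
  [&& uniq L, all (fun l => size l == type_rank X) L &
   all (fun j => all (fun l => zrefl X j l \in L) L) (iota 0 (type_rank X))].

Definition power_check (X : EFH_type) (L : seq zvec) : bool :=
  trivial_kernel (type_rank X) [seq power_row X L d | d <- type_degrees X].

Lemma orbit_checkP X : orbit_check X (zorbit X).
Proof. by rewrite zorbitE; case: X; vm_compute. Qed.

Lemma power_checkP X : power_check X (zorbit X).
Proof. by rewrite zorbitE; case: X; vm_compute. Qed.

Section TrivialKernel.
Context {R : realType}.
Local Notation g0 := (zphi_nat 0).
Local Notation gv := (@gval R).

Lemma primitive_row_eq0 k r (x : nat -> R) :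
  \sum_(i < k) gv (nth g0 r i) * x i = 0 ->
  \sum_(i < k) gv (nth g0 (primitive_row r) i) * x i = 0.
Proof.
have [->//|[c c0 er]] : primitive_row r = r \/
    exists2 c, gv c != 0 & r = [seq zphi_mul c x | x <- primitive_row r].
  rewrite /primitive_row; case: ifP => [/andP[gn /eqP er]|_]; [right|by left].
  eexists; last exact: esym er.
  by apply: contra gn => /eqP/gval_eq0 ->.
move: (primitive_row r) er => r' -> h; apply: (mulfI c0); rewrite mulr0 -[RHS]h mulr_sumr.
apply: eq_bigr => i _; have [ir|ir] := ltnP i (size r').
  by rewrite (nth_map g0)// gvalM mulrA.
by rewrite !nth_default ?size_map// gval_nat mul0r mulr0.
Qed.

Lemma trivial_kernelP k rows (x : nat -> R) : trivial_kernel k rows ->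
  (forall r, r \in rows -> \sum_(i < k) gv (nth g0 r i) * x i = 0) ->
  forall i, (i < k)%N -> x i = 0.
Proof.
elim: k rows x => [//|k IH] rows x /= /andP[]; set r0 := nth _ rows _ => h0 tk hr.
have r0rows : r0 \in rows.
  rewrite mem_nth// ltnNge; apply: contra h0 => le.
  by have -> : r0 = [::] by apply: nth_default.
have xS i : (i < k)%N -> x i.+1 = 0.
  apply: (IH _ (fun i => x i.+1) tk) => _ /mapP[r rr ->].
  apply: (@primitive_row_eq0 k (eliminate k r0 r) (fun i => x i.+1)).
  transitivity (gv (nth g0 r0 0) * (\sum_(i < k.+1) gv (nth g0 r i) * x i) -
      gv (nth g0 r 0) * (\sum_(i < k.+1) gv (nth g0 r0 i) * x i)).
    rewrite !big_ord_recl !mulrDr !mulr_sumr opprD addrACA -sumrB.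
    rewrite [X in _ = X + _](_ : _ = 0) ?add0r; last by rewrite /=; ring.
    apply: eq_bigr => j _; rewrite (nth_map 0%N) ?size_iota// nth_iota// add0n.
    by rewrite lift0 gvalB !gvalM; ring.
  by rewrite (hr r rr) (hr r0 r0rows) !mulr0 subrr.
case=> [_|i]; last by rewrite ltnS; exact: xS.
have := hr r0 r0rows; rewrite big_ord_recl big1 ?addr0 => [|j _].
  move=> /eqP; rewrite mulf_eq0 => /orP[/eqP/gval_eq0 e|/eqP//].
  by rewrite e eqxx in h0.
by rewrite xS ?mulr0// ltn_ord.
Qed.

End TrivialKernel.

(** * The degrees of each type *)

Section TypeDegrees.
Context {R : realType}.
Variable X : EFH_type.
Local Notation n := (type_rank X).
Local Notation poly := (mpoly n R[i]).
Implicit Types (a b u v : 'rV[R]_n) (w : 'M[R]_n) (l : zvec).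
Variables (Phi P : seq 'rV[R]_n) (s : n.-tuple 'rV[R]_n).
Hypotheses (rsPhi : root_system Phi) (ssS : simple_system Phi s).
Hypothesis ordS : forall i j, has_order (refl_mx (tnth s i) *m refl_mx (tnth s j))
  (coxeter_matrix X i j).
Hypothesis psP : positive_system Phi P.

Local Notation g0 := (zphi_nat 0).
Local Notation gv := (@gval R).
Local Notation sroot := (@sroot R X s).
Local Notation zv := (@zval_vec R X s).

Lemma root_on_line a : a \in Phi ->
  exists2 l, l \in zroots X & exists2 k : R, k != 0 & a = k *: zv l.
Proof.
move=> aPhi; have [pa|pa] := orP (simple_pos_or ssS aPhi).
  exact: (zroots_cover rsPhi ssS ordS).
have [l lL [k k0 e]] := zroots_cover rsPhi ssS ordS (root_opp rsPhi aPhi) pa.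
by exists l => //; exists (- k); rewrite ?oppr_eq0// scaleNr -e opprK.
Qed.

(** Each table vector is reached from a simple root by simple reflections, so every reflection is a
    conjugate of a simple one. This is what reduces invariance to the simple reflections tested in
    [orbit_check]. *)
Lemma coxeter_simple_ind (Q : 'M[R]_n -> Prop) : Q 1%:M ->
  (forall A B, Q A -> Q B -> Q (A *m B)) -> (forall i, Q (refl_mx (tnth s i))) ->
  forall w, coxeter_group Phi w -> Q w.
Proof.
move=> Q1 QM Qs w; elim=> [//|{}w a _ Qw /root_on_line[l lL [k k0 ->]]].
apply: (QM) => //; rewrite refl_mxZ//.
suff [] : size l = n /\ Q (refl_mx (zv l)) by [].
move: lL; rewrite zrootsE; move: l; apply: zclosure_ind => [l|l|l j [sl Ql] _].
- move=> /mapP[j]; rewrite mem_iota => /andP[_ jn] ->; split; first by rewrite size_map size_iota.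
  rewrite (zval_vec_unit s (Ordinal jn)) refl_mxZ ?gt_eqF//.
  exact: (scaling_gt0 rsPhi ssS).
- move=> /mapP[j]; rewrite mem_iota => /andP[_ jn] ->; split; first by rewrite size_map size_iota.
  rewrite (zval_vec_unit s (Ordinal jn)) refl_mxZ ?gt_eqF//.
  exact: (scaling_gt0 rsPhi ssS).
split; first exact: size_zrefl.
rewrite (zval_vec_refl rsPhi ssS ordS j sl) refl_mxJ; last exact: orthogonal_refl.
by rewrite refl_mxT; apply: (QM); [apply: (QM)|].
Qed.

Local Notation D k := (nth 0%N (type_degrees X) k).

Definition power_sum (d : nat) : poly := \sum_(l <- zorbit X) linform (zv l) ^+ d.

Lemma size_zorbit l : l \in zorbit X -> size l = n.
Proof. by have /and3P[_ /allP h _] := orbit_checkP X => /h/eqP. Qed.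

Lemma act_exp w f k : act w (f ^+ k) = act w f ^+ k :> poly.
Proof. by elim: k => [|k IH]; rewrite ?expr0 ?act_1// !exprS actM IH. Qed.

Lemma power_sum_invariant d : Defs.invariant Phi (power_sum d).
Proof.
move=> w Ww; rewrite -actE.
suff [] : orthogonal_mx w /\ act w (power_sum d) = power_sum d by [].
move: w Ww; apply: coxeter_simple_ind => [|A B [oA eA] [oB eB]|i].
- by split; [exact: orthogonal1|exact: act1].
- by split; [exact: orthogonalM|rewrite act_mul// eA].
have oi := orthogonal_refl (tnth s i); split; first exact: oi.
have pe : perm_eq [seq zrefl X i l | l <- zorbit X] (zorbit X).
  have /and3P[uO _ /allP/(_ (i : nat))] := orbit_checkP X.
  rewrite mem_iota ltn_ord => /(_ isT)/allP ci.
  have um : uniq [seq zrefl X i l | l <- zorbit X].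
    rewrite map_inj_in_uniq// => l l' /size_zorbit sl /size_zorbit sl' e.
    apply: (zval_vec_inj rsPhi ssS sl sl').
    have := congr1 zv e; rewrite !(zval_vec_refl rsPhi ssS ordS)//.
    by move=> /(congr1 (mulmx^~ (refl_mx (tnth s i)))); rewrite -!mulmxA refl_mxK !mulmx1.
  have sub : {subset [seq zrefl X i l | l <- zorbit X] <= zorbit X}.
    by move=> _ /mapP[l lO ->]; exact: ci.
  apply: uniq_perm => //; apply: (uniq_min_size um sub _).2.
  by rewrite size_map.
rewrite /power_sum -[in RHS](perm_big _ pe) big_map act_sum; apply: eq_big_seq => l lO.
rewrite act_exp (act_linform_orth _ oi) (zval_vec_refl rsPhi ssS ordS); first by [].
exact: size_zorbit.
Qed.

Lemma power_sum_homog d : homog d (power_sum d).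
Proof.
apply: homog_sum => l _; elim: d => [|d IH]; first by rewrite expr0; exact: homog_1.
by rewrite exprS -add1n; apply: homogM => //; exact: homog_linform.
Qed.

Lemma size_type_degrees : size (type_degrees X) = n.
Proof. by case: X. Qed.

Lemma type_degree_gt0 k : (k < n)%N -> (0 < D k)%N.
Proof.
rewrite -size_type_degrees => /(mem_nth 0%N); move: (D k) => d dD.
by have /allP/(_ d dD) : all (leq 1) (type_degrees X) by case: X.
Qed.

Lemma power_sums_jacobian : exists (b : 'I_n -> 'rV[R]_n) x0,
  \det (\matrix_(p < n, k < n) peval (pderiv (b p) (power_sum (D k))) x0) != 0.
Proof.
have fs := simple_free ssS.
have sc0 i : scaling s i != 0 by rewrite gt_eqF// (scaling_gt0 rsPhi ssS).
(* The point x0 has product 1 with every rescaled simple root, so (l, x0) is the height; the b_p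
   form the dual basis and extract coordinates. *)
have [x0 hx0] := exists_dual (fun i => (scaling s i)^-1) fs.
have /choice[b hb] (p : 'I_n) := exists_dual (fun i => (i == p)%:R / scaling s i) fs.
have x0E l : size l = n -> dot (zv l) x0 = gv (zheight l).
  move=> sl; rewrite gval_zsum (big_nth g0) big_mkord sl dot_suml.
  by apply: eq_bigr => i _; rewrite !dotZl hx0 mulfV// mulr1.
have bE l p : dot (zv l) (b p) = gv (nth g0 l p).
  rewrite dot_suml (bigD1 p)//= !dotZl hb eqxx mul1r mulfV// mulr1 big1 ?addr0// => i ip.
  by rewrite !dotZl hb (negbTE ip) mul0r !mulr0.
exists b, x0.
have gvX x k : gv (zphi_exp x k) = gv x ^+ k.
  by elim: k => [|k IH]; rewrite ?expr0 ?gval_nat// exprS -IH -gvalM.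
have entry (p k : 'I_n) : peval (pderiv (b p) (power_sum (D k))) x0 =
    ((D k)%:R * gv (nth g0 (power_row X (zorbit X) (D k)) p))%:C%C.
  rewrite (nth_map 0%N) ?size_iota// nth_iota// add0n gval_zsum big_map.
  have := type_degree_gt0 (ltn_ord k); case: (D k) => // d _.
  rewrite pderiv_sum peval_sum mulr_sumr rmorph_sum; apply: eq_big_seq => l lO.
  rewrite pderiv_exp pevalZ pevalM peval_exp peval_linform x0E ?size_zorbit//.
  rewrite pderiv_linform pevalZ peval1 mulr1 bE gvalM gvX !rmorphM rmorphXn /=.
  by rewrite rmorph_nat.
apply/det0P => -[v v0 hv]; case/negP: v0; apply/eqP/rowP => p; rewrite mxE.
(* A kernel vector is complex while the table is real, so its real and imaginary parts are treated
   separately; [r] stands for either part. *)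
have part0 (r : R[i] -> R) : (forall z z', r (z + z') = r z + r z') ->
    (forall z (t : R), r (z * t%:C%C) = r z * t) -> r (v 0 p) = 0.
  move=> rD rM; have r0 : r 0 = 0 by have := rD 0 0; rewrite addr0; lra.
  pose x i := if insub i is Some j then r (v 0 (j : 'I_n)) else 0.
  have xE (i : 'I_n) : x i = r (v 0 i) by rewrite /x valK.
  rewrite -xE; apply: (trivial_kernelP (power_checkP X) _ (ltn_ord p)) => row /(nthP [::])[k].
  rewrite size_map size_type_degrees => kn <-; rewrite (nth_map 0%N) ?size_type_degrees//.
  have := congr1 (fun M : 'rV_n => r (M 0 (Ordinal kn))) hv.
  rewrite !mxE r0 (big_morph r rD r0) => e.
  have Dk : (D k)%:R != 0 :> R by rewrite pnatr_eq0 -lt0n type_degree_gt0.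
  apply: (mulfI Dk); rewrite mulr0 -[RHS]e mulr_sumr; apply: eq_bigr => i _.
  by rewrite mxE (entry i (Ordinal kn)) rM xE /=; ring.
apply/eqP; rewrite eq_complex.
apply/andP; split; apply/eqP; apply: part0; do ?by [move=> [? ?] [? ?]].
- by move=> [a b'] t /=; rewrite mulr0 subr0.
- by move=> [a b'] t /=; rewrite mulr0 add0r.
Qed.

Lemma basic_type_degrees F e : basic_invariants Phi F e -> e =i type_degrees X.
Proof.
move=> biF; have [b [x0 J0]] := power_sums_jacobian.
have sumD : (\sum_(k < n) D k = size P + n)%N.
  have := type_count rsPhi ssS ordS psP.
  have -> : (\sum_(k < n) D k = sumn (type_degrees X))%N.
    by rewrite sumnE (big_nth 0%N) big_mkord size_type_degrees.
  have : (2 * sumn (type_degrees X) = 2 * n + (n + 2) * type_degree X)%N by case: X.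
  by lia.
have [t tI te] := basic_degrees rsPhi psP biF (fun k => power_sum_invariant (D k))
  (fun k => power_sum_homog (D k)) J0 sumD.
move=> x; apply/idP/idP => [/tnthP[j ->]|].
  have [t' tK t'K] := injF_bij tI; rewrite -(t'K j) te mem_nth// size_type_degrees ltn_ord.
  done.
move=> /(nthP 0%N)[k]; rewrite size_type_degrees => kn <-.
by rewrite -(te (Ordinal kn)) mem_tnth.
Qed.

Lemma highest_type_degree h d : coxeter_number Phi h -> highest_degree_below Phi h d ->
  d = type_degree X.
Proof.
move=> /(type_coxeter_bounds rsPhi ssS ordS)/andP[dh hc] [[F [e [biF de]]] ltd maxd].
have eE := basic_type_degrees biF.
apply/eqP; rewrite eqn_leq; apply/andP; split.
  have : all (fun x => (x < type_coxeter X)%N ==> (x <= type_degree X)%N) (type_degrees X).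
    by case: X.
  by move=> /allP/(_ d); rewrite -eE => /(_ de)/implyP; apply; exact: leq_trans ltd hc.
apply: maxd => //; exists F, e; split => //; rewrite eE.
by case: X.
Qed.

End TypeDegrees.

Theorem proposition6p7 (R : realType) (N : nat) (Phi P : seq 'rV[R]_N)
    (X : EFH_type) (h d : nat) (S : set (mpoly N R[i])) :
  root_system Phi ->
  irreducible_roots Phi ->
  positive_system Phi P ->
  has_type Phi X ->
  coxeter_number Phi h ->
  highest_degree_below Phi h d ->
  minimal_submodule Phi P d%:R^-1 S ->
  gaussian_converges P d%:R^-1 S /\ unitary Phi P d%:R^-1 S.
Proof.
move=> rs _ ps [s [ss os]] hh hd minS.
(* The simple roots form a basis, so the type determines the dimension. *)
have e := simple_rank ss; subst N.
have dE := highest_type_degree rs ss os ps hh hd; subst d.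
have [n1 d0] : (1 < type_rank X)%N /\ (0 < type_degree X)%N by clear; case: X.
exact: (unitary_of_designs rs ps n1 d0 (type_design2 rs ss os ps) (type_design4 rs ss os ps)
  (type_critical X) (type_flats rs ss os ps) (type_count rs ss os ps) minS).
Qed.
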